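(* Let $p_1,p_2\in\mathcal{S}_{1,1}\cap\mathcal{S}_{2,0}$ and $f\in L^2(\mathbb{R})$. Then $$\|\mathfrak{C}(p_1,p_2)f\|_{L^2}\le|||\mathfrak{C}(p_1,p_2)|||\,\|f\|_{L^2},$$ where $$|||\mathfrak{C}(p_1,p_2)|||\le C\left(\|p_1\|_{1,1}\|\partial_\xi p_2\|_{1,0}+\left(\|p_2\|_{1,1}+\|p_2\|_{2,0}\right)\|\partial_\xi p_1\|_{1,0}\right)$$ and $C$ is an absolute constant.
   Context: For a symbol $p(x,\xi)$ on $\mathbb{R}\times\mathbb{R}$, $\mathrm{Op}(p)f(x)=\int_{\mathbb{R}}e^{2\pi ix\xi}p(x,\xi)\hat f(\xi)\,d\xi$ for Schwartz $f$, with $\hat f(\xi)=\int e^{-2\pi ix\xi}f(x)\,dx$ (extended to $L^2$ by density when bounded). $\mathfrak{C}(p_1,p_2)=\mathrm{Op}(p_1)\circ\mathrm{Op}(p_2)-\mathrm{Op}(p_1p_2)$, and $|||\mathfrak{C}(p_1,p_2)|||$ denotes its operator norm bound on $L^2(\mathbb{R})$. For nonnegative integers $\alpha,\beta$, $\|p\|_{\alpha,\beta}=\sup_{x,\xi,\ \alpha'\le\alpha,\ \beta'\le\beta}|\partial_x^{\alpha'}\partial_\xi^{\beta'}p(x,\xi)|$ with derivatives in the distributional sense, and $p\in\mathcal{S}_{\alpha,\beta}$ iff $\|p\|_{\alpha,\beta}<\infty$. *)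

(* Defs.v *)
From HB Require Import structures.
From mathcomp Require Import all_boot all_order all_algebra.
From mathcomp Require Import complex.
From mathcomp Require Import all_classical all_reals all_analysis.

Set Implicit Arguments.
Unset Strict Implicit.
Unset Printing Implicit Defensive.
Import Order.TTheory GRing.Theory Num.Theory.
Import numFieldNormedType.Exports.

Local Open Scope classical_set_scope.
Local Open Scope complex_scope.
Local Open Scope ring_scope.

Section ComplexIntegration.
Context (d : measure_display) (T : measurableType d) (R : realType).
Variable mu : {measure set T -> \bar R}.

Definition cmeasurable (f : T -> R[i]) : Prop :=
  measurable_fun setT (fun x => complex.Re (f x)) /\
  measurable_fun setT (fun x => complex.Im (f x)).

Definition cintegral (f : T -> R[i]) : R[i] :=
  (\int[mu]_x complex.Re (f x)) +i* (\int[mu]_x complex.Im (f x)).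

Definition cLnorm (p : \bar R) (f : T -> R[i]) : \bar R :=
  Lnorm mu p (fun x => (Normc.normc (f x))%:E).

End ComplexIntegration.

Section PseudoDifferential.
Context (R : realType).
Implicit Types (f g : R -> R[i]) (p : R * R -> R[i]) (phi : R * R -> R).

Local Notation leb := (@lebesgue_measure R).
Local Notation leb2 := (leb \x leb)%E.

Definition dx phi : R * R -> R := fun z => 'D_(1, 0) phi z.
Definition dxi phi : R * R -> R := fun z => 'D_(0, 1) phi z.

(* [true] stands for dx and [false] for dxi, so that [w] ranges over all
   iterated partial derivatives, in any order. *)
Definition dword (w : seq bool) phi : R * R -> R :=
  foldr (fun b psi => if b then dx psi else dxi psi) phi w.

Definition smooth2 phi : Prop := forall w : seq bool,
  continuous (dword w phi) /\
  forall z, derivable (dword w phi) z (1, 0) /\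
            derivable (dword w phi) z (0, 1).

Definition test_function phi : Prop :=
  smooth2 phi /\ compact (closure [set z | phi z != 0]).

(* Complex distributions on the plane are determined by their values on real
   test functions; the values outside [test_function] are irrelevant. *)
Definition distribution := (R * R -> R) -> R[i].

Definition loc_integrable2 p : Prop :=
  cmeasurable p /\
  forall K : set (R * R), compact K ->
    (\int[leb2]_(z in K) (Normc.normc (p z))%:E < +oo)%E.

Definition distr p : distribution :=
  fun phi => cintegral leb2 (fun z => p z * (phi z)%:C).

Definition distr_dx (u : distribution) : distribution :=
  fun phi => - u (dx phi).
Definition distr_dxi (u : distribution) : distribution :=
  fun phi => - u (dxi phi).

Definition represents p (u : distribution) : Prop :=
  loc_integrable2 p /\ forall phi, test_function phi -> u phi = distr p phi.

(* The supremum of a distribution: the L^oo norm of the (almost everywhere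
   unique) function representing it, +oo when there is no such function. *)
Definition distr_sup (u : distribution) : \bar R :=
  ereal_inf [set cLnorm leb2 +oo%E p | p in [set p | represents p u]].

Definition symbol_norm (a b : nat) (u : distribution) : \bar R :=
  ereal_sup [set distr_sup (iter ij.1 distr_dx (iter ij.2 distr_dxi u))
            | ij in [set ij : nat * nat | (ij.1 <= a)%N /\ (ij.2 <= b)%N]].

Definition symbol_class (a b : nat) : set (R * R -> R[i]) :=
  [set p | loc_integrable2 p /\ (symbol_norm a b (distr p) < +oo)%E].

Definition schwartz_real (h : R -> R) : Prop :=
  (forall n x, derivable (derive1n n h) x 1) /\
  forall k n, exists M : R, forall x, `|x ^+ k * derive1n n h x| <= M.

Definition schwartz f : Prop :=
  schwartz_real (fun x => complex.Re (f x)) /\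
  schwartz_real (fun x => complex.Im (f x)).

Definition expi (t : R) : R[i] := cos t +i* sin t.

Definition fourier f : R -> R[i] := fun xi =>
  cintegral leb (fun x => expi (- (2 * pi * x * xi)) * f x).

Definition Op p f : R -> R[i] := fun x =>
  cintegral leb (fun xi => expi (2 * pi * x * xi) * p (x, xi) * fourier f xi).

Definition L2norm f : \bar R := cLnorm leb 2%:E f.

Definition L2 : set (R -> R[i]) :=
  [set f | cmeasurable f /\ (L2norm f < +oo)%E].

Definition L2_bounded (T : (R -> R[i]) -> (R -> R[i])) : Prop :=
  exists M : R, forall f, schwartz f ->
    L2 (T f) /\ (L2norm (T f) <= M%:E * L2norm f)%E.

Definition is_L2_value (T : (R -> R[i]) -> (R -> R[i])) f g : Prop :=
  L2 g /\ exists fn : nat -> R -> R[i],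
    [/\ forall n, schwartz (fn n),
        (fun n => L2norm (fun x => fn n x - f x)) @ \oo --> 0%E &
        (fun n => L2norm (fun x => T (fn n) x - g x)) @ \oo --> 0%E].

(* The extension of [T] to L^2 by density, for [T] linear on Schwartz functions
   and [L2_bounded]: then for every [f] in L^2 the values [g] exist and
   are almost everywhere equal, and one representative is chosen. *)
Definition L2_ext (T : (R -> R[i]) -> (R -> R[i])) f : R -> R[i] :=
  xget (fun=> 0) [set g | is_L2_value T f g].

Definition composition_error p1 p2 f : R -> R[i] := fun x =>
  L2_ext (Op p1) (L2_ext (Op p2) f) x - L2_ext (Op (fun z => p1 z * p2 z)) f x.

Definition L2_opnorm (T : (R -> R[i]) -> (R -> R[i])) : \bar R :=
  ereal_sup [set L2norm (T f) | f in [set f | L2 f /\ (L2norm f <= 1)%E]].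

End PseudoDifferential.

(* Main.v *)
(* Write e(y) = exp(2 pi i y).  A symbol P with bounded P, dP/dx, dP/dxi and
   d^2P/dxdxi is a sum of four averages of these functions over the unit square,
   with weights E(s) E'(r), where E and E' are 1 or s - 1 on [0, 1].  Inserting
   this in the pairing of g(x) G(xi) e(x xi) with P and translating expresses the
   pairing through local Fourier transforms of g and G; AM-GM with a weight
   depending on xi and Bessel's inequality give a weighted form of the
   Calderon-Vaillancourt bound.

   For the composition, average p2 in xi only, so that Op(p2) f is the sum of a
   main term, with weight E0 and symbol p2, and of a term with weight E1 and
   symbol dp2/dxi, to which the Calderon-Vaillancourt bound applies directly.  The
   Fourier transform of the main term is a superposition over t of functions
   Gam(xi - t, t), whose decay in xi - t is paid for by two x-derivatives of p2.
   Freezing p1 at the frequency t yields the main term of Op(p1 p2) f; the error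
   carries p1(x, xi) - p1(x, t), which is at most |xi - t| times the bound on
   dp1/dxi, and the decay of Gam makes the integral over t converge.

   This is first done for p2 integrable in x and f bounded with compact support.
   The general case follows by multiplying p2 by 1 / (1 + (x / n)^2), by density,
   and by testing against bounded compactly supported g. *)
Require Import Defs.
From HB Require Import structures.
From mathcomp Require Import all_boot all_order all_algebra.
From mathcomp Require Import complex.
From mathcomp Require Import all_classical all_reals all_analysis.
From mathcomp Require Import ring lra measurable_realfun ess_sup_inf.
Import Order.TTheory GRing.Theory Num.Theory.
Import numFieldNormedType.Exports.
Set Implicit Arguments.
Unset Strict Implicit.
Unset Printing Implicit Defensive.
Local Open Scope classical_set_scope.
Local Open Scope complex_scope.
Local Open Scope ring_scope.

(** For fixed t a bounded function of x need not have a square-integrable Fourier transform.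
    Averaging p2 in xi replaces the value F(t) of the transform F of f by a local Fourier transform
    of F near t; this is square integrable in x, with total energy at most that of F, so the energy
    of [Gam] is finite. In the square averages the phase e(s r) couples the two averaging variables.
    Writing it as an integral over a bounded parameter decouples them, and Bessel then applies to
    each factor. For the part with symbol dp2/dxi the increment of p1 is only bounded by twice its
    supremum, and one x-derivative suffices. Averaging Op(p1 p2) in xi leaves a third term, with
    symbol (dp1/dxi) p2; its xi-average is already present, so no second xi-derivative of p1 enters.
    The bilinear bounds have the form c (|g|^2 + |F|^2); testing with a multiple of the output
    restores homogeneity. *)

Notation nc := (Normc.normc).

(** * Integration of complex-valued functions *)

Section ComplexNorm.
Context {R : realType}.
Implicit Types (z w : R[i]) (t s : R).

Lemma nc_sqr z : nc z ^+ 2 = complex.Re z ^+ 2 + complex.Im z ^+ 2.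
Proof. by case: z => a b /=; rewrite sqr_sqrtr// addr_ge0// sqr_ge0. Qed.

Lemma nc_ge0 z : 0 <= nc z.
Proof. by case: z => a b; exact: sqrtr_ge0. Qed.

Lemma normRe_le_nc z : `|complex.Re z| <= nc z.
Proof.
rewrite -ler_sqr ?nnegrE ?nc_ge0// nc_sqr real_normK ?num_real//.
by rewrite lerDl sqr_ge0.
Qed.

Lemma normIm_le_nc z : `|complex.Im z| <= nc z.
Proof.
rewrite -ler_sqr ?nnegrE ?nc_ge0// nc_sqr real_normK ?num_real//.
by rewrite lerDr sqr_ge0.
Qed.

Lemma nc_le_ReIm z : nc z <= `|complex.Re z| + `|complex.Im z|.
Proof.
rewrite -ler_sqr ?nnegrE ?nc_ge0 ?addr_ge0// nc_sqr sqrrD !real_normK ?num_real//.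
by rewrite -addrA [_ *+ 2 + _]addrC addrA lerDl mulrn_wge0// mulr_ge0.
Qed.

Lemma ncM z w : nc (z * w) = nc z * nc w. Proof. exact: Normc.normcM. Qed.
Lemma ncN z : nc (- z) = nc z. Proof. exact: normcN. Qed.
Lemma ncD z w : nc (z + w) <= nc z + nc w. Proof. exact: le_normcD. Qed.
Lemma ncB z w : nc (z - w) <= nc z + nc w.
Proof. by rewrite (le_trans (ncD _ _))// ncN. Qed.
Lemma nc0 : nc (0 : R[i]) = 0. Proof. exact: Normc.normc0. Qed.
Lemma nc_eq0 z : nc z = 0 -> z = 0. Proof. exact: Normc.eq0_normc. Qed.
Lemma ncR t : nc t%:C = `|t|.
Proof. by rewrite /= expr0n addr0 sqrtr_sqr. Qed.
Lemma ncJ z : nc z^* = nc z.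
Proof. by case: z => a b /=; rewrite sqrrN. Qed.
Lemma mulcJ z : z * z^* = (nc z ^+ 2)%:C.
Proof.
rewrite nc_sqr; case: z => a b; apply/eqP; rewrite eq_complex /=.
by apply/andP; split; apply/eqP; ring.
Qed.

Lemma expiD s t : expi (s + t) = expi s * expi t.
Proof. by rewrite /expi cosD sinD; apply/eqP; rewrite eq_complex /= eqxx addrC (mulrC (sin s)) addrC eqxx. Qed.
Lemma expi0 : expi (0 : R) = 1. Proof. by rewrite /expi cos0 sin0. Qed.
Lemma nc_expi t : nc (expi t) = 1.
Proof. by rewrite /= cos2Dsin2 sqrtr1. Qed.
Lemma expiJ t : (expi t)^* = expi (- t).
Proof. by rewrite /expi cosN sinN. Qed.
Lemma expiN t : expi t * expi (- t) = 1.
Proof. by rewrite -expiD subrr expi0. Qed.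

(** Rotating an integral onto the nonnegative real axis by such a [u] reduces [cint_norm] to an
    inequality between real integrals. *)
Lemma unimodular z : exists2 u, nc u = 1 & u * z = (nc z)%:C.
Proof.
have [->|z0] := eqVneq z 0; first by exists 1; rewrite ?Normc.normc1// mulr0 nc0.
have n0 : nc z != 0 by apply: contra_neq z0; exact: nc_eq0.
exists (z^* * ((nc z)^-1)%:C).
  by rewrite ncM ncJ ncR ger0_norm ?invr_ge0 ?nc_ge0// mulfV.
by rewrite mulrAC mulrC (mulrC z^*) mulcJ -rmorphM/= expr2 mulKf.
Qed.

Lemma ReM z w : complex.Re (z * w) =
  complex.Re z * complex.Re w - complex.Im z * complex.Im w.
Proof. by case: z; case: w. Qed.
Lemma ImM z w : complex.Im (z * w) =
  complex.Re z * complex.Im w + complex.Im z * complex.Re w.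
Proof. by case: z; case: w. Qed.
Lemma ReD z w : complex.Re (z + w) = complex.Re z + complex.Re w.
Proof. by case: z; case: w. Qed.
Lemma ImD z w : complex.Im (z + w) = complex.Im z + complex.Im w.
Proof. by case: z; case: w. Qed.
Lemma ReN z : complex.Re (- z) = - complex.Re z. Proof. by case: z. Qed.
Lemma ImN z : complex.Im (- z) = - complex.Im z. Proof. by case: z. Qed.
Lemma ReJ z : complex.Re z^* = complex.Re z. Proof. by case: z. Qed.
Lemma ImJ z : complex.Im z^* = - complex.Im z. Proof. by case: z. Qed.
Lemma complex_ext z w : complex.Re z = complex.Re w ->
  complex.Im z = complex.Im w -> z = w.
Proof. by case: z; case: w => /= ? ? ? ? -> ->. Qed.

End ComplexNorm.

Section CMeasurable.
Context d (T : measurableType d) (R : realType).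
Implicit Types (f g : T -> R[i]) (h : T -> R).

Lemma cmeas_cst (c : R[i]) : cmeasurable (fun _ : T => c).
Proof. by split; exact: measurable_cst. Qed.
Lemma cmeasR h : measurable_fun setT h -> cmeasurable (fun x => (h x)%:C).
Proof. by move=> mh; split. Qed.
Lemma cmeasD f g : cmeasurable f -> cmeasurable g -> cmeasurable (fun x => f x + g x).
Proof.
move=> [f1 f2] [g1 g2]; split.
  by under eq_fun do rewrite ReD; exact: measurable_funD.
by under eq_fun do rewrite ImD; exact: measurable_funD.
Qed.
Lemma cmeasN f : cmeasurable f -> cmeasurable (fun x => - f x).
Proof.
move=> [f1 f2]; split.
  by under eq_fun do rewrite ReN; exact: measurable_funN.
by under eq_fun do rewrite ImN; exact: measurable_funN.
Qed.
Lemma cmeasB f g : cmeasurable f -> cmeasurable g -> cmeasurable (fun x => f x - g x).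
Proof. by move=> mf mg; apply: cmeasD => //; exact: cmeasN. Qed.
Lemma cmeasM f g : cmeasurable f -> cmeasurable g -> cmeasurable (fun x => f x * g x).
Proof.
move=> [f1 f2] [g1 g2]; split.
  by under eq_fun do rewrite ReM; apply: measurable_funB; exact: measurable_funM.
by under eq_fun do rewrite ImM; apply: measurable_funD; exact: measurable_funM.
Qed.
Lemma cmeasJ f : cmeasurable f -> cmeasurable (fun x => (f x)^*).
Proof.
move=> [f1 f2]; split; first by under eq_fun do rewrite ReJ.
by under eq_fun do rewrite ImJ; exact: measurable_funN.
Qed.
Lemma cmeas_nc f : cmeasurable f -> measurable_fun setT (fun x => nc (f x)).
Proof.
move=> [f1 f2].
rewrite (_ : (fun x => _) = (fun x => Num.sqrt (complex.Re (f x) ^+ 2 + complex.Im (f x) ^+ 2))).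
  apply: (measurableT_comp (f := @Num.sqrt R)).
    by apply: continuous_measurable_fun; exact: sqrt_continuous.
  by apply: measurable_funD; exact: measurable_funX.
by apply/funext => x; case: (f x).
Qed.
Lemma cmeas_nce f : cmeasurable f -> measurable_fun setT (fun x => (nc (f x))%:E).
Proof. by move=> mf; apply/measurable_EFinP; exact: cmeas_nc. Qed.
Lemma cmeas_comp d' (T' : measurableType d') (u : T' -> T) f :
  measurable_fun setT u -> cmeasurable f -> cmeasurable (fun x => f (u x)).
Proof. by move=> mu [f1 f2]; split; [exact: (measurableT_comp f1 mu)|exact: (measurableT_comp f2 mu)]. Qed.
Lemma cmeas_expi h : measurable_fun setT h -> cmeasurable (fun x => expi (h x)).
Proof.
move=> mh; split => /=.
  apply: (measurableT_comp (f := @cos R)) => //.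
  by apply: continuous_measurable_fun; exact: continuous_cos.
apply: (measurableT_comp (f := @sin R)) => //.
by apply: continuous_measurable_fun; exact: continuous_sin.
Qed.
Lemma cmeas_if (b : T -> bool) f g : measurable_fun setT b ->
  cmeasurable f -> cmeasurable g -> cmeasurable (fun x => if b x then f x else g x).
Proof.
move=> mb [f1 f2] [g1 g2]; split.
  rewrite (_ : (fun x => _) = (fun x => if b x then complex.Re (f x) else complex.Re (g x))).
    exact: measurable_fun_ifT.
  by apply/funext => x; case: ifP.
rewrite (_ : (fun x => _) = (fun x => if b x then complex.Im (f x) else complex.Im (g x))).
  exact: measurable_fun_ifT.
by apply/funext => x; case: ifP.
Qed.
End CMeasurable.

Section CIntegral.
Context d (T : measurableType d) (R : realType).
Variable mu : {measure set T -> \bar R}.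
Implicit Types (f g : T -> R[i]) (h : T -> R).
Local Notation cint := (cintegral mu).

Definition cintble f := cmeasurable f /\ (\int[mu]_x (nc (f x))%:E < +oo)%E.

Lemma cintble_Re f : cintble f -> mu.-integrable setT (EFin \o (fun x => complex.Re (f x))).
Proof.
move=> [mf foo]; have [m1 m2] := mf; apply/integrableP; split; first exact/measurable_EFinP.
apply: le_lt_trans foo; apply: ge0_le_integral => //=.
- by apply/measurable_EFinP; exact: measurableT_comp.
- exact: cmeas_nce.
- by move=> x _; rewrite lee_fin normRe_le_nc.
Qed.

Lemma cintble_Im f : cintble f -> mu.-integrable setT (EFin \o (fun x => complex.Im (f x))).
Proof.
move=> [mf foo]; have [m1 m2] := mf; apply/integrableP; split; first exact/measurable_EFinP.
apply: le_lt_trans foo; apply: ge0_le_integral => //=.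
- by apply/measurable_EFinP; exact: measurableT_comp.
- exact: cmeas_nce.
- by move=> x _; rewrite lee_fin normIm_le_nc.
Qed.

Lemma cintble_dom f h : cmeasurable f -> measurable_fun setT h ->
  (forall x, nc (f x) <= h x) -> (\int[mu]_x (h x)%:E < +oo)%E -> cintble f.
Proof.
move=> mf mh fh hoo; split=> //; apply: le_lt_trans hoo.
apply: ge0_le_integral => //=.
- by move=> x _; rewrite lee_fin nc_ge0.
- exact: cmeas_nce.
- by apply/measurable_EFinP.
- by move=> x _; rewrite lee_fin.
Qed.

Lemma cintbleZ (c : R[i]) f : cintble f -> cintble (fun x => c * f x).
Proof.
move=> [mf foo]; split; first by apply: cmeasM => //; exact: cmeas_cst.
under eq_integral do rewrite ncM EFinM.
rewrite ge0_integralZl//.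
- by rewrite lte_mul_pinfty// lee_fin nc_ge0.
- exact: cmeas_nce.
- by move=> x _; rewrite lee_fin nc_ge0.
- by rewrite lee_fin nc_ge0.
Qed.

Lemma cintbleD f g : cintble f -> cintble g -> cintble (fun x => f x + g x).
Proof.
move=> [mf foo] [mg goo]; apply: (@cintble_dom _ (fun x => nc (f x) + nc (g x))).
- exact: cmeasD.
- by apply: measurable_funD; exact: cmeas_nc.
- by move=> x; exact: ncD.
under eq_integral do rewrite EFinD.
rewrite ge0_integralD//.
- by rewrite lte_add_pinfty.
- by move=> x _; rewrite lee_fin nc_ge0.
- exact: cmeas_nce.
- by move=> x _; rewrite lee_fin nc_ge0.
- exact: cmeas_nce.
Qed.

Lemma cintbleN f : cintble f -> cintble (fun x => - f x).
Proof.
move=> [mf foo]; split; first exact: cmeasN.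
by under eq_integral do rewrite ncN.
Qed.

Lemma cintbleB f g : cintble f -> cintble g -> cintble (fun x => f x - g x).
Proof. by move=> /cintbleD fi /cintbleN; exact: fi. Qed.

Lemma cintbleJ f : cintble f -> cintble (fun x => (f x)^*).
Proof.
move=> [mf foo]; split; first exact: cmeasJ.
by under eq_integral do rewrite ncJ.
Qed.

Lemma cintble_bddM f g (M : R) : cmeasurable g -> (forall x, nc (g x) <= M) ->
  cintble f -> cintble (fun x => g x * f x).
Proof.
move=> mg gM fi; have [mf foo] := fi; have [_ Moo] := cintbleZ M%:C fi.
split; first exact: cmeasM.
apply: le_lt_trans Moo; apply: ge0_le_integral => //=.
- by move=> x _; rewrite lee_fin nc_ge0.
- by apply: cmeas_nce; exact: cmeasM.
- by apply: cmeas_nce; apply: cmeasM => //; exact: cmeas_cst.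
- move=> x _; rewrite lee_fin !ncM ler_wpM2r ?nc_ge0//.
  by rewrite (le_trans (gM _))// ncR ler_norm.
Qed.

Lemma eq_cint f g : f =1 g -> cint f = cint g.
Proof. by move=> /funext ->. Qed.

Lemma cintD f g : cintble f -> cintble g ->
  cint (fun x => f x + g x) = cint f + cint g.
Proof.
move=> fi gi; apply: complex_ext; rewrite ?ReD ?ImD /=.
  by under eq_Rintegral do rewrite ReD; rewrite RintegralD//; exact: cintble_Re.
by under eq_Rintegral do rewrite ImD; rewrite RintegralD//; exact: cintble_Im.
Qed.

Lemma cintZl (c : R[i]) f : cintble f -> cint (fun x => c * f x) = c * cint f.
Proof.
move=> fi; have r := cintble_Re fi; have i := cintble_Im fi.
have rZ k := integrableZl measurableT k r; have iZ k := integrableZl measurableT k i.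
apply: complex_ext; rewrite ?ReM ?ImM /=.
  under eq_Rintegral do rewrite ReM.
  rewrite RintegralB//; [|exact: rZ|exact: iZ].
  by rewrite !RintegralZl.
under eq_Rintegral do rewrite ImM.
rewrite RintegralD//; [|exact: iZ|exact: rZ].
by rewrite !RintegralZl.
Qed.

Lemma cintZr (c : R[i]) f : cintble f -> cint (fun x => f x * c) = cint f * c.
Proof. by move=> fi; rewrite mulrC -cintZl//; apply: eq_cint => x; rewrite mulrC. Qed.

Lemma cintN f : cintble f -> cint (fun x => - f x) = - cint f.
Proof. by move=> fi; rewrite -mulN1r -cintZl//; apply: eq_cint => x; rewrite mulN1r. Qed.

Lemma cintB f g : cintble f -> cintble g ->
  cint (fun x => f x - g x) = cint f - cint g.
Proof. by move=> fi gi; rewrite cintD//; [rewrite cintN|exact: cintbleN]. Qed.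

Lemma cint0 : cint (fun=> 0) = 0.
Proof. by apply: complex_ext; rewrite /= /Rintegral integral0. Qed.

Lemma cint_norm f : cintble f -> ((nc (cint f))%:E <= \int[mu]_x (nc (f x))%:E)%E.
Proof.
move=> fi; have [u u1 uE] := unimodular (cint f).
have ui := cintbleZ u fi.
have -> : nc (cint f) = complex.Re (cint (fun x => u * f x)) by rewrite cintZl// uE.
rewrite /= /Rintegral fineK; last exact: (integrable_fin_num measurableT (cintble_Re ui)).
apply: (le_trans (lee_abs _)); apply: (le_trans (le_abse_integral _ _ _)) => //.
  by have /integrableP[] := cintble_Re ui.
apply: ge0_le_integral => //=.
- by have /integrableP[/measurable_EFinP m _] := cintble_Re ui; exact/measurable_EFinP/measurableT_comp.
- by apply: cmeas_nce; exact: fi.1.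
- by move=> x _; rewrite lee_fin (le_trans (normRe_le_nc _))// ncM u1 mul1r.
Qed.

(* When [f] is not integrable the right-hand side is [+oo]. *)
Lemma cint_norm_le f : cmeasurable f ->
  ((nc (cint f))%:E <= \int[mu]_x (nc (f x))%:E)%E.
Proof.
move=> mf; have [/eqP ->|foo] := boolP (\int[mu]_x (nc (f x))%:E == +oo)%E.
  by rewrite leey.
by apply: cint_norm; split => //; rewrite ltey.
Qed.

Lemma ae_eq_cint f g : cmeasurable f -> cmeasurable g ->
  {ae mu, forall x, f x = g x} -> cint f = cint g.
Proof.
move=> [f1 f2] [g1 g2] fg; apply: complex_ext => /=; rewrite /Rintegral; congr fine;
  apply: ae_eq_integral => //; try exact/measurable_EFinP.
- by apply: filterS fg => x -> _.
- by apply: filterS fg => x -> _.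
Qed.

Lemma cintJ f : cintble f -> cint (fun x => (f x)^*) = (cint f)^*.
Proof.
move=> fi; apply: complex_ext; rewrite ?ReJ ?ImJ /=.
  by under eq_Rintegral do rewrite ReJ.
under eq_Rintegral do rewrite ImJ -mulN1r.
by rewrite RintegralZl ?mulN1r//; exact: cintble_Im.
Qed.

Lemma nc_le_fine (z : R[i]) (a : \bar R) : (a < +oo)%E -> ((nc z)%:E <= a)%E ->
  nc z <= fine a.
Proof.
move=> aoo za; rewrite -lee_fin fineK// ge0_fin_numE//.
by apply: le_trans za; rewrite lee_fin nc_ge0.
Qed.

End CIntegral.

Section NonnegativeIntegral.
Context d (T : measurableType d) (R : realType).
Variable mu : {measure set T -> \bar R}.
Implicit Types f g : T -> \bar R.

Lemma le_nnint f g : measurable_fun setT f -> measurable_fun setT g ->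
  (forall x, (0 <= f x)%E) -> (forall x, (f x <= g x)%E) ->
  (\int[mu]_x f x <= \int[mu]_x g x)%E.
Proof. by move=> mf mg f0 fg; apply: ge0_le_integral. Qed.

Lemma ae_le_nnint f g : measurable_fun setT f -> measurable_fun setT g ->
  (forall x, (0 <= f x)%E) -> (forall x, (0 <= g x)%E) -> {ae mu, forall x, (f x <= g x)%E} ->
  (\int[mu]_x f x <= \int[mu]_x g x)%E.
Proof.
move=> mf mg f0 g0 fg; apply: ae_ge0_le_integral => //.
by apply: filterS fg => x ? _.
Qed.

Lemma nnintZl (k : R) f : 0 <= k -> measurable_fun setT f -> (forall x, (0 <= f x)%E) ->
  (\int[mu]_x (k%:E * f x) = k%:E * \int[mu]_x f x)%E.
Proof. by move=> k0 mf f0; rewrite ge0_integralZl. Qed.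

Lemma nnintD f g : measurable_fun setT f -> measurable_fun setT g ->
  (forall x, (0 <= f x)%E) -> (forall x, (0 <= g x)%E) ->
  (\int[mu]_x (f x + g x) = \int[mu]_x f x + \int[mu]_x g x)%E.
Proof. by move=> mf mg f0 g0; rewrite ge0_integralD. Qed.

Lemma nnint_ge0 f : (forall x, (0 <= f x)%E) -> (0 <= \int[mu]_x f x)%E.
Proof. by move=> f0; apply: integral_ge0 => x _; exact: f0. Qed.
End NonnegativeIntegral.

Section AlmostEverywhere.
Context d (T : measurableType d) (R : realType).
Variable mu : {measure set T -> \bar R}.

Lemma ae_imp (P Q : T -> Prop) : (forall x, P x -> Q x) ->
  {ae mu, forall x, P x} -> {ae mu, forall x, Q x}.
Proof. by move=> PQ; apply: filterS. Qed.

Lemma ae_imp2 (P Q S : T -> Prop) : (forall x, P x -> Q x -> S x) ->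
  {ae mu, forall x, P x} -> {ae mu, forall x, Q x} -> {ae mu, forall x, S x}.
Proof. by move=> PQS; apply: filterS2. Qed.

Lemma ae_all_nat (P : nat -> T -> Prop) : (forall n, {ae mu, forall x, P n x}) ->
  {ae mu, forall x, forall n, P n x}.
Proof. by move=> aeP; exact: ae_foralln. Qed.

Lemma ae_true (P : T -> Prop) : (forall x, P x) -> {ae mu, forall x, P x}.
Proof. by move=> H; apply: nearW. Qed.
End AlmostEverywhere.

Ltac default_done := trivial; hnf; intros; solve
   [ do ![solve [trivial | apply: sym_equal; trivial]
         | discriminate | contradiction | split]
   | match goal with H : ~ _ |- _ => solve [case H; trivial] end ].

(* The default tactic unfolds these predicates and spends seconds comparing integrals by conversion. *)
Ltac done ::= solve [trivial] || lazymatch goal with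
  | |- cintble _ _ => fail
  | |- cmeasurable (fun _ => ?c) => exact: cmeas_cst
  | |- cmeasurable _ => fail
  | _ => default_done
  end.

(** * Fubini and Tonelli for complex-valued functions, and null sets in products *)

Section CFubini.
Context d1 d2 (T1 : measurableType d1) (T2 : measurableType d2) (R : realType).
Variable m1 : {sigma_finite_measure set T1 -> \bar R}.
Variable m2 : {sigma_finite_measure set T2 -> \bar R}.
Implicit Types f : T1 * T2 -> R[i].

(** No integrability is assumed: the real integral is [fine] of a difference of the integrals of the
    positive and negative parts, each measurable in x by Tonelli. *)
Lemma measurable_Rfubini (h : T1 * T2 -> R) : measurable_fun setT h ->
  measurable_fun setT (fun x => (\int[m2]_y (h (x, y)))%R).
Proof.
move=> mh; rewrite /Rintegral.
apply: (measurableT_comp (f := @fine R)); first exact: fine_measurable.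
under eq_fun do rewrite integralE.
pose hp := (EFin \o h)^\+%E; pose hn := (EFin \o h)^\-%E.
have mhp : measurable_fun setT hp by apply: measurable_funepos; exact/measurable_EFinP.
have mhn : measurable_fun setT hn by apply: measurable_funeneg; exact/measurable_EFinP.
apply: emeasurable_funB.
  have hp0 z : (0 <= hp z)%E by rewrite /hp funeposE le_max lexx orbT.
  rewrite (_ : (fun x => _) = fubini_F m2 hp).
    exact: (measurable_fun_fubini_tonelli_F _ mhp hp0).
  by apply/funext => x; apply: eq_integral => y _; rewrite /hp !funeposE.
have hn0 z : (0 <= hn z)%E by rewrite /hn funenegE le_max lexx orbT.
rewrite (_ : (fun x => _) = fubini_F m2 hn).
  exact: (measurable_fun_fubini_tonelli_F _ mhn hn0).
by apply/funext => x; apply: eq_integral => y _; rewrite /hn !funenegE.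
Qed.

Lemma cmeas_cint f : cmeasurable f ->
  cmeasurable (fun x => cintegral m2 (fun y => f (x, y))).
Proof. by move=> [f1 f2]; split; [exact: (measurable_Rfubini f1)|exact: (measurable_Rfubini f2)]. Qed.

Lemma meas_nneint (h : T1 * T2 -> \bar R) : measurable_fun setT h ->
  (forall z, (0 <= h z)%E) -> measurable_fun setT (fun x => (\int[m2]_y h (x, y))%E).
Proof. by move=> mh h0; exact: (measurable_fun_fubini_tonelli_F _ mh h0). Qed.

Lemma cintble_prodE f : cmeasurable f ->
  (\int[m1]_x \int[m2]_y (nc (f (x, y)))%:E < +oo)%E -> cintble (m1 \x m2)%E f.
Proof.
move=> mf foo; split=> //; rewrite fubini_tonelli1//; first exact: cmeas_nce.
by move=> z; rewrite lee_fin nc_ge0.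
Qed.

Lemma cintble_prod_lty f : cintble (m1 \x m2)%E f ->
  (\int[m1]_x \int[m2]_y (nc (f (x, y)))%:E < +oo)%E.
Proof.
move=> [mf]; rewrite fubini_tonelli1//; first exact: cmeas_nce.
by move=> z; rewrite lee_fin nc_ge0.
Qed.

Lemma ae_cintble1 f : cintble (m1 \x m2)%E f ->
  {ae m1, forall x, cintble m2 (fun y => f (x, y))}.
Proof.
move=> fi; have [mf _] := fi.
have mn : measurable_fun setT (fun z => (nc (f z))%:E) by exact: cmeas_nce.
have ni : (m1 \x m2)%E.-integrable setT (fun z => (nc (f z))%:E).
  apply/integrableP; split => //.
  by under eq_integral do rewrite gee0_abs ?lee_fin ?nc_ge0//; exact: fi.2.
have := ae_integrable1 ni; apply: filterS => x xi; have {xi}[_ xi] := elimT (integrableP _ _ _) xi.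
split; first by apply: (cmeas_comp (u := fun y => (x, y))) => //; exact: measurable_fun_pair.
apply: le_lt_trans xi; apply: ge0_le_integral => //=.
- by move=> y _; rewrite lee_fin nc_ge0.
- by apply: cmeas_nce; apply: (cmeas_comp (u := fun y => (x, y))) => //; exact: measurable_fun_pair.
- apply/measurable_EFinP; apply: measurableT_comp => //.
  by apply: cmeas_nc; apply: (cmeas_comp (u := fun y => (x, y))) => //; exact: measurable_fun_pair.
- by move=> y _; rewrite lee_fin ler_norm.
Qed.

Lemma Rfubini1 (h : T1 * T2 -> R) :
  (m1 \x m2)%E.-integrable setT (EFin \o h) ->
  \int[m1]_x \int[m2]_y h (x, y) = \int[(m1 \x m2)%E]_z h z.
Proof.
move=> hi; rewrite /Rintegral; congr fine.
rewrite -integral12_prod_meas1//.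
have mh : measurable_fun setT h by have /integrableP[m _] := hi; exact/measurable_EFinP.
apply: ae_eq_integral => //.
- by apply/measurable_EFinP; exact: (measurable_Rfubini mh).
- exact: (measurable_fubini_F hi).
have := ae_integrable1 hi; apply: filterS => x xi _.
by rewrite /fubini_F fineK//; exact: (integrable_fin_num measurableT xi).
Qed.

Lemma Rfubini2 (h : T1 * T2 -> R) :
  (m1 \x m2)%E.-integrable setT (EFin \o h) ->
  \int[m2]_y \int[m1]_x h (x, y) = \int[(m1 \x m2)%E]_z h z.
Proof.
move=> hi; rewrite /Rintegral; congr fine.
rewrite -integral21_prod_meas1//.
have mh : measurable_fun setT h by have /integrableP[m _] := hi; exact/measurable_EFinP.
apply: ae_eq_integral => //.
- have -> : (fun y => (fine (\int[m1]_x (h (x, y))%:E)%E)%:E) =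
    EFin \o (fun y => fine (\int[m1]_x (h (x, y))%:E)%E) by [].
  apply/measurable_EFinP; rewrite /Rintegral.
  apply: (measurableT_comp (f := @fine R)); first exact: fine_measurable.
  exact: (measurable_fubini_G hi).
- exact: (measurable_fubini_G hi).
have := ae_integrable2 hi; apply: filterS => x xi _.
by rewrite /fubini_G fineK//; exact: (integrable_fin_num measurableT xi).
Qed.

Lemma cfubini1 f : cintble (m1 \x m2)%E f ->
  cintegral m1 (fun x => cintegral m2 (fun y => f (x, y))) = cintegral (m1 \x m2)%E f.
Proof.
move=> fi; apply: complex_ext => /=.
  exact: Rfubini1 (cintble_Re fi).
exact: Rfubini1 (cintble_Im fi).
Qed.

Lemma cfubini2 f : cintble (m1 \x m2)%E f ->
  cintegral m2 (fun y => cintegral m1 (fun x => f (x, y))) = cintegral (m1 \x m2)%E f.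
Proof.
move=> fi; apply: complex_ext => /=.
  exact: Rfubini2 (cintble_Re fi).
exact: Rfubini2 (cintble_Im fi).
Qed.

Lemma cfubini f : cmeasurable f ->
  (\int[m1]_x \int[m2]_y (nc (f (x, y)))%:E < +oo)%E ->
  cintegral m1 (fun x => cintegral m2 (fun y => f (x, y))) =
  cintegral m2 (fun y => cintegral m1 (fun x => f (x, y))).
Proof. by move=> mf foo; rewrite cfubini1 ?cfubini2//; exact: cintble_prodE. Qed.

Lemma cintble_fubini1 f : cintble (m1 \x m2)%E f ->
  cintble m1 (fun x => cintegral m2 (fun y => f (x, y))).
Proof.
move=> fi; have [mf _] := fi; split; first exact: cmeas_cint.
apply: le_lt_trans (cintble_prod_lty fi); apply: ge0_le_integral => //.
- by move=> x _; rewrite lee_fin nc_ge0.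
- by apply: cmeas_nce; exact: cmeas_cint.
- apply: (@meas_nneint (fun z => (nc (f z))%:E)); first exact: cmeas_nce.
  by move=> z; rewrite lee_fin nc_ge0.
move=> x _; apply: cint_norm_le.
by apply: (cmeas_comp (u := fun y => (x, y))) => //; exact: measurable_fun_pair.
Qed.

End CFubini.

Section CTonelliSwap.
Context d1 d2 (T1 : measurableType d1) (T2 : measurableType d2) (R : realType).
Variable m1 : {sigma_finite_measure set T1 -> \bar R}.
Variable m2 : {sigma_finite_measure set T2 -> \bar R}.

Lemma ae_prod_ae (P : T1 * T2 -> Prop) : {ae (m1 \x m2)%E, forall z, P z} ->
  {ae m1, forall x, {ae m2, forall y, P (x, y)}}.
Proof.
move=> [N [mN N0 PN]].
have : ae_eq m1 setT (m2 \o xsection N) (cst 0%E).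
  apply/ae_eq_integral_abs => //; first exact: measurable_fun_xsection.
  rewrite /product_measure1 in N0; rewrite -[RHS]N0.
  by apply: eq_integral => x _; rewrite gee0_abs.
apply: filterS => x /(_ I) /= Nx0.
exists (xsection N x); split => //; first exact: measurable_xsection.
by move=> y nP; rewrite /xsection /= inE; exact: PN.
Qed.

(** The two product measures of the null set are iterated integrals of its indicator, hence equal by
    Tonelli. *)
Lemma ae_swap (P : T1 * T2 -> Prop) : {ae (m1 \x m2)%E, forall z, P z} ->
  {ae (m2 \x m1)%E, forall z, P (z.2, z.1)}.
Proof.
move=> [N [mN N0 PN]]; pose M := (fun z : T2 * T1 => (z.2, z.1)) @^-1` N.
have mM : measurable M.
  by rewrite /M -[_ @^-1` _]setTI; apply: measurable_swap.
have i0 (T : Type) (A : set T) z : (0 <= (cst 1%E \_ A : T -> \bar R) z)%E.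
  by rewrite /patch; case: ifP.
have mr d (T : measurableType d) (A : set T) : measurable A ->
    measurable_fun setT (cst 1%E \_ A : T -> \bar R).
  by move=> mA; exact: (measurable_restrictT _ mA).1.
exists M; split => //; last by move=> z nP; exact: PN.
rewrite -N0 -[LHS]mul1e -integral_cst// -[RHS]mul1e -integral_cst//.
rewrite integral_mkcond [RHS]integral_mkcond.
rewrite fubini_tonelli1//; last exact: mr.
rewrite fubini_tonelli1//; last exact: mr.
rewrite [RHS](@fubini_tonelli _ _ _ _ _ m1 m2 (cst 1%E \_ N))//; last exact: mr.
Qed.

Lemma ae_prod_of_ae (N : set (T1 * T2)) : measurable N ->
  {ae m1, forall x, {ae m2, forall y, ~ N (x, y)}} -> (m1 \x m2)%E N = 0%E.
Proof.
move=> mN H; rewrite /product_measure1; rewrite (ae_eq_integral (cst 0%E)) ?integral0//.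
  exact: measurable_fun_xsection.
apply: filterS H => x [M [mM M0 NM]] _ /=.
apply: (subset_measure0 _ _ _ M0) => //; first exact: measurable_xsection.
by move=> y; rewrite /xsection /= inE => Nxy; apply: NM => /=; apply; exact: Nxy.
Qed.
End CTonelliSwap.

Section ProductSigmaFinite.
Context d1 d2 (T1 : measurableType d1) (T2 : measurableType d2) (R : realType).
Variable m1 : {sigma_finite_measure set T1 -> \bar R}.
Variable m2 : {sigma_finite_measure set T2 -> \bar R}.

(* In the library the measure [m1 \x m2] only inherits a sigma-finite structure
   when [m1] and [m2] are sub-probabilities. *)
Definition prodsf : set (T1 * T2)%type -> \bar R := (m1 \x m2)%E.
HB.instance Definition _ := Measure.on prodsf.

Lemma prodsf_sigma_finite : sigma_finite setT prodsf.
Proof.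
have [F TF Foo] := sigma_finiteT m1; have [G TG Goo] := sigma_finiteT m2.
exists (fun n => if @unpickle (nat * nat)%type n is Some ij then F ij.1 `*` G ij.2 else set0).
  apply/esym; rewrite -subTset => -[x y] _.
  have [i _ Fx] : (\bigcup_n F n) x by rewrite -TF.
  have [j _ Gy] : (\bigcup_n G n) y by rewrite -TG.
  by exists (pickle (i, j)) => //; rewrite pickleK.
move=> n; case: unpickle => [[i j]|]; last by rewrite measure0.
have [mF Fi] := Foo i; have [mG Gj] := Goo j; split; first exact: measurableX.
by rewrite /prodsf product_measure1E// lte_mul_pinfty// ge0_fin_numE.
Qed.
HB.instance Definition _ := Measure_isSigmaFinite.Build _ _ _ prodsf prodsf_sigma_finite.
End ProductSigmaFinite.

(** * Translation and reflection invariance of Lebesgue measure *)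

Section LebesgueShift.
Context {R : realType}.
Local Notation leb := (@lebesgue_measure R).

Lemma measurable_shift (a : R) : measurable_fun [set: R] (fun x => x + a).
Proof. exact: measurable_funD. Qed.

(** By uniqueness of Lebesgue measure it is enough to compare the two measures on half-open
    intervals. *)
Lemma leb_shift (a : R) (A : set R) : measurable A ->
  pushforward leb ((fun x => x + a) : _ -> measurableTypeR R) A = leb A.
Proof.
pose s : measurableTypeR R -> measurableTypeR R := fun x => x + a.
pose ms := isMeasurableFun.Build _ _ _ _ s (measurable_shift a).
pose phi : {mfun measurableTypeR R >-> measurableTypeR R} := HB.pack s ms.
move=> mA; apply/esym; apply: (@lebesgue_measure_unique R (pushforward leb phi)) => //= _ [[u v]] _ <-.
rewrite /pushforward (_ : _ @^-1` _ = `]u - a, v - a]%classic).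
  rewrite !lebesgue_measure_itv/= !lte_fin ltrD2r; case: ifP => // _.
  by rewrite -!EFinB; congr EFin; ring.
by apply/seteqP; split => x /=; rewrite !in_itv /= ltrBlDr lerBrDr.
Qed.

Lemma nneint_shift (a : R) (f : R -> \bar R) : measurable_fun setT f ->
  (forall x, (0 <= f x)%E) -> (\int[leb]_x f (x + a)%R = \int[leb]_x f x)%E.
Proof.
move=> mf f0; rewrite -(@ge0_integral_pushforward _ _ (measurableTypeR R) (measurableTypeR R) R _ (measurable_shift a) leb setT f)//.
apply: eq_measure_integral => [|? A mA _]; first exact: measurable_shift.
exact: leb_shift.
Qed.

Lemma nneint_opp (f : R -> \bar R) : measurable_fun setT f ->
  (forall x, (0 <= f x)%E) -> (\int[leb]_x f (- x)%R = \int[leb]_x f x)%E.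
Proof.
move=> mf f0; rewrite -(@ge0_integral_pushforward _ _ (measurableTypeR R) (measurableTypeR R) R _ (@oppr_measurable R setT) leb setT f)//.
by apply: eq_measure_integral => A mA _; exact: lebesgue_measureN.
Qed.

Lemma Rint_shift (a : R) (h : R -> R) : measurable_fun setT h ->
  \int[leb]_x h (x + a) = \int[leb]_x h x.
Proof.
move=> mh; rewrite /Rintegral; congr fine; rewrite integralE [RHS]integralE.
congr (_ - _)%E.
  rewrite -[RHS](nneint_shift a).
  - by apply: eq_integral => x _; rewrite !funeposE.
  - by apply: measurable_funepos; exact/measurable_EFinP.
  - by move=> x; rewrite funeposE le_max lexx orbT.
rewrite -[RHS](nneint_shift a).
- by apply: eq_integral => x _; rewrite !funenegE.
- by apply: measurable_funeneg; exact/measurable_EFinP.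
- by move=> x; rewrite funenegE le_max lexx orbT.
Qed.

Lemma Rint_opp (h : R -> R) : measurable_fun setT h ->
  \int[leb]_x h (- x) = \int[leb]_x h x.
Proof.
move=> mh; rewrite /Rintegral; congr fine; rewrite integralE [RHS]integralE.
congr (_ - _)%E.
  rewrite -[RHS](nneint_opp).
  - by apply: eq_integral => x _; rewrite !funeposE.
  - by apply: measurable_funepos; exact/measurable_EFinP.
  - by move=> x; rewrite funeposE le_max lexx orbT.
rewrite -[RHS](nneint_opp).
- by apply: eq_integral => x _; rewrite !funenegE.
- by apply: measurable_funeneg; exact/measurable_EFinP.
- by move=> x; rewrite funenegE le_max lexx orbT.
Qed.

Lemma cint_shift (a : R) (f : R -> R[i]) : cmeasurable f ->
  cintegral leb (fun x => f (x + a)) = cintegral leb f.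
Proof. by move=> [f1 f2]; apply: complex_ext => /=; [exact: (Rint_shift a f1)|exact: (Rint_shift a f2)]. Qed.

Lemma cint_opp (f : R -> R[i]) : cmeasurable f ->
  cintegral leb (fun x => f (- x)) = cintegral leb f.
Proof. by move=> [f1 f2]; apply: complex_ext => /=; [exact: (Rint_opp f1)|exact: (Rint_opp f2)]. Qed.

Lemma cint_subl (a : R) (f : R -> R[i]) : cmeasurable f ->
  cintegral leb (fun x => f (a - x)) = cintegral leb f.
Proof.
move=> mf; rewrite -[RHS](cint_shift a)// -[RHS]cint_opp//.
  by apply: eq_cint => x; rewrite addrC.
exact: (cmeas_comp (measurable_shift a) mf).
Qed.

Lemma nneint_subl (a : R) (f : R -> \bar R) : measurable_fun setT f ->
  (forall x, (0 <= f x)%E) -> (\int[leb]_x f (a - x)%R = \int[leb]_x f x)%E.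
Proof.
move=> mf f0; rewrite -[RHS](nneint_shift a)// -[RHS]nneint_opp//.
  by apply: eq_integral => x _; rewrite addrC.
by apply: (measurableT_comp mf); exact: measurable_shift.
Qed.
End LebesgueShift.

Section IteratedMeasurability.
Context d1 d2 (T1 : measurableType d1) (T2 : measurableType d2) (R : realType).
Variable m2 : {sigma_finite_measure set T2 -> \bar R}.

Lemma cmeas_cint2 (F : T1 -> T2 -> R[i]) : cmeasurable (fun z : T1 * T2 => F z.1 z.2) ->
  cmeasurable (fun x => cintegral m2 (fun y => F x y)).
Proof. exact: (@cmeas_cint _ _ _ _ _ m2 (fun z : T1 * T2 => F z.1 z.2)). Qed.

Lemma meas_nneint2 (F : T1 -> T2 -> \bar R) :
  measurable_fun setT (fun z : T1 * T2 => F z.1 z.2) ->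
  (forall x y, (0 <= F x y)%E) -> measurable_fun setT (fun x => (\int[m2]_y F x y)%E).
Proof. by move=> mF F0; apply: (@meas_nneint _ _ _ _ _ m2 (fun z : T1 * T2 => F z.1 z.2)). Qed.
End IteratedMeasurability.

Lemma meas_fst_of d d1 d2 (T : measurableType d) (T1 : measurableType d1) (T2 : measurableType d2)
  (u : T -> T1 * T2) : measurable_fun setT u -> measurable_fun setT (fun z => (u z).1).
Proof. by move=> mu; exact: (measurableT_comp measurable_fst mu). Qed.
Lemma meas_snd_of d d1 d2 (T : measurableType d) (T1 : measurableType d1) (T2 : measurableType d2)
  (u : T -> T1 * T2) : measurable_fun setT u -> measurable_fun setT (fun z => (u z).2).
Proof. by move=> mu; exact: (measurableT_comp measurable_snd mu). Qed.
Lemma meas_comp_of d d1 d2 (T : measurableType d) (T1 : measurableType d1) (T2 : measurableType d2)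
  (f : T1 -> T2) (u : T -> T1) : measurable_fun setT f -> measurable_fun setT u ->
  measurable_fun setT (fun z => f (u z)).
Proof. by move=> mf mu; exact: (measurableT_comp mf mu). Qed.

Ltac meas1 := lazymatch goal with
  | |- cmeasurable (fun _ => (_ * _)%R) => apply: cmeasM
  | |- cmeasurable (fun _ => (_ + - _)%R) => apply: cmeasB
  | |- cmeasurable (fun _ => (_ + _)%R) => apply: cmeasD
  | |- cmeasurable (fun _ => (- _)%R) => apply: cmeasN
  | |- cmeasurable (fun _ => conjc _) => apply: cmeasJ
  | |- cmeasurable (fun _ => real_complex_def _ _) => apply: cmeasR
  | |- cmeasurable (fun _ => expi _) => apply: cmeas_expi
  | |- cmeasurable (fun _ => cintegral _ _) => apply: cmeas_cint2
  | |- cmeasurable (fun _ => if _ then _ else _) => apply: cmeas_if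
  | |- cmeasurable (fun _ => ?c) => exact: cmeas_cst
  | |- measurable_fun _ (fun _ => EFin _) => apply/measurable_EFinP
  | |- measurable_fun _ (fun _ => expR _) => apply: (meas_comp_of (@measurable_expR _))
  | |- measurable_fun _ (fun _ => Num.norm _) => apply: (meas_comp_of (@normr_measurable _ setT))
  | |- measurable_fun _ (fun _ => Order.min _ _) => apply: measurable_minr
  | |- measurable_fun _ (fun _ => mule _ _) => apply: emeasurable_funM
  | |- measurable_fun _ (fun _ => Normc.normc _) => apply: cmeas_nc
  | |- measurable_fun _ (fun _ => (_ * _)%R) => apply: measurable_funM
  | |- measurable_fun _ (fun _ => (_ + - _)%R) => apply: measurable_funB
  | |- measurable_fun _ (fun _ => (_ + _)%R) => first [apply: measurable_funD | apply: emeasurable_funD]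
  | |- measurable_fun _ (fun _ => (- _)%R) => apply: measurable_funN
  | |- measurable_fun _ (fun _ => (_ ^+ _)%R) => apply: measurable_funX
  | |- measurable_fun _ (GRing.add ?a) => exact: (measurable_funD (measurable_cst a) (@measurable_id _ _ _))
  | |- measurable_fun _ (GRing.mul ?a) => exact: (measurable_funM (measurable_cst a) (@measurable_id _ _ _))
  | |- measurable_fun _ (Order.le ?a) => apply: (measurable_fun_ler (measurable_cst a) (@measurable_id _ _ _))
  | |- measurable_fun _ (Order.lt ?a) => apply: (measurable_fun_ltr (measurable_cst a) (@measurable_id _ _ _))
  | |- measurable_fun _ (fun _ => (_ <= _)%O) => apply: measurable_fun_ler
  | |- measurable_fun _ (fun _ => (_ < _)%O) => apply: measurable_fun_ltr
  | |- measurable_fun _ (fun _ => (_ && _)%B) => apply: measurable_and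
  | |- measurable_fun _ (fun _ => if _ then _ else _) => apply: measurable_fun_ifT
  | |- measurable_fun _ (fun _ => (_, _)) => apply: measurable_fun_pair
  | |- measurable_fun _ fst => exact: measurable_fst
  | |- measurable_fun _ snd => exact: measurable_snd
  | |- measurable_fun _ (fun x => x) => exact: measurable_id
  | |- measurable_fun _ (fun _ => fst _) => apply: meas_fst_of
  | |- measurable_fun _ (fun _ => snd _) => apply: meas_snd_of
  | |- measurable_fun _ (fun _ => ?c) => exact: measurable_cst
  | H : cmeasurable ?f |- cmeasurable ?f => exact: H
  | H : measurable_fun _ ?f |- measurable_fun _ ?f => exact: H
  | |- cmeasurable (fun _ => ?f _) => first [ match goal with
      H : cmeasurable f |- _ => apply: (cmeas_comp _ H) end | apply: cmeasJ ]
  | |- measurable_fun _ (fun _ => ?f _) => match goal with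
      H : measurable_fun _ f |- _ => apply: (meas_comp_of H) end
  end.
Ltac meas := repeat meas1.
Ltac pos := repeat first [assumption | done | apply: ltW; assumption
  | apply: mulr_ge0 | apply: addr_ge0 | apply: sqr_ge0 | apply: expR_ge0 | apply: nc_ge0
  | apply: normr_ge0 | rewrite invr_ge0].

Section DeriveRules.
Context {R : realType}.
Implicit Types (f g : R -> R) (x : R).

Lemma isdc (c x : R) : is_derive x 1 (fun=> c) (0 : R). Proof. exact: is_derive_cst. Qed.
Lemma isdid (x : R) : is_derive x 1 (fun y : R => y) (1 : R). Proof. exact: is_derive_id. Qed.
Lemma isdD f g x a b : is_derive x 1 f a -> is_derive x 1 g b ->
  is_derive x 1 (fun y => f y + g y) (a + b).
Proof. by move=> fa gb; exact: is_deriveD. Qed.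
Lemma isdN f x a : is_derive x 1 f a -> is_derive x 1 (fun y => - f y) (- a).
Proof. by move=> fa; exact: is_deriveN. Qed.
Lemma isdM f g x a b : is_derive x 1 f a -> is_derive x 1 g b ->
  is_derive x 1 (fun y => f y * g y) (f x * b + g x * a).
Proof. by move=> fa gb; have := is_deriveM fa gb. Qed.
Lemma isd_comp f g x a b : is_derive x 1 g b -> is_derive (g x) 1 f a ->
  is_derive x 1 (fun y => f (g y)) (b * a).
Proof.
move=> gb fa; have := @is_derive1_comp R f g x a b fa gb.
by rewrite mulrC.
Qed.
Lemma isd_eq f x a b : is_derive x 1 f a -> a = b -> is_derive x 1 f b.
Proof. by move=> ? <-. Qed.
Lemma isdE f x a : is_derive x 1 f a -> derive1 f x = a.
Proof. by move=> fa; rewrite derive1E; exact: derive_val. Qed.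
Lemma isd_derivable f x a : is_derive x 1 f a -> derivable f x 1.
Proof. by move=> fa; exact: ex_derive. Qed.
Lemma isd_continuous f x a : is_derive x 1 f a -> {for x, continuous f}.
Proof. by move=> fa; apply/differentiable_continuous/derivable1_diffP; exact: isd_derivable fa. Qed.
End DeriveRules.

Ltac isd1 := first [ eapply isdc | eapply isdid | eapply isdD | eapply isdN
  | eapply isdM
  | match goal with |- is_derive _ _ (fun y => expR _) _ => eapply isd_comp; [|eapply is_derive_expR] end
  | match goal with |- is_derive _ _ (fun y => cos _) _ => eapply isd_comp; [|eapply is_derive_cos] end
  | match goal with |- is_derive _ _ (fun y => sin _) _ => eapply isd_comp; [|eapply is_derive_sin] end
  | match goal with |- is_derive _ _ (fun y => atan _) _ => eapply isd_comp; [|eapply is_derive1_atan] end ].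
Ltac isd := eapply isd_eq; [repeat isd1|].

(** * Fourier transforms and the Bessel inequality *)

Section Poisson.
Context {R : realType}.
Local Notation leb := (@lebesgue_measure R).

(** By evenness the integral is twice the one over the half line, where [l] is the limit of the
    primitive [F] at infinity. *)
Lemma FTC_half_line (f F : R -> R) (l : R) : (forall x, 0 <= f x) -> continuous f ->
  (forall x, derivable F x 1) -> (forall x, 0 < x -> derive1 F x = f x) -> F x @[x --> +oo] --> l -> f =1 f \o -%R ->
  (\int[leb]_x (f x)%:E = (2 * (l - F 0))%:E)%E.
Proof.
move=> f0 cf dF dF' Fl fe; rewrite ge0_symfun_integralT// -set_itvcy.
rewrite (@ge0_continuous_FTC2y _ f F 0 l)//.
- exact: continuous_subspaceT.
- by apply/cvg_at_right_filter/differentiable_continuous/derivable1_diffP; exact: dF.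
- by move=> x; rewrite in_itv/= andbT; exact: dF'.
Qed.

(* The Fourier transform of [exp(- e |x|)]. *)
Definition poisson (e z : R) := 2 * e / (e ^+ 2 + (2 * pi * z) ^+ 2).

Lemma poisson_den (e z : R) : 0 < e -> 0 < e ^+ 2 + (2 * pi * z) ^+ 2.
Proof. by move=> e0; rewrite ltr_wpDr ?sqr_ge0// exprn_gt0. Qed.

Lemma poisson_ge0 (e z : R) : 0 < e -> 0 <= poisson e z.
Proof. by move=> e0; rewrite /poisson divr_ge0// ?mulr_ge0 ?ltW// poisson_den. Qed.

Lemma continuous_poisson (e : R) : 0 < e -> continuous (poisson e).
Proof.
move=> e0 z; rewrite /poisson; apply: cvgM; first exact: cvg_cst.
apply: cvgV; first by rewrite gt_eqF// poisson_den.
apply: (@isd_continuous _ (fun z => e ^+ 2 + (2 * pi * z) ^+ 2)).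
Qed.

Lemma measurable_poisson (e : R) : 0 < e -> measurable_fun setT (poisson e).
Proof. by move=> e0; apply: continuous_measurable_fun; exact: continuous_poisson. Qed.

Lemma integral_poisson (e : R) : 0 < e -> (\int[leb]_z (poisson e z)%:E = 1)%E.
Proof.
move=> e0; have p0 := pi_gt0 R; have e00 : e != 0 by rewrite gt_eqF.
have p00 : pi != 0 :> R by rewrite gt_eqF.
rewrite (@FTC_half_line _ (fun z => atan (2 * pi * z / e) / pi) (1 / 2)).
- by rewrite mulr0 mul0r atan0 mul0r subr0; congr EFin; field.
- by move=> z; exact: poisson_ge0.
- exact: continuous_poisson.
- by move=> z; eapply isd_derivable; repeat isd1.
- move=> z _; apply: isdE; isd.
  rewrite /poisson; have d0 : e ^+ 2 + (2 * pi * z) ^+ 2 != 0 by rewrite gt_eqF// poisson_den.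
  move: (pi : R) p00 d0 => p p00 d0.
  by field; apply/and3P; split.
- rewrite (_ : 1 / 2 = (pi / 2) / pi); last by move: (pi : R) p00 => p p00; field.
  apply: cvgM; last exact: cvg_cst.
  apply: (@cvg_comp _ _ _ (fun x : R => 2 * pi * x / e) (@atan R)); last exact: cvgy_atan.
  under eq_fun do rewrite (mulrAC _ _ e^-1).
  have H : (2 * pi / e) * x @[x --> +oo] --> (+oo : set_system R).
    by apply: gt0_cvgMry; [rewrite divr_gt0// mulr_gt0|exact: cvg_id].
  exact: H.
- by move=> z /=; rewrite /poisson mulrN sqrrN.
Qed.

Lemma cvg_expR_lin (e : R) : 0 < e -> expR (- (e * x)) @[x --> +oo] --> (0 : R).
Proof.
move=> e0; apply: (@cvg_comp _ _ _ (fun x : R => e * x) (fun y : R => expR (- y))); last exact: cvgr_expR.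
have H : e * x @[x --> +oo] --> (+oo : set_system R) by apply: gt0_cvgMry => //; exact: cvg_id.
exact: H.
Qed.

Lemma continuous_exp_abs (e : R) : continuous (fun x : R => expR (- (e * `|x|))).
Proof.
move=> x; apply: (continuous_comp (f := fun x : R => - (e * `|x|))); last exact: continuous_expR.
by apply: cvgN; apply: cvgM; [exact: cvg_cst|exact: norm_continuous].
Qed.

Lemma integral_exp_abs (e : R) : 0 < e ->
  (\int[leb]_x (expR (- (e * `|x|)))%:E = (2 / e)%:E)%E.
Proof.
move=> e0; have e00 : e != 0 by rewrite gt_eqF.
rewrite (@FTC_half_line _ (fun x => - (expR (- (e * x)) / e)) 0).
- by rewrite mulr0 oppr0 expR0 sub0r opprK mul1r.
- by move=> x; exact: expR_ge0.
- exact: continuous_exp_abs.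
- by move=> z; eapply isd_derivable; repeat isd1.
- move=> z z0; apply: isdE; isd; rewrite gtr0_norm//.
  by move: (expR _) => E; field.
- rewrite -[0]oppr0 -[X in - X](mul0r e^-1); apply: cvgN; apply: cvgM; last exact: cvg_cst.
  exact: cvg_expR_lin.
- by move=> x /=; rewrite normrN.
Qed.

(** [FTC_half_line] asks for a nonnegative integrand, hence 1 + cos instead of cos; the cosine
    transform is recovered in [fourier_exp_abs] by subtracting [integral_exp_abs]. *)
Lemma integral_exp_abs_cos (e b : R) : 0 < e ->
  (\int[leb]_x (expR (- (e * `|x|)) * (1 + cos (b * x)))%:E =
   (2 / e + 2 * e / (e ^+ 2 + b ^+ 2))%:E)%E.
Proof.
move=> e0; have e00 : e != 0 by rewrite gt_eqF.
have d0 : 0 < e ^+ 2 + b ^+ 2 by rewrite ltr_wpDr ?sqr_ge0// exprn_gt0.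
pose G (x : R) := expR (- (e * x)) * (b * sin (b * x) - e * cos (b * x)).
rewrite (@FTC_half_line _ (fun x => - (expR (- (e * x)) / e) + G x / (e ^+ 2 + b ^+ 2)) 0).
- rewrite /G !mulr0 oppr0 expR0 sin0 cos0; congr EFin.
  by field; rewrite e00 gt_eqF.
- move=> x; rewrite mulr_ge0 ?expR_ge0//; have := cos_geN1 (b * x); lra.
- move=> x; apply: cvgM; first exact: continuous_exp_abs.
  apply: cvgD; first exact: cvg_cst.
  apply: (continuous_comp (f := fun x => b * x)); last exact: continuous_cos.
  by apply: cvgM; [exact: cvg_cst|exact: cvg_id].
- by move=> z; eapply isd_derivable; rewrite /G; repeat isd1.
- move=> z z0; apply: isdE; rewrite /G; isd; rewrite gtr0_norm//.
  move: (expR _) (cos _) (sin _) => E c s.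
  by field; rewrite e00 gt_eqF.
- have cE := cvg_expR_lin e0.
  rewrite -[0]addr0 -{1}[0]oppr0 -[X in - X](mul0r e^-1); apply: cvgD.
    by apply: cvgN; apply: cvgM; [exact: cE|exact: cvg_cst].
  rewrite -[0](mul0r (e ^+ 2 + b ^+ 2)^-1); apply: cvgM; last exact: cvg_cst.
  apply/norm_cvg0P; apply: (@squeeze_cvgr _ _ _ _ (fun=> 0) (fun x => expR (- (e * x)) * (`|b| + e))).
  + apply: nearW => x; rewrite normr_ge0/= /G normrM ger0_norm ?expR_ge0//.
    have Hs : `|sin (b * x)| <= 1 by rewrite ler_norml sin_geN1 sin_le1.
    have Hc : `|cos (b * x)| <= 1 by rewrite ler_norml cos_geN1 cos_le1.
    rewrite ler_wpM2l ?expR_ge0// (le_trans (ler_normB _ _))// !normrM (gtr0_norm e0).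
    by apply: lerD; [exact: ler_piMr|apply: ler_piMr => //; exact: ltW].
  + exact: cvg_cst.
  + by rewrite -[0](mul0r (`|b| + e)); apply: cvgM; [exact: cE|exact: cvg_cst].
- by move=> x /=; rewrite normrN mulrN cosN.
Qed.

Lemma measurable_exp_abs (e : R) : measurable_fun setT (fun x : R => expR (- (e * `|x|))).
Proof. by apply: continuous_measurable_fun; exact: continuous_exp_abs. Qed.

Lemma measurable_cos_lin (b : R) : measurable_fun setT (fun x : R => cos (b * x)).
Proof.
apply: (measurableT_comp (f := @cos R)); last exact: measurable_funM.
by apply: continuous_measurable_fun; exact: continuous_cos.
Qed.

Lemma measurable_sin_lin (b : R) : measurable_fun setT (fun x : R => sin (b * x)).
Proof.
apply: (measurableT_comp (f := @sin R)); last exact: measurable_funM.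
by apply: continuous_measurable_fun; exact: continuous_sin.
Qed.

Lemma cos1_ge0 (t : R) : 0 <= 1 + cos t.
Proof. by have := cos_geN1 t; lra. Qed.

Lemma cintble_exp_abs (e b : R) : 0 < e ->
  cintble leb (fun x => expi (- (b * x)) * (expR (- (e * `|x|)))%:C).
Proof.
move=> e0; have me := measurable_exp_abs e.
apply: (@cintble_dom _ (measurableTypeR R) R leb _ (fun x => expR (- (e * `|x|)))) => //.
- by meas.
- by move=> x; rewrite ncM nc_expi mul1r ncR ger0_norm ?expR_ge0.
- by rewrite integral_exp_abs// ltry.
Qed.

Lemma fourier_exp_abs (e b : R) : 0 < e ->
  cintegral leb (fun x => expi (- (b * x)) * (expR (- (e * `|x|)))%:C) =
  (2 * e / (e ^+ 2 + b ^+ 2))%:C.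
Proof.
move=> e0; have me := measurable_exp_abs e.
have mc := measurable_cos_lin b; have ms := measurable_sin_lin b.
apply: complex_ext => /=.
  under eq_Rintegral do rewrite mulr0 subr0 cosN.
  have E0 := integral_exp_abs e0; have E1 := integral_exp_abs_cos b e0.
  have i0 : leb.-integrable setT (EFin \o (fun x => expR (- (e * `|x|)))).
    apply/integrableP; split; first exact/measurable_EFinP.
    under eq_integral do rewrite /= ger0_norm ?expR_ge0//.
    by rewrite E0 ltry.
  have i1 : leb.-integrable setT (EFin \o (fun x => expR (- (e * `|x|)) * (1 + cos (b * x)))).
    apply/integrableP; split.
      by apply/measurable_EFinP; apply: measurable_funM => //; exact: measurable_funD.
    have p0 (x : R) : 0 <= expR (- (e * `|x|)) * (1 + cos (b * x)).
      by rewrite mulr_ge0 ?expR_ge0 ?cos1_ge0.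
    by under eq_integral do rewrite /= (ger0_norm (p0 _)); rewrite E1 ltry.
  transitivity (\int[leb]_x (expR (- (e * `|x|)) * (1 + cos (b * x)) - expR (- (e * `|x|)))).
    by apply: eq_Rintegral => x _; ring.
  rewrite RintegralB// /Rintegral E0 E1 /=; ring.
under eq_Rintegral do rewrite mulr0 add0r sinN.
set I := Rintegral _ _ _.
(* The integrand of the imaginary part is odd, so reflection changes the sign of the integral. *)
have : I = - I.
  rewrite {1}/I -Rint_opp; last first.
    by apply: measurable_funM => //; exact: measurable_funN.
  rewrite /I -mulN1r -RintegralZl//; last first.
    have := cintble_Im (cintble_exp_abs b e0); apply: eq_integrable => // x _ /=.
    by rewrite mulr0 add0r sinN.
  by apply: eq_Rintegral => x _; rewrite normrN mulrN sinN opprK; ring.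
lra.
Qed.

End Poisson.

Arguments Normc.normc {R} x : simpl never.
Arguments cintegral {d T R} mu f : simpl never.
Arguments fourier {R} f _ : simpl never.
Arguments expi {R} t : simpl never.

Section Bessel.
Context {R : realType}.
Local Notation leb := (@lebesgue_measure R).
Local Notation leb2 := (prodsf leb leb).
Implicit Types h : R -> R[i].

Lemma cint_real_ge0 d (T : measurableType d) (mu : {measure set T -> \bar R}) (f : T -> R) :
  measurable_fun setT f -> (forall x, 0 <= f x) -> (\int[mu]_x (f x)%:E < +oo)%E ->
  (\int[mu]_x (f x)%:E = (nc (cintegral mu (fun x => (f x)%:C)))%:E)%E.
Proof.
move=> mf f0 foo.
have -> : cintegral mu (fun x => (f x)%:C) = (\int[mu]_x f x)%:C.
  by apply: complex_ext => //=; rewrite /Rintegral integral0.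
have I0 : (0 <= \int[mu]_x (f x)%:E)%E by apply: integral_ge0 => x _; rewrite lee_fin.
by rewrite ncR ger0_norm ?fine_ge0// /Rintegral fineK// ge0_fin_numE.
Qed.

Lemma cmeas_fourier h : cmeasurable h -> cmeasurable (fourier h).
Proof. by move=> mh; rewrite /fourier; meas. Qed.

Lemma cintble_fourier h (xi : R) : cintble leb h ->
  cintble leb (fun x => expi (- (2 * pi * x * xi)) * h x).
Proof.
move=> hi; apply: (@cintble_bddM _ _ _ _ _ _ 1) => //; last by move=> x; rewrite nc_expi.
by meas.
Qed.

Lemma fourier_bdd h (xi : R) : cintble leb h ->
  nc (fourier h xi) <= fine (\int[leb]_x (nc (h x))%:E)%E.
Proof.
move=> hi; apply: nc_le_fine; first by have [] := hi.
apply: le_trans (cint_norm (cintble_fourier xi hi)) _.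
by under eq_integral do rewrite ncM nc_expi mul1r.
Qed.

Lemma poisson_conv_le (e : R) (q : R -> R) : 0 < e -> measurable_fun setT q ->
  (forall x, 0 <= q x) ->
  (\int[leb]_x \int[leb]_y (q x * poisson e (x - y))%:E = \int[leb]_x (q x)%:E)%E.
Proof.
move=> e0 mq q0; have mp := measurable_poisson e0.
apply: eq_integral => x _; under eq_integral do rewrite EFinM.
rewrite ge0_integralZl//; last 3 first.
- by meas.
- by move=> y _; rewrite lee_fin poisson_ge0.
- by rewrite lee_fin.
rewrite (nneint_subl x (f := fun y => (poisson e y)%:E)) ?integral_poisson ?mule1//.
- by meas.
- by move=> y; rewrite lee_fin poisson_ge0.
Qed.

Lemma poisson_conv_le2 (e : R) (q : R -> R) : 0 < e -> measurable_fun setT q ->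
  (forall x, 0 <= q x) ->
  (\int[leb]_x \int[leb]_y (q y * poisson e (x - y))%:E = \int[leb]_x (q x)%:E)%E.
Proof.
move=> e0 mq q0; have mp := measurable_poisson e0.
rewrite (@fubini_tonelli _ _ _ _ _ leb leb (fun z => (q z.2 * poisson e (z.1 - z.2))%:E)); last 2 first.
- by meas.
- by move=> z; rewrite lee_fin mulr_ge0// poisson_ge0.
rewrite -(poisson_conv_le e0 mq q0).
apply: eq_integral => x _ /=; apply: eq_integral => y _; congr (_ * _)%:E.
by rewrite /poisson -opprB mulrN sqrrN.
Qed.

Lemma cintbleM_prod d1 d2 (T1 : measurableType d1) (T2 : measurableType d2)
  (m1 : {sigma_finite_measure set T1 -> \bar R}) (m2 : {sigma_finite_measure set T2 -> \bar R})
  (f : T1 -> R[i]) (g : T2 -> R[i]) : cintble m1 f -> cintble m2 g ->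
  cintble (m1 \x m2)%E (fun z => f z.1 * g z.2).
Proof.
move=> [mf foo] [mg goo]; apply: cintble_prodE; first by meas.
rewrite (_ : (fun x => _) = (fun x => (nc (f x))%:E * \int[m2]_y (nc (g y))%:E)%E); last first.
  apply/funext => x; rewrite -ge0_integralZl//.
  - by apply: eq_integral => y _; rewrite ncM.
  - by meas.
  - by move=> y _; rewrite lee_fin nc_ge0.
  - by rewrite lee_fin nc_ge0.
have f0 : (0 <= \int[m1]_y (nc (f y))%:E)%E by apply: integral_ge0 => y _; rewrite lee_fin nc_ge0.
have g0 : (0 <= \int[m2]_y (nc (g y))%:E)%E by apply: integral_ge0 => y _; rewrite lee_fin nc_ge0.
rewrite ge0_integralZr//.
- by rewrite lte_mul_pinfty// ge0_fin_numE.
- by meas.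
- by move=> x _; rewrite lee_fin nc_ge0.
Qed.

Lemma nc_sqr_fourier h (xi : R) : cintble leb h ->
  (nc (fourier h xi) ^+ 2)%:C =
  cintegral leb2 (fun z => h z.1 * (h z.2)^* * expi (- (2 * pi * (z.1 - z.2) * xi))).
Proof.
move=> hi; have fi := cintble_fourier xi hi.
have fJ := cintbleJ fi.
rewrite -mulcJ /fourier -(cintJ fi).
rewrite -(cintZr _ fi).
transitivity (cintegral leb (fun x => cintegral leb (fun y =>
  (expi (- (2 * pi * x * xi)) * h x) * (expi (- (2 * pi * y * xi)) * h y)^*))).
  by apply: eq_cint => x; rewrite cintZl.
rewrite (@cfubini1 _ _ _ _ _ leb leb (fun z => (expi (- (2 * pi * z.1 * xi)) * h z.1) *
   (expi (- (2 * pi * z.2 * xi)) * h z.2)^*)); last exact: cintbleM_prod fi fJ.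
apply: eq_cint => z; rewrite rmorphM/= expiJ opprK.
rewrite (_ : - (2 * pi * (z.1 - z.2) * xi) = - (2 * pi * z.1 * xi) + 2 * pi * z.2 * xi); last ring.
by rewrite expiD; ring.
Qed.

(** Expanding the square and integrating the damping factor over xi first leaves h(x) h(y)^* against
    the Poisson kernel at x - y. Bound the product by half the sum of the squares; the kernel has
    integral 1 in each variable. *)
Lemma bessel_poisson h (e : R) : 0 < e -> cintble leb h ->
  (\int[leb]_xi (nc (fourier h xi) ^+ 2 * expR (- (e * `|xi|)))%:E <=
   \int[leb]_x (nc (h x) ^+ 2)%:E)%E.
Proof.
move=> e0 hi; have [mh hoo] := hi.
have mF := cmeas_fourier mh; have me := measurable_exp_abs e; have mp := measurable_poisson e0.
pose B := fine (\int[leb]_x (nc (h x))%:E)%E.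
have B0 : 0 <= B by rewrite fine_ge0// integral_ge0// => x _; rewrite lee_fin nc_ge0.
have FB xi : nc (fourier h xi) <= B by exact: fourier_bdd.
rewrite cint_real_ge0; last 3 first.
- by meas.
- by move=> x; rewrite mulr_ge0 ?expR_ge0 ?sqr_ge0.
- apply: (@le_lt_trans _ _ (\int[leb]_xi ((B ^+ 2)%:E * (expR (- (e * `|xi|)))%:E))%E).
    apply: ge0_le_integral => //.
    + by move=> x _; rewrite lee_fin mulr_ge0 ?expR_ge0 ?sqr_ge0.
    + by meas.
    + by meas.
    + by move=> x _; rewrite lee_fin ler_wpM2r ?expR_ge0// lerXn2r// nnegrE ?nc_ge0.
  rewrite ge0_integralZl//.
  + by rewrite integral_exp_abs// -EFinM ltry.
  + by meas.
  + by rewrite lee_fin sqr_ge0.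
pose K (z : R * (R * R)) := h z.2.1 * (h z.2.2)^* * expi (- (2 * pi * (z.2.1 - z.2.2) * z.1)) * (expR (- (e * `|z.1|)))%:C.
have mK : cmeasurable K by rewrite /K; meas.
have Ei : cintble leb (fun x => (expR (- (e * `|x|)))%:C).
  by have := cintble_exp_abs 0 e0; under eq_fun do rewrite mul0r oppr0 expi0 mul1r.
have Wi : cintble leb2 (fun z => h z.1 * (h z.2)^*) by exact: cintbleM_prod hi (cintbleJ hi).
have Ki : cintble (leb \x leb2)%E K.
  have := cintbleM_prod Ei Wi => -[_ oo]; split => //.
  apply: le_lt_trans oo; rewrite le_eqVlt; apply/orP; left; apply/eqP.
  by apply: eq_integral => z _; rewrite /K !ncM nc_expi; congr _%:E; ring.
have -> : cintegral leb (fun xi => (nc (fourier h xi) ^+ 2 * expR (- (e * `|xi|)))%:C) =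
   cintegral leb2 (fun z => h z.1 * (h z.2)^* * (poisson e (z.1 - z.2))%:C).
  transitivity (cintegral leb (fun xi => cintegral leb2 (fun z => K (xi, z)))).
    apply: eq_cint => xi; rewrite rmorphM/= nc_sqr_fourier// -cintZr//.
    rewrite (_ : (fun z => _) = fun z => expi (- (2 * pi * (z.1 - z.2) * xi)) * (h z.1 * (h z.2)^*)).
      by apply: (@cintble_bddM _ _ _ _ _ _ 1) => //; [meas|move=> z; rewrite nc_expi].
    by apply/funext => z; rewrite mulrC.
  rewrite (cfubini1 Ki) -(cfubini2 Ki); apply: eq_cint => z; rewrite /K /=.
  rewrite /poisson -(fourier_exp_abs _ e0) -cintZl; last exact: cintble_exp_abs.
  by apply: eq_cint => x; rewrite mulrA.
have mW : measurable_fun setT (fun z : R * R => nc (h z.1) ^+ 2 * poisson e (z.1 - z.2)) by meas.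
have mW2 : measurable_fun setT (fun z : R * R => nc (h z.2) ^+ 2 * poisson e (z.1 - z.2)) by meas.
have p0 (z : R * R) : 0 <= poisson e (z.1 - z.2) by exact: poisson_ge0.
apply: (le_trans (cint_norm_le _ _)); first by meas.
apply: (@le_trans _ _ (\int[leb2]_z (2^-1%:E * ((nc (h z.1) ^+ 2 * poisson e (z.1 - z.2))%:E +
   (nc (h z.2) ^+ 2 * poisson e (z.1 - z.2))%:E)))%E).
  apply: ge0_le_integral => //=.
  - by move=> z _; rewrite lee_fin nc_ge0.
  - by meas.
  - by meas.
  move=> z _; rewrite -EFinD -EFinM lee_fin !ncM ncJ ncR ger0_norm// -mulrDl mulrA ler_wpM2r//.
  by have := sqr_ge0 (nc (h z.1) - nc (h z.2)); lra.
rewrite ge0_integralZl//; last 2 first.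
- exact/measurable_EFinP/measurable_funD.
- by move=> z _; rewrite adde_ge0// lee_fin mulr_ge0// sqr_ge0.
rewrite ge0_integralD//; last 4 first.
- by move=> z _; rewrite lee_fin mulr_ge0// sqr_ge0.
- exact/measurable_EFinP.
- by move=> z _; rewrite lee_fin mulr_ge0// sqr_ge0.
- exact/measurable_EFinP.
rewrite fubini_tonelli1; last 2 first.
- exact/measurable_EFinP.
- by move=> z; rewrite lee_fin mulr_ge0// sqr_ge0.
rewrite fubini_tonelli1; last 2 first.
- exact/measurable_EFinP.
- by move=> z; rewrite lee_fin mulr_ge0// sqr_ge0.
rewrite /fubini_F /= (poisson_conv_le e0 (q := fun x => nc (h x) ^+ 2)); last 2 first.
- by meas.
- by move=> x; exact: sqr_ge0.
rewrite (poisson_conv_le2 e0 (q := fun x => nc (h x) ^+ 2)); last 2 first.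
- by meas.
- by move=> x; exact: sqr_ge0.
have i0 : (0 <= \int[leb]_x (nc (h x) ^+ 2)%:E)%E by apply: integral_ge0 => x _; rewrite lee_fin sqr_ge0.
move: (\int[leb]_x _)%E i0 => [r| |]// r0.
  by rewrite -EFinD -EFinM lee_fin; lra.
by rewrite addye// gt0_muley ?lte_fin.
Qed.

(** The damping factors with e = 1 / (n + 1) increase to 1, so monotone convergence removes them.
    Only this half of the Plancherel identity enters the estimates. *)
Theorem bessel h : cintble leb h ->
  (\int[leb]_xi (nc (fourier h xi) ^+ 2)%:E <= \int[leb]_x (nc (h x) ^+ 2)%:E)%E.
Proof.
move=> hi; have [mh _] := hi; have mF := cmeas_fourier mh.
pose g n xi := (nc (fourier h xi) ^+ 2 * expR (- (n.+1%:R^-1 * `|xi|)))%:E.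
have mg n : measurable_fun setT (g n).
  by have me := @measurable_exp_abs R n.+1%:R^-1; rewrite /g; meas.
have g0 n xi : (0 <= g n xi)%E by rewrite lee_fin mulr_ge0 ?expR_ge0 ?sqr_ge0.
have gnd xi : nondecreasing_seq (g ^~ xi).
  move=> m n mn; rewrite lee_fin ler_wpM2l ?sqr_ge0// ler_expR lerN2 ler_wpM2r//.
  by rewrite lef_pV2 ?posrE// ler_nat.
have gl xi : g n xi @[n --> \oo] --> (nc (fourier h xi) ^+ 2)%:E.
  apply: cvg_EFin; first by apply: nearW.
  rewrite -[X in _ --> X]mulr1; apply: cvgM; first exact: cvg_cst.
  rewrite -[X in _ --> X](@expR0 R); apply: continuous_cvg; first exact: continuous_expR.
  rewrite -[X in _ --> X]oppr0 -[X in _ --> - X](mul0r `|xi|); apply: cvgN; apply: cvgM; last exact: cvg_cst.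
  exact: cvg_harmonic.
rewrite [leLHS](_ : _ = \int[leb]_xi (limn (g ^~ xi)))%E; last first.
  by apply: eq_integral => xi _; apply/esym/cvg_lim => //; exact: gl.
rewrite monotone_convergence//.
apply: lime_le; last by apply: nearW => n; exact: bessel_poisson.
apply: ereal_nondecreasing_is_cvgn => m n mn.
by apply: le_nnint; [exact: mg|exact: mg|exact: g0|move=> xi; exact: gnd].
Qed.

End Bessel.

(** * Derivatives, dominated convergence and inversion for the Fourier transform *)

Section FourierTools.
Context {R : realType}.
Local Notation leb := (@lebesgue_measure R).
Local Notation leb2 := (prodsf leb leb).
Implicit Types h : R -> R[i].

Definition win (a b w : R) : R[i] := if (a <= w) && (w <= b) then 1 else 0.

Lemma nc1 : nc (1 : R[i]) = 1. Proof. by rewrite (ncR 1) normr1. Qed.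

Lemma nc_win a b w : nc (win a b w) = ((a <= w) && (w <= b))%:R.
Proof. by rewrite /win; case: ifP => _; rewrite ?nc1 ?nc0. Qed.

Lemma cmeas_win a b : cmeasurable (win a b).
Proof.
have m : cmeasurable (fun w : R => if (a <= w) && (w <= b) then 1 else 0 : R[i]) by meas.
exact: m.
Qed.

Lemma nnint_itv (f : R -> \bar R) (a b : R) :
  (\int[leb]_x (((a <= x) && (x <= b))%:R%:E * f x) = \int[leb]_(x in `[a, b]) f x)%E.
Proof.
rewrite [RHS]integral_mkcond; apply: eq_integral => x _; rewrite /patch.
rewrite mem_setE in_itv /=; case: ifP => _; first by rewrite mul1e.
by rewrite mul0e.
Qed.

Lemma int_win a b : a <= b -> (\int[leb]_x (nc (win a b x))%:E = (b - a)%:E)%E.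
Proof.
move=> ab; under eq_integral do rewrite nc_win -[_%:E]mule1.
rewrite (nnint_itv (cst 1%E)) integral_cst//= mul1e lebesgue_measure_itv/= lte_fin.
case: ltP => // ba; have -> : b = a by apply/le_anti; rewrite ab ba.
by rewrite subrr.
Qed.

Lemma cintble_win a b : cintble leb (win a b).
Proof.
split; first exact: cmeas_win.
have [ab|ba] := leP a b; first by rewrite int_win// ltry.
rewrite integral0_eq// => x _; rewrite nc_win; case: (boolP (_ && _)) => //= /andP[ax xb].
by have := le_lt_trans (le_trans ax xb) ba; rewrite ltxx.
Qed.

(** The absence of a division by [b] keeps the case b = 0. *)
Lemma expi_integral (b u : R) : 0 <= u ->
  (Complex 0 b) * cintegral leb (fun w => win 0 u w * expi (b * w)) = expi (b * u) - 1.
Proof.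
rewrite le_eqVlt => /predU1P[<-|u0].
  rewrite mulr0 expi0 subrr (ae_eq_cint (g := fun=> 0)) ?cint0 ?mulr0//.
  - by have mw := cmeas_win 0 0; meas.
  exists [set 0]; split => //; first exact: lebesgue_measure_set1.
  move=> w /= H; apply: contrapT => w0; apply: H; rewrite /win.
  case: ifP => [/andP[w1 w2]|_]; last by rewrite mul0r.
  by case: w0; apply/le_anti; rewrite w1 w2.
have E (f F : R -> R) : (forall x : R, is_derive x 1 F (b * f x)) -> continuous f ->
    b * \int[leb]_w (((0 <= w) && (w <= u))%:R * f w) = F u - F 0.
  move=> dF cf; have cF : continuous F by move=> x; exact: isd_continuous (dF x).
  rewrite /Rintegral; under eq_integral do rewrite EFinM.
  rewrite (nnint_itv (EFin \o f)).
  have := @continuous_FTC2 R (fun x => b * f x) F 0 u u0.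
  have -> : (\int[leb]_(x in `[0%R, u]) (b * f x)%:E = b%:E * \int[leb]_(x in `[0%R, u]) (f x)%:E)%E.
    under eq_integral do rewrite EFinM.
    rewrite integralZl//; apply: continuous_compact_integrable; first exact: segment_compact.
    exact: continuous_subspaceT.
  have ifi : leb.-integrable `[0, u] (EFin \o f).
    apply: continuous_compact_integrable; first exact: segment_compact.
    exact: continuous_subspaceT.
  have fn : (\int[leb]_(x in `[0%R, u]) (f x)%:E \is a fin_num)%E by exact: integrable_fin_num.
  rewrite -EFinB => H; apply: EFin_inj; rewrite EFinM fineK//; apply: H.
  - apply: continuous_subspaceT => x; apply: cvgM; [exact: cvg_cst|exact: cf].
  - split; first by move=> x _; exact: isd_derivable (dF x).
    + by apply/cvg_at_right_filter; exact: cF.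
    + by apply/cvg_at_left_filter; exact: cF.
  - by move=> x _; exact: isdE.
have dR w : complex.Re (win 0 u w * expi (b * w)) = ((0 <= w) && (w <= u))%:R * cos (b * w).
  by rewrite /win /expi; case: ifP => _ /=; rewrite ?mul1r ?mul0r ?subr0.
have dI w : complex.Im (win 0 u w * expi (b * w)) = ((0 <= w) && (w <= u))%:R * sin (b * w).
  by rewrite /win /expi; case: ifP => _ /=; rewrite ?mul1r ?mul0r ?addr0.
have cc : continuous (fun w => cos (b * w)).
  move=> x; apply: (continuous_comp (f := fun x => b * x)); last exact: continuous_cos.
  by apply: cvgM; [exact: cvg_cst|exact: cvg_id].
have cs : continuous (fun w => sin (b * w)).
  move=> x; apply: (continuous_comp (f := fun x => b * x)); last exact: continuous_sin.
  by apply: cvgM; [exact: cvg_cst|exact: cvg_id].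
have dS (x : R) : is_derive x 1 (fun w : R => sin (b * w)) (b * cos (b * x)) by isd; rewrite mulr1 mulr0 addr0.
have dC (x : R) : is_derive x 1 (fun w : R => - cos (b * w)) (b * sin (b * x)) by isd; rewrite mulr1 mulr0 addr0 mulrN opprK.
have EC := E _ _ dS cc; have ES := E _ _ dC cs.
apply: complex_ext; rewrite ?ReM ?ImM.
  rewrite /cintegral /=; under [X in _ - _ * X]eq_Rintegral do rewrite dI.
  by rewrite mul0r sub0r ES mulr0 cos0 /expi /=; ring.
rewrite /cintegral /=; under [X in _ + _ * X]eq_Rintegral do rewrite dR.
by rewrite mul0r add0r EC mulr0 sin0 /expi /=; ring.
Qed.

(** Convergence in the complex plane is expressed by [nc] of the difference tending to 0 in the
    reals; the real dominated convergence theorem then applies to these differences with majorant 2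
    G. *)
Lemma cdominated d (T : measurableType d) (mu : {measure set T -> \bar R})
  (f_ : nat -> T -> R[i]) (f : T -> R[i]) (G : T -> R) :
  (forall n, cmeasurable (f_ n)) -> cmeasurable f -> measurable_fun setT G ->
  (\int[mu]_x (G x)%:E < +oo)%E ->
  (forall n x, nc (f_ n x) <= G x) ->
  {ae mu, forall x, nc (f_ n x - f x) @[n --> \oo] --> (0 : R)} ->
  cintble mu f /\ nc (cintegral mu (f_ n) - cintegral mu f) @[n --> \oo] --> (0 : R).
Proof.
move=> mf_ mf mG Goo fG cf.
have G0 x : 0 <= G x by exact: le_trans (nc_ge0 _) (fG 0 x).
have fG' : {ae mu, forall x, nc (f x) <= G x}.
  apply: filterS cf => x cx; apply/ler_addgt0Pr => e e0.
  have /cvgrPdist_lt/(_ e e0)[n _ /(_ n (leqnn n))] := cx.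
  rewrite sub0r normrN ger0_norm ?nc_ge0// => lte.
  rewrite (_ : f x = f_ n x - (f_ n x - f x)); last by ring.
  by rewrite (le_trans (ncB _ _))// lerD// ltW.
have fi n : cintble mu (f_ n) by exact: cintble_dom (fG n) _.
have fi' : cintble mu f.
  split=> //; apply: le_lt_trans Goo; apply: ae_le_nnint.
  - by meas.
  - by meas.
  - by move=> x; rewrite lee_fin nc_ge0.
  - by move=> x; rewrite lee_fin.
  - by apply: filterS fG' => x; rewrite lee_fin.
split=> //.
have [| | | | |_ _ cv] := @dominated_convergence _ _ R mu setT measurableT
    (fun n x => (nc (f_ n x - f x))%:E) (fun=> 0%E) (fun x => (2 * G x)%:E).
- by move=> n; meas; exact: mf_.
- exact: measurable_cst.
- by apply: filterS cf => x cx _; apply: cvg_EFin => //; apply: nearW.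
- apply/integrableP; split; first by meas.
  under eq_integral do rewrite gee0_abs ?lee_fin ?mulr_ge0// EFinM.
  by rewrite nnintZl//; [rewrite lte_mul_pinfty// lee_fin|meas].
- apply: filterS fG' => x fx n _; rewrite /= ger0_norm ?nc_ge0// lee_fin.
  by rewrite mulrDl mul1r (le_trans (ncB _ _))// lerD.
rewrite integral0 in cv.
have {}cv : fine (\int[mu]_x (nc (f_ n x - f x))%:E)%E @[n --> \oo] --> (0 : R).
  by have /fine_cvgP[_] := cv.
apply: (@squeeze_cvgr _ _ _ _ (fun=> 0) (fun n => fine (\int[mu]_x (nc (f_ n x - f x))%:E)%E)).
- apply: nearW => n; rewrite nc_ge0 /= -cintB//; have [dm doo] := cintbleB (fi n) fi'.
  exact: nc_le_fine doo (cint_norm_le _ dm).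
- exact: cvg_cst.
- exact: cv.
Qed.

Lemma cintble_shift (f : R -> R[i]) (v : R) : cintble leb f -> cintble leb (fun y : R => f (y + v)).
Proof.
move=> [mf foo]; split; first by meas.
rewrite (nneint_shift v (f := fun y => (nc (f y))%:E)) => //; first by meas.
by move=> x; rewrite lee_fin nc_ge0.
Qed.

Lemma cint_win (a b : R) : a <= b -> cintegral leb (win a b) = (b - a)%:C.
Proof.
move=> ab; have E := int_win ab.
rewrite -[b - a]/(fine (b - a)%:E) -E; apply: complex_ext => /=.
  congr fine; apply: eq_integral => x _; rewrite nc_win /win.
  by case: ifP.
rewrite /Rintegral integral0_eq// => x _; rewrite /win.
by case: ifP.
Qed.

(** Transforming the increment identity for a step u gives (e(xi u) - 1) times the transform of [h],
    equal to the integral of e(xi w) over [0, u] times the transform of [h']. The first factors are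
    proportional by [expi_integral] and cancel once e(xi u) differs from 1; at xi = 0 the step u = 1
    shows that [h'] has integral 0. Countably many steps suffice, so that one null set can serve all
    of them later. *)
Lemma fourier_derivative h h' (xi : R) : cintble leb h -> cintble leb h' ->
  (forall n, {ae leb, forall y, h (y + n.+1%:R^-1) - h y =
     cintegral leb (fun w => win 0 n.+1%:R^-1 w * h' (y + w))}) ->
  fourier h' xi = Complex 0 (2 * pi * xi) * fourier h xi.
Proof.
move=> hi hi' hh'; have [mh _] := hi; have [mh' h'oo] := hi'.
have key n : (expi (2 * pi * xi * n.+1%:R^-1) - 1) * fourier h xi =
   cintegral leb (fun w => win 0 n.+1%:R^-1 w * expi (2 * pi * xi * w)) * fourier h' xi.
  set u := n.+1%:R^-1.
  have mw := cmeas_win 0 u.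
  have mhu : cmeasurable (fun y : R => h (y + u)) by meas.
  have hui : cintble leb (fun y : R => h (y + u)).
    split=> //; rewrite (nneint_shift u (f := fun y => (nc (h y))%:E)).
    - by case: hi.
    - by meas.
    - by move=> x; rewrite lee_fin nc_ge0.
  have fs (f : R -> R[i]) (v : R) : cintble leb f ->
      cintegral leb (fun y => expi (- (2 * pi * y * xi)) * f (y + v)) =
      expi (2 * pi * xi * v) * fourier f xi.
    move=> fi; have [mf _] := fi; rewrite /fourier -cintZl; last exact: cintble_fourier.
    rewrite -[RHS](cint_shift v); last by meas.
    apply: eq_cint => y; rewrite mulrA -expiD; congr (expi _ * _); ring.
  transitivity (cintegral leb (fun y => expi (- (2 * pi * y * xi)) * (h (y + u) - h y))).
    rewrite mulrBl mul1r -fs// -cintB.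
    - by apply: eq_cint => y; rewrite mulrBr.
    - exact: cintble_fourier.
    - exact: cintble_fourier.
  transitivity (cintegral leb (fun y => cintegral leb (fun w =>
       expi (- (2 * pi * y * xi)) * (win 0 u w * h' (y + w))))).
    apply: ae_eq_cint.
    - by meas.
    - by meas.
    have := hh' n; apply: ae_imp => y ->; rewrite cintZl//.
    apply: (@cintble_bddM _ _ _ leb _ _ 1) => //.
    - by move=> x; rewrite nc_win; case: (_ && _).
    - by under eq_fun do rewrite addrC; exact: cintble_shift.
  rewrite (@cfubini _ _ _ _ _ leb leb (fun z => expi (- (2 * pi * z.1 * xi)) * (win 0 u z.2 * h' (z.1 + z.2)))).
  - rewrite -cintZr; last first.
      under eq_fun do rewrite mulrC.
      apply: (@cintble_bddM _ _ _ leb _ _ 1); [by meas|by move=> x; rewrite nc_expi|exact: cintble_win].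
    apply: eq_cint => w /=.
    rewrite -mulrA -(fs h' w)// -cintZl; last first.
      apply: (@cintble_bddM _ _ _ leb _ _ 1) => //; [by meas|by move=> x; rewrite nc_expi|].
      exact: cintble_shift.
    by apply: eq_cint => y; ring.
  - by meas.
  - rewrite (@fubini_tonelli _ _ _ _ _ leb leb (fun z => (nc (expi (- (2 * pi * z.1 * xi)) * (win 0 u z.2 * h' (z.1 + z.2))))%:E)); last 2 first.
    + by meas.
    + by move=> z; rewrite lee_fin nc_ge0.
    rewrite [X in (X < _)%E](_ : _ = \int[leb]_w ((nc (win 0 u w))%:E * \int[leb]_x (nc (h' x))%:E))%E; last first.
      apply: eq_integral => w _ /=; rewrite -nnintZl ?nc_ge0//; last 2 first.
      + by meas.
      + by move=> z; rewrite lee_fin nc_ge0.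
      rewrite -[RHS](nneint_shift w).
      * by apply: eq_integral => y _; rewrite !ncM nc_expi mul1r.
      * by meas.
      * by move=> z; rewrite lee_fin mulr_ge0 ?nc_ge0.
    have h0 : (0 <= \int[leb]_x (nc (h' x))%:E)%E by apply: nnint_ge0 => x; rewrite lee_fin nc_ge0.
    rewrite ge0_integralZr//.
    + by rewrite int_win ?invr_ge0// lte_mul_pinfty// lee_fin subr0 invr_ge0.
    + by meas.
    + by move=> x _; rewrite lee_fin nc_ge0.
have [x0|x0] := eqVneq xi 0.
  have := key 0%N; rewrite x0 !mulr0 mul0r expi0 subrr !mul0r.
  have -> : cintegral leb (fun w => win 0 1^-1 w * expi (0 * w)) = cintegral leb (win 0 1).
    by apply: eq_cint => w; rewrite invr1 mul0r expi0 mulr1.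
  by rewrite cint_win// subr0 mul1r => <-.
have pi0 := pi_gt0 R.
(* With 2 pi |xi| u below pi, the sine of 2 pi xi u is nonzero, hence e(xi u) is not 1. *)
have [n nn] : exists n, 2 * pi * `|xi| * n.+1%:R^-1 < pi.
  exists (Num.bound (2 * `|xi|)).
  rewrite ltr_pdivrMr// mulrAC mulrC ltr_pM2l//.
  apply: lt_le_trans (archi_boundP _) _; first by rewrite mulr_ge0.
  by rewrite ler_nat.
have e1 : expi (2 * pi * xi * n.+1%:R^-1) - 1 != 0.
  have sn (t : R) : 0 < t < pi -> sin t != 0.
    by move=> /sin_gt0_pi; apply: lt0r_neq0.
  suff : sin (2 * pi * xi * n.+1%:R^-1) != 0.
    apply: contra_neq => /eqP; rewrite subr_eq0 /expi => /eqP E.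
    by have := congr1 (@complex.Im R) E.
  have [xp|xn] := ltP 0 xi.
    by apply: sn; rewrite !mulr_gt0 ?invr_gt0//= -(gtr0_norm xp).
  have xn0 : xi < 0 by rewrite lt_neqAle x0.
  rewrite -[xi]opprK !(mulrN, mulNr) sinN oppr_eq0; apply: sn.
  by rewrite -mulNr -mulrN -(ltr0_norm xn0) nn andbT !mulr_gt0 ?invr_gt0// ltr0_norm// oppr_gt0.
have un0 : 0 <= n.+1%:R^-1 :> R by rewrite invr_ge0.
have E := expi_integral (2 * pi * xi) un0.
apply: (mulfI e1).
by rewrite [RHS]mulrCA (key n) mulrA E.
Qed.


Lemma mul_half_frac (a e : R) : 0 <= a -> 0 < e -> a * (e / (2 * (a + 1))) <= e / 2.
Proof.
move=> a0 e0; have a1 : 0 < a + 1 by rewrite ltr_wpDl.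
rewrite mulrA ler_pdivrMr; last by rewrite mulr_gt0.
rewrite (_ : e / 2 * (2 * (a + 1)) = a * e + e); last by field.
by rewrite lerDl ltW.
Qed.

(** Split at |z| = dl. Below, L |z| is at most L dl <= e / 2 and the kernel has mass 1; above, the
    kernel at t is at most K t times the kernel at 1, so the remaining part is at most 2 M K t <= e
    / 2. *)
Lemma poisson_lip_small (M L : R) : 0 <= M -> 0 <= L -> forall e : R, 0 < e -> exists2 d : R, 0 < d &
  forall t, 0 < t < d ->
  (\int[leb]_z (poisson t z * Num.min (2 * M) (L * `|z|))%:E <= e%:E)%E.
Proof.
move=> M0 L0 e e0; have p0 := pi_gt0 R.
pose dl := e / (2 * (L + 1)).
have dl0 : 0 < dl by rewrite divr_gt0// mulr_gt0// ltr_wpDl.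
pose K := (1 + (2 * pi * dl) ^+ 2) / (2 * pi * dl) ^+ 2.
have a0 : 0 < (2 * pi * dl) ^+ 2 by rewrite exprn_gt0// mulr_gt0// mulr_gt0.
have K0 : 0 < K by rewrite divr_gt0// ltr_wpDr ?sqr_ge0.
pose d := e / (2 * (2 * M * K + 1)).
have MK0 : 0 <= 2 * M * K by pos.
exists d; first by rewrite divr_gt0// mulr_gt0// ltr_wpDl.
move=> t /andP[t0 td]; have mp := measurable_poisson t0; have mp1 := @measurable_poisson R _ ltr01.
have bnd z : poisson t z * Num.min (2 * M) (L * `|z|) <= L * dl * poisson t z + 2 * M * K * t * poisson 1 z.
  have pt := poisson_ge0 z t0; have p1 := poisson_ge0 z (@ltr01 R).
  have m1 : Num.min (2 * M) (L * `|z|) <= 2 * M by rewrite ge_min lexx.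
  have m2 : Num.min (2 * M) (L * `|z|) <= L * `|z| by rewrite ge_min lexx orbT.
  have [zd|dz] := leP `|z| dl.
    rewrite (le_trans (ler_wpM2l pt m2))// mulrC.
    by rewrite ler_wpDr ?ler_wpM2r ?ler_wpM2l//; pos.
  apply: (le_trans (ler_wpM2l pt m1)).
  have -> : 2 * M * K * t * poisson 1 z = 2 * M * (K * t * poisson 1 z) by ring.
  apply: (@le_trans _ _ (2 * M * (K * t * poisson 1 z))); last by rewrite lerDr; pos.
  rewrite mulrC; apply: ler_wpM2l; first by pos.
  rewrite /poisson !mulrA.
  have zz : (2 * pi * dl) ^+ 2 <= (2 * pi * z) ^+ 2.
    rewrite -[leRHS]real_normK ?num_real// normrM (gtr0_norm (_ : 0 < 2 * pi)) ?mulr_gt0//.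
    have q0 : 0 <= 2 * pi :> R by pos.
    move: (2 * pi : R) q0 => q q0.
    by apply: lerXn2r; rewrite ?nnegrE ?(mulr_ge0 q0 (ltW dl0)) ?(mulr_ge0 q0)// ler_wpM2l// ltW.
  move: zz a0; rewrite /K; set a := (2 * pi * dl) ^+ 2; set b := (2 * pi * z) ^+ 2 => zz a0'.
  have b0 : 0 < b by exact: lt_le_trans zz.
  rewrite ler_pdivrMr; last by rewrite ltr_wpDl ?sqr_ge0.
  rewrite expr1n mulr1 [leRHS](_ : _ = 2 * t * (((1 + a) * (t ^+ 2 + b)) / (a * (1 + b)))); last first.
    by field; rewrite !gt_eqF// addr_gt0.
  have ta0 : 0 <= a * t ^+ 2 by rewrite mulr_ge0 ?sqr_ge0// ltW.
  apply: ler_peMr; first by pos.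
  rewrite ler_pdivlMr; last by rewrite mulr_gt0// addr_gt0.
  rewrite mul1r.
  by have := sqr_ge0 t; move: zz; lra.
apply: (@le_trans _ _ (\int[leb]_z (L * dl * poisson t z + 2 * M * K * t * poisson 1 z)%:E)%E).
  apply: le_nnint.
  - by meas.
  - by meas.
  - by move=> z; rewrite lee_fin mulr_ge0 ?poisson_ge0// le_min; apply/andP; split; pos.
  - by move=> z; rewrite lee_fin.
under eq_integral do rewrite EFinD (EFinM (L * dl)) (EFinM (2 * M * K * t)).
rewrite nnintD.
- rewrite !nnintZl ?integral_poisson// ?mule1.
  + rewrite -EFinD lee_fin.
    have A : L * dl <= e / 2 by exact: mul_half_frac.
    have B : 2 * M * K * t <= e / 2.
      by apply: (le_trans (ler_wpM2l MK0 (ltW td))); exact: mul_half_frac.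
    by move: A B; lra.
  + by pos.
  + by meas.
  + by move=> x; rewrite lee_fin poisson_ge0.
  + by pos.
  + by meas.
  + by move=> x; rewrite lee_fin poisson_ge0.
- by meas.
- by meas.
- by move=> z; rewrite mule_ge0 ?lee_fin ?poisson_ge0//; pos.
- by move=> z; rewrite mule_ge0 ?lee_fin ?poisson_ge0//; pos.
Qed.


(* The Fourier multiplier [exp(-t|xi|)] is convolution with the Poisson kernel, an approximate identity. *)
Lemma poisson_inverse h (t x : R) : 0 < t -> cintble leb h ->
  cintegral leb (fun xi => expi (2 * pi * x * xi) * (expR (- (t * `|xi|)))%:C * fourier h xi) =
  cintegral leb (fun z => (poisson t z)%:C * h (x - z)).
Proof.
move=> t0 hi; have [mh _] := hi; have mp := measurable_poisson t0.
pose K (w : R * R) := expi (2 * pi * (x - w.2) * w.1) * (expR (- (t * `|w.1|)))%:C * h w.2.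
have mK : cmeasurable K by rewrite /K; meas.
have Ei : cintble leb (fun x => (expR (- (t * `|x|)))%:C).
  by have := cintble_exp_abs 0 t0; under eq_fun do rewrite mul0r oppr0 expi0 mul1r.
have Ki : cintble (leb \x leb)%E K.
  have [_ oo] := cintbleM_prod Ei hi; split => //.
  apply: le_lt_trans oo; rewrite le_eqVlt; apply/orP; left; apply/eqP.
  by apply: eq_integral => z _; rewrite /K !ncM nc_expi mul1r.
transitivity (cintegral leb (fun xi => cintegral leb (fun y => K (xi, y)))).
  apply: eq_cint => xi; rewrite /fourier -cintZl; last exact: cintble_fourier.
  apply: eq_cint => y; rewrite /K /=.
  rewrite (_ : 2 * pi * (x - y) * xi = 2 * pi * x * xi + - (2 * pi * y * xi)); last ring.
  by rewrite expiD; ring.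
rewrite (cfubini1 Ki) -(cfubini2 Ki).
rewrite -(cint_subl x (f := fun y => cintegral leb (fun xi => K (xi, y)))); last by rewrite /K; meas.
apply: eq_cint => z; rewrite /K /=.
rewrite (_ : x - (x - z) = z); last ring.
rewrite (_ : (fun xi => _) = fun xi => (expi (- ((2 * pi * - z) * xi)) * (expR (- (t * `|xi|)))%:C) * h (x - z)).
  rewrite cintZr; last exact: cintble_exp_abs.
  by rewrite fourier_exp_abs// /poisson mulrN sqrrN.
by apply/funext => xi; congr (expi _ * _ * _); ring.
Qed.

(** The Poisson means of h at x tend to the inversion integral by dominated convergence, and to h(x)
    by [poisson_lip_small]. The Lipschitz bound at almost every point takes the place of Lebesgue
    points. *)
Lemma fourier_inversion_ae h (M L : R) : 0 <= M -> 0 <= L -> cintble leb h -> cintble leb (fourier h) ->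
  (forall x, nc (h x) <= M) ->
  {ae leb, forall x, {ae leb, forall z, nc (h (x - z) - h x) <= L * `|z|}} ->
  {ae leb, forall x, h x = cintegral leb (fun xi => expi (2 * pi * x * xi) * fourier h xi)}.
Proof.
move=> M0 L0 hi Fi hM; have [mh _] := hi; have [mF Foo] := Fi.
apply: ae_imp => x hx.
pose t n : R := n.+1%:R^-1.
have t0 n : 0 < t n by rewrite invr_gt0.
pose S n := cintegral leb (fun xi => expi (2 * pi * x * xi) * (expR (- (t n * `|xi|)))%:C * fourier h xi).
pose I := cintegral leb (fun xi => expi (2 * pi * x * xi) * fourier h xi).
have [_ SI] : cintble leb (fun xi => expi (2 * pi * x * xi) * fourier h xi) /\
    nc (S n - I) @[n --> \oo] --> (0 : R).
  apply: (@cdominated _ _ leb _ _ (fun xi => nc (fourier h xi))) => //.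
  - by move=> n; meas.
  - by meas.
  - by meas.
  - move=> n xi; rewrite !ncM nc_expi mul1r ncR ger0_norm ?expR_ge0// ler_piMl ?nc_ge0//.
    by rewrite -expR0 ler_expR oppr_le0 mulr_ge0// ltW.
  apply: ae_true => xi.
  rewrite (_ : (fun n => nc _) = fun n => `|expR (- (t n * `|xi|)) - 1| * nc (fourier h xi)); last first.
    apply/funext => n; rewrite -mulrBl ncM -{2}[expi _]mulr1 -mulrBr ncM nc_expi mul1r.
    by rewrite -(rmorph1 (@real_complex_def _ _)) -rmorphB ncR.
  rewrite -[X in _ --> X](mul0r (nc (fourier h xi))); apply: cvgM; last exact: cvg_cst.
  rewrite -[X in _ --> X](@normr0 R R^o); apply: (@cvg_norm _ R^o); rewrite -[X in _ --> X](subrr 1).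
  apply: cvgB; last exact: cvg_cst.
  rewrite -[X in _ --> X](@expR0 R); apply: continuous_cvg; first exact: continuous_expR.
  rewrite -[X in _ --> X]oppr0 -[X in _ --> - X](mul0r `|xi|); apply: cvgN; apply: cvgM; last exact: cvg_cst.
  exact: cvg_harmonic.
apply/eqP; rewrite -subr_eq0; apply/eqP/nc_eq0/eqP; rewrite -[_ == _]negbK; apply/negP => n0.
have e0 : 0 < nc (h x - I) / 3 by rewrite divr_gt0// lt_neqAle eq_sym n0 nc_ge0.
have [d d0 Hd] := poisson_lip_small M0 L0 e0.
have [n [nd nS]] : exists n, t n < d /\ nc (S n - I) < nc (h x - I) / 3.
  have [N1 _ H1] : \forall n \near \oo, t n < d.
    have /cvgrPdist_lt/(_ d d0) := @cvg_harmonic R.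
    by apply: filterS => n; rewrite sub0r normrN gtr0_norm ?t0.
  have [N2 _ H2] : \forall n \near \oo, nc (S n - I) < nc (h x - I) / 3.
    have /cvgrPdist_lt/(_ _ e0) := SI.
    by apply: filterS => n; rewrite sub0r normrN ger0_norm ?nc_ge0.
  exists (maxn N1 N2); split; [apply: H1|apply: H2]; rewrite /= ?leq_maxl ?leq_maxr//.
have mp := measurable_poisson (t0 n).
have Pi : cintble leb (fun z => (poisson (t n) z)%:C).
  split; first by meas.
  under eq_integral do rewrite ncR ger0_norm ?poisson_ge0//.
  by rewrite integral_poisson// ltry.
have P1 : cintegral leb (fun z => (poisson (t n) z)%:C) = 1.
  have := integral_poisson (t0 n) => E.
  apply: complex_ext => /=; first by rewrite /cintegral /= /Rintegral E.
  by rewrite /cintegral /= /Rintegral integral0.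
have hSn : nc (S n - h x) <= nc (h x - I) / 3.
  have -> : S n - h x = cintegral leb (fun z => (poisson (t n) z)%:C * (h (x - z) - h x)).
    rewrite /S poisson_inverse// -[X in _ - X]mul1r -P1 -cintZr// -cintB.
    - by apply: eq_cint => z; rewrite mulrBr.
    - under eq_fun do rewrite mulrC.
      by apply: (@cintble_bddM _ _ _ leb _ _ M) => //; meas.
    - under eq_fun do rewrite mulrC.
      exact: cintbleZ.
  rewrite -lee_fin; apply: le_trans (Hd (t n) _); last by rewrite t0 nd.
  apply: (le_trans (cint_norm_le _ _)); first by meas.
  apply: ae_le_nnint.
  - by meas.
  - by meas.
  - by move=> z; rewrite lee_fin nc_ge0.
  - move=> z; rewrite lee_fin mulr_ge0 ?poisson_ge0// le_min; apply/andP; split; pos.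
  apply: ae_imp hx => z hz; rewrite lee_fin ncM ncR ger0_norm ?poisson_ge0//.
  rewrite ler_wpM2l ?poisson_ge0// le_min hz andbT mulrDl mul1r.
  by rewrite (le_trans (ncB _ _))// lerD.
have : nc (h x - I) <= nc (S n - h x) + nc (S n - I).
  rewrite -(ncN (S n - h x)) (_ : h x - I = - (S n - h x) + (S n - I)) ?ncD//; ring.
by move: hSn nS e0; lra.
Qed.

End FourierTools.

Section Tonelli.
Context d1 d2 (T1 : measurableType d1) (T2 : measurableType d2) (R : realType).
Variable m1 : {sigma_finite_measure set T1 -> \bar R}.
Variable m2 : {sigma_finite_measure set T2 -> \bar R}.
Implicit Types F : T1 -> T2 -> \bar R.

Lemma nnint_swap F : measurable_fun setT (fun z : T1 * T2 => F z.1 z.2) ->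
  (forall x y, (0 <= F x y)%E) ->
  (\int[m1]_x \int[m2]_y F x y = \int[m2]_y \int[m1]_x F x y)%E.
Proof. by move=> mF F0; exact: (@fubini_tonelli _ _ _ _ _ m1 m2 (fun z => F z.1 z.2)). Qed.

Lemma nnint_prod F : measurable_fun setT (fun z : T1 * T2 => F z.1 z.2) ->
  (forall x y, (0 <= F x y)%E) ->
  (\int[prodsf m1 m2]_z F z.1 z.2 = \int[m1]_x \int[m2]_y F x y)%E.
Proof. by move=> mF F0; exact: (@fubini_tonelli1 _ _ _ _ _ m1 m2 (fun z => F z.1 z.2)). Qed.

Lemma cint_swap (F : T1 -> T2 -> R[i]) : cintble (m1 \x m2)%E (fun z => F z.1 z.2) ->
  cintegral m1 (fun x => cintegral m2 (fun y => F x y)) =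
  cintegral m2 (fun y => cintegral m1 (fun x => F x y)).
Proof. by move=> Fi; rewrite (cfubini1 Fi) -(cfubini2 Fi). Qed.

Lemma cint_prodM (f : T1 -> R[i]) (g : T2 -> R[i]) : cintble m1 f -> cintble m2 g ->
  cintegral (prodsf m1 m2) (fun z => f z.1 * g z.2) = cintegral m1 f * cintegral m2 g.
Proof.
move=> fi gi; rewrite -(cfubini1 (cintbleM_prod fi gi)) -(cintZr _ fi).
by apply: eq_cint => x /=; rewrite cintZl.
Qed.
End Tonelli.

Lemma cmeas_win_of d (T : measurableType d) (R : realType) (a b w : T -> R) :
  measurable_fun setT a -> measurable_fun setT b -> measurable_fun setT w ->
  cmeasurable (fun x => win (a x) (b x) (w x)).
Proof.
move=> ma mb mw; apply: (@cmeas_if _ _ _ (fun x => (a x <= w x) && (w x <= b x))).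
- by apply: measurable_and; apply: measurable_fun_ler.
- exact: cmeas_cst.
- exact: cmeas_cst.
Qed.

Lemma cmeas_Complex d (T : measurableType d) (R : realType) (a b : T -> R) :
  measurable_fun setT a -> measurable_fun setT b -> cmeasurable (fun x => Complex (a x) (b x)).
Proof. by []. Qed.

Ltac meas2 := first [
    lazymatch goal with
    | |- cmeasurable (fun _ => win _ _ _) => apply: cmeas_win_of
    | |- cmeasurable (win _ _) => exact: cmeas_win
    | |- cmeasurable (fun _ => fourier _ _) => rewrite /fourier
    | |- measurable_fun _ (fun _ => poisson _ _) => 
       apply: (meas_comp_of (measurable_poisson _)); [by []|]
    | |- measurable_fun _ (fun _ => integral _ _ _) => apply: meas_nneint2; [|by move=> *; first [rewrite lee_fin; pos | apply: nnint_ge0 => ?; rewrite lee_fin; pos | apply: nnint_ge0 => ?; apply: nnint_ge0 => ?; rewrite lee_fin; pos]]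
    | |- cmeasurable (fun _ => Complex ?a _) => apply: cmeas_Complex
    end
  | meas1 ].
Ltac mes := repeat meas2.


Lemma cint_eq0 d (T : measurableType d) (R : realType) (mu : {measure set T -> \bar R}) (f : T -> R[i]) :
  (forall x, f x = 0) -> cintegral mu f = 0.
Proof. by move=> f0; rewrite -[RHS](cint0 mu); exact: eq_cint. Qed.

(** * A weighted Calderon-Vaillancourt estimate *)

Section PlaneShift.
Context {R : realType}.
Local Notation leb := (@lebesgue_measure R).
Local Notation leb2 := (prodsf leb leb).

Lemma nneint_shift2 (a b : R) (F : R -> R -> \bar R) :
  measurable_fun setT (fun z : R * R => F z.1 z.2) -> (forall x y, (0 <= F x y)%E) ->
  (\int[leb2]_z F (z.1 + a)%R (z.2 + b)%R = \int[leb2]_z F z.1 z.2)%E.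
Proof.
move=> mF F0; rewrite (@nnint_prod _ _ _ _ _ leb leb F)//.
rewrite (@nnint_prod _ _ _ _ _ leb leb (fun x y => F (x + a)%R (y + b)%R)); last 2 first.
- by apply: (meas_comp_of mF (u := fun z : R * R => (z.1 + a, z.2 + b))); meas.
- by move=> x y; exact: F0.
have mi : measurable_fun [set: R] (fun x => \int[leb]_y F x y)%E by exact: meas_nneint2.
rewrite -(nneint_shift a mi); last by move=> x; exact: nnint_ge0.
apply: eq_integral => x _; apply: (nneint_shift b (f := F (x + a))) => //.
by apply: (meas_comp_of mF (u := fun y : R => (x + a, y))); meas.
Qed.

Lemma cint_shift2 (a b : R) (f : R * R -> R[i]) : cintble leb2 f ->
  cintegral leb2 (fun z => f (z.1 + a, z.2 + b)) = cintegral leb2 f.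
Proof.
move=> [mf foo]; have mfs : cmeasurable (fun z : R * R => f (z.1 + a, z.2 + b)) by mes.
have fi' : cintble leb2 (fun z => f (z.1 + a, z.2 + b)).
  split => //; rewrite (@nneint_shift2 a b (fun x y => (nc (f (x, y)))%:E)).
  - by rewrite (_ : (fun z => _) = fun z => (nc (f z))%:E)//; apply/funext => -[].
  - by mes.
  - by move=> x y; rewrite lee_fin nc_ge0.
rewrite -(cfubini1 fi') -[RHS](cfubini1 (conj mf foo)) /=.
have ml : cmeasurable (fun x : R => cintegral leb (fun y => f (x, y))) by mes.
rewrite -[RHS](cint_shift a ml); apply: eq_cint => x.
by apply: (cint_shift b (f := fun y => f (x + a, y))); mes.
Qed.
End PlaneShift.

Section Master.
Context {R : realType}.
Local Notation leb := (@lebesgue_measure R).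
Local Notation leb2 := (prodsf leb leb).

(** One inequality encodes both the support in [0, 1] and the bound 1. *)
Definition window (E : R -> R[i]) := cmeasurable E /\ forall s, nc (E s) <= nc (win 0 1 s).

Lemma nc_win_le1 (a b w : R) : nc (win a b w) <= 1.
Proof. by rewrite nc_win; case: (_ && _). Qed.

Lemma window0 E (s : R) : window E -> ~~ ((0 <= s) && (s <= 1)) -> E s = 0.
Proof.
move=> [_ hE] s0; apply: nc_eq0; apply/le_anti; rewrite nc_ge0 andbT.
by apply: le_trans (hE s) _; rewrite nc_win (negbTE s0).
Qed.

(* [expi (2 pi s r)] is an integral over [-1, s] of functions of [r], for [s >= 0]. *)
Definition phase (rho r : R) : R[i] :=
  if rho < 0 then 1 else Complex 0 (2 * pi * r) * expi (2 * pi * r * rho).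

(** e(s r) is 1 plus the integral over [0, s] of its derivative, and the constant 1 is itself an
    integral over [-1, 0]. *)
Lemma phase_integral (s r : R) : 0 <= s ->
  cintegral leb (fun rho => win (-1) s rho * phase rho r) = expi (2 * pi * s * r).
Proof.
move=> s0; have ei := @expi_integral R (2 * pi * r) s s0.
pose B rho := win 0 s rho * expi (2 * pi * r * rho).
have Bi : cintble leb B.
  rewrite /B; under eq_fun do rewrite mulrC; apply: (@cintble_bddM _ _ _ leb _ _ 1); last exact: cintble_win.
  - by mes.
  - by move=> x; rewrite nc_expi.
rewrite (@ae_eq_cint _ _ _ leb _ (fun rho => win (-1) 0 rho + Complex 0 (2 * pi * r) * B rho)).
- rewrite cintD; [|exact: cintble_win|exact: cintbleZ].
  rewrite cintZl// ei cint_win; last lra.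
  rewrite sub0r opprK addrC subrK; congr expi; ring.
- by rewrite /phase; mes.
- by rewrite /B; mes.
(* The two windows are closed and overlap at 0, the only point where the integrands differ. *)
exists [set 0]; split => //; first exact: lebesgue_measure_set1.
move=> x /= h; apply/eqP; rewrite -[_ == _]negbK; apply/negP => x0; apply: h.
rewrite /phase /B /win; case: (ltP x 0) => x1 /=.
  have -> : x <= s by lra.
  have -> : x <= 0 by lra.
  by rewrite andbT; case: ifP; rewrite ?mulr1 ?mul0r ?mulr0 ?addr0.
have -> : -1 <= x by lra.
have -> : (x <= 0) = false by apply/negbTE; rewrite -ltNge lt_neqAle eq_sym x0.
rewrite andbF /= add0r; case: ifP => _; ring.
Qed.

(** The 8 bounds 2 pi, from pi <= 4. *)
Lemma nc_phase (rho r : R) : 0 <= r <= 1 -> nc (phase rho r) <= 8.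
Proof.
move=> /andP[r0 r1]; rewrite /phase; case: ifP => _; first by rewrite nc1 ler1n.
rewrite ncM nc_expi mulr1 (_ : Complex 0 (2 * pi * r) = Complex 0 1 * (2 * pi * r)%:C); last first.
  by apply: complex_ext; rewrite /=; ring.
rewrite ncM (_ : nc _ = 1) ?mul1r; last by rewrite /Normc.normc expr0n expr1n add0r sqrtr1.
have p0 := pi_ge0 R; have p4 : (pi : R) <= 4 by have := pihalf_lt2 R; lra.
move: p0 p4; move: (pi : R) => p p0 p4; rewrite ncR ger0_norm; nra.
Qed.

Lemma cmeas_phase : cmeasurable (fun z : R * R => phase z.1 z.2).
Proof. by rewrite /phase; mes. Qed.

(* Replacing [e(s r)] by an integral of [phase] splits [inner] into products of [Kw] and [Aw]. *)
Definition Kw (E g : R -> R[i]) (rho v xi : R) : R[i] :=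
  fourier (fun s => win rho 1 s * E s * g (v - s)) xi.
Definition Aw (E G : R -> R[i]) (rho v xi : R) : R[i] :=
  fourier (fun r => phase rho r * E r * G (xi - r)) v.

Lemma cintble_reflect (g : R -> R[i]) (v : R) : cintble leb g -> cintble leb (fun s : R => g (v - s)).
Proof.
move=> [mg goo]; split; first by mes.
rewrite (nneint_subl v (f := fun s => (nc (g s))%:E))//; first by mes.
by move=> s; rewrite lee_fin nc_ge0.
Qed.

Lemma nc_window_le1 E s : window E -> nc (E s) <= 1.
Proof. by move=> [_ hE]; apply: (le_trans (hE s)); exact: nc_win_le1. Qed.

Lemma nc_phaseM_le E (rho r : R) : window E -> nc (phase rho r * E r) <= 8 * nc (win 0 1 r).
Proof.
move=> wE; have [_ hE] := wE; have [r01|r01] := boolP ((0 <= r) && (r <= 1)).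
  by rewrite ncM ler_pM ?nc_ge0// nc_phase.
by rewrite (window0 wE r01) mulr0 nc0 mulr_ge0// nc_ge0.
Qed.

Lemma cintble_Kw E g (rho v : R) : window E -> cintble leb g ->
  cintble leb (fun s => win rho 1 s * E s * g (v - s)).
Proof.
move=> wE gi; have [mE hE] := wE; apply: (@cintble_bddM _ _ _ leb _ _ 1).
- by mes.
- by move=> s; rewrite ncM mulr_ile1 ?nc_ge0 ?nc_win_le1 ?nc_window_le1.
- exact: cintble_reflect.
Qed.

Lemma cintble_Aw E G (rho xi : R) : window E -> cintble leb G ->
  cintble leb (fun r => phase rho r * E r * G (xi - r)).
Proof.
move=> wE gi; have [mE hE] := wE; have mph := cmeas_phase.
apply: (@cintble_bddM _ _ _ leb _ _ 8).
- apply: cmeasM => //; apply: (cmeas_comp _ mph (u := fun r : R => (rho, r))); mes.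
- move=> s; apply: (le_trans (nc_phaseM_le rho s wE)).
  by rewrite -[leRHS]mulr1 ler_wpM2l// nc_win_le1.
- exact: cintble_reflect.
Qed.

(** The factor of Q(v, xi) in the pairing once the averaging shifts have been moved from Q to g, G
    and the exponential. *)
Definition inner (E E' g G : R -> R[i]) (v xi : R) : R[i] :=
  cintegral leb2 (fun s => E s.1 * g (v - s.1) * (E' s.2 * G (xi - s.2)) *
     expi (2 * pi * (v - s.1) * (xi - s.2))).

(** Of the four factors only e(s r) mixes the two integration variables; the others are modulations
    that turn the s and r integrals into Fourier transforms. *)
Lemma expi_split (v xi s r : R) : expi (2 * pi * (v - s) * (xi - r)) =
  expi (2 * pi * v * xi) * expi (- (2 * pi * s * xi)) * expi (- (2 * pi * r * v)) * expi (2 * pi * s * r).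
Proof. by rewrite -!expiD; congr expi; ring. Qed.

(** Once e(s r) is an integral of [phase], the integrand for fixed rho is a product of a function of
    s and a function of r, whose integrals are [Kw] at xi and [Aw] at v. The range of rho is
    bounded, so nothing is lost by taking absolute values inside. *)
Lemma inner_le E E' g G (v xi : R) : window E -> window E' -> cintble leb g -> cintble leb G ->
  ((nc (inner E E' g G v xi))%:E <=
   \int[leb]_rho (nc (win (-1) 1 rho) * (nc (Kw E g rho v xi) * nc (Aw E' G rho v xi)))%:E)%E.
Proof.
move=> wE wE' gi Gi; have [mE hE] := wE; have [mE' hE'] := wE'.
have [mg _] := gi; have [mG _] := Gi; have mph := cmeas_phase.
pose a rho s := win rho 1 s * E s * g (v - s).
pose b rho r := phase rho r * E' r * G (xi - r).
pose Psi (s : R * R) (rho : R) := win (-1) 1 rho *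
  (expi (2 * pi * v * xi) * ((expi (- (2 * pi * s.1 * xi)) * a rho s.1) * (expi (- (2 * pi * s.2 * v)) * b rho s.2))).
have mPsi : cmeasurable (fun z : (R * R) * R => Psi z.1 z.2).
  rewrite /Psi /a /b; mes.
  by apply: (cmeas_comp _ mph (u := fun z : (R * R) * R => (z.2, z.1.2))); mes.
have Gi' : cintble leb (fun r => 8%:C * G (xi - r)) by apply: cintbleZ; exact: cintble_reflect.
have dm := @cintbleM_prod _ _ _ _ _ leb leb _ _ (cintble_reflect v gi) Gi'.
have dom := @cintbleM_prod _ _ _ _ _ leb2 leb _ _ dm (cintble_win (-1 : R) 1).
have Pi : cintble (leb2 \x leb)%E (fun z => Psi z.1 z.2).
  apply: (@cintble_dom _ _ _ (leb2 \x leb)%E _ (fun z => nc (g (v - z.1.1) * (8%:C * G (xi - z.1.2)) * win (-1) 1 z.2))) => //; last by case: dom.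
    by mes.
  move=> [[s r] rho] /=; rewrite /Psi /a /b !ncM !nc_expi !mul1r.
  rewrite [leRHS]mulrC ler_wpM2l ?nc_ge0// ler_pM ?nc_ge0//; first by pos.
    by pos.
    rewrite -[leRHS]mul1r ler_wpM2r ?nc_ge0// mulr_ile1 ?nc_ge0 ?nc_win_le1 ?nc_window_le1//.
  rewrite ler_wpM2r ?nc_ge0// -ncM; apply: (le_trans (nc_phaseM_le rho r wE')).
  rewrite ncR ger0_norm// -[leRHS]mulr1 ler_wpM2l// nc_win_le1//.
have -> : inner E E' g G v xi = cintegral leb2 (fun s => cintegral leb (fun rho => Psi s rho)).
  apply: eq_cint => -[s r] /=; have [s01|s01] := boolP ((0 <= s) && (s <= 1)); last first.
    rewrite (window0 wE s01) !mul0r; by rewrite cint_eq0// => rho; rewrite /Psi /a /= (window0 wE s01) !(mulr0, mul0r).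
  move/andP: (s01) => [s0 s1].
  have [r01|r01] := boolP ((0 <= r) && (r <= 1)); last first.
    rewrite (window0 wE' r01) !(mul0r, mulr0); by rewrite cint_eq0// => rho; rewrite /Psi /b /= (window0 wE' r01) !(mulr0, mul0r).
  have phi : cintble leb (fun rho => win (-1) s rho * phase rho r).
    under eq_fun do rewrite mulrC; apply: (@cintble_bddM _ _ _ leb _ _ 8); last exact: cintble_win.
    - by apply: (cmeas_comp _ mph (u := fun x : R => (x, r))); mes.
    - by move=> x; exact: nc_phase.
  rewrite expi_split -(phase_integral r s0) -!cintZl//; last exact: cintbleZ.
  apply: eq_cint => rho; rewrite /Psi /a /b /=.
  (* For 0 <= s <= 1 the constraint -1 <= rho <= s splits into a fixed range for rho and the
     condition rho <= s <= 1, which belongs to the factor in s. *)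
  have -> : win (-1) s rho = win (-1) 1 rho * win rho 1 s.
    rewrite /win s1 andbT; case: (leP rho s) => rs; rewrite ?andbF ?mulr0// andbT.
    by rewrite (le_trans rs s1) andbT mulr1.
  by ring.
rewrite (@cint_swap _ _ _ _ _ leb2 leb Psi Pi).
apply: (le_trans (cint_norm_le _ _)).
  apply: cmeas_cint2; apply: (cmeas_comp _ mPsi (u := fun z : R * (R * R) => (z.2, z.1))); mes.
apply: le_nnint => //.
- apply/measurable_EFinP/cmeas_nc/cmeas_cint2; apply: (cmeas_comp _ mPsi (u := fun z : R * (R * R) => (z.2, z.1))); mes.
- by rewrite /Kw /Aw; mes.
- by move=> rho; rewrite lee_fin nc_ge0.
move=> rho; rewrite lee_fin /Psi.
have ai := @cintble_fourier R _ xi (cintble_Kw rho v wE gi).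
have bi := @cintble_fourier R _ v (cintble_Aw rho xi wE' Gi).
have abi := @cintbleM_prod _ _ _ _ _ leb leb _ _ ai bi.
rewrite cintZl; last exact: cintbleZ.
rewrite cintZl; last exact: abi.
rewrite (@cint_prodM _ _ _ _ _ leb leb (fun s => expi (- (2 * pi * s * xi)) * a rho s) (fun s => expi (- (2 * pi * s * v)) * b rho s))//.
by rewrite !ncM nc_expi mul1r.
Qed.

Lemma bessel_Kw E g (rho v : R) : window E -> cintble leb g ->
  (\int[leb]_xi (nc (Kw E g rho v xi) ^+ 2)%:E <= \int[leb]_s (nc (win 0 1 s) * nc (g (v - s)) ^+ 2)%:E)%E.
Proof.
move=> wE gi; have [mE hE] := wE; have [mg _] := gi.
apply: (le_trans (bessel (cintble_Kw rho v wE gi))).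
apply: le_nnint; [by mes|by mes|by move=> s; rewrite lee_fin; pos|move=> s; rewrite lee_fin].
rewrite !ncM exprMn ler_wpM2r ?sqr_ge0//.
apply: (le_trans _ (hE s)); apply: (@le_trans _ _ (nc (E s) ^+ 2)).
  by rewrite lerXn2r ?nnegrE ?mulr_ge0 ?nc_ge0// ler_piMl ?nc_ge0 ?nc_win_le1.
by rewrite expr2 ler_piMl ?nc_ge0// nc_window_le1.
Qed.

(** The 64 is the square of the bound 8 on [phase]. *)
Lemma bessel_Aw E G (rho xi : R) : window E -> cintble leb G ->
  (\int[leb]_v (nc (Aw E G rho v xi) ^+ 2)%:E <= 64%:E * \int[leb]_r (nc (win 0 1 r) * nc (G (xi - r)) ^+ 2)%:E)%E.
Proof.
move=> wE gi; have [mE hE] := wE; have [mG _] := gi; have mph := cmeas_phase.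
apply: (le_trans (bessel (cintble_Aw rho xi wE gi))).
rewrite -nnintZl//; [|by mes|by move=> s; rewrite lee_fin; pos].
apply: le_nnint.
- mes; apply: (cmeas_comp _ mph (u := fun r : R => (rho, r))); mes.
- by mes.
- by move=> s; rewrite lee_fin; pos.
move=> s; rewrite -EFinM lee_fin ncM exprMn [64 * (_ * _)]mulrA ler_wpM2r ?sqr_ge0//.
have h := nc_phaseM_le rho s wE.
apply: (@le_trans _ _ ((8 * nc (win 0 1 s)) ^+ 2)).
  by rewrite lerXn2r ?nnegrE ?mulr_ge0 ?nc_ge0.
rewrite exprMn; have := nc_win_le1 0 1 s; have := nc_ge0 (win 0 1 s); nra.
Qed.

Definition Kenergy (E g : R -> R[i]) (xi : R) : \bar R :=
  \int[leb]_rho \int[leb]_v (nc (win (-1) 1 rho) * nc (Kw E g rho v xi) ^+ 2)%:E.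

Lemma nnint_window_conv (h : R -> \bar R) : measurable_fun setT h -> (forall x, (0 <= h x)%E) ->
  (\int[leb]_x \int[leb]_r ((nc (win 0 1 r))%:E * h (x - r)%R) = \int[leb]_x h x)%E.
Proof.
move=> mh h0.
rewrite (@nnint_swap _ _ _ _ _ leb leb (fun x r => (nc (win 0 1 r))%:E * h (x - r)%R)%E); last 2 first.
- by mes.
- by move=> x y; rewrite mule_ge0 ?lee_fin ?nc_ge0.
have E1 r : (\int[leb]_x ((nc (win 0 1 r))%:E * h (x - r)%R) = (nc (win 0 1 r))%:E * \int[leb]_x h x)%E.
  rewrite nnintZl ?nc_ge0//; last by mes.
  by rewrite (nneint_shift (- r) mh h0).
under eq_integral do rewrite E1.
rewrite ge0_integralZr//.
- by rewrite int_win// subr0 mul1e.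
- by mes.
- by move=> x _; rewrite lee_fin nc_ge0.
- exact: nnint_ge0.
Qed.

Lemma measurable_Kenergy E g : cmeasurable E -> cmeasurable g -> measurable_fun setT (Kenergy E g).
Proof. by move=> mE mg; rewrite /Kenergy /Kw; mes. Qed.

(** Bessel in xi leaves a unit-window average of |g|^2, whose integral over v is that of |g|^2; the
    2 is the length of the range of rho. *)
Lemma integral_Kenergy E g : window E -> cintble leb g ->
  (\int[leb]_xi Kenergy E g xi <= 2%:E * \int[leb]_x (nc (g x) ^+ 2)%:E)%E.
Proof.
move=> wE gi; have [mE hE] := wE; have [mg _] := gi.
have W0 : (\int[leb]_rho (nc (win (-1) 1 rho))%:E = 2%:E :> \bar R)%E.
  by rewrite int_win//; congr EFin; lra.
rewrite -W0 -ge0_integralZr//; last 3 first.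
- by mes.
- by move=> x _; rewrite lee_fin nc_ge0.
- by apply: nnint_ge0 => x; rewrite lee_fin sqr_ge0.
rewrite /Kenergy (@nnint_swap _ _ _ _ _ leb leb (fun xi rho => \int[leb]_v (nc (win (-1) 1 rho) * nc (Kw E g rho v xi) ^+ 2)%:E)%E); last 2 first.
- by rewrite /Kw; mes.
- by move=> x y; apply: nnint_ge0 => z; rewrite lee_fin; pos.
apply: le_nnint.
- by rewrite /Kw; mes.
- by mes.
- by move=> x; apply: nnint_ge0 => y; apply: nnint_ge0 => z; rewrite lee_fin; pos.
move=> rho; rewrite (@nnint_swap _ _ _ _ _ leb leb (fun xi v => (nc (win (-1) 1 rho) * nc (Kw E g rho v xi) ^+ 2)%:E)); last 2 first.
- by rewrite /Kw; mes.
- by move=> x y; rewrite lee_fin; pos.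
rewrite -(@nnint_window_conv (fun x => (nc (g x) ^+ 2)%:E)); last 2 first.
- by mes.
- by move=> x; rewrite lee_fin sqr_ge0.
rewrite -nnintZl ?nc_ge0//; last 2 first.
- by mes.
- by move=> x; apply: nnint_ge0 => y; rewrite lee_fin; pos.
apply: le_nnint.
- by rewrite /Kw; mes.
- by mes.
- by move=> x; apply: nnint_ge0 => y; rewrite lee_fin; pos.
move=> v; under eq_integral do rewrite EFinM.
rewrite nnintZl ?nc_ge0//; last 2 first.
- rewrite /Kw; apply/measurable_EFinP; apply: measurable_funX; apply: cmeas_nc; rewrite /fourier; apply: cmeas_cint2; mes.
- by move=> x; rewrite lee_fin sqr_ge0.
by apply: lee_wpmul2l; [rewrite lee_fin nc_ge0|exact: bessel_Kw].
Qed.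
Lemma cintble_inner E E' g G (v xi : R) : window E -> window E' -> cintble leb g -> cintble leb G ->
  cintble leb2 (fun s : R * R => E s.1 * g (v - s.1) * (E' s.2 * G (xi - s.2)) *
     expi (2 * pi * (v - s.1) * (xi - s.2))).
Proof.
move=> wE wE' gi Gi; have [mE hE] := wE; have [mE' hE'] := wE'.
have h F f w : window F -> cintble leb f -> cintble leb (fun s : R => F s * f (w - s)).
  move=> wF fi; apply: (@cintble_bddM _ _ _ leb _ _ 1); first by case: wF.
    by move=> s; exact: nc_window_le1.
  exact: cintble_reflect.
under eq_fun do rewrite mulrC.
apply: (@cintble_bddM _ _ _ leb2 _ _ 1); first by mes.
- by move=> x; rewrite nc_expi.
- exact: (@cintbleM_prod _ _ _ _ _ leb leb _ _ (h E g v wE gi) (h E' G xi wE' Gi)).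
Qed.

(** For fixed s the translation of z by -s frees Q from the averaging variables; this needs the
    order of integration to be exchanged before and after. *)
Lemma master_fubini E E' g G Q (B : R) : window E -> window E' -> cintble leb g -> cintble leb G ->
  cmeasurable Q -> (forall z : R * R, nc (Q z) <= B) ->
  cintegral leb2 (fun z => g z.1 * G z.2 * expi (2 * pi * z.1 * z.2) *
    cintegral leb2 (fun s => E s.1 * E' s.2 * Q (z.1 + s.1, z.2 + s.2))) =
  cintegral leb2 (fun z => Q z * inner E E' g G z.1 z.2).
Proof.
move=> wE wE' gi Gi mQ QB; have [mE hE] := wE; have [mE' hE'] := wE'.
have [mg _] := gi; have [mG _] := Gi.
pose w (s : R * R) := win 0 1 s.1 * win 0 1 s.2.
have wi : cintble leb2 w by exact: (@cintbleM_prod _ _ _ _ _ leb leb _ _ (cintble_win 0 1) (cintble_win 0 1)).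
have gGi : cintble leb2 (fun z : R * R => g z.1 * G z.2) by exact: (@cintbleM_prod _ _ _ _ _ leb leb _ _ gi Gi).
have B0 : 0 <= B by exact: (le_trans (nc_ge0 _) (QB (0, 0))).
have EQ z s : nc (E s.1 * E' s.2 * Q z) <= B * nc (w s).
  rewrite !ncM [leRHS]mulrC ler_pM ?mulr_ge0 ?nc_ge0// ler_pM ?nc_ge0//.
pose Phi (z s : R * R) := g z.1 * G z.2 * expi (2 * pi * z.1 * z.2) * (E s.1 * E' s.2 * Q (z.1 + s.1, z.2 + s.2)).
have mPhi : cmeasurable (fun z : (R * R) * (R * R) => Phi z.1 z.2) by rewrite /Phi; mes.
have Phii : cintble (leb2 \x leb2)%E (fun z => Phi z.1 z.2).
  have dom := @cintbleM_prod _ _ _ _ _ leb2 leb2 _ _ gGi (cintbleZ B%:C wi).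
  apply: (@cintble_dom _ _ _ (leb2 \x leb2)%E _ (fun z => nc (g z.1.1 * G z.1.2 * (B%:C * w z.2)))) => //; last by case: dom.
    by rewrite /w; mes.
  move=> [z s] /=; rewrite /Phi ncM [leRHS]ncM ler_pM ?nc_ge0//; first by rewrite !ncM nc_expi mulr1.
  by rewrite [leRHS]ncM ncR ger0_norm// EQ.
pose Phi' (z s : R * R) := Phi (z.1 - s.1, z.2 - s.2) s.
have mPhi' : cmeasurable (fun z : (R * R) * (R * R) => Phi' z.1 z.2) by rewrite /Phi' /Phi; mes.
transitivity (cintegral leb2 (fun z => cintegral leb2 (fun s => Phi z s))).
  apply: eq_cint => z; rewrite -cintZl//.
  apply: (@cintble_dom _ _ _ leb2 _ (fun s => B * nc (w s))) => //.
  - by mes.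
  - by rewrite /w; mes.
  - by case: (cintbleZ B%:C wi) => _; under eq_integral do rewrite ncM ncR ger0_norm//.
rewrite (@cint_swap _ _ _ _ _ leb2 leb2 Phi Phii).
transitivity (cintegral leb2 (fun s => cintegral leb2 (fun z => Phi' z s))).
  apply: eq_cint => s; rewrite -(@cint_shift2 _ (- s.1) (- s.2) (fun z => Phi z s))//.
  apply: (@cintble_dom _ _ _ leb2 _ (fun z => nc (g z.1 * G z.2 * (B%:C * w s)))).
  - by rewrite /Phi; mes.
  - by mes.
  - move=> z; rewrite /Phi ncM [leRHS]ncM ler_pM ?nc_ge0//; first by rewrite !ncM nc_expi mulr1.
    by rewrite [leRHS]ncM ncR ger0_norm// EQ.
  - by case: (cintbleZ (B%:C * w s) gGi) => _; under eq_integral do rewrite mulrC.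
have Phii' : cintble (leb2 \x leb2)%E (fun z => Phi' z.2 z.1).
  apply: (@cintble_prodE _ _ _ _ _ leb2 leb2 (fun z => Phi' z.2 z.1)).
    apply: (cmeas_comp _ mPhi' (u := fun z : (R * R) * (R * R) => (z.2, z.1))); mes.
  rewrite (_ : (fun s => _) = fun s : R * R => \int[leb2]_z (nc (Phi z s))%:E)%E; last first.
    apply/funext => s; rewrite /Phi' /=.
    rewrite (@nneint_shift2 _ (- s.1) (- s.2) (fun x y => (nc (Phi (x, y) s))%:E)).
    - by apply: eq_integral => -[].
    - by rewrite /Phi; mes.
    - by move=> *; rewrite lee_fin nc_ge0.
  rewrite -(@nnint_swap _ _ _ _ _ leb2 leb2 (fun z s => (nc (Phi z s))%:E)).
  - exact: (cintble_prod_lty Phii).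
  - by mes.
  - by move=> *; rewrite lee_fin nc_ge0.
rewrite (@cint_swap _ _ _ _ _ leb2 leb2 (fun s z => Phi' z s) Phii').
apply: eq_cint => -[v xi] /=; rewrite -cintZl; last exact: cintble_inner.
apply: eq_cint => -[s r]; rewrite /Phi' /Phi /= !subrK; ring.
Qed.

Lemma weighted_amgm (k b x y : R) : 0 < k -> b * (x * y) <= k * x ^+ 2 + b ^+ 2 / k * y ^+ 2.
Proof.
move=> k0; rewrite -(ler_pM2l k0).
rewrite (_ : k * (_ + _) = (k * x) ^+ 2 + (b * y) ^+ 2); last by field; rewrite gt_eqF.
rewrite (_ : k * (b * (x * y)) = (k * x) * (b * y)); last by ring.
by move: (k * x) (b * y) => p q; have := sqr_ge0 (p - q); have := sqr_ge0 (p + q); nra.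
Qed.

(** The uniform bound [B0] serves only integrability. The estimate uses the almost everywhere bound
    [B], which may depend on xi, and a free weight [kap] that distributes it between g and G. The
    128 is the 64 of [bessel_Aw] times the length 2 of the range of rho. *)
Lemma master E E' g G Q (B0 : R) (B kap : R -> R) : window E -> window E' -> cintble leb g -> cintble leb G ->
  cmeasurable Q -> (forall z : R * R, nc (Q z) <= B0) ->
  measurable_fun setT B -> measurable_fun setT (fun x => B x ^+ 2 / kap x) -> measurable_fun setT kap -> (forall x, 0 < kap x) ->
  {ae leb2, forall z, nc (Q z) <= B z.2} ->
  ((nc (cintegral leb2 (fun z => g z.1 * G z.2 * expi (2 * pi * z.1 * z.2) *
    cintegral leb2 (fun s => E s.1 * E' s.2 * Q (z.1 + s.1, z.2 + s.2)))))%:E <=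
  \int[leb]_xi ((kap xi)%:E * Kenergy E g xi) + 128%:E *
  \int[leb]_xi ((B xi ^+ 2 / kap xi)%:E * \int[leb]_r (nc (win 0 1 r) * nc (G (xi - r)) ^+ 2)%:E))%E.
Proof.
move=> wE wE' gi Gi mQ QB mB mBk mk k0 aeQ; have [mE hE] := wE; have [mE' hE'] := wE'.
have [mg _] := gi; have [mG _] := Gi; have mph := cmeas_phase.
have mK : cmeasurable (fun z : R * R * R => Kw E g z.2 z.1.1 z.1.2) by rewrite /Kw; mes.
have mA : cmeasurable (fun z : R * R * R => Aw E' G z.2 z.1.1 z.1.2).
  by rewrite /Aw; mes; apply: (cmeas_comp _ mph (u := fun z : R * R * R * R => (z.1.2, z.2))); mes.
rewrite (master_fubini wE wE' gi Gi mQ QB).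
pose X (v xi rho : R) := (kap xi * (nc (win (-1) 1 rho) * nc (Kw E g rho v xi) ^+ 2))%:E.
pose Y (v xi rho : R) := ((B xi ^+ 2 / kap xi) * (nc (win (-1) 1 rho) * nc (Aw E' G rho v xi) ^+ 2))%:E.
have X0 v xi rho : (0 <= X v xi rho)%E by rewrite lee_fin; have k00 := ltW (k0 xi); pos.
have k1 xi : 0 <= B xi ^+ 2 / kap xi by rewrite divr_ge0 ?sqr_ge0 ?ltW.
have Y0 v xi rho : (0 <= Y v xi rho)%E by rewrite lee_fin; pos.
have mX : measurable_fun setT (fun z : R * R * R => X z.1.1 z.1.2 z.2) by rewrite /X; mes; exact: mK.
have mY : measurable_fun setT (fun z : R * R * R => Y z.1.1 z.1.2 z.2).
  rewrite /Y; apply/measurable_EFinP; apply: measurable_funM; last by mes; exact: mA.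
  by apply: (meas_comp_of mBk (u := fun z : R * R * R => z.1.2)); mes.
have mIX : measurable_fun setT (fun z : R * R => \int[leb]_rho X z.1 z.2 rho)%E.
  by apply: (@meas_nneint2 _ _ _ _ _ leb (fun z rho => X z.1 z.2 rho)); [exact: mX|move=> z rho; exact: X0].
have mIY : measurable_fun setT (fun z : R * R => \int[leb]_rho Y z.1 z.2 rho)%E.
  by apply: (@meas_nneint2 _ _ _ _ _ leb (fun z rho => Y z.1 z.2 rho)); [exact: mY|move=> z rho; exact: Y0].
have mi : cmeasurable (fun z : R * R => inner E E' g G z.1 z.2).
  by rewrite /inner; apply: cmeas_cint2; mes.
apply: (@le_trans _ _ (\int[leb2]_z \int[leb]_rho (X z.1 z.2 rho + Y z.1 z.2 rho))%E).
  apply: (le_trans (cint_norm_le _ _)); first by mes.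
  apply: ae_le_nnint.
  - by mes.
  - by apply: meas_nneint2; [apply: emeasurable_funD; [exact: mX|exact: mY]|move=> *; rewrite adde_ge0].
  - by move=> z; rewrite lee_fin nc_ge0.
  - by move=> z; apply: nnint_ge0 => rho; rewrite adde_ge0.
  apply: ae_imp aeQ => -[v xi] /= hQ.
  have B1 : 0 <= B xi by exact: le_trans (nc_ge0 _) hQ.
  rewrite ncM; apply: (@le_trans _ _ ((B xi)%:E * (nc (inner E E' g G v xi))%:E)%E).
    by rewrite -EFinM lee_fin ler_wpM2r ?nc_ge0.
  apply: (le_trans (lee_wpmul2l _ (inner_le v xi wE wE' gi Gi))); first by rewrite lee_fin.
  rewrite -nnintZl//; last 2 first.
  - apply/measurable_EFinP; apply: measurable_funM; first by mes.
    apply: measurable_funM; apply: cmeas_nc.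
      by apply: (cmeas_comp _ mK (u := fun rho : R => (v, xi, rho))); mes.
    by apply: (cmeas_comp _ mA (u := fun rho : R => (v, xi, rho))); mes.
  - by move=> rho; rewrite lee_fin; pos.
  apply: le_nnint.
  - apply: emeasurable_funM; first exact: measurable_cst.
    apply/measurable_EFinP; apply: measurable_funM; first by mes.
    apply: measurable_funM; apply: cmeas_nc.
      by apply: (cmeas_comp _ mK (u := fun rho : R => (v, xi, rho))); mes.
    by apply: (cmeas_comp _ mA (u := fun rho : R => (v, xi, rho))); mes.
  - by apply: emeasurable_funD; [by apply: (meas_comp_of mX (u := fun rho : R => (v, xi, rho))); mes|by apply: (meas_comp_of mY (u := fun rho : R => (v, xi, rho))); mes].
  - by move=> rho; rewrite mule_ge0 ?lee_fin//; pos.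
  move=> rho; rewrite /X /Y -EFinM -EFinD lee_fin.
  set a := nc (Kw _ _ _ _ _); set b := nc (Aw _ _ _ _ _); set w := nc (win _ _ _).
  rewrite (_ : B xi * (w * (a * b)) = w * (B xi * (a * b))); last ring.
  rewrite (_ : _ + _ = w * (kap xi * a ^+ 2 + B xi ^+ 2 / kap xi * b ^+ 2)); last ring.
  apply: ler_wpM2l; first exact: nc_ge0.
  exact: weighted_amgm.
have XYE : (\int[leb2]_z \int[leb]_rho (X z.1 z.2 rho + Y z.1 z.2 rho) =
  \int[leb2]_z \int[leb]_rho X z.1 z.2 rho + \int[leb2]_z \int[leb]_rho Y z.1 z.2 rho)%E.
  rewrite -nnintD; last 4 first.
  - exact: mIX.
  - exact: mIY.
  - by move=> z; apply: nnint_ge0.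
  - by move=> z; apply: nnint_ge0.
  apply: eq_integral => z _; rewrite nnintD; last 4 first.
  - by apply: (meas_comp_of mX (u := fun rho : R => (z, rho))); mes.
  - by apply: (meas_comp_of mY (u := fun rho : R => (z, rho))); mes.
  - by move=> rho; exact: X0.
  - by move=> rho; exact: Y0.
  by [].
have mBW : measurable_fun setT (fun xi => (B xi ^+ 2 / kap xi)%:E *
    \int[leb]_r (nc (win 0 1 r) * nc (G (xi - r)) ^+ 2)%:E)%E.
  by apply: emeasurable_funM; [exact/measurable_EFinP|mes].
rewrite XYE; apply: leeD.
- rewrite (@nnint_prod _ _ _ _ _ leb leb (fun v xi => \int[leb]_rho X v xi rho)%E); last 2 first.
  + exact: mIX.
  + by move=> *; apply: nnint_ge0.
  rewrite (@nnint_swap _ _ _ _ _ leb leb (fun v xi => \int[leb]_rho X v xi rho)%E); last 2 first.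
  + exact: mIX.
  + by move=> *; apply: nnint_ge0.
  rewrite le_eqVlt; apply/orP; left; apply/eqP; apply: eq_integral => xi _.
  rewrite (@nnint_swap _ _ _ _ _ leb leb (fun v rho => X v xi rho)); last 2 first.
  + by apply: (meas_comp_of mX (u := fun z : R * R => (z.1, xi, z.2))); mes.
  + by [].
  rewrite /Kenergy -nnintZl; last 3 first.
  + exact: ltW.
  + by rewrite /Kw; mes.
  + by move=> ?; apply: nnint_ge0 => ?; rewrite lee_fin; pos.
  apply: eq_integral => rho _; rewrite -nnintZl//; last 3 first.
  + exact: ltW.
  + by rewrite /Kw; mes.
  + by move=> ?; rewrite lee_fin; pos.
- rewrite (@nnint_prod _ _ _ _ _ leb leb (fun v xi => \int[leb]_rho Y v xi rho)%E); last 2 first.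
  + by apply: meas_nneint2.
  + by move=> *; apply: nnint_ge0.
  rewrite (@nnint_swap _ _ _ _ _ leb leb (fun v xi => \int[leb]_rho Y v xi rho)%E); last 2 first.
  + by apply: meas_nneint2.
  + by move=> *; apply: nnint_ge0.
  rewrite -nnintZl//; last first.
  + by move=> x; rewrite mule_ge0 ?lee_fin//; apply: nnint_ge0 => ?; rewrite lee_fin; pos.
  apply: le_nnint.
  + apply: meas_nneint2; last by move=> *; apply: nnint_ge0.
    apply: meas_nneint2; last by move=> z rho; exact: Y0.
    by apply: (meas_comp_of mY (u := fun z : R * R * R => (z.1.2, z.1.1, z.2))); mes.
  + by apply: emeasurable_funM; [exact: measurable_cst|exact: mBW].
  + by move=> ?; apply: nnint_ge0 => ?; apply: nnint_ge0.
  move=> xi; rewrite (@nnint_swap _ _ _ _ _ leb leb (fun v rho => Y v xi rho)); last 2 first.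
  + by apply: (meas_comp_of mY (u := fun z : R * R => (z.1, xi, z.2))); mes.
  + by [].
  set W := (\int[leb]_r (nc (win 0 1 r) * nc (G (xi - r)) ^+ 2)%:E)%E.
  have W0 : (0 <= W)%E by apply: nnint_ge0 => ?; rewrite lee_fin; pos.
  apply: (@le_trans _ _ (\int[leb]_rho ((nc (win (-1) 1 rho))%:E * ((B xi ^+ 2 / kap xi)%:E * (64%:E * W))))%E).
    apply: le_nnint.
    - apply: meas_nneint2 => //.
      by apply: (meas_comp_of mY (u := fun z : R * R => (z.2, xi, z.1))); mes.
    - by mes.
    - by move=> ?; apply: nnint_ge0.
    move=> rho; rewrite /Y; under eq_integral do rewrite mulrA EFinM.
    rewrite nnintZl; last 3 first.
    - by pos.
    - by apply/measurable_EFinP/measurable_funX/cmeas_nc; apply: (cmeas_comp _ mA (u := fun x : R => (x, xi, rho))); mes.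
    - by move=> ?; rewrite lee_fin sqr_ge0.
    rewrite [(_ * nc _)%R]mulrC EFinM -muleA; apply: lee_wpmul2l; first by rewrite lee_fin nc_ge0.
    by apply: lee_wpmul2l; [rewrite lee_fin|exact: bessel_Aw].
  rewrite ge0_integralZr//; last 3 first.
  - by mes.
  - by move=> *; rewrite lee_fin nc_ge0.
  - by rewrite mule_ge0 ?lee_fin// mule_ge0.
  rewrite int_win; last lra.
  have -> : (1 - -1 : R) = 2 by ring.
  rewrite muleCA (muleA 2%:E 64%:E) -EFinM [leRHS]muleCA (_ : 2 * 64 = 128)//; ring.
Qed.
End Master.

Section AlmostEverywhereProduct.
Context d1 d2 (T1 : measurableType d1) (T2 : measurableType d2) (R : realType).
Variable m1 : {sigma_finite_measure set T1 -> \bar R}.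
Variable m2 : {sigma_finite_measure set T2 -> \bar R}.

(** Negligible slices give a negligible set in the product only if that set is measurable; a
    measurable Boolean predicate provides this. *)
Lemma ae_bool_prod (b : T1 -> T2 -> bool) : measurable_fun setT (fun z : T1 * T2 => b z.1 z.2) ->
  {ae m1, forall x, {ae m2, forall y, b x y}} -> {ae prodsf m1 m2, forall z, b z.1 z.2}.
Proof.
move=> mb h; have mN : measurable [set z : T1 * T2 | ~~ b z.1 z.2].
  have := mb measurableT [set false] I; rewrite setTI.
  by congr measurable; apply/seteqP; split => z /=; case: (b _ _).
have N0 : (m1 \x m2)%E [set z : T1 * T2 | ~~ b z.1 z.2] = 0%E.
  by apply: ae_prod_of_ae => //; apply: ae_imp h => x; apply: ae_imp => y /= ->.
by exists [set z : T1 * T2 | ~~ b z.1 z.2]; split => // z /= /negP.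
Qed.

Lemma ae_bool_swap (b : T1 -> T2 -> bool) : measurable_fun setT (fun z : T1 * T2 => b z.1 z.2) ->
  {ae m1, forall x, {ae m2, forall y, b x y}} -> {ae m2, forall y, {ae m1, forall x, b x y}}.
Proof.
move=> mb h; have := @ae_prod_ae _ _ _ _ _ m2 m1 _ (@ae_swap _ _ _ _ _ m1 m2 _ (ae_bool_prod mb h)).
exact.
Qed.

Lemma cintble_swap (F : T1 -> T2 -> R[i]) : cintble (m1 \x m2)%E (fun z => F z.1 z.2) ->
  cintble (m2 \x m1)%E (fun z => F z.2 z.1).
Proof.
move=> Fi; have [mF _] := Fi; have mF' : cmeasurable (fun z : T2 * T1 => F z.2 z.1).
  by apply: (cmeas_comp _ mF (u := fun z : T2 * T1 => (z.2, z.1))); mes.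
apply: (cintble_prodE mF').
rewrite -(@nnint_swap _ _ _ _ _ m1 m2 (fun x y => (nc (F x y))%:E)).
- exact: cintble_prod_lty Fi.
- exact: cmeas_nce.
- by move=> *; rewrite lee_fin nc_ge0.
Qed.

End AlmostEverywhereProduct.

Section FubiniIntegrable.
Context d1 d2 (T1 : measurableType d1) (T2 : measurableType d2) (R : realType).
Variable m1 : {sigma_finite_measure set T1 -> \bar R}.
Variable m2 : {sigma_finite_measure set T2 -> \bar R}.

Lemma cintble_fubini2 (F : T1 -> T2 -> R[i]) : cintble (m1 \x m2)%E (fun z => F z.1 z.2) ->
  cintble m2 (fun y => cintegral m1 (fun x => F x y)).
Proof. by move=> Fi; exact: (cintble_fubini1 (cintble_swap Fi)). Qed.
End FubiniIntegrable.

(** * Symbols as windowed averages of their derivatives *)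

Section Moves.
Context {R : realType}.
Local Notation leb := (@lebesgue_measure R).
Local Notation leb2 := (prodsf leb leb).

(** The Boolean selects the variable, as in [dword], so that each lemma on derivatives is proved
    once for x and xi. *)
Definition mv (b : bool) (w : R) (z : R * R) : R * R :=
  if b then (z.1 + w, z.2) else (z.1, z.2 + w).

Lemma mv0 b z : mv b 0 z = z.
Proof. by case: z => x y; rewrite /mv; case: b; rewrite /= addr0. Qed.

Lemma mvK b u z : mv b (- u) (mv b u z) = z.
Proof. by case: z => x y; rewrite /mv; case: b; rewrite /= addrK. Qed.

Lemma mv_shift b u : exists u1 u2, forall z, mv b u z = (z.1 + u1, z.2 + u2).
Proof. by case: b; [exists u, 0|exists 0, u] => z; rewrite /mv addr0. Qed.

Lemma measurable_mv b d (T : measurableType d) (w : T -> R) (z : T -> R * R) :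
  measurable_fun setT w -> measurable_fun setT z -> measurable_fun setT (fun x => mv b (w x) (z x)).
Proof. by move=> mw mz; rewrite /mv; case: b; mes. Qed.

Lemma cmeas_mv b d (T : measurableType d) (w : T -> R) (z : T -> R * R) (f : R * R -> R[i]) :
  cmeasurable f -> measurable_fun setT w -> measurable_fun setT z ->
  cmeasurable (fun x => f (mv b (w x) (z x))).
Proof. by move=> mf mw mz; apply: (cmeas_comp _ mf); exact: measurable_mv. Qed.

Lemma null_shift2 (a b : R) (N : set (R * R)) : measurable N -> leb2 N = 0%E ->
  {ae leb2, forall z, ~ N (z.1 + a, z.2 + b)}.
Proof.
move=> mN N0.
have mN' : measurable [set z : R * R | N (z.1 + a, z.2 + b)].
  have mu : measurable_fun [set: R * R] (fun z : R * R => (z.1 + a, z.2 + b)) by mes.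
  by have := mu measurableT N mN; rewrite setTI.
exists [set z : R * R | N (z.1 + a, z.2 + b)]; split => //; last first.
  by move=> z /= /contrapT.
have := @nneint_shift2 R a b (fun x y => (\1_N (x, y))%:E).
have -> : (\int[leb2]_z (\1_N (z.1, z.2))%:E = leb2 N)%E.
  rewrite -[in RHS](setIT N) -(integral_indic leb2 measurableT mN).
  by apply: eq_integral => -[].
move=> h; have E' := integral_indic leb2 measurableT mN'; rewrite setIT in E'.
rewrite -E' -[RHS]N0 -h.
- by apply: eq_integral.
- apply/measurable_EFinP; rewrite (_ : (fun z => _) = \1_N) ; last by apply/funext => -[].
  exact: measurable_indic.
- by move=> x y; rewrite lee_fin.
Qed.

Lemma ae_shift2 (a b : R) (P : R * R -> Prop) : {ae leb2, forall z, P z} ->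
  {ae leb2, forall z, P (z.1 + a, z.2 + b)}.
Proof.
move=> [N [mN N0 NP]]; apply: ae_imp (null_shift2 a b mN N0) => z Nz.
by apply: contrapT => h; apply: Nz; exact: NP.
Qed.

Lemma ae_mv b (P : R * R -> Prop) : {ae leb2, forall z, P z} ->
  {ae leb2, forall z, {ae leb, forall w, P (mv b w z)}}.
Proof.
move=> [N [mN N0 NP]].
have h : {ae leb2, forall z, {ae leb, forall w, mv b w z \notin N}}.
  apply: (@ae_bool_swap _ _ _ _ _ leb leb2 (fun w z => mv b w z \notin N)).
    have : measurable_fun setT (fun z : R * (R * R) => \1_N (mv b z.1 z.2) <= (0 : R)).
      apply: measurable_fun_ler; last exact: measurable_cst.
      by apply: (measurableT_comp (f := \1_N : R * R -> R)) => //; apply: measurable_mv; mes.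
    rewrite (_ : (fun _ => _) = (fun z : R * (R * R) => mv b z.1 z.2 \notin N))//.
    by apply/funext => z; rewrite /indic; case: (_ \in N); rewrite ?ler10 ?lexx.
  apply: ae_true => w; case: b.
    apply: ae_imp (null_shift2 w 0 mN N0) => z Nz; apply/negP => /set_mem.
    by rewrite /mv addr0 in Nz *.
  apply: ae_imp (null_shift2 0 w mN N0) => z Nz; apply/negP => /set_mem.
  by rewrite /mv addr0 in Nz *.
apply: ae_imp h => z; apply: ae_imp => w /negP hw; apply: contrapT => hP; apply: hw.
by apply/mem_set/NP.
Qed.

Ltac mes ::= repeat first [
  lazymatch goal with |- measurable_fun _ (fun _ => mv _ _ _) => apply: measurable_mv end | meas2 ].

(* [p'] is the derivative of [p] in [x] for [b = true], in [xi] for [b = false]. *)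
Definition AC b (p p' : R * R -> R[i]) : Prop := forall u, 0 < u ->
  {ae leb2, forall z, p (mv b u z) - p z = cintegral leb (fun w => win 0 u w * p' (mv b w z))}.

Lemma nc_sub_eq0 (x y : R[i]) : (nc (x - y) <= 0) = (x == y).
Proof.
apply/idP/eqP => [|->]; last by rewrite subrr nc0.
move=> h; apply/eqP; rewrite -subr_eq0; apply/eqP/nc_eq0/le_anti; rewrite h nc_ge0//.
Qed.

(** The exceptional set in [AC] may depend on u. Tonelli exchanges the quantifiers, at the price of
    losing a null set of steps on each line. *)
Lemma AC_ae b p p' : cmeasurable p -> cmeasurable p' -> AC b p p' ->
  {ae leb2, forall z, {ae leb, forall u, 0 < u ->
    p (mv b u z) - p z = cintegral leb (fun w => win 0 u w * p' (mv b w z))}}.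
Proof.
move=> mp mp' h.
pose e u z := nc (p (mv b u z) - p z - cintegral leb (fun w => win 0 u w * p' (mv b w z))).
have me : measurable_fun setT (fun z : R * (R * R) => e z.1 z.2).
  by rewrite /e; mes.
have k : {ae leb2, forall z, {ae leb, forall u, (if 0 < u then e u z <= 0 else true)}}.
  apply: (@ae_bool_swap _ _ _ _ _ leb leb2 (fun u z => if 0 < u then e u z <= 0 else true)).
    by apply: measurable_fun_ifT; mes.
  apply: ae_true => u; case: ltP => u0; last exact: ae_true.
  by apply: ae_imp (h u u0) => z ez; rewrite /e nc_sub_eq0; apply/eqP.
apply: ae_imp k => z; apply: ae_imp => u hu u0; rewrite u0 /e nc_sub_eq0 in hu.
exact/eqP.
Qed.

Definition E0 (s : R) : R[i] := win 0 1 s.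
Definition E1 (s : R) : R[i] := win 0 1 s * (s - 1)%:C.

Lemma window_E0 : window E0.
Proof. by split; [exact: cmeas_win|move=> s; rewrite /E0]. Qed.
Lemma window_E1 : window E1.
Proof.
split; first by rewrite /E1; mes.
move=> s; rewrite /E1 ncM nc_win; case: andP => [[s0 s1]|_]; last by rewrite mul0r.
by rewrite (_ : true%:R = 1 :> R)// mul1r ncR ler_norml; lra.
Qed.

Lemma cintble_win_bdd (E f : R -> R[i]) (B : R) : cmeasurable f -> window E -> (forall x, nc (f x) <= B) ->
  cintble leb (fun s => E s * f s).
Proof.
move=> mf wE fB; have [mE hE] := wE; apply: (@cintble_dom _ _ _ leb _ (fun s => B * nc (win 0 1 s))).
- by mes.
- by mes.
- by move=> s; rewrite ncM mulrC ler_pM ?nc_ge0.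
- rewrite [X in (X < _)%E](_ : _ = B%:E * \int[leb]_s (nc (win 0 1 s))%:E)%E.
    by rewrite int_win// -EFinM ltry.
  rewrite -nnintZl//; [exact: le_trans (nc_ge0 _) (fB 0)|by mes|by move=> ?; rewrite lee_fin nc_ge0].
Qed.

Lemma win_win (u w : R) : win 0 1 u * win 0 u w = win 0 1 w * win w 1 u.
Proof.
rewrite /win; case: (leP 0 w) => h1; case: (leP w u) => h2; case: (leP u 1) => h3;
  case: (leP 0 u) => h4; case: (leP w 1) => h5; rewrite /= ?(mulr0, mul0r, mulr1)//; exfalso; lra.
Qed.

(** Average p(z) = p(z + u) - int_0^u p'(z + w) dw over u in [0, 1]. In the double integral w is
    counted for all u in [w, 1], which gives the weight -(1 - w) = w - 1. *)
Lemma representation b p p' (B : R) : cmeasurable p -> cmeasurable p' ->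
  (forall z, nc (p z) <= B) -> (forall z, nc (p' z) <= B) -> AC b p p' ->
  {ae leb2, forall z, p z = cintegral leb (fun s => E0 s * p (mv b s z)) +
                            cintegral leb (fun s => E1 s * p' (mv b s z))}.
Proof.
move=> mp mp' pB pB' /(AC_ae mp mp'); apply: ae_imp => z hz.
have m1 : cmeasurable (fun s : R => p (mv b s z)) by apply: cmeas_mv => //; mes.
have m2 : cmeasurable (fun s : R => p' (mv b s z)) by apply: cmeas_mv => //; mes.
pose J (u w : R) := win 0 1 u * (win 0 u w * p' (mv b w z)).
have i1 : cintble leb (fun s => E0 s * p (mv b s z)) by apply: (cintble_win_bdd m1 window_E0) => s.
have Ji : cintble (leb \x leb)%E (fun z : R * R => J z.1 z.2).
  have := @cintbleM_prod _ _ _ _ _ leb leb _ _ (cintble_win 0 1) (cintble_win_bdd m2 window_E0 (fun s => pB' (mv b s z))).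
  move=> [_ oo]; apply: (@cintble_dom _ _ _ (leb \x leb)%E _ (fun w => nc (win 0 1 w.1 * (E0 w.2 * p' (mv b w.2 z))))) => //.
  - by rewrite /J; mes.
  - by rewrite /E0; mes.
  - move=> [u w]; rewrite /J /E0 /win /=; case: andP => [[u0 u1]|_]; last by rewrite !mul0r.
    case: andP => [[w0 wu]|_]; last by rewrite mul0r mulr0 nc0 nc_ge0.
    by rewrite w0 (le_trans wu u1).
have iJ : cintble leb (fun u => cintegral leb (fun w => J u w)) by exact: (cintble_fubini1 Ji).
have E1E : cintegral leb (fun s => E1 s * p' (mv b s z)) = - cintegral leb (fun u => cintegral leb (fun w => J u w)).
  rewrite (@cint_swap _ _ _ _ _ leb leb _ Ji) -cintN; last exact: (@cintble_fubini2 _ _ _ _ _ leb leb _ Ji).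
  apply: eq_cint => w; rewrite /J /E1.
  transitivity (- cintegral leb (fun u => (win 0 1 w * p' (mv b w z)) * win w 1 u)); last first.
    by congr (- _); apply: eq_cint => u; rewrite mulrA win_win; ring.
  rewrite cintZl; last exact: cintble_win.
  have [/andP[w0 w1]|h] := boolP ((0 <= w) && (w <= 1)).
    by rewrite cint_win// (_ : (w - 1)%:C = - (1 - w)%:C); [ring|rewrite -rmorphN opprB].
  by rewrite /win (negbTE h) !mul0r oppr0.
rewrite E1E -cintB//.
have -> : p z = cintegral leb (fun u => win 0 1 u * p z).
  by rewrite cintZr ?cint_win ?subr0 ?mul1r//; exact: cintble_win.
apply: ae_eq_cint.
- by mes.
- apply: cmeasB; first by rewrite /E0; mes.
  by case: iJ.
have z0 : {ae leb, forall u : R, u != 0}.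
  by exists [set 0]; split => //; [exact: lebesgue_measure_set1|move=> u /= /negP; rewrite negbK => /eqP].
apply: ae_imp2 hz z0 => u hu u0.
have [u01|u01] := boolP ((0 <= u) && (u <= 1)); last first.
  by rewrite /E0 /win (negbTE u01) !mul0r sub0r cint_eq0 ?oppr0// => w; rewrite /J /win (negbTE u01) mul0r.
move/andP: (u01) => [u0' u1].
rewrite /J cintZl; last first.
  apply: (@cintble_dom _ _ _ leb _ (fun w => nc (E0 w * p' (mv b w z)))).
  - by mes.
  - by rewrite /E0; mes.
  - move=> w; rewrite /E0 /win; case: andP => [[w0 wu]|_]; last by rewrite mul0r nc0 nc_ge0.
    by rewrite w0 (le_trans wu u1).
  - by case: (cintble_win_bdd m2 window_E0 (fun s => pB' (mv b s z))).
by rewrite -hu ?lt_neqAle 1?eq_sym ?u0// /E0; ring.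
Qed.

Lemma AC_lip b p p' (L : R) : cmeasurable p -> cmeasurable p' -> (forall z, nc (p' z) <= L) -> AC b p p' ->
  {ae leb2, forall z, {ae leb, forall u, nc (p (mv b u z) - p z) <= L * `|u|}}.
Proof.
move=> mp mp' pL h.
pose e u z := nc (p (mv b u z) - p z) <= L * `|u|.
have me : measurable_fun setT (fun z : R * (R * R) => e z.1 z.2) by rewrite /e; mes.
have L0 : 0 <= L by exact: (le_trans (nc_ge0 _) (pL (0, 0))).
have pos_case u : 0 < u -> {ae leb2, forall z, e u z}.
  move=> u0; apply: ae_imp (h u u0) => z ez; rewrite /e ez -lee_fin.
  apply: (le_trans (cint_norm_le _ _)); first by mes.
  apply: (@le_trans _ _ (\int[leb]_w (L%:E * (nc (win 0 u w))%:E))%E).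
    apply: le_nnint.
    - by mes.
    - by mes.
    - by move=> w; rewrite lee_fin nc_ge0.
    - by move=> w; rewrite -EFinM lee_fin ncM mulrC ler_wpM2r ?nc_ge0.
  rewrite nnintZl//; [|by mes|by move=> w; rewrite lee_fin nc_ge0].
  have W := int_win (ltW u0); rewrite subr0 in W.
  apply: (@le_trans _ _ (L%:E * u%:E)%E); first by rewrite -W.
  by rewrite -EFinM lee_fin gtr0_norm.
apply: (@ae_bool_swap _ _ _ _ _ leb leb2 e me).
apply: ae_true => u; have [u0|u0|->] := ltgtP u 0; last first.
- by apply: ae_true => z; rewrite /e mv0 normr0 mulr0 subrr nc0.
- by exact: pos_case.
have nu : 0 < - u by rewrite oppr_gt0.
have [u1 [u2 hu]] := mv_shift b u; apply: ae_imp (ae_shift2 u1 u2 (pos_case _ nu)) => z.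
rewrite /e -hu normrN -ncN opprB.
by rewrite mvK.
Qed.

(** The square [0, u]^2 is cut along its diagonal into two triangles, one for each summand. The
    diagonal is counted twice but is null. *)
Lemma cint_triangles (a c : R -> R[i]) (u A C : R) : cmeasurable a -> cmeasurable c ->
  (forall w, nc (a w) <= A) -> (forall w, nc (c w) <= C) ->
  cintegral leb (fun w => win 0 u w * (a w * cintegral leb (fun v => win 0 w v * c v) +
     cintegral leb (fun v => win 0 w v * a v) * c w)) =
  cintegral leb (fun w => win 0 u w * a w) * cintegral leb (fun w => win 0 u w * c w).
Proof.
move=> ma mc aA cC.
have wb (f : R -> R[i]) (B s t : R) : cmeasurable f -> (forall w, nc (f w) <= B) -> cintble leb (fun w => win s t w * f w).
  move=> mf fB; under eq_fun do rewrite mulrC.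
  by apply: (@cintble_bddM _ _ _ leb _ _ B) => //; exact: cintble_win.
pose F (w v : R) := (win 0 u w * a w) * (win 0 u v * c v).
have Fi : cintble (leb \x leb)%E (fun z : R * R => F z.1 z.2).
  exact: (@cintbleM_prod _ _ _ _ _ leb leb _ _ (wb a A 0 u ma aA) (wb c C 0 u mc cC)).
have half (b : R -> R -> bool) : measurable_fun setT (fun z : R * R => b z.1 z.2) ->
    cintble (leb \x leb)%E (fun z : R * R => (if b z.1 z.2 then 1 else 0) * F z.1 z.2).
  move=> mb; apply: (@cintble_bddM _ _ _ (leb \x leb)%E _ _ 1) => //.
    by apply: cmeas_if => //; exact: cmeas_cst.
  by move=> z; case: ifP; rewrite ?nc1 ?nc0.
have h1 := half (fun w v => v <= w) _; have h2 := half (fun w v => w <= v) _.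
have {}h1 := h1 ltac:(by mes); have {}h2 := h2 ltac:(by mes).
transitivity (cintegral leb (fun w => cintegral leb (fun v => (if v <= w then 1 else 0) * F w v) +
    cintegral leb (fun v => (if v <= w then 1 else 0) * F v w))).
  apply: eq_cint => w; rewrite mulrDr; congr (_ + _).
    rewrite mulrA -cintZl; last exact: (wb c C).
    apply: eq_cint => v; rewrite /F /win; case: (leP 0 w) => w0 /=; last by rewrite !(mul0r, mulr0).
    case: (leP w u) => wu; last by rewrite !(mul0r, mulr0).
    case: (leP v w) => vw; rewrite ?andbF ?mul0r ?mulr0// andbT (le_trans vw wu) andbT.
    by ring.
  rewrite mulrCA -cintZr; last exact: (wb a A).
  apply: eq_cint => v; rewrite /F /win; case: (leP 0 w) => w0 /=; last by rewrite !(mul0r, mulr0).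
  case: (leP w u) => wu; last by rewrite !(mul0r, mulr0).
  case: (leP v w) => vw; rewrite ?andbF ?mul0r ?mulr0// andbT (le_trans vw wu) andbT.
  by ring.
rewrite cintD; [|exact: (cintble_fubini1 h1)|exact: (@cintble_fubini2 _ _ _ _ _ leb leb (fun v w => (if v <= w then 1 else 0) * F v w) h2)].
rewrite -(@cint_swap _ _ _ _ _ leb leb (fun v w => (if v <= w then 1 else 0) * F v w) h2).
rewrite -cintD; [|exact: (cintble_fubini1 h1)|exact: (cintble_fubini1 h2)].
rewrite -(@cint_prodM _ _ _ _ _ leb leb _ _ (wb a A 0 u ma aA) (wb c C 0 u mc cC)).
rewrite -(cfubini1 Fi); apply: ae_eq_cint.
- by apply: cmeasD; apply: cmeas_cint2; case: h1; case: h2.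
- by apply: cmeas_cint2; case: Fi.
apply: ae_imp2 (ae_cintble1 h1) (ae_cintble1 h2) => w i1 i2.
rewrite -cintD//; apply: ae_eq_cint.
- by case: (cintbleD i1 i2).
- by rewrite /F; mes.
exists [set w]; split => //; first exact: lebesgue_measure_set1.
move=> v /= hv; apply/eqP; rewrite -[_ == _]negbK; apply/negP => vw; apply: hv.
case: (ltgtP v w) vw => //= _ _; rewrite ?mul1r ?mul0r ?add0r ?addr0//.
Qed.

(** Along almost every line p and q are their initial values plus indefinite integrals I and J.
    Expanding both sides, the terms linear in I or J match directly and the product I J is given by
    [cint_triangles]. *)
Lemma AC_mul b p p' q q' (A A' B B' : R) : cmeasurable p -> cmeasurable p' -> cmeasurable q -> cmeasurable q' ->
  (forall z, nc (p z) <= A) -> (forall z, nc (p' z) <= A') -> (forall z, nc (q z) <= B) -> (forall z, nc (q' z) <= B') ->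
  AC b p p' -> AC b q q' -> AC b (fun z => p z * q z) (fun z => p' z * q z + p z * q' z).
Proof.
move=> mp mp' mq mq' pA pA' qB qB' Hp Hq u u0.
apply: ae_imp2 (ae_imp2 (fun z a b => conj a b) (Hp u u0) (Hq u u0))
  (ae_imp2 (fun z a b => conj a b) (AC_ae mp mp' Hp) (AC_ae mq mq' Hq)) => z [hp hq] [hpw hqw].
have m1 : cmeasurable (fun s : R => p (mv b s z)) by mes.
have m2 : cmeasurable (fun s : R => p' (mv b s z)) by mes.
have m3 : cmeasurable (fun s : R => q (mv b s z)) by mes.
have m4 : cmeasurable (fun s : R => q' (mv b s z)) by mes.
have T := @cint_triangles _ _ u A' B' m2 m4 (fun s => pA' (mv b s z)) (fun s => qB' (mv b s z)).
pose a w := p' (mv b w z); pose c w := q' (mv b w z).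
pose I w := cintegral leb (fun v => win 0 w v * a v).
pose J w := cintegral leb (fun v => win 0 w v * c v).
have wb (f : R -> R[i]) (C s t : R) : cmeasurable f -> (forall w, nc (f w) <= C) -> cintble leb (fun w => win s t w * f w).
  move=> mf fB; under eq_fun do rewrite mulrC.
  by apply: (@cintble_bddM _ _ _ leb _ _ C) => //; exact: cintble_win.
transitivity (q z * I u + p z * J u + I u * J u).
  rewrite /I /J -hp -hq; ring.
rewrite -[X in _ + X]T -(cintZl (p z) (wb c B' 0 u m4 (fun s => qB' (mv b s z)))).
rewrite -(cintZl (q z) (wb a A' 0 u m2 (fun s => pA' (mv b s z)))).
have i1 : cintble leb (fun w => q z * (win 0 u w * a w)) by apply: cintbleZ; exact: (wb a A' 0 u m2 (fun s => pA' (mv b s z))).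
have i2 : cintble leb (fun w => p z * (win 0 u w * c w)) by apply: cintbleZ; exact: (wb c B' 0 u m4 (fun s => qB' (mv b s z))).
have mI : cmeasurable I by rewrite /I /a; mes.
have mJ : cmeasurable J by rewrite /J /c; mes.
pose S w := win 0 u w * (p' (mv b w z) * q (mv b w z) + p (mv b w z) * q' (mv b w z)).
have iS : cintble leb S.
  apply: (wb _ (A' * B + A * B')); first by mes.
  by move=> w; apply: (le_trans (ncD _ _)); rewrite !ncM lerD// ler_pM ?nc_ge0.
pose K w := win 0 u w * (a w * J w + I w * c w).
have n0 : {ae leb, forall u : R, u != 0}.
  by exists [set 0]; split => //; [exact: lebesgue_measure_set1|move=> v /= /negP; rewrite negbK => /eqP].
have SK : {ae leb, forall w, S w = q z * (win 0 u w * a w) + p z * (win 0 u w * c w) + K w}.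
  apply: ae_imp2 (ae_imp2 (fun z a b => conj a b) hpw hqw) n0 => w [h1 h2] w0.
  rewrite /S /K; have [/andP[w0' wu]|h] := boolP ((0 <= w) && (w <= u)); last first.
    by rewrite /win (negbTE h) !mul0r !mulr0 !addr0.
  have w1 : 0 < w by rewrite lt_neqAle eq_sym w0.
  have hI : p (mv b w z) = p z + I w by rewrite /I -h1//; ring.
  have hJ : q (mv b w z) = q z + J w by rewrite /J -h2//; ring.
  rewrite hI hJ -/(a w) -/(c w); ring.
have iK : cintble leb K.
  have [mK ooK] := cintbleB iS (cintbleD i1 i2).
  split; first by rewrite /K /a /c; mes.
  apply: le_lt_trans ooK; apply: ae_le_nnint.
  - by rewrite /K /a /c; mes.
  - exact: cmeas_nce.
  - by move=> w; rewrite lee_fin nc_ge0.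
  - by move=> w; rewrite lee_fin nc_ge0.
  by apply: ae_imp SK => w ->; rewrite lee_fin addrC addKr lexx.
rewrite -cintD// -cintD//; last exact: cintbleD.
apply: ae_eq_cint.
- by apply: cmeasD; [apply: cmeasD; [case: i1|case: i2]|case: iK].
- by case: iS.
by apply: ae_imp SK => w; rewrite /S => ->.
Qed.

Definition smear (E E' : R -> R[i]) (Q : R * R -> R[i]) (z : R * R) : R[i] :=
  cintegral leb2 (fun s => E s.1 * E' s.2 * Q (z.1 + s.1, z.2 + s.2)).

Lemma cintble_window E : window E -> cintble leb E.
Proof.
move=> [mE hE]; apply: (@cintble_dom _ _ _ leb _ (fun s => nc (win 0 1 s))) => //; first by mes.
by case: (@cintble_win R 0 1).
Qed.

Lemma cintble_smear E E' Q (B : R) z : window E -> window E' -> cmeasurable Q -> (forall w, nc (Q w) <= B) ->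
  cintble leb2 (fun s => E s.1 * E' s.2 * Q (z.1 + s.1, z.2 + s.2)).
Proof.
move=> wE wE' mQ QB; under eq_fun do rewrite mulrC.
apply: (@cintble_bddM _ _ _ leb2 _ _ B) => //; first by mes.
exact: (@cintbleM_prod _ _ _ _ _ leb leb _ _ (cintble_window wE) (cintble_window wE')).
Qed.

Lemma smear_rows E E' P Q (B : R) z : window E -> window E' -> cmeasurable Q -> (forall w, nc (Q w) <= B) ->
  (forall s, P s = cintegral leb (fun r => E' r * Q (mv false r (mv true s z)))) ->
  cintegral leb (fun s => E s * P s) = smear E E' Q z /\ cintble leb (fun s => E s * P s).
Proof.
move=> wE wE' mQ QB hP; have [mE _] := wE; have [mE' _] := wE'.
have Si := cintble_smear z wE wE' mQ QB.
have e : (fun s => E s * P s) =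
    fun s => cintegral leb (fun r => E s * E' r * Q (z.1 + s, z.2 + r)).
  apply/funext => s; rewrite hP -cintZl; first by apply: eq_cint => r; rewrite mulrA.
  have mq : cmeasurable (fun r : R => Q (mv false r (mv true s z))) by mes.
  by apply: (cintble_win_bdd mq wE') => r.
by rewrite e; split; [exact: (cfubini1 Si)|exact: (cintble_fubini1 Si)].
Qed.

(** The formula in x is applied first and the formula in xi is then used under the x-average, where
    [ae_mv] ensures that it holds at almost every point of almost every horizontal line. *)
Lemma representation2 (p00 p10 p01 p11 : R * R -> R[i]) (B : R) :
  cmeasurable p00 -> cmeasurable p10 -> cmeasurable p01 -> cmeasurable p11 ->
  (forall z, nc (p00 z) <= B) -> (forall z, nc (p10 z) <= B) -> (forall z, nc (p01 z) <= B) -> (forall z, nc (p11 z) <= B) ->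
  AC true p00 p10 -> AC false p00 p01 -> AC false p10 p11 ->
  {ae leb2, forall z, p00 z = smear E0 E0 p00 z + smear E0 E1 p01 z + (smear E1 E0 p10 z + smear E1 E1 p11 z)}.
Proof.
move=> m00 m10 m01 m11 b00 b10 b01 b11 A1 A2 A3.
have rows E p q : window E -> cmeasurable p -> cmeasurable q -> (forall z, nc (p z) <= B) -> (forall z, nc (q z) <= B) ->
    AC false p q -> {ae leb2, forall z, cintegral leb (fun s => E s * p (mv true s z)) = smear E E0 p z + smear E E1 q z}.
  move=> wE mp mq pB qB A; have [mE _] := wE.
  apply: ae_imp (ae_mv true (representation mp mq pB qB A)) => z hz.
  have [s1 i1] := @smear_rows E E0 (fun s => cintegral leb (fun r => E0 r * p (mv false r (mv true s z)))) p B z wE window_E0 mp pB (fun s => erefl).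
  have [s2 i2] := @smear_rows E E1 (fun s => cintegral leb (fun r => E1 r * q (mv false r (mv true s z)))) q B z wE window_E1 mq qB (fun s => erefl).
  rewrite -s1 -s2 -cintD//; apply: ae_eq_cint.
  - by mes.
  - by apply: cmeasD; [case: i1|case: i2].
  by apply: ae_imp hz => s ->; rewrite mulrDr.
apply: ae_imp2 (representation m00 m10 b00 b10 A1)
  (ae_imp2 (fun z a b => conj a b) (rows E0 p00 p01 window_E0 m00 m01 b00 b01 A2)
    (rows E1 p10 p11 window_E1 m10 m11 b10 b11 A3)) => z h [h1 h2].
by rewrite h h1 h2.
Qed.
End Moves.

Ltac mes ::= repeat first [
  lazymatch goal with
  | |- measurable_fun _ (fun _ => mv _ _ _) => apply: measurable_mv
  | |- cmeasurable (fourier _) => apply: cmeas_fourier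
  end | meas2 ].

(** * Composition for integrable symbols *)

Section Gamma.
Context {R : realType}.
Local Notation leb := (@lebesgue_measure R).
Local Notation leb2 := (prodsf leb leb).

Lemma lebZ (k : R) (f : R -> \bar R) : measurable_fun setT f -> 0 <= k -> (forall x, (0 <= f x)%E) ->
  (\int[leb]_x (k%:E * f x) = k%:E * \int[leb]_x f x)%E.
Proof. by move=> mf k0 f0; exact: nnintZl. Qed.

Lemma lebD (f g : R -> \bar R) : measurable_fun setT f -> measurable_fun setT g ->
  (forall x, (0 <= f x)%E) -> (forall x, (0 <= g x)%E) ->
  (\int[leb]_x (f x + g x) = \int[leb]_x f x + \int[leb]_x g x)%E.
Proof. by move=> mf mg f0 g0; exact: nnintD. Qed.

Definition N2 (f : R -> R[i]) : \bar R := (\int[leb]_x (nc (f x) ^+ 2)%:E)%E.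

(** The same parameter bounds the values and the support. *)
Definition nice (N : R) (f : R -> R[i]) : Prop :=
  [/\ cmeasurable f, forall x, nc (f x) <= N & forall x, N < `|x| -> f x = 0].

Lemma nice_le N f x : nice N f -> nc (f x) <= N * nc (win (- N) N x).
Proof.
move=> [_ fN fz]; rewrite nc_win -ler_norml; case: (leP `|x| N) => xN; first by rewrite mulr1.
by rewrite (fz _ xN) mulr0 nc0.
Qed.

Lemma nice_ge0 N f : nice N f -> 0 <= N.
Proof. by move=> [_ fN _]; exact: le_trans (nc_ge0 _) (fN 0). Qed.

Lemma cintble_nice N f : nice N f -> cintble leb f.
Proof.
move=> nf; have [mf _ _] := nf.
apply: (@cintble_dom _ _ _ leb _ (fun x => N * nc (win (- N) N x))) => //.
- by mes.
- by move=> x; exact: nice_le.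
- have [_] := cintbleZ N%:C (cintble_win (- N) N).
  by under eq_integral do rewrite ncM ncR ger0_norm ?(nice_ge0 nf)//.
Qed.

(** Differentiating e(-s y) in y brings down a factor -2 pi i s. It is absorbed into the weight,
    which stays a window since s lies in [0, 1]. *)
Definition sE (E : R -> R[i]) (s : R) : R[i] := s%:C * E s.

Lemma window_sE E : window E -> window (sE E).
Proof.
move=> wE; have [mE hE] := wE; split.
  by rewrite /sE; apply: cmeasM => //; apply: (@cmeasR _ _ _ (fun s => s)); mes.
move=> s; rewrite /sE; have [/andP[s0 s1]|h] := boolP ((0 <= s) && (s <= 1)).
  by rewrite ncM ncR ger0_norm// (le_trans _ (hE s))// ler_piMl ?nc_ge0.
by rewrite (window0 wE h) mulr0 nc0 nc_ge0.
Qed.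

(** The local Fourier transform of F near t, evaluated at y. *)
Definition Hf (E F : R -> R[i]) (y t : R) : R[i] := fourier (fun s => E s * F (t - s)) y.

Variables (F : R -> R[i]) (N : R).
Hypothesis nF : nice N F.
Let N0 : 0 <= N := nice_ge0 nF.
Let mF : cmeasurable F. Proof. by case: nF. Qed.
Let FN x : nc (F x) <= N. Proof. by case: nF. Qed.

Lemma cintble_Hf E t : window E -> cintble leb (fun s => E s * F (t - s)).
Proof. by move=> wE; apply: (@cintble_win_bdd _ _ _ N) => //; mes. Qed.

Lemma Hf_le E y t : window E -> nc (Hf E F y t) <= N * nc (win (- (N + 1)) (N + 1) t).
Proof.
move=> wE; have [mE hE] := wE.
rewrite nc_win -ler_norml; case: (leP `|t| (N + 1)) => tN; last first.
  rewrite mulr0 /Hf /fourier cint_eq0 ?nc0// => s.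
  have [/andP[s0 s1]|h] := boolP ((0 <= s) && (s <= 1)); last by rewrite (window0 wE h) mul0r mulr0.
  have [_ _ F0] := nF; rewrite F0 ?mulr0//.
  have h1 : `|t| <= `|t - s| + `|s| by rewrite -[in leLHS](subrK s t) ler_normD.
  have h2 : `|s| <= 1 by rewrite ger0_norm.
  by move: tN h1 h2; move: `|t| `|s| `|t - s| => a b c; lra.
rewrite mulr1 -lee_fin; apply: (le_trans (cint_norm_le _ _)); first by mes.
apply: (@le_trans _ _ (\int[leb]_s (N%:E * (nc (win 0 1 s))%:E))%E).
  apply: le_nnint.
  - by mes.
  - by mes.
  - by move=> s; rewrite lee_fin nc_ge0.
  - by move=> s; rewrite -EFinM lee_fin !ncM nc_expi mul1r mulrC ler_pM ?nc_ge0.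
rewrite nnintZl//; [|by mes|by move=> s; rewrite lee_fin nc_ge0].
by have := @int_win R 0 1 ler01 => ->; rewrite subr0 mule1.
Qed.

Lemma Hf_leN E y t : window E -> nc (Hf E F y t) <= N.
Proof. by move=> wE; apply: (le_trans (Hf_le y t wE)); rewrite ler_piMr// nc_win_le1. Qed.

Lemma cmeas_Hf E : cmeasurable E -> cmeasurable (fun z : R * R => Hf E F z.1 z.2).
Proof. by move=> mE; rewrite /Hf; mes. Qed.

Lemma AC_Hf E : window E -> AC true (fun z => Hf E F z.1 z.2)
  (fun z => Complex 0 (- (2 * pi)) * Hf (sE E) F z.1 z.2).
Proof.
move=> wE u u0; have [mE hE] := wE; apply: ae_true => -[y t]; rewrite /mv /=.
pose f s := E s * F (t - s); pose f' s := sE E s * F (t - s).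
have fi : cintble leb f by exact: cintble_Hf.
have fi' : cintble leb f' by apply: cintble_Hf; exact: window_sE.
have [mf _] := fi; have [mf' _] := fi'.
pose K (w s : R) := win 0 u w * (expi (- (2 * pi * s * (y + w))) * f' s).
have Ki : cintble (leb \x leb)%E (fun z : R * R => K z.1 z.2).
  have [_ oo] := @cintbleM_prod _ _ _ _ _ leb leb _ _ (cintble_win 0 u) fi'.
  split; first by rewrite /K; mes.
  apply: le_lt_trans oo; rewrite le_eqVlt; apply/orP; left; apply/eqP; apply: eq_integral => z _.
  by rewrite /K !ncM nc_expi mul1r.
rewrite [RHS](_ : _ = Complex 0 (- (2 * pi)) * cintegral leb (fun w => cintegral leb (fun s => K w s))); last first.
  rewrite -cintZl; last exact: (cintble_fubini1 Ki).
  apply: eq_cint => w; rewrite /K cintZl; last exact: cintble_fourier.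
  by rewrite /Hf /fourier /f'; ring.
rewrite (@cint_swap _ _ _ _ _ leb leb _ Ki) -cintZl; last exact: (@cintble_fubini2 _ _ _ _ _ leb leb _ Ki).
rewrite /Hf /fourier -cintB; [|exact: cintble_fourier|exact: cintble_fourier].
apply: eq_cint => s; rewrite /K /f' /sE -/(f s).
transitivity ((s%:C * f s * expi (- (2 * pi * s * y))) * (Complex 0 (- (2 * pi)) *
   cintegral leb (fun w => win 0 u w * expi (- (2 * pi * s) * w)))).
  have e := @expi_integral R (- (2 * pi * s)) u (ltW u0).
  have -> : forall c, (s%:C * f s * expi (- (2 * pi * s * y))) * (Complex 0 (- (2 * pi)) * c) =
     f s * expi (- (2 * pi * s * y)) * (Complex 0 (- (2 * pi * s)) * c).
    move=> c; have -> : Complex 0 (- (2 * pi * s)) = s%:C * Complex 0 (- (2 * pi)) :> R[i].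
      by apply: complex_ext; rewrite /=; ring.
    by ring.
  rewrite e (_ : - (2 * pi * s * (y + u)) = - (2 * pi * s * y) + - (2 * pi * s) * u); last by ring.
  by rewrite expiD /f; ring.
have wi : cintble leb (fun w => win 0 u w * expi (- (2 * pi * s) * w)).
  under eq_fun do rewrite mulrC; apply: (@cintble_bddM _ _ _ leb _ _ 1); last exact: cintble_win.
  - by mes.
  - by move=> x; rewrite nc_expi.
rewrite mulrCA; congr (_ * _); rewrite -cintZl//; apply: eq_cint => w.
rewrite (_ : - (2 * pi * s * (y + w)) = - (2 * pi * s * y) + - (2 * pi * s) * w); last by ring.
by rewrite expiD /f; ring.
Qed.

Variables (X : R -> R).
Hypothesis mX : measurable_fun setT X.
Hypothesis X0 : forall y, 0 <= X y.
Hypothesis iX : (\int[leb]_y (X y)%:E < +oo)%E.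

(** [B] is the bound that enters the estimates; [X] is an integrable majorant in x that justifies
    Fourier transforms and exchanges of integrals, and whose integral never appears in a
    constant. *)
Definition symb (B : R) (P : R * R -> R[i]) : Prop :=
  [/\ cmeasurable P, forall z, nc (P z) <= B & forall z, nc (P z) <= X z.1].

(** The Fourier transform in x of the amplitude carried by the frequency t in the smeared operator,
    see [smearOp_Hf]. *)
Definition Gam (E : R -> R[i]) (P : R * R -> R[i]) (th t : R) : R[i] :=
  fourier (fun y => P (y, t) * Hf E F y t) th.

Lemma cmeas_Gam E P : cmeasurable E -> cmeasurable P -> cmeasurable (fun z : R * R => Gam E P z.1 z.2).
Proof. by move=> mE mP; rewrite /Gam /Hf; mes. Qed.

Lemma cintble_X (f : R -> R[i]) (c : R) : 0 <= c -> cmeasurable f -> (forall y, nc (f y) <= c * X y) -> cintble leb f.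
Proof.
move=> c0 mf fX; apply: (@cintble_dom _ _ _ leb _ (fun y => c * X y)) => //.
- by mes.
- under eq_integral do rewrite EFinM.
  rewrite nnintZl//; last by mes.
  by rewrite lte_mul_pinfty// ge0_fin_numE// nnint_ge0// => y; rewrite lee_fin.
Qed.

Lemma cintble_PH E P B t : window E -> symb B P -> cintble leb (fun y => P (y, t) * Hf E F y t).
Proof.
move=> wE [mP _ PX]; have mH := cmeas_Hf (proj1 wE).
apply: (@cintble_X _ N) => //.
- by apply: cmeasM; [mes|apply: (cmeas_comp _ mH (u := fun y : R => (y, t))); mes].
- move=> y; rewrite ncM mulrC; apply: ler_pM; [exact: nc_ge0|exact: nc_ge0|exact: Hf_leN|exact: (PX (y, t))].
Qed.

(** Bessel in th removes the outer transform and |P| <= B is taken out; Bessel in y then removes the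
    transform inside [Hf]. What remains is a unit-window average of |F|^2, whose integral over t is
    [N2 F]. *)
Lemma Gam_energy E P B : window E -> symb B P ->
  (\int[leb]_t \int[leb]_th (nc (Gam E P th t) ^+ 2)%:E <= (B ^+ 2)%:E * N2 F)%E.
Proof.
move=> wE sP; have [mP PB PX] := sP; have [mE hE] := wE; have mH := cmeas_Hf mE.
have mG := cmeas_Gam mE mP.
rewrite /N2 -(@nnint_window_conv _ (fun x => (nc (F x) ^+ 2)%:E)); last 2 first.
- by mes.
- by move=> x; rewrite lee_fin sqr_ge0.
rewrite -nnintZl ?sqr_ge0//; last 2 first.
- by mes.
- by move=> x; apply: nnint_ge0 => y; rewrite lee_fin; pos.
apply: le_nnint.
- by rewrite /Gam /Hf; mes.
- by mes.
- by move=> x; apply: nnint_ge0 => y; rewrite lee_fin; pos.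
move=> t; apply: (le_trans (bessel (cintble_PH t wE sP))).
have mHt : cmeasurable (fun y : R => Hf E F y t) by apply: (cmeas_comp _ mH (u := fun y : R => (y, t))); mes.
apply: (@le_trans _ _ (\int[leb]_y ((B ^+ 2)%:E * (nc (Hf E F y t) ^+ 2)%:E))%E).
  apply: le_nnint.
  - by mes.
  - by mes.
  - by move=> x; rewrite lee_fin; pos.
  - move=> y; rewrite -EFinM lee_fin ncM exprMn ler_wpM2r ?sqr_ge0//.
    by rewrite lerXn2r ?nnegrE ?nc_ge0// (le_trans (nc_ge0 _) (PB (y, t))).
rewrite nnintZl ?sqr_ge0//; [|by mes|by move=> s; rewrite lee_fin sqr_ge0].
apply: lee_wpmul2l; first by rewrite lee_fin sqr_ge0.
apply: (le_trans (bessel (cintble_Hf t wE))).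
apply: le_nnint.
- by mes.
- by mes.
- by move=> x; rewrite lee_fin; pos.
- move=> s; rewrite -EFinM lee_fin ncM exprMn ler_wpM2r ?sqr_ge0//.
  apply: (le_trans _ (hE s)); rewrite expr2 ler_piMl ?nc_ge0// nc_window_le1//.
Qed.

(** Multiplication by 2 pi i th is differentiation of P Hf in x, and the product rule lets it fall
    on P or on the weight of [Hf]. Since only the steps 1 / (n + 1) are tested, one null set of t
    serves all th. *)
Lemma Gam_derivative E P P' B : window E -> symb B P -> symb B P' -> AC true P P' ->
  {ae leb, forall t, forall th, Complex 0 (2 * pi * th) * Gam E P th t =
     Gam E P' th t + Complex 0 (- (2 * pi)) * Gam (sE E) P th t}.
Proof.
move=> wE sP sP' A; have [mP PB PX] := sP; have [mP' PB' PX'] := sP'; have [mE hE] := wE.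
have wsE := window_sE wE; have [msE _] := wsE.
have mH := cmeas_Hf mE; have mH' := cmeas_Hf msE.
have bH (z : R * R) : nc (Hf E F z.1 z.2) <= N by exact: Hf_leN.
have bH' (z : R * R) : nc (Complex 0 (- (2 * pi)) * Hf (sE E) F z.1 z.2) <= nc (Complex 0 (- (2 * pi)) : R[i]) * N.
  by rewrite ncM ler_wpM2l ?nc_ge0// Hf_leN.
have mH2 : cmeasurable (fun z : R * R => Complex 0 (- (2 * pi)) * Hf (sE E) F z.1 z.2) by mes; exact: mH'.
have AA := AC_mul mP mP' mH mH2 PB PB' bH bH' A (AC_Hf wE).
have h n : {ae leb, forall t, {ae leb, forall y,
    P (y + n.+1%:R^-1, t) * Hf E F (y + n.+1%:R^-1) t - P (y, t) * Hf E F y t =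
    cintegral leb (fun w => win 0 n.+1%:R^-1 w * (P' (y + w, t) * Hf E F (y + w) t +
      P (y + w, t) * (Complex 0 (- (2 * pi)) * Hf (sE E) F (y + w) t)))}}.
  have n0 : 0 < n.+1%:R^-1 :> R by rewrite invr_gt0.
  exact: (@ae_prod_ae _ _ _ _ _ leb leb _ (@ae_swap _ _ _ _ _ leb leb _ (AA _ n0))).
apply: ae_imp (ae_all_nat h) => t ht th.
have i1 := cintble_PH t wE sP; have i2 := cintble_PH t wE sP'; have i3 := cintble_PH t wsE sP.
have i4 : cintble leb (fun y => P (y, t) * (Complex 0 (- (2 * pi)) * Hf (sE E) F y t)).
  by under eq_fun do rewrite mulrCA; exact: cintbleZ.
have := @fourier_derivative _ (fun y => P (y, t) * Hf E F y t) _ th i1 (cintbleD i2 i4) ht.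
rewrite -/(Gam E P th t) => <-.
rewrite /Gam /fourier -(cintZl _ (cintble_fourier th i3)).
rewrite -(cintD (cintble_fourier th i2) (cintbleZ _ (cintble_fourier th i3))).
by apply: eq_cint => y; ring.
Qed.

Lemma nc_imag (a : R) : nc (Complex 0 a : R[i]) ^+ 2 = a ^+ 2.
Proof. by rewrite nc_sqr /= expr0n add0r. Qed.

Lemma sqr_2pi : (2 * pi : R) ^+ 2 <= 64.
Proof. by have := pihalf_lt2 R; have := pi_ge0 R; move: (pi : R) => p; nra. Qed.

Lemma sqrD2 (a b c : R) : 0 <= a -> 0 <= b -> 0 <= c -> a <= c + b -> a ^+ 2 <= 2 * c ^+ 2 + 2 * b ^+ 2.
Proof. by move=> a0 b0 c0 h; have := sqr_ge0 (b - c); nra. Qed.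

Lemma nc_sqrD2 (z w : R[i]) : nc (z + w) ^+ 2 <= 2 * nc z ^+ 2 + 2 * nc w ^+ 2.
Proof.
exact: sqrD2 (nc_ge0 _) (nc_ge0 _) (nc_ge0 _) (ncD z w).
Qed.

(** The homogeneous Sobolev energy of order k in x of P Hf, on the Fourier side. *)
Definition En (k : nat) (E : R -> R[i]) (P : R * R -> R[i]) : \bar R :=
  (\int[leb]_t \int[leb]_th ((2 * pi * th) ^+ (2 * k) * nc (Gam E P th t) ^+ 2)%:E)%E.

Lemma En0 E P B : window E -> symb B P -> (En 0 E P <= (B ^+ 2)%:E * N2 F)%E.
Proof.
move=> wE sP; rewrite /En muln0; under eq_integral do under eq_integral do rewrite expr0 mul1r.
exact: Gam_energy.
Qed.

Lemma weight_le (w a x y z : R) : 0 <= w -> a * x <= 2 * y + 128 * z ->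
  a * (w * x) <= 2 * (w * y) + 128 * (w * z).
Proof.
move=> w0 h; rewrite (mulrCA a) (mulrCA 2) (mulrCA 128) -mulrDr.
exact: ler_wpM2l.
Qed.

(** From |z + w|^2 <= 2 |z|^2 + 2 |w|^2 in [Gam_derivative]; 128 is 2 times 64, a bound on 2 (2
    pi)^2. *)
Lemma EnS k E P P' B : window E -> symb B P -> symb B P' -> AC true P P' ->
  (En k.+1 E P <= 2%:E * En k E P' + 128%:E * En k (sE E) P)%E.
Proof.
move=> wE sP sP' A; have [mP _ _] := sP; have [mP' _ _] := sP'; have [mE _] := wE.
have [msE _] := window_sE wE.
have p0 th (x : R) : 0 <= (2 * pi * th : R) ^+ (2 * k) by rewrite exprM exprn_ge0// sqr_ge0.
have m1 : measurable_fun setT (fun z : R * R => ((2 * pi * z.2) ^+ (2 * k) * nc (Gam E P' z.2 z.1) ^+ 2)%:E).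
  by rewrite /Gam /Hf; mes.
have m2 : measurable_fun setT (fun z : R * R => ((2 * pi * z.2) ^+ (2 * k) * nc (Gam (sE E) P z.2 z.1) ^+ 2)%:E).
  by rewrite /Gam /Hf; mes.
have m3 : measurable_fun setT (fun z : R * R => ((2 * pi * z.2) ^+ (2 * k.+1) * nc (Gam E P z.2 z.1) ^+ 2)%:E).
  by rewrite /Gam /Hf; mes.
have q0 Q E' t th : (0 <= ((2 * pi * th) ^+ (2 * k) * nc (Gam E' Q th t) ^+ 2)%:E)%E.
  by rewrite lee_fin mulr_ge0 ?sqr_ge0 ?p0.
have M1 : measurable_fun setT (fun t : R => \int[leb]_th ((2 * pi * th) ^+ (2 * k) * nc (Gam E P' th t) ^+ 2)%:E)%E.
  by apply: meas_nneint2 => [|t th]; [exact: m1|exact: q0].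
have M2 : measurable_fun setT (fun t : R => \int[leb]_th ((2 * pi * th) ^+ (2 * k) * nc (Gam (sE E) P th t) ^+ 2)%:E)%E.
  by apply: meas_nneint2 => [|t th]; [exact: m2|exact: q0].
rewrite /En -(lebZ M1)//; last by move=> t; apply: nnint_ge0.
rewrite -(lebZ M2)//; last by move=> t; apply: nnint_ge0.
rewrite -lebD; last 4 first.
- by apply: emeasurable_funM; [exact: measurable_cst|exact: M1].
- by apply: emeasurable_funM; [exact: measurable_cst|exact: M2].
- by move=> t; rewrite mule_ge0//; apply: nnint_ge0.
- by move=> t; rewrite mule_ge0//; apply: nnint_ge0.
apply: ae_le_nnint.
- apply: meas_nneint2 => [|t th]; first exact: m3.
  rewrite lee_fin mulr_ge0 ?sqr_ge0// exprM exprn_ge0// sqr_ge0//.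
- by apply: emeasurable_funD; (apply: emeasurable_funM; [exact: measurable_cst|]); [exact: M1|exact: M2].
- by move=> t; apply: nnint_ge0 => th; rewrite lee_fin mulr_ge0 ?sqr_ge0// exprM exprn_ge0// sqr_ge0.
- by move=> t; apply: adde_ge0; (apply: mule_ge0; [by rewrite lee_fin|by apply: nnint_ge0 => th; exact: q0]).
apply: ae_imp (Gam_derivative wE sP sP' A) => t ht.
have n1 : measurable_fun setT (fun th : R => ((2 * pi * th) ^+ (2 * k) * nc (Gam E P' th t) ^+ 2)%:E).
  by rewrite /Gam /Hf; mes.
have n2 : measurable_fun setT (fun th : R => ((2 * pi * th) ^+ (2 * k) * nc (Gam (sE E) P th t) ^+ 2)%:E).
  by rewrite /Gam /Hf; mes.
rewrite -(lebZ n1)// -(lebZ n2)// -lebD; last 4 first.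
- by apply: emeasurable_funM; [exact: measurable_cst|exact: n1].
- by apply: emeasurable_funM; [exact: measurable_cst|exact: n2].
- by move=> th; rewrite mule_ge0.
- by move=> th; rewrite mule_ge0.
apply: le_nnint.
- by rewrite /Gam /Hf; mes.
- by apply: emeasurable_funD; (apply: emeasurable_funM; [exact: measurable_cst|]); [exact: n1|exact: n2].
- by move=> th; rewrite lee_fin mulr_ge0 ?sqr_ge0// exprM exprn_ge0// sqr_ge0.
move=> th; rewrite -!EFinM -EFinD lee_fin mulnS exprD -mulrA.
apply: weight_le; first exact: (p0 th 0).
rewrite -nc_imag -exprMn -ncM ht; apply: (le_trans (nc_sqrD2 _ _)).
rewrite lerD2l ncM exprMn nc_imag sqrrN mulrA ler_wpM2r ?sqr_ge0//.
by have := sqr_2pi; lra.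
Qed.

Lemma ge0_combine (a b : R) (x : \bar R) : 0 <= a -> 0 <= b -> ((a + b)%:E * x = a%:E * x + b%:E * x)%E.
Proof. by move=> a0 b0; rewrite EFinD ge0_muleDl ?lee_fin. Qed.

(** Each use of [EnS] multiplies the constant by 2 + 128 = 130; the square 16900 appears in
    [En2]. *)
Lemma En1 E P P' B : window E -> symb B P -> symb B P' -> AC true P P' ->
  (En 1 E P <= (130 * B ^+ 2)%:E * N2 F)%E.
Proof.
move=> wE sP sP' A; apply: (le_trans (EnS 0 wE sP sP' A)).
have B0 : 0 <= B by have [_ h _] := sP; exact: le_trans (nc_ge0 _) (h (0, 0)).
have n0 : (0 <= N2 F)%E by apply: nnint_ge0 => x; rewrite lee_fin sqr_ge0.
apply: (@le_trans _ _ (2%:E * ((B ^+ 2)%:E * N2 F) + 128%:E * ((B ^+ 2)%:E * N2 F))%E).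
  by apply: leeD; (apply: lee_wpmul2l; [rewrite lee_fin|apply: En0 => //; exact: window_sE]).
rewrite (muleA 2%:E) (muleA 128%:E) -(EFinM 2) -(EFinM 128) -ge0_combine ?mulr_ge0 ?sqr_ge0//.
by rewrite (_ : 2 * B ^+ 2 + 128 * B ^+ 2 = 130 * B ^+ 2)//; ring.
Qed.

Lemma En2 E P P' P'' B : window E -> symb B P -> symb B P' -> symb B P'' -> AC true P P' -> AC true P' P'' ->
  (En 2 E P <= (16900 * B ^+ 2)%:E * N2 F)%E.
Proof.
move=> wE sP sP' sP'' A A'; apply: (le_trans (EnS 1 wE sP sP' A)).
have B0 : 0 <= B by have [_ h _] := sP; exact: le_trans (nc_ge0 _) (h (0, 0)).
have n0 : (0 <= N2 F)%E by apply: nnint_ge0 => x; rewrite lee_fin sqr_ge0.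
have wsE := window_sE wE.
apply: (@le_trans _ _ (2%:E * ((130 * B ^+ 2)%:E * N2 F) + 128%:E * ((130 * B ^+ 2)%:E * N2 F))%E).
  apply: leeD; (apply: lee_wpmul2l; first by rewrite lee_fin).
    exact: (En1 wE sP' sP'' A').
  exact: (En1 wsE sP sP' A).
rewrite (muleA 2%:E) (muleA 128%:E) -(EFinM 2) -(EFinM 128) -ge0_combine; last 2 first.
- by apply: mulr_ge0 => //; apply: mulr_ge0 => //; exact: sqr_ge0.
- by apply: mulr_ge0 => //; apply: mulr_ge0 => //; exact: sqr_ge0.
by rewrite (_ : 2 * (130 * B ^+ 2) + 128 * (130 * B ^+ 2) = 16900 * B ^+ 2)//; ring.
Qed.
End Gamma.

Lemma cmeas_Hf_of d (T : measurableType d) (R : realType) (E F : R -> R[i]) (y t : T -> R) :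
  cmeasurable E -> cmeasurable F -> measurable_fun setT y -> measurable_fun setT t ->
  cmeasurable (fun x => Hf E F (y x) (t x)).
Proof. by move=> mE mF my mt; rewrite /Hf; mes. Qed.

Lemma cmeas_Gam_of d (T : measurableType d) (R : realType) (F E : R -> R[i]) P (th t : T -> R) :
  cmeasurable F -> cmeasurable E -> cmeasurable P -> measurable_fun setT th -> measurable_fun setT t ->
  cmeasurable (fun x => Gam F E P (th x) (t x)).
Proof.
move=> mF mE mP mth mt; rewrite /Gam /fourier; apply: cmeas_cint2.
apply: cmeasM; first by mes.
apply: cmeasM; first by mes.
by apply: cmeas_Hf_of => //; mes.
Qed.

Ltac mes ::= repeat first [
  lazymatch goal with
  | |- measurable_fun _ (fun _ => mv _ _ _) => apply: measurable_mv
  | |- cmeasurable (fourier _) => apply: cmeas_fourier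
  | |- cmeasurable (fun _ => Hf _ _ _ _) => apply: cmeas_Hf_of
  | |- cmeasurable (Hf ?E ?F ?y) => apply: (@cmeas_Hf_of _ _ _ E F (fun=> y) (fun t => t))
  | |- cmeasurable (fun _ => Gam _ _ _ _ _) => apply: cmeas_Gam_of
  | |- cmeasurable (Gam ?F ?E ?P ?y) => apply: (@cmeas_Gam_of _ _ _ F E P (fun=> y) (fun t => t))
  end | meas2 ].

Section AlmostEverywhereLine.
Context {R : realType}.
Local Notation leb := (@lebesgue_measure R).
Local Notation leb2 := (prodsf leb leb).

Lemma ae_transfer (s : R -> R) (P : R -> Prop) : measurable_fun setT s ->
  (forall f : R -> \bar R, measurable_fun setT f -> (forall x, (0 <= f x)%E) ->
    (\int[leb]_x f (s x) = \int[leb]_x f x)%E) ->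
  {ae leb, forall x, P x} -> {ae leb, forall x, P (s x)}.
Proof.
move=> ms inv [N [mN N0 NP]].
have mN' : measurable (s @^-1` N : set R) by rewrite -[_ @^-1` _]setTI; exact: ms.
exists (s @^-1` N); split => //; last by move=> x /= h; apply: NP.
have E1 := integral_indic leb measurableT mN; rewrite setIT in E1.
have E2 := integral_indic leb measurableT mN'; rewrite setIT in E2.
rewrite -E2; apply: (eq_trans (inv (fun x => (\1_N x)%:E) _ _)); last exact: (eq_trans E1 N0).
- by apply/measurable_EFinP; exact: measurable_indic.
- by move=> x; rewrite lee_fin.
Qed.

Lemma ae_shift1 (c : R) (P : R -> Prop) : {ae leb, forall x, P x} -> {ae leb, forall x, P (x + c)}.
Proof. by apply: ae_transfer => [|f mf f0]; [exact: measurable_shift|exact: nneint_shift]. Qed.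

Lemma ae_opp (P : R -> Prop) : {ae leb, forall x, P x} -> {ae leb, forall x, P (- x)}.
Proof. by apply: ae_transfer => [|f mf f0]; [by mes|exact: nneint_opp]. Qed.

Lemma ae_fst (P : R -> Prop) : {ae leb, forall x, P x} -> {ae leb2, forall z : R * R, P z.1}.
Proof.
move=> [N [mN N0 NP]].
have mN' : measurable (fst @^-1` N : set (R * R)).
  by rewrite -[_ @^-1` _]setTI; exact: measurable_fst.
exists (fst @^-1` N); split => //; last by move=> x /= h; apply: NP.
apply: (@ae_prod_of_ae _ _ _ _ _ leb leb) => //.
by exists N; split => // x /= h; apply: contrapT => Nx; apply: h; exact: ae_true.
Qed.

Lemma ae_slice (P : R * R -> Prop) : {ae leb2, forall z, P z} ->
  {ae leb, forall t, {ae leb, forall x, P (x, t)}}.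
Proof. by move=> h; exact: (@ae_prod_ae _ _ _ _ _ leb leb _ (@ae_swap _ _ _ _ _ leb leb _ h)). Qed.
End AlmostEverywhereLine.

Section Composition.
Context {R : realType}.
Local Notation leb := (@lebesgue_measure R).
Local Notation leb2 := (prodsf leb leb).
Variables (F : R -> R[i]) (N : R).
Hypothesis nF : nice N F.
Let N0 : 0 <= N := nice_ge0 nF.
Let mF : cmeasurable F. Proof. by case: nF. Qed.
Let FN x : nc (F x) <= N. Proof. by case: nF. Qed.

(* The symbol [Q] acting on [F], smeared in frequency by [E]. *)
Definition smearOp (E : R -> R[i]) (Q : R * R -> R[i]) (y : R) : R[i] :=
  cintegral leb (fun eta => expi (2 * pi * y * eta) * F eta * cintegral leb (fun s => E s * Q (y, eta + s))).

(** The substitution t = eta + s writes the smeared operator as a superposition of pure frequencies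
    e(y t); the factor e(-y s) left over makes the s-integral a local Fourier transform of F. *)
Lemma smearOp_Hf E Q B y : window E -> cmeasurable Q -> (forall z, nc (Q z) <= B) ->
  cintegral leb (fun t => Q (y, t) * (expi (2 * pi * y * t) * Hf E F y t)) = smearOp E Q y.
Proof.
move=> wE mQ QB; have [mE hE] := wE.
pose K (eta s : R) := expi (2 * pi * y * eta) * F eta * (E s * Q (y, eta + s)).
have dom := @cintbleM_prod _ _ _ _ _ leb leb _ _ (cintble_nice nF) (cintbleZ B%:C (cintble_win 0 1)).
have B0 : 0 <= B by exact: le_trans (nc_ge0 _) (QB (0, 0)).
have Ki : cintble (leb \x leb)%E (fun z : R * R => K z.1 z.2).
  apply: (@cintble_dom _ _ _ (leb \x leb)%E _ (fun z => nc (F z.1 * (B%:C * win 0 1 z.2)))) => //; last by case: dom.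
  - by rewrite /K; mes.
  - by mes.
  - move=> [eta s]; rewrite /K /= !ncM nc_expi mul1r ler_wpM2l ?nc_ge0//.
    by rewrite mulrC ncR (ger0_norm B0) ler_pM ?nc_ge0.
transitivity (cintegral leb (fun eta => cintegral leb (fun s => K eta s))); last first.
  apply: eq_cint => eta; rewrite /K cintZl//.
  by apply: (@cintble_win_bdd _ _ _ B) => //; mes.
rewrite (@cint_swap _ _ _ _ _ leb leb _ Ki).
transitivity (cintegral leb (fun s => cintegral leb (fun t => K (t - s) s))); last first.
  apply: eq_cint => s; apply: (@cint_shift _ (- s) (fun eta => K eta s)).
  by rewrite /K; mes.
pose L (s t : R) := K (t - s) s.
have Li : cintble (leb \x leb)%E (fun z : R * R => L z.1 z.2).
  apply: cintble_prodE; first by rewrite /L /K; mes.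
  rewrite (_ : (fun s => _) = fun s : R => (\int[leb]_eta (nc (K eta s))%:E)%E); last first.
    apply/funext => s; apply: (@nneint_shift _ (- s) (fun eta => (nc (K eta s))%:E)).
    - by rewrite /K; mes.
    - by move=> ?; rewrite lee_fin nc_ge0.
  rewrite -(@nnint_swap _ _ _ _ _ leb leb (fun eta s => (nc (K eta s))%:E)).
  - exact: (cintble_prod_lty Ki).
  - by rewrite /K; mes.
  - by move=> *; rewrite lee_fin nc_ge0.
rewrite (@cint_swap _ _ _ _ _ leb leb (fun s t => K (t - s) s) Li).
apply: eq_cint => t; rewrite /K.
rewrite [in RHS](_ : (fun s => _) = fun s => (Q (y, t) * expi (2 * pi * y * t)) * (expi (- (2 * pi * s * y)) * (E s * F (t - s)))).
  by rewrite cintZl /Hf /fourier ?mulrA//; apply: cintble_fourier; exact: (@cintble_Hf _ F N nF E t wE).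
apply/funext => s; rewrite subrK (_ : 2 * pi * y * (t - s) = 2 * pi * y * t + - (2 * pi * s * y)); last by ring.
by rewrite expiD; ring.
Qed.

Variables (X : R -> R).
Hypothesis mX : measurable_fun setT X.
Hypothesis X0 : forall y, 0 <= X y.
Hypothesis iX : (\int[leb]_y (X y)%:E < +oo)%E.

Local Notation Gam := (Gam F).
Local Notation En := (En F).
Local Notation symb := (symb X).

Lemma Gam_eq0 E P th t : window E -> N + 1 < `|t| -> Gam E P th t = 0.
Proof.
move=> wE tN; rewrite /Gam /fourier; apply: cint_eq0 => y.
have := Hf_le nF y t wE; rewrite nc_win -ler_norml.
have -> : (`|t| <= N + 1) = false by apply/negbTE; rewrite -ltNge.
rewrite mulr0 => h.
rewrite (_ : Hf E F y t = 0) ?mulr0//.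
by apply: nc_eq0; apply/le_anti; rewrite h nc_ge0.
Qed.

Lemma N2_nice_lty : (N2 F < +oo)%E.
Proof.
have [_ oo] := cintbleZ (N%:C) (cintble_nice nF).
apply: le_lt_trans oo; apply: le_nnint.
- by mes.
- by mes.
- by move=> x; rewrite lee_fin sqr_ge0.
- by move=> x; rewrite lee_fin expr2 ncM ncR ger0_norm// ler_wpM2r ?nc_ge0.
Qed.

Lemma half_poisson (th : R) : 0 < 1 + (2 * pi * th) ^+ 2 -> (1 + (2 * pi * th) ^+ 2)^-1 = 2^-1 * poisson 1 th.
Proof. by move=> h; rewrite /poisson expr1n mulr1 mulrA mulVf// mul1r. Qed.

Lemma le_amgm1 (x w : R) : 0 < w -> 0 <= x -> x <= w * x ^+ 2 + w^-1.
Proof.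
move=> w0 x0; rewrite -(ler_pM2l w0) mulrDr mulfV ?gt_eqF//.
have := sqr_ge0 (w * x - 1); have : 0 <= w * x by rewrite mulr_ge0// ltW.
have -> : w * (w * x ^+ 2) = (w * x) ^+ 2 by ring.
by move: (w * x) => y; nra.
Qed.

(** With w = 1 + (2 pi th)^2, |Gam| <= w |Gam|^2 + 1 / w. The first term is controlled by the
    energies of orders 0 and 1; the second is half a Poisson kernel in th, and t stays in a bounded
    interval because F has bounded support. *)
Lemma cintble_Gam E P P' B : window E -> symb B P -> symb B P' -> AC true P P' ->
  cintble (leb \x leb)%E (fun z : R * R => Gam E P z.2 z.1).
Proof.
move=> wE sP sP' A; have [mP _ _] := sP; have [mE _] := wE.
have mG := cmeas_Gam nF mE mP.
have mp := @measurable_poisson R 1 ltr01.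
have w0 th : 0 < 1 + (2 * pi * th : R) ^+ 2 by rewrite ltr_pwDl// sqr_ge0.
have m1 : measurable_fun setT (fun z : R * R => (nc (Gam E P z.2 z.1) ^+ 2)%:E) by rewrite /Gam /Hf; mes.
have m2 : measurable_fun setT (fun z : R * R => ((2 * pi * z.2) ^+ 2 * nc (Gam E P z.2 z.1) ^+ 2)%:E) by rewrite /Gam /Hf; mes.
have m3 : measurable_fun setT (fun z : R * R => (nc (win (- (N + 1)) (N + 1) z.1) * (2^-1 * poisson 1 z.2))%:E) by mes.
have n1 (t th : R) : (0 <= (nc (Gam E P th t) ^+ 2)%:E)%E by rewrite lee_fin sqr_ge0.
have n2 (t th : R) : (0 <= ((2 * pi * th) ^+ 2 * nc (Gam E P th t) ^+ 2)%:E)%E by rewrite lee_fin mulr_ge0 ?sqr_ge0.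
have n3 (t th : R) : (0 <= (nc (win (- (N + 1)) (N + 1) t) * (2^-1 * poisson 1 th))%:E)%E.
  by rewrite lee_fin mulr_ge0 ?nc_ge0// mulr_ge0 ?poisson_ge0.
apply: (@cintble_dom _ _ _ leb2 _ (fun z => nc (Gam E P z.2 z.1) ^+ 2 + (2 * pi * z.2) ^+ 2 * nc (Gam E P z.2 z.1) ^+ 2 +
   nc (win (- (N + 1)) (N + 1) z.1) * (2^-1 * poisson 1 z.2))).
- by rewrite /Gam /Hf; mes.
- by rewrite /Gam /Hf; mes.
- move=> [t th] /=; rewrite nc_win -ler_norml; case: (leP `|t| (N + 1)) => tN; last first.
    by rewrite (Gam_eq0 P th wE tN) nc0 mul0r addr0 expr0n mulr0 addr0.
  rewrite mul1r -half_poisson//.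
  rewrite (_ : nc (Gam E P th t) ^+ 2 + _ = (1 + (2 * pi * th) ^+ 2) * nc (Gam E P th t) ^+ 2); last by ring.
  by apply: le_amgm1 => //; exact: nc_ge0.
under eq_integral do rewrite !EFinD.
rewrite (@nnintD _ _ _ leb2); last 4 first.
- exact: emeasurable_funD.
- exact: m3.
- by move=> z; rewrite adde_ge0.
- by move=> z; exact: n3.
rewrite (@nnintD _ _ _ leb2)//.
have F0 : (0 <= N2 F)%E by apply: nnint_ge0 => x; rewrite lee_fin sqr_ge0.
have fin c : 0 <= c -> (c%:E * N2 F < +oo)%E.
  by move=> c0; rewrite lte_mul_pinfty// N2_nice_lty.
rewrite lte_add_pinfty//; first rewrite lte_add_pinfty//.
- rewrite (@nnint_prod _ _ _ _ _ leb leb (fun t th => (nc (Gam E P th t) ^+ 2)%:E))//.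
  by apply: le_lt_trans (Gam_energy nF mX X0 iX wE sP) _; rewrite fin// sqr_ge0.
- rewrite (@nnint_prod _ _ _ _ _ leb leb (fun t th => ((2 * pi * th) ^+ 2 * nc (Gam E P th t) ^+ 2)%:E))//.
  by apply: le_lt_trans (En1 nF mX X0 iX wE sP sP' A) _; rewrite fin// mulr_ge0// sqr_ge0.
rewrite (@nnint_prod _ _ _ _ _ leb leb (fun t th => (nc (win (- (N + 1)) (N + 1) t) * (2^-1 * poisson 1 th))%:E))//.
rewrite [X in (X < _)%E](_ : _ = \int[leb]_t (nc (win (- (N + 1)) (N + 1) t) * 2^-1)%:E)%E; last first.
  apply: eq_integral => t _; under eq_integral do rewrite mulrA EFinM.
  rewrite lebZ ?mulr_ge0 ?nc_ge0//; last 2 first.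
  - by mes.
  - by move=> x; rewrite lee_fin poisson_ge0.
  by rewrite integral_poisson// mule1.
under eq_integral do rewrite mulrC EFinM.
rewrite lebZ//; last 2 first.
- by mes.
- by move=> x; rewrite lee_fin nc_ge0.
by rewrite int_win -?EFinM ?ltry//; have h : 0 <= N := N0; lra.
Qed.

Lemma fourier_superposition E P B xi : window E -> symb B P ->
  fourier (fun y => cintegral leb (fun t => P (y, t) * (expi (2 * pi * y * t) * Hf E F y t))) xi =
  cintegral leb (fun t => Gam E P (xi - t) t).
Proof.
move=> wE [mP PB PX]; have [mE _] := wE; have mH := cmeas_Hf nF mE.
pose K (y t : R) := expi (- (2 * pi * y * xi)) * (P (y, t) * (expi (2 * pi * y * t) * Hf E F y t)).
have Xi : cintble leb (fun y => (X y)%:C).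
  split; first by mes.
  by under eq_integral do rewrite ncR ger0_norm//.
have dom := @cintbleM_prod _ _ _ _ _ leb leb _ _ Xi (cintbleZ N%:C (cintble_win (- (N + 1)) (N + 1))).
have Ki : cintble (leb \x leb)%E (fun z : R * R => K z.1 z.2).
  apply: (@cintble_dom _ _ _ (leb \x leb)%E _ (fun z => nc ((X z.1)%:C * (N%:C * win (- (N + 1)) (N + 1) z.2)))) => //; last by case: dom.
  - by rewrite /K; mes.
  - by mes.
  - move=> [y t]; rewrite /K /= !ncM !nc_expi !mul1r ler_pM ?nc_ge0//.
      by rewrite ncR ger0_norm//; exact: (PX (y, t)).
    by rewrite ncR (ger0_norm N0); exact: Hf_le.
transitivity (cintegral leb (fun y => cintegral leb (fun t => K y t))).
  apply: eq_cint => y; rewrite /K cintZl//.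
  apply: (@cintble_dom _ _ _ leb _ (fun t => X y * (N * nc (win (- (N + 1)) (N + 1) t)))).
  - by mes.
  - by mes.
  - by move=> t; rewrite !ncM nc_expi mul1r ler_pM ?nc_ge0//; exact: (Hf_le nF).
  - have [_] := cintbleZ ((X y * N)%:C) (cintble_win (- (N + 1)) (N + 1)).
    by under eq_integral do rewrite ncM ncR ger0_norm ?mulr_ge0// -mulrA.
rewrite (@cint_swap _ _ _ _ _ leb leb _ Ki); apply: eq_cint => t.
apply: eq_cint => y; rewrite /K (_ : - (2 * pi * y * (xi - t)) = - (2 * pi * y * xi) + 2 * pi * y * t); last by ring.
by rewrite expiD; ring.
Qed.

(** For almost every t the function P Hf satisfies the Lipschitz bound of [AC_lip] in x, and its
    transform is integrable by [cintble_Gam]: these are the hypotheses of [fourier_inversion_ae]. *)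
Lemma Gam_inversion E P P' B : window E -> symb B P -> symb B P' -> AC true P P' ->
  {ae leb, forall t, {ae leb, forall x, P (x, t) * Hf E F x t =
     cintegral leb (fun th => expi (2 * pi * x * th) * Gam E P th t)}}.
Proof.
move=> wE sP sP' A; have [mP PB PX] := sP; have [mP' PB' PX'] := sP'; have [mE hE] := wE.
have wsE := window_sE wE; have [msE _] := wsE.
have mH := cmeas_Hf nF mE; have mH' := cmeas_Hf nF msE.
have bH (z : R * R) : nc (Hf E F z.1 z.2) <= N by exact: (Hf_leN nF).
have bH' (z : R * R) : nc (Complex 0 (- (2 * pi)) * Hf (sE E) F z.1 z.2) <= nc (Complex 0 (- (2 * pi)) : R[i]) * N.
  by rewrite ncM ler_wpM2l ?nc_ge0// (Hf_leN nF).
have mH2 : cmeasurable (fun z : R * R => Complex 0 (- (2 * pi)) * Hf (sE E) F z.1 z.2) by mes.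
have AA := AC_mul mP mP' mH mH2 PB PB' bH bH' A (AC_Hf nF wE).
have B0 : 0 <= B by exact: le_trans (nc_ge0 _) (PB (0, 0)).
pose L := B * N + B * (nc (Complex 0 (- (2 * pi)) : R[i]) * N).
have L0 : 0 <= L by rewrite addr_ge0// mulr_ge0// mulr_ge0// nc_ge0.
have LL z : nc (P' z * Hf E F z.1 z.2 + P z * (Complex 0 (- (2 * pi)) * Hf (sE E) F z.1 z.2)) <= L.
  by apply: (le_trans (ncD _ _)); rewrite lerD// ncM ler_pM ?nc_ge0.
have mPH : cmeasurable (fun z => P z * Hf E F z.1 z.2) by mes.
have mPH' : cmeasurable (fun z => P' z * Hf E F z.1 z.2 + P z * (Complex 0 (- (2 * pi)) * Hf (sE E) F z.1 z.2)).
  by mes.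
have Hl := ae_slice (AC_lip mPH mPH' LL AA).
apply: ae_imp2 Hl (ae_cintble1 (cintble_Gam wE sP sP' A)) => t hl gi.
apply: (@fourier_inversion_ae _ (fun x => P (x, t) * Hf E F x t) (B * N) L).
- by rewrite mulr_ge0.
- exact: L0.
- exact: (cintble_PH nF mX X0 iX t wE sP).
- exact: gi.
- by move=> x; rewrite ncM ler_pM ?nc_ge0//; exact: (bH (x, t)).
apply: ae_imp hl => x /ae_opp; apply: ae_imp => z; rewrite /mv /= normrN.
exact.
Qed.

Variables (g : R -> R[i]) (Ng : R).
Hypothesis ng : nice Ng g.
Variables (a : R * R -> R[i]) (A0 : R).
Hypothesis ma : cmeasurable a.
Hypothesis aA : forall z, nc (a z) <= A0.

(* The pairing of [g] with the operator of symbol [a] applied to [G] is [int G Kg]. *)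
Definition Kg (xi : R) : R[i] := cintegral leb (fun x => g x * (expi (2 * pi * x * xi) * a (x, xi))).

(** The error made at frequency t when the symbol [a] is frozen at t. *)
Definition Tt (E : R -> R[i]) (P : R * R -> R[i]) (t : R) : R[i] :=
  cintegral leb2 (fun z => g z.1 * Gam E P (z.2 - t) t * expi (2 * pi * z.1 * z.2) * (a z - a (z.1, t))).

Lemma Kg_bounded : exists M, forall xi, nc (Kg xi) <= M.
Proof.
have [mg gN _] := ng; have gi := cintble_nice ng.
have A00 : 0 <= A0 by exact: le_trans (nc_ge0 _) (aA (0, 0)).
exists (fine (\int[leb]_x (nc (A0%:C * g x))%:E)%E) => xi.
have [_ oo] := cintbleZ A0%:C gi.
apply: nc_le_fine => //; apply: (le_trans (cint_norm_le _ _)); first by mes.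
apply: le_nnint; [by mes|by mes|by move=> x; rewrite lee_fin nc_ge0|move=> x; rewrite lee_fin].
by rewrite !ncM nc_expi mul1r mulrC ler_wpM2r ?nc_ge0// ncR ger0_norm.
Qed.

Lemma cintble_Gam_shift E P P' B : window E -> symb B P -> symb B P' -> AC true P P' ->
  cintble (leb \x leb)%E (fun z : R * R => Gam E P (z.2 - z.1) z.1).
Proof.
move=> wE sP sP' A; have [mP _ _] := sP; have [mE hE] := wE.
have Gi := cintble_Gam wE sP sP' A.
apply: cintble_prodE; first by mes.
rewrite (_ : (fun t => _) = fun t : R => (\int[leb]_th (nc (Gam E P th t))%:E)%E); last first.
  apply/funext => t; apply: (@nneint_shift _ (- t) (fun th => (nc (Gam E P th t))%:E)).
  - by mes.
  - by move=> ?; rewrite lee_fin nc_ge0.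
exact: (cintble_prod_lty Gi).
Qed.

Lemma fourier_pairing E P P' B : window E -> symb B P -> symb B P' -> AC true P P' ->
  cintegral leb (fun xi => cintegral leb (fun t => Gam E P (xi - t) t) * Kg xi) =
  cintegral leb (fun t => Tt E P t) + cintegral leb (fun x => g x * smearOp E (fun z => a z * P z) x).
Proof.
move=> wE sP sP' A; have [mP PB PX] := sP; have [mE hE] := wE; have [mg gN _] := ng.
have gi := cintble_nice ng; have Ng0 := nice_ge0 ng.
have A00 : 0 <= A0 by exact: le_trans (nc_ge0 _) (aA (0, 0)).
have mG := cmeas_Gam nF mE mP.
have mK : cmeasurable Kg by rewrite /Kg; mes.
have Gi := cintble_Gam wE sP sP' A.
have Gs t : cintble leb (fun th => Gam E P th t) -> cintble leb (fun xi => Gam E P (xi - t) t).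
  by move=> h; exact: (@cintble_shift _ _ (- t) h).
have mGs : cmeasurable (fun z : R * R => Gam E P (z.2 - z.1) z.1) by mes.
have Gsi := cintble_Gam_shift wE sP sP' A.
have [M KM] := Kg_bounded.
have Ji : cintble (leb \x leb)%E (fun z : R * R => Gam E P (z.2 - z.1) z.1 * Kg z.2).
  under eq_fun do rewrite mulrC.
  by apply: (@cintble_bddM _ _ _ (leb \x leb)%E _ _ M); [mes|move=> z; exact: KM|exact: Gsi].
transitivity (cintegral leb (fun t => cintegral leb (fun xi => Gam E P (xi - t) t * Kg xi))).
  rewrite (@cint_swap _ _ _ _ _ leb leb (fun t xi => Gam E P (xi - t) t * Kg xi) Ji).
  apply: ae_eq_cint.
  - by mes.
  - by mes.
  apply: ae_imp (ae_cintble1 (@cintble_swap _ _ _ _ _ leb leb (fun t xi => Gam E P (xi - t) t) Gsi)) => xi /= h.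
  by rewrite cintZr.
pose S (t : R) := cintegral leb (fun x => g x * ((a (x, t) * P (x, t)) * (expi (2 * pi * x * t) * Hf E F x t))).
have mH := cmeas_Hf nF mE.
pose SS (x t : R) := g x * ((a (x, t) * P (x, t)) * (expi (2 * pi * x * t) * Hf E F x t)).
have B0 : 0 <= B by exact: le_trans (nc_ge0 _) (PB (0, 0)).
have SSi : cintble (leb \x leb)%E (fun z : R * R => SS z.1 z.2).
  have dom := @cintbleM_prod _ _ _ _ _ leb leb _ _ gi (cintbleZ (A0 * B * N)%:C (cintble_win (- (N + 1)) (N + 1))).
  apply: (@cintble_dom _ _ _ (leb \x leb)%E _ (fun z => nc (g z.1 * ((A0 * B * N)%:C * win (- (N + 1)) (N + 1) z.2)))) => //; last by case: dom.
  - by rewrite /SS; mes.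
  - by mes.
  - move=> [x t]; rewrite /SS /= !ncM nc_expi mul1r ler_wpM2l ?nc_ge0//.
    rewrite ncR ger0_norm ?mulr_ge0// -(mulrA (A0 * B)) ler_pM ?mulr_ge0 ?nc_ge0//.
      by rewrite ler_pM ?nc_ge0.
    exact: (Hf_le nF).
have Si : cintble leb S by exact: (@cintble_fubini2 _ _ _ _ _ leb leb SS SSi).
have main t : cintble leb (fun th => Gam E P th t) ->
   {ae leb, forall x, P (x, t) * Hf E F x t = cintegral leb (fun th => expi (2 * pi * x * th) * Gam E P th t)} ->
   cintegral leb (fun xi => Gam E P (xi - t) t * Kg xi) = Tt E P t + S t.
  move=> Gt inv; have Gst := Gs t Gt; have [mGst _] := Gst.
  have gGi := @cintbleM_prod _ _ _ _ _ leb leb _ _ gi Gst.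
  have I1 (q : R * R -> R[i]) (C : R) : cmeasurable q -> (forall z, nc (q z) <= C) ->
     cintble leb2 (fun z : R * R => g z.1 * Gam E P (z.2 - t) t * expi (2 * pi * z.1 * z.2) * q z).
    move=> mq qC; under eq_fun do rewrite -mulrA mulrC.
    apply: (@cintble_bddM _ _ _ leb2 _ _ C) => //; first by mes.
    by move=> z; rewrite ncM nc_expi mul1r.
  have mat : cmeasurable (fun z : R * R => a (z.1, t)) by mes.
  have i1 := I1 a A0 ma aA; have i2 := I1 _ A0 mat (fun z => aA (z.1, t)).
  rewrite /Tt; under [X in _ = cintegral _ X + _]eq_fun do rewrite mulrBr.
  rewrite (cintB i1 i2).
  have -> : cintegral leb (fun xi => Gam E P (xi - t) t * Kg xi) =
     cintegral leb2 (fun z => g z.1 * Gam E P (z.2 - t) t * expi (2 * pi * z.1 * z.2) * a z).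
    rewrite -(cfubini2 i1); apply: eq_cint => xi; rewrite /Kg -cintZl.
      by apply: eq_cint => x /=; ring.
    under eq_fun do rewrite mulrC; apply: (@cintble_bddM _ _ _ leb _ _ A0) => //; first by mes.
    by move=> x; rewrite ncM nc_expi mul1r.
  have -> : S t = cintegral leb2 (fun z => g z.1 * Gam E P (z.2 - t) t * expi (2 * pi * z.1 * z.2) * a (z.1, t)).
    rewrite -(cfubini1 i2); apply: ae_eq_cint.
    - by rewrite /S; mes.
    - by mes.
    apply: ae_imp inv => x hx /=.
    rewrite (_ : g x * _ = g x * a (x, t) * expi (2 * pi * x * t) * (P (x, t) * Hf E F x t)); last by ring.
    rewrite hx -(@cint_shift _ (- t) (fun th => expi (2 * pi * x * th) * Gam E P th t)); last first.
      by case: Gt => mGt _; mes.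
    rewrite -cintZl; last first.
      apply: (@cintble_bddM _ _ _ leb _ _ 1) => //; first by mes.
      by move=> y; rewrite nc_expi.
    apply: eq_cint => xi; rewrite (_ : 2 * pi * x * (xi - t) = 2 * pi * x * xi + - (2 * pi * x * t)); last by ring.
    rewrite expiD -[RHS]mulr1 -(expiN (2 * pi * x * t)); ring.
  by ring.
have e1 : cintegral leb (fun t => cintegral leb (fun xi => Gam E P (xi - t) t * Kg xi)) =
   cintegral leb (fun t => Tt E P t + S t).
  apply: ae_eq_cint.
  - by mes.
  - apply: cmeasD; last by case: Si.
    by rewrite /Tt; mes.
  by apply: ae_imp2 (ae_cintble1 Gi) (Gam_inversion wE sP sP' A) => t; exact: main.
have TSi : cintble leb (fun t => cintegral leb (fun xi => Gam E P (xi - t) t * Kg xi)) by exact: (cintble_fubini1 Ji).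
(* Integrability is not estimated directly: [Tt] is almost everywhere a difference of two functions
   already known to be integrable. *)
have Ti : cintble leb (Tt E P).
  have [mB ooB] := cintbleB TSi Si; have mT : cmeasurable (Tt E P).
    by rewrite /Tt; mes.
  split => //; apply: le_lt_trans ooB; apply: ae_le_nnint.
  - by mes.
  - exact: cmeas_nce.
  - by move=> t; rewrite lee_fin nc_ge0.
  - by move=> t; rewrite lee_fin nc_ge0.
  apply: ae_imp2 (ae_cintble1 Gi) (Gam_inversion wE sP sP' A) => t h1 h2.
  by rewrite (main t h1 h2) addrK.
rewrite e1 cintD//; congr (_ + _).
rewrite /S -(@cint_swap _ _ _ _ _ leb leb SS SSi); apply: eq_cint => x.
rewrite /SS cintZl; last first.
  apply: (@cintble_dom _ _ _ leb _ (fun t => (A0 * B * N) * nc (win (- (N + 1)) (N + 1) t))).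
  - by mes.
  - by mes.
  - move=> t; rewrite !ncM nc_expi mul1r -(mulrA (A0 * B)) ler_pM ?mulr_ge0 ?nc_ge0//.
      by rewrite ler_pM ?nc_ge0.
    exact: (Hf_le nF).
  - have [_] := cintbleZ ((A0 * B * N)%:C) (cintble_win (- (N + 1)) (N + 1)).
    by under eq_integral do rewrite ncM ncR ger0_norm ?mulr_ge0//.
congr (_ * _); apply: (smearOp_Hf x wE (B := A0 * B)).
- by mes.
- by move=> z; rewrite ncM ler_pM ?nc_ge0.
Qed.
End Composition.

(** * Calderon-Vaillancourt bounds with constant weights *)

Section Smear.
Context {R : realType}.
Local Notation leb := (@lebesgue_measure R).
Local Notation leb2 := (prodsf leb leb).

Lemma cint_E0 : cintegral leb (@E0 R) = 1.
Proof. by rewrite cint_win// subr0. Qed.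

Lemma smear_le E E' Q (B : R) z : window E -> window E' -> cmeasurable Q -> (forall w, nc (Q w) <= B) ->
  nc (smear E E' Q z) <= B.
Proof.
move=> wE wE' mQ QB; have [mE hE] := wE; have [mE' hE'] := wE'.
have B0 : 0 <= B by exact: le_trans (nc_ge0 _) (QB (0, 0)).
have W := @int_win R 0 1 ler01; rewrite subr0 in W.
rewrite -lee_fin; apply: (le_trans (cint_norm_le _ _)); first by mes.
apply: (@le_trans _ _ (\int[leb2]_s (B%:E * ((nc (win 0 1 s.1))%:E * (nc (win 0 1 s.2))%:E)))%E).
  apply: le_nnint.
  - by mes.
  - by mes.
  - by move=> s; rewrite lee_fin nc_ge0.
  - move=> s; rewrite -!EFinM lee_fin !ncM mulrC ler_pM ?mulr_ge0 ?nc_ge0//.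
    by rewrite ler_pM ?nc_ge0.
rewrite (@nnint_prod _ _ _ _ _ leb leb (fun x y => B%:E * ((nc (win 0 1 x))%:E * (nc (win 0 1 y))%:E)))%E; last 2 first.
- by mes.
- by move=> x y; rewrite mule_ge0 ?lee_fin// mulr_ge0 ?nc_ge0.
rewrite [X in (X <= _)%E](_ : _ = \int[leb]_x (B%:E * (nc (win 0 1 x))%:E))%E; last first.
  apply: eq_integral => x _; rewrite lebZ//; last 2 first.
  - by mes.
  - by move=> y; rewrite mule_ge0 ?lee_fin ?nc_ge0.
  rewrite lebZ ?nc_ge0 ?W ?mule1//; first by mes.
  by move=> y; rewrite lee_fin nc_ge0.
by rewrite lebZ ?W ?mule1//; [mes|move=> y; rewrite lee_fin nc_ge0].
Qed.

Lemma smear_sub E E' P Q (B C : R) z : window E -> window E' -> cmeasurable P -> cmeasurable Q ->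
  (forall w, nc (P w) <= B) -> (forall w, nc (Q w) <= C) ->
  smear E E' (fun w => P w - Q w) z = smear E E' P z - smear E E' Q z.
Proof.
move=> wE wE' mP mQ PB QC.
rewrite /smear -(cintB (cintble_smear z wE wE' mP PB) (cintble_smear z wE wE' mQ QC)).
by apply: eq_cint => s; rewrite mulrBr.
Qed.

Lemma smear_const E Q (B t : R) z : window E -> cmeasurable Q -> (forall w, nc (Q w) <= B) ->
  smear E (@E0 R) (fun w => Q (w.1, t)) z = cintegral leb (fun s => E s * Q (z.1 + s, t)).
Proof.
move=> wE mQ QB; have mQt : cmeasurable (fun s : R => Q (z.1 + s, t)) by mes.
have i1 : cintble leb (fun s => E s * Q (z.1 + s, t)) by apply: (cintble_win_bdd mQt wE) => s.
rewrite -[RHS]mulr1 -cint_E0 -(@cint_prodM _ _ _ _ _ leb leb _ _ i1 (cintble_window (@window_E0 R))).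
by apply: eq_cint => s /=; ring.
Qed.

Lemma cmeas_smear (E E' : R -> R[i]) (Q : R * R -> R[i]) : cmeasurable E -> cmeasurable E' -> cmeasurable Q -> cmeasurable (smear E E' Q).
Proof. by move=> mE mE' mQ; rewrite /smear; mes. Qed.

Lemma cintble_gG E E' g G Q (B : R) : window E -> window E' -> cintble leb g -> cintble leb G ->
  cmeasurable Q -> (forall z, nc (Q z) <= B) ->
  cintble leb2 (fun z => g z.1 * G z.2 * expi (2 * pi * z.1 * z.2) * smear E E' Q z).
Proof.
move=> wE wE' gi Gi mQ QB; have [mE _] := wE; have [mE' _] := wE'; have mS := cmeas_smear mE mE' mQ.
have gGi := @cintbleM_prod _ _ _ _ _ leb leb _ _ gi Gi.
under eq_fun do rewrite -mulrA mulrC.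
apply: (@cintble_bddM _ _ _ leb2 _ _ B) => //; first by mes.
by move=> z; rewrite ncM nc_expi mul1r; exact: smear_le.
Qed.

Lemma lee_nc4 (x y z w : R[i]) (a b c d : \bar R) : ((nc x)%:E <= a -> (nc y)%:E <= b -> (nc z)%:E <= c ->
  (nc w)%:E <= d -> (nc (x + y + (z + w)))%:E <= a + b + (c + d))%E.
Proof.
move=> hx hy hz hw; apply: (@le_trans _ _ ((nc x)%:E + (nc y)%:E + ((nc z)%:E + (nc w)%:E))%E).
  rewrite -!EFinD lee_fin; apply: (le_trans (ncD _ _)); apply: lerD; exact: ncD.
by apply: leeD; apply: leeD.
Qed.

Lemma lee_comb (k : R) (a b x y : \bar R) : (0 <= x)%E -> (0 <= y)%E ->
  (a <= k%:E * x)%E -> (b <= k%:E * y)%E -> (a + b <= k%:E * (x + y))%E.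
Proof. by move=> x0 y0 ha hb; rewrite ge0_muleDr//; apply: leeD. Qed.

Lemma sum4 (m : R) (x : \bar R) : 0 <= m ->
  (m%:E * x + m%:E * x + (m%:E * x + m%:E * x) = (4 * m)%:E * x)%E.
Proof.
move=> m0; rewrite -!ge0_combine ?addr_ge0//; congr (_%:E * _)%E; ring.
Qed.

(** [master] with bound and weight both equal to the constant B, so that B^2 / kap is again B. The
    128 also absorbs the 2 of [integral_Kenergy]. *)
Lemma master_const E E' g G Q (B : R) : window E -> window E' -> cintble leb g -> cintble leb G ->
  cmeasurable Q -> (forall z : R * R, nc (Q z) <= B) -> 0 < B ->
  ((nc (cintegral leb2 (fun z => g z.1 * G z.2 * expi (2 * pi * z.1 * z.2) * smear E E' Q z)))%:E <=
   (128 * B)%:E * (N2 g + N2 G))%E.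
Proof.
move=> wE wE' gi Gi mQ QB B0; have [mE _] := wE; have [mg _] := gi; have [mG _] := Gi.
apply: (le_trans (@master _ E E' g G Q B (fun=> B) (fun=> B) wE wE' gi Gi mQ QB _ _ _ _ _)).
- by mes.
- by mes.
- by mes.
- by [].
- exact: ae_true.
rewrite lebZ ?(ltW B0)//; last 2 first.
- exact: measurable_Kenergy.
- by move=> x; apply: nnint_ge0 => ?; apply: nnint_ge0 => ?; rewrite lee_fin; pos.
have BB : B ^+ 2 / B = B by rewrite expr2 mulfK// gt_eqF.
rewrite BB lebZ ?(ltW B0)//; last 2 first.
- by mes.
- by move=> x; apply: nnint_ge0 => ?; rewrite lee_fin; pos.
under [X in (_ + 128%:E * (_ * X))%E]eq_integral do under eq_integral do rewrite EFinM.
rewrite (@nnint_window_conv _ (fun x => (nc (G x) ^+ 2)%:E)); last 2 first.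
- by mes.
- by move=> x; rewrite lee_fin sqr_ge0.
have g0 : (0 <= N2 g)%E by apply: nnint_ge0 => x; rewrite lee_fin sqr_ge0.
have G0 : (0 <= N2 G)%E by apply: nnint_ge0 => x; rewrite lee_fin sqr_ge0.
apply: lee_comb => //; last by rewrite muleA -(EFinM 128).
apply: (@le_trans _ _ (B%:E * (2%:E * N2 g))%E).
  by apply: lee_wpmul2l; [rewrite lee_fin ltW|exact: integral_Kenergy].
by rewrite muleA -EFinM; apply: lee_wpmul2r => //; rewrite lee_fin mulrC ler_pM2r// ler_nat.
Qed.

(** Each of the four terms of [representation2] costs 128 B. *)
Lemma calderon_vaillancourt (p00 p10 p01 p11 : R * R -> R[i]) (B : R) g G :
  cmeasurable p00 -> cmeasurable p10 -> cmeasurable p01 -> cmeasurable p11 ->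
  (forall z, nc (p00 z) <= B) -> (forall z, nc (p10 z) <= B) -> (forall z, nc (p01 z) <= B) -> (forall z, nc (p11 z) <= B) ->
  AC true p00 p10 -> AC false p00 p01 -> AC false p10 p11 -> cintble leb g -> cintble leb G -> 0 < B ->
  ((nc (cintegral leb2 (fun z => g z.1 * G z.2 * expi (2 * pi * z.1 * z.2) * p00 z)))%:E <=
   (512 * B)%:E * (N2 g + N2 G))%E.
Proof.
move=> m00 m10 m01 m11 b00 b10 b01 b11 A1 A2 A3 gi Gi B0.
have [mg _] := gi; have [mG _] := Gi; have w0 := @window_E0 R; have w1 := @window_E1 R.
have i1 := cintble_gG w0 w0 gi Gi m00 b00; have i2 := cintble_gG w0 w1 gi Gi m01 b01.
have i3 := cintble_gG w1 w0 gi Gi m10 b10; have i4 := cintble_gG w1 w1 gi Gi m11 b11.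
rewrite (@ae_eq_cint _ _ _ leb2 _ (fun z => g z.1 * G z.2 * expi (2 * pi * z.1 * z.2) * smear (@E0 R) (@E0 R) p00 z +
  g z.1 * G z.2 * expi (2 * pi * z.1 * z.2) * smear (@E0 R) (@E1 R) p01 z +
  (g z.1 * G z.2 * expi (2 * pi * z.1 * z.2) * smear (@E1 R) (@E0 R) p10 z +
   g z.1 * G z.2 * expi (2 * pi * z.1 * z.2) * smear (@E1 R) (@E1 R) p11 z))); last 3 first.
- by mes.
- by case: (cintbleD (cintbleD i1 i2) (cintbleD i3 i4)).
- apply: ae_imp (representation2 m00 m10 m01 m11 b00 b10 b01 b11 A1 A2 A3) => z.
  move: (smear _ _ p00 z) (smear _ _ p01 z) (smear _ _ p10 z) (smear _ _ p11 z) => s1 s2 s3 s4 ->; ring.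
rewrite (cintD (cintbleD i1 i2) (cintbleD i3 i4)) (cintD i1 i2) (cintD i3 i4).
have h1 := master_const w0 w0 gi Gi m00 b00 B0; have h2 := master_const w0 w1 gi Gi m01 b01 B0.
have h3 := master_const w1 w0 gi Gi m10 b10 B0; have h4 := master_const w1 w1 gi Gi m11 b11 B0.
apply: (le_trans (lee_nc4 h1 h2 h3 h4)).
rewrite sum4 ?mulr_ge0 ?(ltW B0)//.
by rewrite mulrA (_ : 4 * 128 = 512 :> R)//; ring.
Qed.

Lemma smear_cols E E' Q (B : R) z : window E -> window E' -> cmeasurable Q -> (forall w, nc (Q w) <= B) ->
  cintegral leb (fun r => E' r * cintegral leb (fun s => E s * Q (mv true s (mv false r z)))) = smear E E' Q z /\
  cintble leb (fun r => E' r * cintegral leb (fun s => E s * Q (mv true s (mv false r z)))).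
Proof.
move=> wE wE' mQ QB; have [mE _] := wE; have [mE' _] := wE'.
have Si := cintble_smear z wE wE' mQ QB.
have e : (fun r => E' r * cintegral leb (fun s => E s * Q (mv true s (mv false r z)))) =
    fun r => cintegral leb (fun s => E s * E' r * Q (z.1 + s, z.2 + r)).
  apply/funext => r; rewrite -cintZl; first by apply: eq_cint => s; rewrite mulrA (mulrC (E' r)).
  have mq : cmeasurable (fun s : R => Q (mv true s (mv false r z))) by mes.
  by apply: (cintble_win_bdd mq wE) => s.
rewrite e; split; first exact: (cfubini2 Si).
exact: (@cintble_fubini2 _ _ _ _ _ leb leb (fun s r => E s * E' r * Q (z.1 + s, z.2 + r)) Si).
Qed.

(** The xi-average is already there, so only the x-average has to be created and the symbol is
    differentiated in x alone. This fits the product of dp1/dxi with p2, for which no further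
    xi-derivative is available. The two terms of [representation] give 256. *)
Lemma smear_row_bound E' Q Q' (B : R) g G : window E' -> cmeasurable Q -> cmeasurable Q' ->
  (forall z, nc (Q z) <= B) -> (forall z, nc (Q' z) <= B) -> AC true Q Q' -> 0 < B ->
  cintble leb g -> cintble leb G ->
  ((nc (cintegral leb2 (fun z => g z.1 * G z.2 * expi (2 * pi * z.1 * z.2) *
      cintegral leb (fun r => E' r * Q (mv false r z)))))%:E <= (256 * B)%:E * (N2 g + N2 G))%E.
Proof.
move=> wE' mQ mQ' QB QB' A B0 gi Gi; have [mE' _] := wE'.
have [mg _] := gi; have [mG _] := Gi; have w0 := @window_E0 R; have w1 := @window_E1 R.
have i1 := cintble_gG w0 wE' gi Gi mQ QB; have i2 := cintble_gG w1 wE' gi Gi mQ' QB'.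
rewrite (@ae_eq_cint _ _ _ leb2 _ (fun z => g z.1 * G z.2 * expi (2 * pi * z.1 * z.2) * smear (@E0 R) E' Q z +
  g z.1 * G z.2 * expi (2 * pi * z.1 * z.2) * smear (@E1 R) E' Q' z)); last 3 first.
- by mes.
- by case: (cintbleD i1 i2).
- apply: ae_imp (ae_mv false (representation mQ mQ' QB QB' A)) => z hz.
  have [e1 j1] := smear_cols z w0 wE' mQ QB; have [e2 j2] := smear_cols z w1 wE' mQ' QB'.
  rewrite -mulrDr -e1 -e2 -cintD//; congr (_ * _); apply: ae_eq_cint.
  + by mes.
  + by apply: cmeasD; [case: j1|case: j2].
  + by apply: ae_imp hz => s ->; rewrite mulrDr.
rewrite (cintD i1 i2).
have h1 := master_const w0 wE' gi Gi mQ QB B0; have h2 := master_const w1 wE' gi Gi mQ' QB' B0.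
rewrite (_ : 256 * B = 128 * B + 128 * B); last by ring.
rewrite ge0_combine ?mulr_ge0 ?(ltW B0)//.
apply: (le_trans _ (leeD h1 h2)); rewrite -EFinD lee_fin; exact: ncD.
Qed.
End Smear.

(** * The error of freezing the first symbol *)

Section MainTerm.
Context {R : realType}.
Local Notation leb := (@lebesgue_measure R).
Local Notation leb2 := (prodsf leb leb).
Variables (F : R -> R[i]) (N : R).
Hypothesis nF : nice N F.
Let N0 : 0 <= N := nice_ge0 nF.
Let mF : cmeasurable F. Proof. by case: nF. Qed.
Variables (X : R -> R).
Hypothesis mX : measurable_fun setT X.
Hypothesis X0 : forall y, 0 <= X y.
Hypothesis iX : (\int[leb]_y (X y)%:E < +oo)%E.
Variables (g : R -> R[i]) (Ng : R).
Hypothesis ng : nice Ng g.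
Variables (a ax q qx : R * R -> R[i]) (M : R).
Hypotheses (ma : cmeasurable a) (max : cmeasurable ax) (mq : cmeasurable q) (mqx : cmeasurable qx).
Hypotheses (ba : forall z, nc (a z) <= M) (bax : forall z, nc (ax z) <= M)
  (bq : forall z, nc (q z) <= M) (bqx : forall z, nc (qx z) <= M).
Hypotheses (ACa : AC true a ax) (ACq : AC false a q) (ACaxq : AC false ax qx).
Local Notation Gam := (Gam F).
Local Notation En := (En F).
Local Notation symb := (symb X).
Let M0 : 0 <= M. Proof. exact: le_trans (nc_ge0 _) (ba (0, 0)). Qed.

Definition dif (p : R * R -> R[i]) (t : R) (z : R * R) : R[i] := p z - p (z.1, t).

Lemma cmeas_dif p t : cmeasurable p -> cmeasurable (dif p t).
Proof. by move=> mp; rewrite /dif; mes. Qed.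

Lemma dif_le p t z : (forall z, nc (p z) <= M) -> nc (dif p t z) <= 2 * M.
Proof. by move=> bp; rewrite /dif (le_trans (ncB _ _))// (_ : 2 * M = M + M) ?lerD//; ring. Qed.

Lemma dif_representation : {ae leb, forall t, {ae leb2, forall z,
  dif a t z = smear (@E0 R) (@E0 R) (dif a t) z + smear (@E0 R) (@E1 R) q z +
    (smear (@E1 R) (@E0 R) (dif ax t) z + smear (@E1 R) (@E1 R) qx z)}}.
Proof.
have w0 := @window_E0 R; have w1 := @window_E1 R.
have h := representation2 ma max mq mqx ba bax bq bqx ACa ACq ACaxq.
apply: ae_imp (ae_slice (representation ma max ba bax ACa)) => t /ae_fst ht.
apply: ae_imp2 h ht => z h1 h2; rewrite {1}/dif h1 h2.
have mat : cmeasurable (fun w : R * R => a (w.1, t)) by mes.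
have maxt : cmeasurable (fun w : R * R => ax (w.1, t)) by mes.
rewrite (smear_sub z w0 w0 ma mat ba (fun w => ba (w.1, t))) (smear_sub z w1 w0 max maxt bax (fun w => bax (w.1, t))).
rewrite (smear_const t z w0 ma ba) (smear_const t z w1 max bax) /mv /=.
ring.
Qed.

Lemma dif_lip (p p' : R * R -> R[i]) (L : R) : cmeasurable p -> cmeasurable p' -> (forall z, nc (p' z) <= L) ->
  AC false p p' -> {ae leb, forall t, {ae leb2, forall z, nc (dif p t z) <= L * `|z.2 - t|}}.
Proof.
move=> mp mp' pL A.
pose b (z : R * R) (xi : R) := nc (p (z.1, xi) - p z) <= L * `|xi - z.2|.
have mb : measurable_fun setT (fun w : (R * R) * R => b w.1 w.2) by rewrite /b; mes.
have h : {ae leb2, forall z, {ae leb, forall xi, b z xi}}.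
  apply: ae_imp (AC_lip mp mp' pL A) => -[x t] /= /(ae_shift1 (- t)).
  by apply: ae_imp => xi; rewrite /mv /b /= (addrC t) subrK.
apply: ae_imp (ae_slice h) => t ht.
have mbt : measurable_fun setT (fun w : R * R => b (w.1, t) w.2) by rewrite /b; mes.
apply: ae_imp (@ae_bool_prod _ _ _ _ _ leb leb (fun x xi => b (x, t) xi) mbt ht) => -[x xi].
by rewrite /b /dif.
Qed.

(** [Bf] bounds the four symbols of the representation as a function of xi - t, and m is the number
    of x-derivatives of P that pay for its growth together with the weight. The two uses are [Bf]
    constant with m = 1 and [Bf] of linear growth with m = 2. *)
Variables (kap0 c : R) (Bf : R -> R) (m : nat).
Hypotheses (kap00 : 0 < kap0) (c0 : 0 <= c) (mBf : measurable_fun setT Bf).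
Hypothesis Bfc : forall th r, 0 <= r <= 1 ->
  Bf (th + r) ^+ 2 * (1 + (2 * pi * (th + r)) ^+ 2) / kap0 <= c * (1 + (2 * pi * th) ^+ (2 * m)).
Hypothesis Bdif : {ae leb, forall t, {ae leb2, forall z, [/\ nc (dif a t z) <= Bf (z.2 - t),
  nc (dif ax t z) <= Bf (z.2 - t), nc (q z) <= Bf (z.2 - t) & nc (qx z) <= Bf (z.2 - t)]}}.

(** This is kap0 / (1 + (2 pi th)^2), see [half_poisson]. Its integrability makes the sum over t of
    the g-side energies converge; the reciprocal weight is charged to [Gam] through [betaw]. *)
Definition kapw (th : R) := kap0 * (2^-1 * poisson 1 th).
Definition betaw (th : R) := Bf th ^+ 2 * (1 + (2 * pi * th) ^+ 2) / kap0.

Lemma kapw_gt0 th : 0 < kapw th.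
Proof. by rewrite mulr_gt0// mulr_gt0// divr_gt0// ?mulr_gt0// poisson_den. Qed.

Lemma betawE th : Bf th ^+ 2 / kapw th = betaw th.
Proof.
have h : 0 < 1 + (2 * pi * th : R) ^+ 2 by rewrite ltr_pwDl// sqr_ge0.
by rewrite /betaw /kapw -half_poisson// invfM invrK mulrA [RHS]mulrAC.
Qed.

Lemma betaw_ge0 th : 0 <= betaw th.
Proof. by rewrite /betaw mulr_ge0 ?invr_ge0 ?(ltW kap00)// mulr_ge0 ?sqr_ge0// addr_ge0// sqr_ge0. Qed.

Lemma measurable_betaw : measurable_fun setT betaw.
Proof. by rewrite /betaw; mes. Qed.

Lemma measurable_kapw : measurable_fun setT kapw.
Proof. by have mp := @measurable_poisson R 1 ltr01; rewrite /kapw; mes. Qed.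

Definition Iterm (E : R -> R[i]) (t : R) : \bar R :=
  (\int[leb]_xi ((kapw (xi - t))%:E * Kenergy E g xi))%E.
Definition Jterm (E : R -> R[i]) P (t : R) : \bar R :=
  (\int[leb]_xi ((betaw (xi - t))%:E *
     \int[leb]_r (nc (win 0 1 r) * nc (Gam E P (xi - r - t) t) ^+ 2)%:E))%E.

(** [master] is applied to each term with G(xi) = Gam(xi - t, t) and with all weights evaluated at
    xi - t. *)
Lemma Tt_le E P t : window E -> cmeasurable P -> cintble leb (fun th => Gam E P th t) ->
  {ae leb2, forall z, dif a t z = smear (@E0 R) (@E0 R) (dif a t) z + smear (@E0 R) (@E1 R) q z +
    (smear (@E1 R) (@E0 R) (dif ax t) z + smear (@E1 R) (@E1 R) qx z)} ->
  {ae leb2, forall z, [/\ nc (dif a t z) <= Bf (z.2 - t),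
    nc (dif ax t z) <= Bf (z.2 - t), nc (q z) <= Bf (z.2 - t) & nc (qx z) <= Bf (z.2 - t)]} ->
  ((nc (Tt F g a E P t))%:E <= (Iterm (@E0 R) t + 128%:E * Jterm E P t) + (Iterm (@E0 R) t + 128%:E * Jterm E P t) +
     ((Iterm (@E1 R) t + 128%:E * Jterm E P t) + (Iterm (@E1 R) t + 128%:E * Jterm E P t)))%E.
Proof.
move=> wE mP Gt rep bnd; have [mE _] := wE; have gi := cintble_nice ng.
have w0 := @window_E0 R; have w1 := @window_E1 R.
pose G xi := Gam E P (xi - t) t.
have Gi : cintble leb G by exact: (@cintble_shift _ _ (- t) Gt).
have [mG _] := Gi; have [mg _] := gi.
have md := cmeas_dif t ma; have mdx := cmeas_dif t max.
have bd z : nc (dif a t z) <= 2 * M by exact: dif_le.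
have bdx z : nc (dif ax t z) <= 2 * M by exact: dif_le.
have mas (E' E'' : R -> R[i]) (Q : R * R -> R[i]) (C : R) : window E' -> window E'' -> cmeasurable Q -> (forall z, nc (Q z) <= C) ->
    {ae leb2, forall z, nc (Q z) <= Bf (z.2 - t)} ->
    ((nc (cintegral leb2 (fun z => g z.1 * G z.2 * expi (2 * pi * z.1 * z.2) * smear E' E'' Q z)))%:E <=
      Iterm E' t + 128%:E * Jterm E P t)%E.
  move=> wE' wE'' mQ QC aQ.
  apply: (le_trans (@master _ E' E'' g G Q C (fun xi => Bf (xi - t)) (fun xi => kapw (xi - t)) wE' wE'' gi Gi mQ QC _ _ _ _ aQ)).
  - by mes.
  - rewrite (_ : (fun x => _) = fun x : R => betaw (x - t)); last by apply/funext => x; rewrite betawE.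
    by have mb := measurable_betaw; mes.
  - by have mk := measurable_kapw; mes.
  - by move=> x; exact: kapw_gt0.
  rewrite le_eqVlt; apply/orP; left; apply/eqP; congr (_ + _ * _)%E.
  apply: eq_integral => xi _; rewrite betawE; by [].
have i1 := cintble_gG w0 w0 gi Gi md bd; have i2 := cintble_gG w0 w1 gi Gi mq bq.
have i3 := cintble_gG w1 w0 gi Gi mdx bdx; have i4 := cintble_gG w1 w1 gi Gi mqx bqx.
rewrite /Tt (@ae_eq_cint _ _ _ leb2 _ (fun z => g z.1 * G z.2 * expi (2 * pi * z.1 * z.2) * smear (@E0 R) (@E0 R) (dif a t) z +
  g z.1 * G z.2 * expi (2 * pi * z.1 * z.2) * smear (@E0 R) (@E1 R) q z +
  (g z.1 * G z.2 * expi (2 * pi * z.1 * z.2) * smear (@E1 R) (@E0 R) (dif ax t) z +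
   g z.1 * G z.2 * expi (2 * pi * z.1 * z.2) * smear (@E1 R) (@E1 R) qx z))); last 3 first.
- by mes.
- by case: (cintbleD (cintbleD i1 i2) (cintbleD i3 i4)).
- apply: ae_imp rep => z; rewrite {1}/dif -/(G z.2).
  move: (smear _ _ (dif a t) z) (smear _ _ q z) (smear _ _ (dif ax t) z) (smear _ _ qx z) => s1 s2 s3 s4 ->; ring.
rewrite (cintD (cintbleD i1 i2) (cintbleD i3 i4)) (cintD i1 i2) (cintD i3 i4).
apply: lee_nc4.
- by apply: (mas _ _ _ _ w0 w0 md bd); apply: ae_imp bnd => z [].
- by apply: (mas _ _ _ _ w0 w1 mq bq); apply: ae_imp bnd => z [].
- by apply: (mas _ _ _ _ w1 w0 mdx bdx); apply: ae_imp bnd => z [].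
- by apply: (mas _ _ _ _ w1 w1 mqx bqx); apply: ae_imp bnd => z [].
Qed.

Lemma Iterm_ge0 E t : (0 <= Iterm E t)%E.
Proof.
apply: nnint_ge0 => xi; rewrite mule_ge0 ?lee_fin ?(ltW (kapw_gt0 _))//.
by apply: nnint_ge0 => ?; apply: nnint_ge0 => ?; rewrite lee_fin; pos.
Qed.

(** The integral of [kapw] is kap0 / 2, which cancels the 2 of [integral_Kenergy]. *)
Lemma integral_Iterm E : window E -> (\int[leb]_t Iterm E t <= kap0%:E * N2 g)%E.
Proof.
move=> wE; have [mE _] := wE; have [mg _ _] := ng; have mk := measurable_kapw.
have mK := measurable_Kenergy mE mg.
have K0 xi : (0 <= Kenergy E g xi)%E by apply: nnint_ge0 => ?; apply: nnint_ge0 => ?; rewrite lee_fin; pos.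
have mp := @measurable_poisson R 1 ltr01.
rewrite /Iterm (@nnint_swap _ _ _ _ _ leb leb (fun t xi => (kapw (xi - t))%:E * Kenergy E g xi)%E); last 2 first.
- apply: emeasurable_funM; first by mes.
  by apply: (meas_comp_of mK (u := snd)); mes.
- by move=> t xi; rewrite mule_ge0 ?lee_fin ?(ltW (kapw_gt0 _)).
rewrite [X in (X <= _)%E](_ : _ = \int[leb]_xi ((kap0 * 2^-1)%:E * Kenergy E g xi))%E; last first.
  apply: eq_integral => xi _; under eq_integral do rewrite muleC.
  rewrite ge0_integralZl//; last 2 first.
  - by mes.
  - by move=> t _; rewrite lee_fin (ltW (kapw_gt0 _)).
  rewrite muleC; congr (_ * _)%E; rewrite (nneint_subl xi (f := fun t => (kapw t)%:E)); last 2 first.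
  - by mes.
  - by move=> x; rewrite lee_fin (ltW (kapw_gt0 _)).
  rewrite /kapw; under eq_integral do rewrite mulrA EFinM.
  rewrite lebZ ?integral_poisson ?mule1//; first by mes.
    by rewrite mulr_ge0// ltW.
  by move=> x; rewrite lee_fin poisson_ge0.
rewrite lebZ ?mulr_ge0 ?(ltW kap00)//.
apply: (@le_trans _ _ ((kap0 * 2^-1)%:E * (2%:E * N2 g))%E).
  apply: lee_wpmul2l; last exact: (integral_Kenergy wE (cintble_nice ng)).
  by rewrite lee_fin mulr_ge0// ltW.
by rewrite muleA -EFinM mulfVK.
Qed.

Lemma Jterm_ge0 E P t : (0 <= Jterm E P t)%E.
Proof.
apply: nnint_ge0 => xi; rewrite mule_ge0 ?lee_fin ?betaw_ge0//.
by apply: nnint_ge0 => r; rewrite lee_fin mulr_ge0 ?nc_ge0// sqr_ge0.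
Qed.

(** After the substitution xi = th + r + t the weight sits at th + r and [Gam] at th; [Bfc] compares
    the weight with a polynomial in th uniformly for r in the unit window. *)
Lemma Jterm_le E P t : window E -> cmeasurable P ->
  (Jterm E P t <= c%:E * (\int[leb]_th ((2 * pi * th) ^+ (2 * 0) * nc (Gam E P th t) ^+ 2)%:E +
     \int[leb]_th ((2 * pi * th) ^+ (2 * m) * nc (Gam E P th t) ^+ 2)%:E))%E.
Proof.
move=> wE mP; have [mE _] := wE; have mb := measurable_betaw.
pose W (r th : R) := (betaw (th + r) * (nc (win 0 1 r) * nc (Gam E P th t) ^+ 2))%:E.
have e0 k (th : R) : 0 <= (2 * pi * th : R) ^+ (2 * k) by rewrite exprM exprn_ge0// sqr_ge0.
have W0 r th : (0 <= W r th)%E by rewrite lee_fin mulr_ge0 ?betaw_ge0// mulr_ge0 ?nc_ge0// sqr_ge0.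
have -> : Jterm E P t = (\int[leb]_r \int[leb]_th W r th)%E.
  rewrite /Jterm.
  pose Z (xi r : R) := (betaw (xi - t) * (nc (win 0 1 r) * nc (Gam E P (xi - r - t) t) ^+ 2))%:E.
  have mZ : measurable_fun setT (fun z : R * R => Z z.1 z.2) by rewrite /Z; mes.
  have Z0 xi r : (0 <= Z xi r)%E by rewrite lee_fin mulr_ge0 ?betaw_ge0// mulr_ge0 ?nc_ge0// sqr_ge0.
  transitivity (\int[leb]_xi \int[leb]_r Z xi r)%E.
    apply: eq_integral => xi _; rewrite -lebZ ?betaw_ge0//.
    - by mes.
    - by move=> r; rewrite lee_fin mulr_ge0 ?nc_ge0// sqr_ge0.
  apply: (eq_trans (@nnint_swap _ _ _ _ _ leb leb Z mZ Z0)); rewrite /Z.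
  apply: eq_integral => r _.
  have mWr : measurable_fun setT (W r) by rewrite /W; mes.
  apply: (eq_trans _ (@nneint_shift _ (- r - t) (W r) mWr (W0 r))).
  apply: eq_integral => xi _; rewrite /W; congr (betaw _ * (_ * nc (Gam E P _ t) ^+ 2))%:E; ring.
pose V (th : R) := (c * ((2 * pi * th) ^+ (2 * 0) * nc (Gam E P th t) ^+ 2 + (2 * pi * th) ^+ (2 * m) * nc (Gam E P th t) ^+ 2)).
have mV : measurable_fun setT (fun th => (V th)%:E) by rewrite /V; mes.
have V0 th : (0 <= (V th)%:E)%E by rewrite lee_fin mulr_ge0// addr_ge0// mulr_ge0 ?e0// sqr_ge0.
apply: (@le_trans _ _ (\int[leb]_r ((nc (win 0 1 r))%:E * \int[leb]_th (V th)%:E))%E).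
  apply: le_nnint.
  - by apply: meas_nneint2 => //; rewrite /W; mes.
  - by apply: emeasurable_funM; [mes|exact: measurable_cst].
  - by move=> r; exact: nnint_ge0.
  move=> r; rewrite -lebZ ?nc_ge0//.
  apply: le_nnint.
  - by rewrite /W; mes.
  - by apply: emeasurable_funM => //; exact: measurable_cst.
  - by [].
  move=> th; rewrite /W /V -EFinM lee_fin mulrCA nc_win.
  have [r01|_] := boolP ((0 <= r) && (r <= 1)); last by rewrite !mul0r.
  rewrite !mul1r; have := Bfc th r01; rewrite -/(betaw (th + r)) => h.
  have -> : forall n y : R, c * (n + y * n) = c * (1 + y) * n by move=> *; ring.
  by rewrite ler_wpM2r ?sqr_ge0.
have W1 := @int_win R 0 1 ler01; rewrite subr0 in W1.
rewrite ge0_integralZr//; last 3 first.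
- by mes.
- by move=> r _; rewrite lee_fin nc_ge0.
- exact: nnint_ge0.
rewrite W1 mul1e /V; under eq_integral do rewrite EFinM.
rewrite lebZ//; last 2 first.
- by mes.
- by move=> th; rewrite lee_fin addr_ge0// mulr_ge0 ?e0// sqr_ge0.
under eq_integral do rewrite EFinD.
rewrite lebD//; first by mes.
- by mes.
- by move=> th; rewrite lee_fin mulr_ge0 ?e0// sqr_ge0.
- by move=> th; rewrite lee_fin mulr_ge0 ?e0// sqr_ge0.
Qed.

Lemma integral_Tt E P P' B : window E -> symb B P -> symb B P' -> AC true P P' ->
  (\int[leb]_t (nc (Tt F g a E P t))%:E <=
   4%:E * (kap0%:E * N2 g + (128 * c)%:E * (En 0 E P + En m E P)))%E.
Proof.
move=> wE sP sP' A; have [mP _ _] := sP; have [mE _] := wE; have [mg _ _] := ng.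
have mk := measurable_kapw; have mb := measurable_betaw.
have w0 := @window_E0 R; have w1 := @window_E1 R; have [m0 _] := w0; have [m1 _] := w1.
have mI E' : cmeasurable E' -> measurable_fun setT (Iterm E').
  move=> mE'; have mK := measurable_Kenergy mE' mg; apply: meas_nneint2.
    by apply: emeasurable_funM; [mes|apply: (meas_comp_of mK (u := snd)); mes].
  move=> t xi; rewrite mule_ge0 ?lee_fin ?(ltW (kapw_gt0 _))//.
  by apply: nnint_ge0 => ?; apply: nnint_ge0 => ?; rewrite lee_fin; pos.
have mJ : measurable_fun setT (Jterm E P).
  apply: meas_nneint2.
    by apply: emeasurable_funM; mes.
  move=> t xi; rewrite mule_ge0 ?lee_fin ?betaw_ge0//.
  by apply: nnint_ge0 => r; rewrite lee_fin mulr_ge0 ?nc_ge0// sqr_ge0.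
pose u E' t := (Iterm E' t + 128%:E * Jterm E P t)%E.
have mu E' : cmeasurable E' -> measurable_fun setT (u E').
  by move=> mE'; apply: emeasurable_funD; [exact: mI|apply: emeasurable_funM => //; exact: measurable_cst].
have u0 E' t : (0 <= u E' t)%E by apply: adde_ge0; [exact: Iterm_ge0|apply: mule_ge0; [by rewrite lee_fin|exact: Jterm_ge0]].
have Gi := cintble_Gam nF mX X0 iX wE sP sP' A.
apply: (@le_trans _ _ (\int[leb]_t (u (@E0 R) t + u (@E0 R) t + (u (@E1 R) t + u (@E1 R) t)))%E).
  apply: ae_le_nnint.
  - rewrite /Tt; mes.
  - by apply: emeasurable_funD; apply: emeasurable_funD; exact: mu.
  - by move=> t; rewrite lee_fin nc_ge0.
  - by move=> t; apply: adde_ge0; apply: adde_ge0; exact: u0.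
  apply: ae_imp2 (ae_cintble1 Gi) (ae_imp2 (fun t a b => conj a b) dif_representation Bdif) => t Gt [h1 h2].
  exact: Tt_le.
have e0 k (th : R) : 0 <= (2 * pi * th : R) ^+ (2 * k) by rewrite exprM exprn_ge0// sqr_ge0.
have mEn k : measurable_fun setT (fun t : R => \int[leb]_th ((2 * pi * th) ^+ (2 * k) * nc (Gam E P th t) ^+ 2)%:E)%E.
  apply: meas_nneint2; first by mes.
  by move=> t th; rewrite lee_fin mulr_ge0 ?e0// sqr_ge0.
have En0' k t : (0 <= \int[leb]_th ((2 * pi * th) ^+ (2 * k) * nc (Gam E P th t) ^+ 2)%:E)%E.
  by apply: nnint_ge0 => th; rewrite lee_fin mulr_ge0 ?e0// sqr_ge0.
have JE : (\int[leb]_t Jterm E P t <= c%:E * (En 0 E P + En m E P))%E.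
  rewrite /En -lebD// -lebZ//; last 2 first.
  - exact: emeasurable_funD.
  - by move=> t; rewrite adde_ge0.
  apply: le_nnint => //.
  - by apply: emeasurable_funM; [exact: measurable_cst|exact: (emeasurable_funD (mEn 0%N) (mEn m))].
  - by move=> t; exact: Jterm_ge0.
  - by move=> t; exact: Jterm_le.
set y := (kap0%:E * N2 g + _)%E.
have uE E' : window E' -> (\int[leb]_t u E' t <= y)%E.
  move=> wE'; have [mE' _] := wE'; rewrite lebD; last 4 first.
  - exact: mI.
  - by apply: emeasurable_funM => //; exact: measurable_cst.
  - by move=> t; exact: Iterm_ge0.
  - by move=> t; rewrite mule_ge0// Jterm_ge0.
  apply: leeD; first exact: integral_Iterm.
  rewrite lebZ//; last by move=> t; exact: Jterm_ge0.
  by rewrite EFinM -muleA; apply: lee_wpmul2l.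
clearbody u.
rewrite lebD; last 4 first.
- by apply: emeasurable_funD; exact: mu.
- by apply: emeasurable_funD; exact: mu.
- by move=> t; rewrite adde_ge0.
- by move=> t; rewrite adde_ge0.
rewrite (lebD (mu _ m0) (mu _ m0) (u0 _) (u0 _)) (lebD (mu _ m1) (mu _ m1) (u0 _) (u0 _)).
apply: (@le_trans _ _ (1%:E * y + 1%:E * y + (1%:E * y + 1%:E * y))%E); last by rewrite sum4// mulr1.
by rewrite mul1e; apply: leeD; apply: leeD; apply: uE.
Qed.
End MainTerm.

(** * Assembling the composition estimate *)

Section CompositionBound.
Context {R : realType}.
Local Notation leb := (@lebesgue_measure R).
Local Notation leb2 := (prodsf leb leb).

(** [Op p f] is [op p (fourier f)]. Taking the frequency-side function as argument allows it to be
    truncated. *)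
Definition op (p : R * R -> R[i]) (G : R -> R[i]) (y : R) : R[i] :=
  cintegral leb (fun eta => expi (2 * pi * y * eta) * p (y, eta) * G eta).

Lemma window_cint_le (E f : R -> R[i]) (B : R) : window E -> cmeasurable f -> (forall s, nc (f s) <= B) ->
  nc (cintegral leb (fun s => E s * f s)) <= B.
Proof.
move=> wE mf fB; have [mE hE] := wE.
have B0 : 0 <= B by exact: le_trans (nc_ge0 _) (fB 0).
have W := @int_win R 0 1 ler01; rewrite subr0 in W.
rewrite -lee_fin; apply: (le_trans (cint_norm_le _ _)); first by mes.
apply: (@le_trans _ _ (\int[leb]_s (B%:E * (nc (win 0 1 s))%:E))%E).
  apply: le_nnint; [by mes|by mes|by move=> s; rewrite lee_fin nc_ge0|].
  by move=> s; rewrite -EFinM lee_fin ncM mulrC ler_pM ?nc_ge0.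
by rewrite lebZ ?W ?mule1//; [mes|move=> y; rewrite lee_fin nc_ge0].
Qed.

Variables (F : R -> R[i]) (N : R).
Hypothesis nF : nice N F.
Let mF : cmeasurable F. Proof. by case: nF. Qed.
Let Fi : cintble leb F := cintble_nice nF.

Lemma nc_smearOp_le E Q (B : R) y : window E -> cmeasurable Q -> (forall eta, nc (Q (y, eta)) <= B) ->
  nc (smearOp F E Q y) <= fine (\int[leb]_x (nc (F x))%:E)%E * B /\
  cintble leb (fun eta => expi (2 * pi * y * eta) * F eta * cintegral leb (fun s => E s * Q (y, eta + s))).
Proof.
move=> wE mQ QB; have [mE hE] := wE; have [_ Foo] := Fi.
have B0 : 0 <= B by exact: le_trans (nc_ge0 _) (QB 0).
have le1 eta : nc (expi (2 * pi * y * eta) * F eta * cintegral leb (fun s => E s * Q (y, eta + s))) <= B * nc (F eta).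
  rewrite !ncM nc_expi mul1r mulrC ler_wpM2r ?nc_ge0//.
  by apply: window_cint_le => //; mes.
have E1 : (\int[leb]_x (B * nc (F x))%:E = B%:E * \int[leb]_x (nc (F x))%:E)%E.
  by rewrite -lebZ//; [mes|move=> x; rewrite lee_fin nc_ge0].
have F0 : (0 <= \int[leb]_x (nc (F x))%:E)%E by apply: nnint_ge0 => x; rewrite lee_fin nc_ge0.
split; last first.
  apply: (@cintble_dom _ _ _ leb _ (fun x => B * nc (F x))) => //.
  - by mes.
  - by mes.
  - by rewrite E1 lte_mul_pinfty.
rewrite -lee_fin; apply: (le_trans (cint_norm_le _ _)); first by mes.
apply: (@le_trans _ _ (\int[leb]_x (B * nc (F x))%:E)%E).
  by apply: le_nnint; [mes|mes|move=> x; rewrite lee_fin nc_ge0|move=> x; rewrite lee_fin].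
by rewrite E1 mulrC EFinM fineK// ge0_fin_numE.
Qed.

Lemma cmeas_smearOp E Q : cmeasurable E -> cmeasurable Q -> cmeasurable (smearOp F E Q).
Proof. by move=> mE mQ; rewrite /smearOp; mes. Qed.

Lemma op_smear Q Q' (B : R) : cmeasurable Q -> cmeasurable Q' -> (forall z, nc (Q z) <= B) -> (forall z, nc (Q' z) <= B) ->
  AC false Q Q' -> {ae leb, forall y, op Q F y = smearOp F (@E0 R) Q y + smearOp F (@E1 R) Q' y}.
Proof.
move=> mQ mQ' QB QB' A; have w0 := @window_E0 R; have w1 := @window_E1 R.
apply: ae_imp (@ae_prod_ae _ _ _ _ _ leb leb _ (representation mQ mQ' QB QB' A)) => y hy.
have [_ i0] := nc_smearOp_le w0 mQ (fun eta => QB (y, eta)).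
have [_ i1] := nc_smearOp_le w1 mQ' (fun eta => QB' (y, eta)).
rewrite /smearOp -(cintD i0 i1); apply: ae_eq_cint.
- by mes.
- by case: (cintbleD i0 i1).
apply: ae_imp hy => eta; rewrite /mv /= => ->; ring.
Qed.

Variables (X : R -> R).
Hypothesis mX : measurable_fun setT X.
Hypothesis X0 : forall y, 0 <= X y.
Hypothesis iX : (\int[leb]_y (X y)%:E < +oo)%E.
Variables (g : R -> R[i]) (Ng : R).
Hypothesis ng : nice Ng g.
(** Here [a], [ax], [q], [qx] are p1 and its derivatives in x, xi and x xi; [b], [bx], [bxx], [r],
    [rx] play the same part for the second symbol made integrable in x. [M1], [M2] bound the symbols
    and their x-derivatives, [e1], [e2] bound the xi-derivatives. *)
Variables (a ax q qx b bx bxx r rx : R * R -> R[i]) (M1 M2 e1 e2 : R).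
Hypotheses (M10 : 0 < M1) (M20 : 0 < M2) (e10 : 0 < e1) (e20 : 0 < e2) (e1M1 : e1 <= M1).
Hypotheses (ma : cmeasurable a) (max : cmeasurable ax) (mq : cmeasurable q) (mqx : cmeasurable qx).
Hypotheses (ba : forall z, nc (a z) <= M1) (bax : forall z, nc (ax z) <= M1)
  (bq : forall z, nc (q z) <= e1) (bqx : forall z, nc (qx z) <= e1).
Hypotheses (ACa : AC true a ax) (ACq : AC false a q) (ACaxq : AC false ax qx) (ACqx : AC true q qx).
Hypotheses (sb : symb X M2 b) (sbx : symb X M2 bx) (sbxx : symb X M2 bxx) (sr : symb X e2 r) (srx : symb X e2 rx).
Hypotheses (ACb : AC true b bx) (ACbx : AC true bx bxx) (ACr : AC false b r) (ACrx : AC true r rx).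

(** With (x + y)^2 <= 2 x^2 + 2 y^2 and (2 pi s)^2 <= 64 the left side is at most 1 + 128 + 2 (2 pi
    th)^2. *)
Lemma weight_shift (th s : R) : 0 <= s <= 1 -> 1 + (2 * pi * (th + s)) ^+ 2 <= 129 * (1 + (2 * pi * th) ^+ 2).
Proof.
move=> /andP[s0 s1]; have h := @sqr_2pi R; rewrite !exprMn -!exprMn.
rewrite mulrDr; have : (2 * pi * s) ^+ 2 <= 64.
  by rewrite exprMn; apply: (@le_trans _ _ (64 * 1)); [apply: ler_pM; rewrite ?sqr_ge0//; nra|rewrite mulr1].
move: (2 * pi * th) (2 * pi * s) => x y hy.
by have := sqr_ge0 (x - y); have := sqr_ge0 x; nra.
Qed.

Lemma fourier_smearOp E P P' B : window E -> symb X B P -> symb X B P' -> AC true P P' ->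
  cintble leb (fun xi => fourier (smearOp F E P) xi * Kg g a xi) /\
  cintegral leb (fun xi => fourier (smearOp F E P) xi * Kg g a xi) =
  cintegral leb (fun t => Tt F g a E P t) + cintegral leb (fun x => g x * smearOp F E (fun z => a z * P z) x).
Proof.
move=> wE sP sP' A; have [mP PB _] := sP; have [mE _] := wE.
have [M KM] := Kg_bounded ng ma ba; have [mg _ _] := ng.
have mK : cmeasurable (Kg g a) by rewrite /Kg; mes.
have e : fourier (smearOp F E P) = fun xi => cintegral leb (fun t => Gam F E P (xi - t) t).
  have ee : smearOp F E P = fun y => cintegral leb (fun t => P (y, t) * (expi (2 * pi * y * t) * Hf E F y t)).
    by apply/funext => y; exact: (esym (smearOp_Hf nF y wE mP PB)).
  by rewrite ee; apply/funext => xi; exact: (fourier_superposition nF mX X0 iX xi wE sP).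
rewrite e; split; last exact: (fourier_pairing nF mX X0 iX ng ma ba wE sP sP' A).
under eq_fun do rewrite mulrC.
apply: (@cintble_bddM _ _ _ leb _ _ M) => //.
exact: (@cintble_fubini2 _ _ _ _ _ leb leb _ (cintble_Gam_shift nF mX X0 iX wE sP sP' A)).
Qed.

Lemma cintble_smearOp E P B : window E -> symb X B P -> cintble leb (smearOp F E P).
Proof.
move=> wE [mP PB PX]; have [mE _] := wE.
have F0 : 0 <= fine (\int[leb]_x (nc (F x))%:E)%E.
  by rewrite fine_ge0//; apply: nnint_ge0 => x; rewrite lee_fin nc_ge0.
apply: (cintble_X mX X0 iX F0); first exact: cmeas_smearOp.
by move=> y; have [] := @nc_smearOp_le E P (X y) y wE mP (fun eta => PX (y, eta)).
Qed.

Lemma cintble_g_smearOp E Q (B : R) : window E -> cmeasurable Q -> (forall z, nc (Q z) <= B) ->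
  cintble leb (fun x => g x * smearOp F E Q x).
Proof.
move=> wE mQ QB; have [mE _] := wE; have gi := cintble_nice ng.
under eq_fun do rewrite mulrC.
apply: (@cintble_bddM _ _ _ leb _ _ (fine (\int[leb]_x (nc (F x))%:E)%E * B)) => //.
- exact: cmeas_smearOp.
- by move=> y; have [] := nc_smearOp_le wE mQ (fun eta => QB (y, eta)).
Qed.

Lemma composition_identity :
  cintegral leb (fun xi => fourier (op b F) xi * Kg g a xi) -
  cintegral leb (fun x => g x * op (fun z => a z * b z) F x) =
  cintegral leb (fun t => Tt F g a (@E0 R) b t) + cintegral leb (fun t => Tt F g a (@E1 R) r t) -
  cintegral leb (fun x => g x * smearOp F (@E1 R) (fun z => q z * b z) x).
Proof.
have w0 := @window_E0 R; have w1 := @window_E1 R; have [m0 _] := w0; have [m1 _] := w1.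
have [mb bM _] := sb; have [mr rM _] := sr; have [mg _ _] := ng.
have [j0 p0] := fourier_smearOp w0 sb sbx ACb; have [j1 p1] := fourier_smearOp w1 sr srx ACrx.
have aM1 : 0 <= M1 := ltW M10.
have opb : {ae leb, forall y, op b F y = smearOp F (@E0 R) b y + smearOp F (@E1 R) r y}.
  apply: (@op_smear b r (M2 + e2)) => //.
  - by move=> z; rewrite (le_trans (bM z))// lerDl ltW.
  - by move=> z; rewrite (le_trans (rM z))// lerDr ltW.
have i0 := cintble_smearOp w0 sb; have i1 := cintble_smearOp w1 sr.
have mop Q : cmeasurable Q -> cmeasurable (op Q F) by move=> mQ; rewrite /op; mes.
have e1' : fourier (op b F) = fun xi => fourier (smearOp F (@E0 R) b) xi + fourier (smearOp F (@E1 R) r) xi.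
  apply/funext => xi; rewrite /fourier -(cintD (cintble_fourier xi i0) (cintble_fourier xi i1)).
  apply: ae_eq_cint.
  - by have mm := mop b mb; mes.
  - case: i0 => mi0 _; case: i1 => mi1 _.
    by apply: cmeasD; (apply: cmeasM; first by mes); [exact: mi0|exact: mi1].
  - by apply: ae_imp opb => y ->; rewrite mulrDr.
have -> : cintegral leb (fun xi => fourier (op b F) xi * Kg g a xi) =
    cintegral leb (fun xi => fourier (smearOp F (@E0 R) b) xi * Kg g a xi) +
    cintegral leb (fun xi => fourier (smearOp F (@E1 R) r) xi * Kg g a xi).
  by rewrite -(cintD j0 j1) e1'; apply: eq_cint => xi; rewrite mulrDl.
pose ab z := a z * b z; pose qb z := q z * b z; pose ar z := a z * r z.
have mab : cmeasurable ab by rewrite /ab; mes.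
have mqb : cmeasurable qb by rewrite /qb; mes.
have mar : cmeasurable ar by rewrite /ar; mes.
have abM z : nc (ab z) <= M1 * M2 by rewrite ncM ler_pM ?nc_ge0.
have qbM z : nc (qb z) <= e1 * M2 by rewrite ncM ler_pM ?nc_ge0.
have arM z : nc (ar z) <= M1 * e2 by rewrite ncM ler_pM ?nc_ge0.
have ACab : AC false ab (fun z => qb z + ar z) by exact: (AC_mul ma mq mb mr ba bq bM rM ACq ACr).
have g1 := cintble_g_smearOp w0 mab abM; have g2 := cintble_g_smearOp w1 mqb qbM; have g3 := cintble_g_smearOp w1 mar arM.
have algebra : forall c0 c1 t0 s0 t1 s1 A k : R[i], c0 = t0 + s0 -> c1 = t1 + s1 -> A = s0 + (k + s1) -> c0 + c1 - A = t0 + t1 - k.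
  by move=> c0 c1 t0 s0 t1 s1 A k -> -> ->; ring.
apply: (algebra _ _ _ _ _ _ _ _ p0 p1).
have -> : cintegral leb (fun x => g x * op ab F x) = cintegral leb (fun x => g x * smearOp F (@E0 R) ab x) +
   (cintegral leb (fun x => g x * smearOp F (@E1 R) qb x) + cintegral leb (fun x => g x * smearOp F (@E1 R) ar x)).
  have E3 := cintD g1 (cintbleD g2 g3); have E4 := cintD g2 g3.
  apply: (eq_trans _ (eq_trans E3 (f_equal2 +%R erefl E4))); apply: ae_eq_cint.
  - by have mm := mop _ mab; mes.
  - by case: (cintbleD g1 (cintbleD g2 g3)).
  have mqa : cmeasurable (fun z => qb z + ar z) by mes.
  have M0 : 0 <= M1 * M2 by rewrite mulr_ge0// ltW.
  have M0' : 0 <= e1 * M2 by rewrite mulr_ge0// ltW.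
  have M0'' : 0 <= M1 * e2 by rewrite mulr_ge0// ltW.
  have op1 : {ae leb, forall y, op ab F y = smearOp F (@E0 R) ab y + smearOp F (@E1 R) (fun z => qb z + ar z) y}.
    apply: (@op_smear ab _ (M1 * M2 + (e1 * M2 + M1 * e2))) => //.
    - by move=> z; rewrite (le_trans (abM z))// lerDl addr_ge0.
    - by move=> z; rewrite (le_trans (ncD _ _))// (le_trans (lerD (qbM z) (arM z)))// lerDr.
  apply: ae_imp op1 => x ->; rewrite mulrDr; congr (_ + _); rewrite -mulrDr; congr (_ * _).
  have [_ k1] := nc_smearOp_le w1 mqb (fun eta => qbM (x, eta)).
  have [_ k2] := nc_smearOp_le w1 mar (fun eta => arM (x, eta)).
  rewrite /smearOp -(cintD k1 k2); apply: eq_cint => eta; rewrite -mulrDr; congr (_ * _).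
  rewrite -cintD.
  - by apply: eq_cint => s; rewrite mulrDr.
  - by apply: (@cintble_win_bdd _ _ _ (e1 * M2)) => //; mes.
  - by apply: (@cintble_win_bdd _ _ _ (M1 * e2)) => //; mes.
by [].
Qed.

Lemma nc_cint_Tt_le E P P' B (y : \bar R) : window E -> symb X B P -> symb X B P' -> AC true P P' ->
  (\int[leb]_t (nc (Tt F g a E P t))%:E <= y)%E -> ((nc (cintegral leb (fun t => Tt F g a E P t)))%:E <= y)%E.
Proof.
move=> wE sP sP' A; have [mP _ _] := sP; have [mE _] := wE; have [mg _ _] := ng.
by apply: le_trans; apply: cint_norm_le; rewrite /Tt; mes.
Qed.

Let g0 : (0 <= N2 g)%E. Proof. by apply: nnint_ge0 => x; rewrite lee_fin sqr_ge0. Qed.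
Let F0 : (0 <= N2 F)%E. Proof. by apply: nnint_ge0 => x; rewrite lee_fin sqr_ge0. Qed.

(** Sized by [main_term0]: four terms in [integral_Tt], 128 from [master], 4 times 129^2 from
    comparing the weights, and 1 + 16900 from the energies of orders 0 and 2. *)
Definition Kc : R := 4 * (128 * (4 * 129 ^+ 2 * 16901)).

Lemma sqr_weight_le (x : R) : (1 + x ^+ 2) ^+ 2 <= 2 * (1 + x ^+ (2 * 2)).
Proof.
rewrite (_ : (2 * 2)%N = 4%N)// (_ : x ^+ 4 = (x ^+ 2) ^+ 2); last by rewrite -exprM.
by move: (x ^+ 2) => y; have := sqr_ge0 (1 - y); nra.
Qed.

(** The increments of a and ax are bounded by the constant 2 M1, so m = 1. The choice kap0 = M1 e2
    balances the sides: F costs (M1 / e2) e2^2, again M1 e2. Here 516 is 4 times 129 and 131 is 1 +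
    130. *)
Lemma main_term1 : ((nc (cintegral leb (fun t => Tt F g a (@E1 R) r t)))%:E <= (Kc * (M1 * e2))%:E * (N2 g + N2 F))%E.
Proof.
have w1 := @window_E1 R; have bqM z : nc (q z) <= M1 by exact: le_trans (bq z) e1M1.
have bqxM z : nc (qx z) <= M1 by exact: le_trans (bqx z) e1M1.
apply: (nc_cint_Tt_le w1 sr srx ACrx).
have k0 : 0 < M1 * e2 by rewrite mulr_gt0.
have c0 : 0 <= 516 * (M1 / e2) by apply: mulr_ge0; [exact: ler0n|apply: divr_ge0; exact: ltW].
have mB : measurable_fun setT (fun _ : R => 2 * M1) by mes.
have hB (th s : R) : 0 <= s <= 1 -> (2 * M1) ^+ 2 * (1 + (2 * pi * (th + s)) ^+ 2) / (M1 * e2) <=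
    516 * (M1 / e2) * (1 + (2 * pi * th) ^+ (2 * 1)).
  move=> s01; have h := weight_shift th s01; rewrite muln1.
  rewrite (_ : (2 * M1) ^+ 2 * _ / _ = (M1 / e2) * (4 * (1 + (2 * pi * (th + s)) ^+ 2))); last first.
    by field; rewrite !gt_eqF.
  rewrite (mulrC 516) -[leRHS]mulrA; apply: ler_wpM2l; first by apply: divr_ge0; exact: ltW.
  by move: h; move: ((2 * pi * (th + s)) ^+ 2) ((2 * pi * th) ^+ 2) => u v; lra.
have bnd : {ae leb, forall t, {ae leb2, forall z : R * R, [/\ nc (dif a t z) <= 2 * M1,
    nc (dif ax t z) <= 2 * M1, nc (q z) <= 2 * M1 & nc (qx z) <= 2 * M1]}}.
  apply: ae_true => t; apply: ae_true => z; split; try exact: dif_le.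
  - by rewrite (le_trans (bqM z))// ler_peMl ?(ltW M10)// ler1n.
  - by rewrite (le_trans (bqxM z))// ler_peMl ?(ltW M10)// ler1n.
apply: (le_trans (integral_Tt nF mX X0 iX ng ma max mq mqx ba bax bqM bqxM ACa ACq ACaxq k0 c0 mB hB bnd w1 sr srx ACrx)).
have h0 := En0 nF mX X0 iX w1 sr; have h1 := En1 nF mX X0 iX w1 sr srx ACrx.
rewrite (_ : Kc * (M1 * e2) = 4 * ((128 * (4 * 129 ^+ 2 * 16901)) * (M1 * e2))); last by rewrite /Kc [RHS]mulrA.
rewrite (EFinM 4) -muleA; apply: lee_wpmul2l; first by rewrite lee_fin ler0n.
apply: lee_comb => //.
  by apply: lee_wpmul2r => //; rewrite lee_fin; apply: ler_peMl; [exact: ltW|lra].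
apply: (@le_trans _ _ ((128 * (516 * (M1 / e2)))%:E * ((131 * e2 ^+ 2)%:E * N2 F))%E).
  apply: lee_wpmul2l; first by rewrite lee_fin; apply: mulr_ge0; [exact: ler0n|exact: c0].
    rewrite (_ : 131 * e2 ^+ 2 = e2 ^+ 2 + 130 * e2 ^+ 2); last by ring.
  by rewrite ge0_combine; [apply: leeD|exact: sqr_ge0|apply: mulr_ge0; [exact: ler0n|exact: sqr_ge0]].
rewrite muleA -EFinM; apply: lee_wpmul2r => //; rewrite lee_fin.
rewrite (_ : _ * (131 * e2 ^+ 2) = (128 * 516 * 131) * (M1 * e2)); last by field; rewrite gt_eqF.
by rewrite ler_wpM2r ?(ltW k0)//; lra.
Qed.

(** The increments of a and ax grow like e1 |xi - t|; together with the reciprocal of the integrable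
    weight this asks for m = 2. The choice kap0 = M2 e1 makes both sides cost M2 e1, since (e1 / M2)
    M2^2 = M2 e1. *)
Lemma main_term0 : ((nc (cintegral leb (fun t => Tt F g a (@E0 R) b t)))%:E <= (Kc * (M2 * e1))%:E * (N2 g + N2 F))%E.
Proof.
have w0 := @window_E0 R; have bqM z : nc (q z) <= M1 by exact: le_trans (bq z) e1M1.
have bqxM z : nc (qx z) <= M1 by exact: le_trans (bqx z) e1M1.
apply: (nc_cint_Tt_le w0 sb sbx ACb).
have k0 : 0 < M2 * e1 by rewrite mulr_gt0.
have c0 : 0 <= 4 * 129 ^+ 2 * (e1 / M2).
  by apply: mulr_ge0; [apply: mulr_ge0; [exact: ler0n|exact: sqr_ge0]|apply: divr_ge0; exact: ltW].
pose Bf (th : R) := e1 * (1 + `|th|).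
have mB : measurable_fun setT Bf by rewrite /Bf; mes.
have hB (th s : R) : 0 <= s <= 1 -> Bf (th + s) ^+ 2 * (1 + (2 * pi * (th + s)) ^+ 2) / (M2 * e1) <=
    4 * 129 ^+ 2 * (e1 / M2) * (1 + (2 * pi * th) ^+ (2 * 2)).
  move=> s01; have h := weight_shift th s01.
  rewrite /Bf (_ : (e1 * _) ^+ 2 * _ / _ = (e1 / M2) * ((1 + `|th + s|) ^+ 2 * (1 + (2 * pi * (th + s)) ^+ 2))); last first.
    by field; rewrite !gt_eqF.
  rewrite [4 * 129 ^+ 2 * (e1 / M2)]mulrC -[leRHS]mulrA; apply: ler_wpM2l; first by apply: divr_ge0; exact: ltW.
  (* Needed to bound the growth in |th + s| by the weight, which is written in 2 pi (th + s). *)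
  have p1 : 1 <= (2 * pi : R) ^+ 2 by have := pi_ge2 R; move: (pi : R) => p hp; nra.
  have h1 : (1 + `|th + s|) ^+ 2 <= 2 * (1 + (2 * pi * (th + s)) ^+ 2).
    have e : (th + s) ^+ 2 <= (2 * pi * (th + s)) ^+ 2 by rewrite [leRHS]exprMn ler_peMl ?sqr_ge0.
    have e' : `|th + s| ^+ 2 = (th + s) ^+ 2 by rewrite real_normK ?num_real.
    by move: e e'; move: `|th + s| ((th + s) ^+ 2) ((2 * pi * (th + s)) ^+ 2) => u v w e e'; have := sqr_ge0 (1 - u); nra.
  have h2 := sqr_weight_le (2 * pi * th).
  move: h h1 h2; set W := 1 + (2 * pi * (th + s)) ^+ 2; set w := 1 + (2 * pi * th) ^+ 2 => h h1 h2.
  have W1 : 0 <= W by rewrite /W addr_ge0// sqr_ge0.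
  have w1 : 0 <= w by rewrite /w addr_ge0// sqr_ge0.
  apply: (@le_trans _ _ (2 * W * W)); first by rewrite ler_wpM2r.
  apply: (@le_trans _ _ (2 * 129 ^+ 2 * w ^+ 2)).
    rewrite (_ : 2 * W * W = 2 * (W ^+ 2)); last by ring.
    rewrite (_ : 2 * 129 ^+ 2 * w ^+ 2 = 2 * ((129 * w) ^+ 2)); last by ring.
    by rewrite ler_wpM2l// lerXn2r ?nnegrE ?mulr_ge0.
  by move: h2; move: (w ^+ 2) (1 + _) => u v; lra.
have bnd : {ae leb, forall t, {ae leb2, forall z : R * R, [/\ nc (dif a t z) <= Bf (z.2 - t),
    nc (dif ax t z) <= Bf (z.2 - t), nc (q z) <= Bf (z.2 - t) & nc (qx z) <= Bf (z.2 - t)]}}.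
  apply: ae_imp2 (dif_lip ma mq bq ACq) (dif_lip max mqx bqx ACaxq) => t; apply: ae_imp2 => z h1 h2.
  have e1' : 0 <= e1 := ltW e10.
  split; rewrite /Bf.
  - by rewrite (le_trans h1)// ler_wpM2l// lerDr.
  - by rewrite (le_trans h2)// ler_wpM2l// lerDr.
  - by rewrite (le_trans (bq z))// ler_peMr// lerDl.
  - by rewrite (le_trans (bqx z))// ler_peMr// lerDl.
apply: (le_trans (integral_Tt nF mX X0 iX ng ma max mq mqx ba bax bqM bqxM ACa ACq ACaxq k0 c0 mB hB bnd w0 sb sbx ACb)).
have h0 := En0 nF mX X0 iX w0 sb; have h1 := En2 nF mX X0 iX w0 sb sbx sbxx ACb ACbx.
rewrite (_ : Kc * (M2 * e1) = 4 * ((128 * (4 * 129 ^+ 2 * 16901)) * (M2 * e1))); last by rewrite /Kc [RHS]mulrA.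
rewrite (EFinM 4) -muleA; apply: lee_wpmul2l; first by rewrite lee_fin ler0n.
apply: lee_comb => //.
  by apply: lee_wpmul2r => //; rewrite lee_fin; apply: ler_peMl; [exact: ltW|lra].
apply: (@le_trans _ _ ((128 * (4 * 129 ^+ 2 * (e1 / M2)))%:E * ((16901 * M2 ^+ 2)%:E * N2 F))%E).
  apply: lee_wpmul2l; first by rewrite lee_fin; apply: mulr_ge0; [exact: ler0n|exact: c0].
    rewrite (_ : 16901 * M2 ^+ 2 = M2 ^+ 2 + 16900 * M2 ^+ 2); last by ring.
  by rewrite ge0_combine; [apply: leeD|exact: sqr_ge0|apply: mulr_ge0; [exact: ler0n|exact: sqr_ge0]].
rewrite muleA -EFinM; apply: lee_wpmul2r => //; rewrite lee_fin.
rewrite (_ : _ * (16901 * M2 ^+ 2) = (128 * (4 * 129 ^+ 2 * 16901)) * (M2 * e1)); last by field; rewrite gt_eqF.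
by [].
Qed.

(** Both q b and its x-derivative are at most 2 M2 e1, and [smear_row_bound] contributes 256. *)
Lemma perturbation : ((nc (cintegral leb (fun x => g x * smearOp F (@E1 R) (fun z => q z * b z) x)))%:E <=
  (512 * (M2 * e1))%:E * (N2 g + N2 F))%E.
Proof.
have w1 := @window_E1 R; have [mE1 _] := w1; have [mb bM _] := sb; have [mbx bxM _] := sbx.
have gi := cintble_nice ng.
have mQ : cmeasurable (fun z => q z * b z) by mes.
have mQ' : cmeasurable (fun z => qx z * b z + q z * bx z) by mes.
have k0 : 0 < M2 * e1 by rewrite mulr_gt0.
have QB z : nc (q z * b z) <= 2 * (M2 * e1).
  rewrite ncM; apply: (@le_trans _ _ (e1 * M2)); first by rewrite ler_pM ?nc_ge0.
  by move: k0; rewrite (mulrC M2); lra.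
have QB' z : nc (qx z * b z + q z * bx z) <= 2 * (M2 * e1).
  rewrite (le_trans (ncD _ _))// !ncM (_ : 2 * (M2 * e1) = e1 * M2 + e1 * M2); last by ring.
  by rewrite lerD// ler_pM ?nc_ge0.
have A := AC_mul mq mqx mb mbx bq bqx bM bxM ACqx ACb.
have B0 : 0 < 2 * (M2 * e1) by rewrite mulr_gt0.
have := smear_row_bound w1 mQ mQ' QB QB' A B0 gi Fi.
rewrite (_ : 256 * (2 * (M2 * e1)) = 512 * (M2 * e1)); last by ring.
apply: le_trans; rewrite le_eqVlt; apply/orP; left; apply/eqP; congr (nc _)%:E.
have [mg _] := gi.
pose Z (z : R * R) := g z.1 * F z.2 * expi (2 * pi * z.1 * z.2) * cintegral leb (fun s => E1 s * (q (mv false s z) * b (mv false s z))).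
have Zi : cintble (leb \x leb)%E Z.
  have gF := @cintbleM_prod _ _ _ _ _ leb leb _ _ gi Fi.
  rewrite /Z; under eq_fun do rewrite -mulrA mulrC.
  apply: (@cintble_bddM _ _ _ leb2 _ _ (2 * (M2 * e1))) => //; first by mes.
  move=> z; rewrite ncM nc_expi mul1r; by apply: window_cint_le => //; mes.
rewrite -(cfubini1 Zi); apply: eq_cint => x.
have [_ i1] := nc_smearOp_le w1 mQ (fun eta => QB (x, eta)).
rewrite /smearOp -(cintZl _ i1); apply: eq_cint => eta; rewrite /Z /mv /=; ring.
Qed.

Lemma composition_bound :
  ((nc (cintegral leb (fun xi => fourier (op b F) xi * Kg g a xi) -
        cintegral leb (fun x => g x * op (fun z => a z * b z) F x)))%:E <=
   ((2 * Kc) * (M1 * e2 + M2 * e1))%:E * (N2 g + N2 F))%E.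
Proof.
rewrite composition_identity.
have h := main_term0; have h' := main_term1; have h'' := perturbation.
have K512 : 512 <= Kc by rewrite /Kc; lra.
have p1 : 0 <= M1 * e2 by rewrite mulr_ge0// ltW.
have p2 : 0 <= M2 * e1 by rewrite mulr_ge0// ltW.
apply: (@le_trans _ _ ((Kc * (M2 * e1))%:E * (N2 g + N2 F) + (Kc * (M1 * e2))%:E * (N2 g + N2 F) +
   (512 * (M2 * e1))%:E * (N2 g + N2 F))%E).
  apply: (le_trans _ (leeD (leeD h h') h'')); rewrite -!EFinD lee_fin.
  by rewrite (le_trans (ncB _ _))// lerD2r ncD.
have K0 : 0 <= Kc by apply: (le_trans _ K512); exact: ler0n.
rewrite -!ge0_combine; last 4 first.
- by apply: addr_ge0; exact: mulr_ge0.
- by apply: mulr_ge0; [exact: ler0n|].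
- exact: mulr_ge0.
- exact: mulr_ge0.
apply: lee_wpmul2r; first by rewrite adde_ge0.
rewrite lee_fin; have k1 := ler_wpM2r p2 K512; have k2 := mulr_ge0 K0 p1.
move: k1 k2; move: Kc (M1 * e2) (M2 * e1) => k u v; lra.
Qed.
End CompositionBound.

(** * Test functions and weak derivatives *)

Section Bumps.
Context {R : realType}.
Implicit Types (f g phi psi : R -> R) (x : R).

(** The functions x^-k exp(-1/x), extended by 0, have derivatives that are linear combinations of
    members of the same family; smoothness follows without computing any higher derivative. *)
Definition expinv (k : nat) x : R := if 0 < x then x^-1 ^+ k * expR (- x^-1) else 0.

(** The m-th power of t / m <= exp(t / m). *)
Lemma exprX_expRN (m : nat) (t : R) : 0 <= t -> t ^+ m * expR (- t) <= m%:R ^+ m.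
Proof.
move=> t0; case: m => [|m]; first by rewrite !expr0 mul1r -expR0 ler_expR oppr_le0.
have m0 : 0 < m.+1%:R :> R by rewrite ltr0n.
rewrite expRN ler_pdivrMr ?expR_gt0//.
have -> : expR t = expR (t / m.+1%:R) ^+ m.+1 by rewrite -expRM_natl mulrC divfK// gt_eqF.
rewrite -exprMn lerXn2r ?nnegrE ?mulr_ge0 ?expR_ge0//.
rewrite -[leLHS](@mulVKf _ m.+1%:R) ?gt_eqF// ler_pM2l// mulrC.
by apply: le_trans (expR_ge1Dx _); rewrite lerDr.
Qed.

Lemma expinv_ge0 k x : 0 <= expinv k x.
Proof. by rewrite /expinv; case: ifP => // x0; rewrite mulr_ge0 ?expR_ge0// exprn_ge0// invr_ge0 ltW. Qed.

Lemma expinv_bounded k x : `|expinv k x| <= k%:R ^+ k.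
Proof.
rewrite ger0_norm ?expinv_ge0// /expinv; case: ifP => x0; last by rewrite exprn_ge0.
by apply: exprX_expRN; rewrite invr_ge0 ltW.
Qed.

(** Raising the index by 2 gains a factor x^2, which by [isd0_of_sqr] gives derivative 0 at the
    origin. *)
Lemma expinv_sqr k x : `|expinv k x| <= k.+2%:R ^+ k.+2 * x ^+ 2.
Proof.
rewrite ger0_norm ?expinv_ge0// /expinv; case: ifP => x0; last by rewrite mulr_ge0 ?sqr_ge0 ?exprn_ge0.
have h : 0 <= x^-1 by rewrite invr_ge0 ltW.
rewrite (_ : x^-1 ^+ k * expR (- x^-1) = x^-1 ^+ k.+2 * expR (- x^-1) * x ^+ 2).
  by rewrite ler_wpM2r ?sqr_ge0// exprX_expRN.
by rewrite -addn2 exprD mulrAC -(mulrA _ _ (x ^+ 2)) -exprMn mulVf ?gt_eqF// expr1n mulr1.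
Qed.

Lemma isd0_of_sqr f (C : R) : (forall x, `|f x| <= C * x ^+ 2) -> is_derive (0 : R) 1 f (0 : R).
Proof.
move=> fC; have f0 : f 0 = 0 by apply/eqP; rewrite -normr_le0 (le_trans (fC 0))// expr0n mulr0.
have h : h^-1 *: ((f \o shift (0 : R)) (h *: (1 : R)) - f 0) @[h --> (0 : R)^'] --> (0 : R).
  have C0 : 0 <= C by apply: le_trans (normr_ge0 _) _; last (have := fC 1; rewrite expr1n mulr1; exact).
  apply/cvgr0Pnorm_le => e e0; have d0 : 0 < e / (2 * (C + 1)) by rewrite divr_gt0// mulr_gt0// ltr_wpDl.
  near=> h; have hn : h != 0 by near: h; exact: nbhs_dnbhs_neq.
  have hd : `|h| <= e / (2 * (C + 1)) by near: h; exact: dnbhs0_le.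
  rewrite /= f0 subr0 addr0 [h *: 1]mulr1 normrM normfV.
  rewrite ler_pdivrMl ?normr_gt0// (le_trans (fC h))// -real_normK ?num_real// expr2 mulrCA ler_wpM2l//.
  apply: le_trans (ler_wpM2l C0 hd) _; apply: le_trans (mul_half_frac C0 e0) _; lra.
apply: DeriveDef; first by apply/cvg_ex; exists 0.
exact: (cvg_lim _ h).
Unshelve. all: by end_near.
Qed.

Lemma expinv_isd k x : is_derive x 1 (expinv k) (expinv k.+2 x - k%:R * expinv k.+1 x).
Proof.
have [x0|x0|->] := ltgtP x 0.
- have e j : expinv j x = 0 by rewrite /expinv ltNge (ltW x0).
  rewrite !e mulr0 subr0; apply: (@near_eq_is_derive _ _ _ (fun=> 0)).
  by near=> y; rewrite /expinv ltNge ltW//; near: y; exact: lt_nbhsl.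
- have dV : is_derive x 1 (fun y : R => y^-1) (- x ^- 2).
    by apply: isd_eq (@is_deriveV R (fun y : R => y) x 1 1 (lt0r_neq0 x0) (isdid x)) _; rewrite /GRing.scale /= mulr1.
  have dE := isd_comp (isdN dV) (is_derive_expR (- x^-1)).
  have dX : is_derive x 1 (fun y : R => y^-1 ^+ k) (- x ^- 2 * (k%:R * x^-1 ^+ k.-1)).
    have dP : is_derive (x^-1) 1 (fun y : R => y ^+ k) (k%:R * x^-1 ^+ k.-1).
      have := @is_deriveX R R id k (x^-1) 1 1 (is_derive_id _ _).
      by rewrite exprfctE /GRing.scale /= mulr1.
    exact: isd_comp dV dP.
  have nE : \near x, x^-1 ^+ k * expR (- x^-1) = expinv k x.
    by near=> y; rewrite /expinv ifT//; near: y; exact: lt_nbhsr.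
  apply: isd_eq (near_eq_is_derive nE (isdM dX dE)) _.
  rewrite /expinv x0 -exprVn opprK; clear; move: (x^-1) (expR _) => i E.
  by case: k => [|k] /=; rewrite ?expr0 !exprS; ring.
- have e j : expinv j (0 : R) = 0 by rewrite /expinv ltxx.
  rewrite !e mulr0 subr0; exact: isd0_of_sqr (expinv_sqr k).
Unshelve. all: by end_near.
Qed.

(* With m > 0 the generators vanish outside (a, b). *)
Inductive bump : (R -> R) -> Prop :=
| bump1 (k l : nat) (m a b : R) : 0 < m -> bump (fun x => expinv k (m * (x - a)) * expinv l (m * (b - x)))
| bumpZ (c : R) f : bump f -> bump (fun x => c * f x)
| bumpD f g : bump f -> bump g -> bump (fun x => f x + g x)
| bumpM f g : bump f -> bump g -> bump (fun x => f x * g x).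

Lemma bump_isd f : bump f -> exists2 f', bump f' & forall x, is_derive x 1 f (f' x).
Proof.
elim=> [k l m a b m0|c g bg [g' bg' dg]|g h bg [g' bg' dg] bh [h' bh' dh]|g h bg [g' bg' dg] bh [h' bh' dh]].
- pose e i j x := expinv i (m * (x - a)) * expinv j (m * (b - x)).
  have be i j : bump (e i j) by exact: bump1.
  exists (fun x => (m * e k.+2 l x + (- m * k%:R) * e k.+1 l x) + ((- m) * e k l.+2 x + (m * l%:R) * e k l.+1 x)).
    by do 2?apply: bumpD; apply: bumpZ.
  move=> x; have d1 : is_derive x 1 (fun x => m * (x - a)) m.
    by apply: isd_eq (isdM (isdc m x) (isdD (isdid x) (isdc (- a) x))) _; ring.
  have d2 : is_derive x 1 (fun x => m * (b - x)) (- m).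
    by apply: isd_eq (isdM (isdc m x) (isdD (isdc b x) (isdN (isdid x)))) _; ring.
  apply: isd_eq (isdM (isd_comp d1 (expinv_isd k _)) (isd_comp d2 (expinv_isd l _))) _.
  by rewrite /e; ring.
- exists (fun x => c * g' x); first exact: bumpZ.
  by move=> x; apply: isd_eq (isdM (isdc c x) (dg x)) _; ring.
- exists (fun x => g' x + h' x); first exact: bumpD.
  by move=> x; apply: isdD.
- exists (fun x => g x * h' x + h x * g' x); first by apply: bumpD; apply: bumpM.
  by move=> x; apply: isdM.
Qed.

Lemma bump_continuous f : bump f -> continuous f.
Proof. by move=> /bump_isd[f' _ d] x; exact: isd_continuous (d x). Qed.

Lemma bump_support f : bump f -> exists2 N, 0 < N & forall x, N <= `|x| -> f x = 0.
Proof.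
elim=> [k l m a b m0|c g bg [N N0 h]|g h bg [N N0 Ng] bh [M M0 Mh]|g h bg [N N0 Ng] bh [M M0 Mh]].
- exists (`|a| + `|b| + 1) => [|x].
    by rewrite ltr_wpDl ?addr_ge0.
  rewrite /expinv !pmulr_rgt0// !subr_gt0; case: ifP => ax; last by rewrite mul0r.
  case: ifP => bx; rewrite ?mulr0// => h; exfalso; move: h; rewrite leNgt => /negP; apply.
  rewrite ltr_norml; have := ler_norm b; have := ler_norm (- a); rewrite normrN => h1 h2.
  by have := normr_ge0 a; have := normr_ge0 b => h3 h4; apply/andP; split; lra.
- by exists N => // x /h ->; rewrite mulr0.
- exists (N + M) => [|x xN]; first exact: addr_gt0.
  by rewrite Ng ?Mh ?addr0//; apply: le_trans xN; lra.
- by exists N => // x /Ng ->; rewrite mul0r.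
Qed.

Lemma bump_bounded f : bump f -> exists2 M, 0 < M & forall x, `|f x| <= M.
Proof.
elim=> [k l m a b m0|c g bg [N N0 h]|g h bg [N N0 Ng] bh [M M0 Mh]|g h bg [N N0 Ng] bh [M M0 Mh]].
- exists (k%:R ^+ k * l%:R ^+ l + 1) => [|x]; first by rewrite ltr_wpDl ?mulr_ge0 ?exprn_ge0.
  by rewrite normrM ler_wpDr// ler_pM ?expinv_bounded.
- exists (`|c| * N + 1) => [|x]; first by rewrite ltr_wpDl ?mulr_ge0 ?(ltW N0).
  by rewrite normrM ler_wpDr// ler_wpM2l.
- exists (N + M) => [|x]; first exact: addr_gt0.
  by rewrite (le_trans (ler_normD _ _))// lerD.
- exists (N * M) => [|x]; first exact: mulr_gt0.
  by rewrite normrM ler_pM.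
Qed.

Lemma bump_shift f (c : R) : bump f -> bump (fun x => f (x + c)).
Proof.
elim=> [k l m a b m0|e g bg h|g h bg hg bh hh|g h bg hg bh hh].
- rewrite (_ : (fun x => _) = (fun x => expinv k (m * (x - (a - c))) * expinv l (m * ((b - c) - x)))); first exact: bump1.
  by apply/funext => x; congr (expinv k (m * _) * expinv l (m * _)); ring.
- exact: bumpZ.
- exact: bumpD.
- exact: bumpM.
Qed.

Lemma bump_measurable f : bump f -> measurable_fun setT f.
Proof. by move=> /bump_continuous; exact: continuous_measurable_fun. Qed.

Lemma bump_derive1n f n : bump f -> bump (derive1n n f) /\ forall x, derivable (derive1n n f) x 1.
Proof.
move=> bf; have H g : bump g -> bump (derive1 g) /\ forall x, derivable g x 1.
  move=> /bump_isd[g' bg' d]; rewrite (_ : derive1 g = g').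
    by split => // x; exact: isd_derivable (d x).
  by apply/funext => x; exact: isdE (d x).
elim: n => [|n [b1 _]]; first by split=> // x; have [_] := H _ bf.
have [b2 _] := H _ b1; have e : derive1n n.+1 f = derive1 (derive1n n f) by rewrite derive1nS.
by rewrite e; split => // x; have [_] := H _ b2.
Qed.

Lemma schwartz_bump f : bump f -> schwartz_real f.
Proof.
move=> bf; split=> [n x|k n]; first by have [_] := bump_derive1n n bf.
have [bn _] := bump_derive1n n bf; have [N N0 sN] := bump_support bn; have [M M0 fM] := bump_bounded bn.
exists (N ^+ k * M) => x; have [xN|xN] := leP N `|x|.
  by rewrite sN// mulr0 normr0 mulr_ge0 ?exprn_ge0// ltW.
by rewrite normrM normrX ler_pM ?exprn_ge0// lerXn2r ?nnegrE// ltW.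
Qed.

Lemma is_derive_tensor f (f' : R) g (z : R * R) : is_derive z.1 1 f f' ->
  is_derive z (1, 0) (fun z : R * R => f z.1 * g z.2) (f' * g z.2).
Proof.
move=> d; have [df ef] := d; have h : h^-1 *: (((fun z : R * R => f z.1 * g z.2) \o shift z) (h *: ((1, 0) : R * R)) - f z.1 * g z.2) @[h --> (0 : R)^'] --> f' * g z.2.
  rewrite (_ : (fun h : R => _) = (fun h : R => h^-1 *: ((f \o shift z.1) (h *: (1 : R)) - f z.1) * g z.2)).
    by apply: cvgM; [rewrite -ef; exact: df|exact: cvg_cst].
  apply/funext => h /=; rewrite [h *: (0 : R)]mulr0 add0r /GRing.scale /=; ring.
by apply: DeriveDef; [apply/cvg_ex; exists (f' * g z.2)|exact: (cvg_lim _ h)].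
Qed.

Lemma is_derive_tensor2 f g (g' : R) (z : R * R) : is_derive z.2 1 g g' ->
  is_derive z (0, 1) (fun z : R * R => f z.1 * g z.2) (f z.1 * g').
Proof.
move=> d; have [df ef] := d; have h : h^-1 *: (((fun z : R * R => f z.1 * g z.2) \o shift z) (h *: ((0, 1) : R * R)) - f z.1 * g z.2) @[h --> (0 : R)^'] --> f z.1 * g'.
  rewrite (_ : (fun h : R => _) = (fun h : R => f z.1 * (h^-1 *: ((g \o shift z.2) (h *: (1 : R)) - g z.2)))).
    by apply: cvgM; [exact: cvg_cst|rewrite -ef; exact: df].
  apply/funext => h /=; rewrite [h *: (0 : R)]mulr0 add0r /GRing.scale /=; ring.
by apply: DeriveDef; [apply/cvg_ex; exists (f z.1 * g')|exact: (cvg_lim _ h)].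
Qed.

Definition tensor f g (z : R * R) : R := f z.1 * g z.2.

Lemma dx_tensor f f' g : (forall x, is_derive x 1 f (f' x)) -> dx (tensor f g) = tensor f' g.
Proof. by move=> d; apply/funext => z; have [] := is_derive_tensor g (d z.1). Qed.

Lemma dxi_tensor f g g' : (forall x, is_derive x 1 g (g' x)) -> dxi (tensor f g) = tensor f g'.
Proof. by move=> d; apply/funext => z; have [] := is_derive_tensor2 f (d z.2). Qed.

(** Every iterated partial derivative of a tensor product of bumps is again one, whatever the order
    of the derivatives. *)
Lemma test_tensor f g : bump f -> bump g -> test_function (tensor f g).
Proof.
move=> bf bg; split=> [w|].
  have [f' [g' [bf' bg' ->]]] : exists f' g', [/\ bump f', bump g' & dword w (tensor f g) = tensor f' g'].
    elim: w => [|b w [f' [g' [bf' bg' e]]]] /=; first by exists f, g.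
    have [f2 bf2 df] := bump_isd bf'; have [g2 bg2 dg] := bump_isd bg'.
    by case: b; rewrite -/(dword w _) e; [exists f2, g'|exists f', g2]; split=> //; [rewrite (dx_tensor _ df)|rewrite (dxi_tensor _ dg)].
  split=> [z|z].
    apply: cvgM; apply: cvg_comp; try exact: bump_continuous; [exact: cvg_fst|exact: cvg_snd].
  have [f2 _ df] := bump_isd bf'; have [g2 _ dg] := bump_isd bg'.
  by split; [have [] := is_derive_tensor g' (df z.1)|have [] := is_derive_tensor2 f' (dg z.2)].
have [N N0 sN] := bump_support bf; have [M M0 sM] := bump_support bg.
have cK : compact (`[-N, N] `*` `[-M, M] : set (R * R)) by apply: compact_setX; exact: segment_compact.
apply: (subclosed_compact _ cK); first exact: closed_closure.
have clK : closed (`[-N, N] `*` `[-M, M] : set (R * R)) by apply: compact_closed => //; exact: norm_hausdorff.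
rewrite [X in _ `<=` X](closure_id _).1//; apply: closure_subset => z /= zn.
have : `|z.1| < N /\ `|z.2| < M.
  split; rewrite ltNge; apply/negP => h; move: zn; rewrite /tensor ?(sN _ h) ?(sM _ h) ?mulr0 ?mul0r eqxx//.
by rewrite /= !in_itv /= -!ler_norml => -[/ltW -> /ltW ->].
Qed.
End Bumps.

(** * Functions determined by their integrals against test functions *)

Section DynkinZero.
Context d (T : measurableType d) (R : realType).
Variable mu : {measure set T -> \bar R}.
Implicit Types (f : T -> R[i]) (S : set T).

Definition ind S (x : T) : R[i] := (\1_S x)%:C.

Lemma indE S x : ind S x = (x \in S)%:R%:C.
Proof. by rewrite /ind indicE. Qed.

Lemma nc_ind S x : nc (ind S x) <= 1.
Proof. by rewrite indE ncR; case: (x \in S); rewrite ?normr1 ?normr0. Qed.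

Lemma cmeas_ind S : measurable S -> cmeasurable (ind S).
Proof. by move=> mS; apply: cmeasR; exact: measurable_indic. Qed.

Lemma cintble_ind S f : measurable S -> cintble mu f -> cintble mu (fun x => ind S x * f x).
Proof. by move=> mS fi; apply: (cintble_bddM _ (fun x => nc_ind S x) fi); exact: cmeas_ind. Qed.

Lemma zero_on_sets f : cintble mu f -> (forall S, measurable S -> cintegral mu (fun x => ind S x * f x) = 0) ->
  {ae mu, forall x, f x = 0}.
Proof.
move=> fi fS; have H (h : T -> R) : mu.-integrable setT (EFin \o h) ->
    (forall S, measurable S -> \int[mu]_x (\1_S x * h x) = 0) -> {ae mu, forall x, h x = 0}.
  move=> hi hS; have := @integral_ae_eq _ _ _ mu setT measurableT (cst 0%E) (EFin \o h) hi (measurable_cst _).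
  have e E : E `<=` setT -> measurable E -> (\int[mu]_(x in E) (EFin \o h) x = \int[mu]_(x in E) (cst 0%E : T -> \bar R) x)%E.
    move=> _ mE; rewrite integral0.
    have hE : mu.-integrable E (EFin \o h) by exact: integrableS hi.
    have e : ((EFin \o h) \_ E = (fun x => (\1_E x * h x)%:E))%E.
      by apply/funext => x; rewrite epatch_indic /= EFinM muleC.
    rewrite -(fineK (integrable_fin_num mE hE)) [X in fine X]integral_mkcond e.
    by have := hS E mE; rewrite /Rintegral => ->.
  by move=> /(_ e); apply: ae_imp => x /= /(_ I) [].
have [mf _] := fi; have hR := H _ (cintble_Re fi); have hI := H _ (cintble_Im fi).
apply: ae_imp2 (hR _) (hI _) => [x a b|S mS|S mS]; first exact: complex_ext.
- have := congr1 (@complex.Re R) (fS S mS); rewrite /cintegral /=; apply: eq_trans; apply: eq_Rintegral => x _.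
  by rewrite ReM /ind /= mul0r subr0.
- have := congr1 (@complex.Im R) (fS S mS); rewrite /cintegral /=; apply: eq_trans; apply: eq_Rintegral => x _.
  by rewrite ImM /ind /= mul0r addr0.
Qed.

Lemma ind_cup_disjoint (F : nat -> set T) n x : trivIset setT F ->
  ind (\big[setU/set0]_(i < n.+1) F i) x = ind (\big[setU/set0]_(i < n) F i) x + ind (F n) x.
Proof.
move=> tF; rewrite !indE big_ord_recr /= -rmorphD /= -natrD; congr (_%:R%:C).
have := @trivIset_bigsetUI _ xpredT F; move=> /(_ _ n n); rewrite leqnn => /(_ _ isT isT) h.
have {h} : \big[setU/set0]_(i < n) F i `&` F n = set0.
  by apply: h; exact: sub_trivIset tF.
move=> h; rewrite in_setU; have [xn|xn] := boolP (x \in F n); have [xc|xc] //:= boolP (x \in _).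
have : (\big[setU/set0]_(i < n) F i `&` F n) x by split; exact: set_mem.
by rewrite h.
Qed.

Lemma cvg_ind_cup (F : nat -> set T) x : \forall n \near \oo, ind (\big[setU/set0]_(i < n) F i) x = ind (\bigcup_k F k) x.
Proof.
rewrite !indE; have [/set_mem[k _ kx]|h] := boolP (x \in \bigcup_k F k).
  exists k.+1 => // n /= kn; rewrite indE mem_set//; rewrite -bigcup_mkord; by exists k.
exists 0%N => // n _; rewrite indE; case: (boolP (x \in _)) => // /set_mem xb.
by move: h; rewrite mem_set//; exact: (@bigsetU_bigcup _ F n _ xb).
Qed.

Lemma nc_cvg0_near (u : nat -> R[i]) (l : R[i]) : (\forall n \near \oo, u n = l) -> nc (u n - l) @[n --> \oo] --> (0 : R).
Proof.
move=> h; apply: cvg_near_cst.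
by apply: filterS h => n ->; rewrite subrr nc0.
Qed.

Lemma cint_lim_eq0 (f_ : nat -> T -> R[i]) f (G : T -> R) : (forall n, cmeasurable (f_ n)) -> cmeasurable f ->
  measurable_fun setT G -> (\int[mu]_x (G x)%:E < +oo)%E -> (forall n x, nc (f_ n x) <= G x) ->
  {ae mu, forall x, nc (f_ n x - f x) @[n --> \oo] --> (0 : R)} -> (forall n, cintegral mu (f_ n) = 0) ->
  cintegral mu f = 0.
Proof.
move=> mf_ mf mG Goo fG cf f0; have [_ c] := cdominated mf_ mf mG Goo fG cf.
apply/nc_eq0/(cvg_unique _ (F := nc (cintegral mu (f_ n) - cintegral mu f) @[n --> \oo])) => //.
by apply: cvg_near_cst; exists 0%N => // n _; rewrite f0 sub0r ncN.
Qed.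

(** The measurable sets on which f has integral 0 form a Dynkin system: complements use that the
    total integral is 0, and disjoint unions pass to the limit by dominated convergence. *)
Lemma dynkin_zero (G : set (set T)) f : @measurable _ T = <<s G >> -> setI_closed G -> cintble mu f ->
  cintegral mu f = 0 -> (forall S, G S -> cintegral mu (fun x => ind S x * f x) = 0) ->
  {ae mu, forall x, f x = 0}.
Proof.
move=> GE GI fi f0 fG; apply: zero_on_sets => // S; rewrite GE; move: S.
apply: (dynkin_induction GE GI).
- by rewrite (@eq_cint _ _ _ mu _ f)// => x; rewrite indE in_setT mul1r.
- exact: fG.
- move=> S mS h; rewrite (@eq_cint _ _ _ mu _ (fun x => f x - ind S x * f x)).
    by rewrite (cintB fi (cintble_ind mS fi)) h subr0.
  by move=> x; rewrite !indE in_setC; case: (x \in S); rewrite ?mul1r ?mul0r ?subrr ?subr0.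
- move=> F mF tF h; have [mf _] := fi.
  have mU n : measurable (\big[setU/set0]_(i < n) F i) by apply: bigsetU_measurable.
  have H n : cintegral mu (fun x => ind (\big[setU/set0]_(i < n) F i) x * f x) = 0.
    elim: n => [|n IH].
      by rewrite (@eq_cint _ _ _ mu _ (fun=> 0)) ?cint0// => x; rewrite indE big_ord0 in_set0 mul0r.
    rewrite (@eq_cint _ _ _ mu _ (fun x => ind (\big[setU/set0]_(i < n) F i) x * f x + ind (F n) x * f x)).
      by rewrite (cintD (cintble_ind (mU n) fi) (cintble_ind (mF n) fi)) IH h addr0.
    by move=> x; rewrite ind_cup_disjoint// mulrDl.
  have mB : measurable (\bigcup_k F k) by exact: bigcup_measurable.
  apply: (@cint_lim_eq0 (fun n x => ind (\big[setU/set0]_(i < n) F i) x * f x) _ (fun x => nc (f x))) => //.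
  - by move=> n; apply: cmeasM => //; exact: cmeas_ind.
  - by apply: cmeasM => //; exact: cmeas_ind.
  - exact: cmeas_nc.
  - by case: fi.
  - by move=> n x; rewrite ncM ler_piMl ?nc_ge0 ?nc_ind.
  - apply: ae_true => x; apply: nc_cvg0_near.
    by near=> n; congr (_ * _); near: n; exact: cvg_ind_cup.
Unshelve. all: by end_near.
Qed.
End DynkinZero.
Arguments ind {d T R} S x.
Arguments indE {d T R} S x.
Arguments nc_ind {d T R} S x.
Arguments cmeas_ind {d T R} [S].

Section TestFunctions.
Context {R : realType}.
Local Notation leb := (@lebesgue_measure R).
Local Notation leb2 := (prodsf leb leb).
Implicit Types (f phi psi : R -> R).

Lemma cint_FTC f f' (u : R) : 0 <= u -> (forall x : R, is_derive x 1 f (f' x)) -> continuous f' ->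
  cintegral leb (fun w => win 0 u w * (f' w)%:C) = (f u - f 0)%:C.
Proof.
rewrite le_eqVlt => /predU1P[<-|u0] df cf.
  rewrite subrr (ae_eq_cint (g := fun=> 0)) ?cint0//.
    by apply: cmeasM; [exact: cmeas_win|apply: cmeasR; exact: continuous_measurable_fun].
  exists [set 0]; split => //; first exact: lebesgue_measure_set1.
  move=> w /= H; apply: contrapT => w0; apply: H; rewrite /win.
  case: ifP => [/andP[w1 w2]|_]; last by rewrite mul0r.
  by case: w0; apply/le_anti; rewrite w1 w2.
have cF : continuous f by move=> x; exact: isd_continuous (df x).
have wR w : complex.Re (win 0 u w * (f' w)%:C) = ((0 <= w) && (w <= u))%:R * f' w.
  by rewrite /win; case: ifP => _ /=; rewrite ?mul1r ?mul0r ?subr0.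
have wI w : complex.Im (win 0 u w * (f' w)%:C) = 0.
  by rewrite /win; case: ifP => _ /=; rewrite ?mul1r ?mul0r ?mulr0 ?addr0.
apply: complex_ext; rewrite /cintegral /=; last first.
  by under eq_Rintegral do rewrite wI; rewrite /Rintegral integral0.
under eq_Rintegral do rewrite wR.
rewrite /Rintegral; under eq_integral do rewrite EFinM.
rewrite (nnint_itv (EFin \o f')) (@continuous_FTC2 R f' f 0 u u0)//.
- exact: continuous_subspaceT.
- split; first by move=> x _; exact: isd_derivable (df x).
  + by apply/cvg_at_right_filter; exact: cF.
  + by apply/cvg_at_left_filter; exact: cF.
- by move=> x _; exact: isdE.
Qed.

Lemma nice_bump phi : bump phi -> exists N, nice N (fun x => (phi x)%:C).
Proof.
move=> bp; have [N N0 sN] := bump_support bp; have [M M0 fM] := bump_bounded bp.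
exists (N + M); split=> [|x|x xN].
- by apply: cmeasR; exact: bump_measurable.
- by rewrite ncR (le_trans (fM x))// ler_wpDl// ltW.
- by rewrite sN// ltW// (le_lt_trans _ xN)// ler_wpDr// ltW.
Qed.

Lemma cintble_bump phi : bump phi -> cintble leb (fun x => (phi x)%:C).
Proof. by move=> /nice_bump[N]; exact: cintble_nice. Qed.

(** As n grows, exp(-1 / ((n + 1) t)) tends to 1 for t > 0, so these bumps tend to the indicator of
    the open interval (a, b). *)
Definition plateau (n : nat) (a b x : R) : R := expinv 0 (n.+1%:R * (x - a)) * expinv 0 (n.+1%:R * (b - x)).

Lemma bump_plateau n a b : bump (plateau n a b).
Proof. by apply: bump1; rewrite ltr0n. Qed.

Lemma plateau_ge0 n a b x : 0 <= plateau n a b x.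
Proof. by rewrite mulr_ge0// expinv_ge0. Qed.

Lemma plateau_le1 n a b x : `|plateau n a b x| <= 1.
Proof. by rewrite normrM -[leRHS]mulr1 ler_pM// (le_trans (expinv_bounded _ _))// expr0. Qed.

Lemma plateau_gt0 n a b x : a < x < b -> 0 < plateau n a b x.
Proof.
move=> /andP[ax xb].
have H t : 0 < t -> 0 < expinv 0 (n.+1%:R * t).
  by move=> t0; rewrite /expinv pmulr_rgt0 ?ltr0n// t0 expr0 mul1r expR_gt0.
by rewrite mulr_gt0// H ?subr_gt0.
Qed.

Lemma plateau_cvg a b x : plateau n a b x @[n --> \oo] --> (((a < x) && (x < b))%:R : R).
Proof.
have H t : 0 < t -> expinv 0 (n.+1%:R * t) @[n --> \oo] --> (1 : R).
  move=> t0; rewrite (_ : (fun n => _) = (fun n => expR (- (n.+1%:R^-1 * t^-1)))).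
    rewrite -[X in _ --> X](@expR0 R); apply: continuous_cvg; first exact: continuous_expR.
    rewrite -[X in _ --> X]oppr0; apply: cvgN; rewrite -[X in _ --> X](mul0r (t^-1)).
    by apply: cvgMl; exact: cvg_harmonic.
  by apply/funext => n; rewrite /expinv pmulr_rgt0 ?ltr0n// t0 expr0 mul1r invfM.
rewrite /plateau; case: (ltP a x) => ax; last first.
  apply: cvg_near_cst; exists 0%N => // n _; rewrite {1}/expinv pmulr_rgt0 ?ltr0n// subr_gt0.
  by rewrite ltNge ax mul0r.
case: (ltP x b) => xb; last first.
  apply: cvg_near_cst; exists 0%N => // n _; rewrite {2}/expinv pmulr_rgt0 ?ltr0n// subr_gt0.
  by rewrite ltNge xb mulr0.
by rewrite -[X in _ --> X](mulr1 (1 : R)); apply: cvgM; apply: H; rewrite subr_gt0.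
Qed.

Lemma nc_cvg_scale (u : nat -> R) (l : R) (c : R[i]) : u n @[n --> \oo] --> l ->
  nc ((u n)%:C * c - l%:C * c) @[n --> \oo] --> (0 : R).
Proof.
move=> h; rewrite (_ : (fun n => _) = (fun n => `|u n - l| * nc c)).
  rewrite -[X in _ --> X](mul0r (nc c)); apply: cvgMl; rewrite -[X in _ --> X](@normr0 _ R).
  by apply: cvg_norm; rewrite -(subrr l); apply: cvgB => //; exact: cvg_cst.
by apply/funext => n; rewrite -mulrBl ncM -rmorphB ncR.
Qed.

Lemma zero_of_bumps (h : R -> R[i]) : cintble leb h ->
  (forall phi, bump phi -> cintegral leb (fun x => (phi x)%:C * h x) = 0) -> {ae leb, forall x, h x = 0}.
Proof.
move=> fi H; have [mf foo] := fi.
have HS (a b : R) : cintegral leb (fun x => ind `]a, b] x * h x) = 0.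
  apply: (@cint_lim_eq0 _ _ _ leb (fun n x => (plateau n a b x)%:C * h x) _ (fun x => nc (h x))) => //.
  - move=> n; apply: cmeasM => //; apply: cmeasR; exact: bump_measurable (bump_plateau n a b).
  - by apply: cmeasM => //; apply: cmeas_ind; exact: measurable_itv.
  - exact: cmeas_nc.
  - by move=> n x; rewrite ncM ncR ler_piMl ?nc_ge0// plateau_le1.
  (* The plateaus converge to the indicator of the open interval, which differs from the half-open
     one only at b. *)
  - exists [set b]; split => //; first exact: lebesgue_measure_set1.
    move=> x /= nh; apply: contrapT => xb; apply: nh.
    have -> : ind `]a, b] x = (((a < x) && (x < b))%:R)%:C :> R[i].
      have xb' : b != x by apply/eqP => e; apply: xb.
      by rewrite indE mem_setE in_itv /= [x < b]lt_neqAle eq_sym xb'.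
    exact: nc_cvg_scale (@plateau_cvg a b x).
  - by move=> n; apply: H; exact: bump_plateau.
apply: (@dynkin_zero _ (measurableTypeR R) R leb (@ocitv R) h) => //; first exact: ocitvI.
  apply: (@cint_lim_eq0 _ _ _ leb (fun (n : nat) (x : R) => ind (`](- n%:R), n%:R]%classic : set R) x * h x) h (fun x => nc (h x))) => //.
  - by move=> n; apply: cmeasM => //; apply: cmeas_ind; exact: measurable_itv.
  - exact: cmeas_nc.
  - by move=> n x; rewrite ncM ler_piMl ?nc_ge0 ?nc_ind.
  - apply: ae_true => x; apply: nc_cvg0_near; exists (Num.trunc `|x|).+1 => // n /= xn.
    have : `|x| < n%:R by apply: lt_le_trans (truncnS_gt _) _; rewrite ler_nat.
    by rewrite ltr_norml => /andP[h1 h2]; rewrite indE mem_setE in_itv /= h1 (ltW h2) mul1r.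
by move=> S [[a b] _ <-] /=; exact: HS.
Qed.

Lemma tensor_cM phi psi (z : R * R) : (tensor phi psi z)%:C = (phi z.1)%:C * (psi z.2)%:C.
Proof. by rewrite /tensor rmorphM. Qed.

Lemma cintble_tensor phi psi : bump phi -> bump psi -> cintble leb2 (fun z => (tensor phi psi z)%:C).
Proof.
move=> b1 b2; have := cintbleM_prod (cintble_bump b1) (cintble_bump b2).
by congr cintble; apply/funext => z; rewrite tensor_cM.
Qed.

(** Testing in x for a fixed psi gives an exceptional set that depends on psi. Integrating over a
    measurable set A of x before letting psi vary avoids a union of uncountably many null sets; it
    gives zero integrals over all rectangles, which generate the product. *)
Lemma zero_of_tensors (h : R * R -> R[i]) : cintble leb2 h ->
  (forall phi psi, bump phi -> bump psi -> cintegral leb2 (fun z => (tensor phi psi z)%:C * h z) = 0) ->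
  {ae leb2, forall z, h z = 0}.
Proof.
move=> hi H; have [mh _] := hi.
have iS (E : R -> R[i]) : cmeasurable E -> (forall x, nc (E x) <= 1) -> cintble leb2 (fun z => E z.1 * h z).
  move=> mE E1; apply: (@cintble_bddM _ _ _ leb2 _ _ 1) hi => //.
  by apply: (cmeas_comp _ mE); exact: measurable_fst.
have step1 psi : bump psi -> {ae leb, forall x, cintegral leb (fun y => (psi y)%:C * h (x, y)) = 0}.
  move=> bpsi; have [N nN] := nice_bump bpsi; have [mpsi psiN _] := nN.
  have i1 : cintble leb2 (fun z => (psi z.2)%:C * h z).
    apply: (@cintble_bddM _ _ _ leb2 _ _ N) hi => [|z]; last exact: psiN.
    by apply: (cmeas_comp _ mpsi); exact: measurable_snd.
  apply: zero_of_bumps; first exact: (cintble_fubini1 i1).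
  move=> phi bphi; have [M [mphi phiM _]] := nice_bump bphi.
  have i2 : cintble leb2 (fun z => (phi z.1)%:C * ((psi z.2)%:C * h z)).
    apply: (@cintble_bddM _ _ _ leb2 _ _ M) i1 => [|z]; last exact: phiM.
    by apply: (cmeas_comp _ mphi); exact: measurable_fst.
  rewrite -(H phi psi bphi bpsi); apply: eq_trans (eq_trans (cfubini1 i2) _); last first.
    by apply: eq_cint => z; rewrite tensor_cM mulrA.
  apply: ae_eq_cint.
  - by apply: cmeasM => //; have [] := cintble_fubini1 i1.
  - by have [] := cintble_fubini1 i2.
  - by apply: ae_imp (ae_cintble1 i1) => x ix; rewrite -(cintZl (phi x)%:C ix).
have step2 (A : set R) : measurable A -> {ae leb, forall y, cintegral leb (fun x => ind A x * h (x, y)) = 0}.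
  move=> mA; have i1 := iS _ (cmeas_ind mA) (nc_ind A).
  have i1' : cintble leb2 (fun z : R * R => ind A z.1 * h (z.1, z.2)).
    by have := i1; congr cintble; apply/funext => -[].
  have i5 : cintble leb (fun y => cintegral leb (fun x => ind A x * h (x, y))).
    exact: (@cintble_fubini2 _ _ _ _ _ leb leb (fun x y => ind A x * h (x, y)) i1').
  apply: (zero_of_bumps i5).
  move=> psi bpsi; have [M [mpsi psiM _]] := nice_bump bpsi.
  have i2 : cintble leb2 (fun z => (psi z.2)%:C * (ind A z.1 * h z)).
    apply: (@cintble_bddM _ _ _ leb2 _ _ M) i1 => [|z]; last exact: psiM.
    by apply: (cmeas_comp _ mpsi); exact: measurable_snd.
  have i3 : cintble leb2 (fun z => (psi z.2)%:C * (ind A z.1 * h (z.1, z.2))).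
    by have := i2; congr cintble; apply/funext => -[].
  rewrite (_ : cintegral _ _ = cintegral leb (fun y => cintegral leb (fun x => (psi y)%:C * (ind A x * h (x, y))))).
    rewrite (cfubini2 i2) -(cfubini1 i2) (@ae_eq_cint _ _ _ leb _ (fun=> 0)) ?cint0//.
    - by have [] := cintble_fubini1 i2.
    - apply: ae_imp2 (step1 psi bpsi) (ae_cintble1 hi) => x e ix /=.
      rewrite (@eq_cint _ _ _ leb _ (fun y => ind A x * ((psi y)%:C * h (x, y)))); last by move=> y; rewrite mulrCA.
      rewrite (cintZl (ind A x) _) ?e ?mulr0//.
      exact: (@cintble_bddM _ _ _ leb _ _ M mpsi psiM ix).
  apply: ae_eq_cint.
  - by apply: cmeasM => //; have [] := i5.
  - by have [] := @cintble_fubini2 _ _ _ _ _ leb leb (fun x y => (psi y)%:C * (ind A x * h (x, y))) i3.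
  - have := ae_cintble1 (@cintble_swap _ _ _ _ _ leb leb (fun x y => ind A x * h (x, y)) i1').
    by apply: ae_imp => y iy /=; rewrite -(cintZl (psi y)%:C iy).
have rect (A B : set R) : measurable A -> measurable B -> cintegral leb2 (fun z => ind (A `*` B) z * h z) = 0.
  move=> mA mB; have i1 : cintble leb2 (fun z => ind (A `*` B) z * h z).
    by apply: cintble_ind hi; exact: measurableX.
  rewrite -(cfubini2 i1) (@ae_eq_cint _ _ _ leb _ (fun=> 0)) ?cint0//.
  - have i1' : cintble leb2 (fun z : R * R => ind (A `*` B) (z.1, z.2) * h (z.1, z.2)).
      by have := i1; congr cintble; apply/funext => -[].
    by have [] := @cintble_fubini2 _ _ _ _ _ leb leb (fun x y => ind (A `*` B) (x, y) * h (x, y)) i1'.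
  - have i2 := iS _ (cmeas_ind mA) (nc_ind A).
    have i2' : cintble leb2 (fun z : R * R => ind A z.1 * h (z.1, z.2)).
      by have := i2; congr cintble; apply/funext => -[].
    apply: ae_imp2 (step2 A mA) (ae_cintble1 (@cintble_swap _ _ _ _ _ leb leb (fun x y => ind A x * h (x, y)) i2')) => y e iy /=.
    rewrite (@eq_cint _ _ _ leb _ (fun x => ind B y * (ind A x * h (x, y)))).
      by rewrite (cintZl _ iy) e mulr0.
    by move=> x; rewrite !indE in_setX /= andbC mulrA -rmorphM -natrM mulnb.
apply: (@dynkin_zero _ (measurableTypeR R * measurableTypeR R)%type R leb2
  [set A `*` B | A in @measurable _ (measurableTypeR R) & B in @measurable _ (measurableTypeR R)] h) => //.
- exact: measurable_prod_measurableType.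
- move=> _ _ [A1 mA1 [B1 mB1 <-]] [A2 mA2 [B2 mB2 <-]]; rewrite -setXI.
  by exists (A1 `&` A2); [exact: measurableI|exists (B1 `&` B2) => //; exact: measurableI].
- have := rect setT setT measurableT measurableT; apply: eq_trans; apply: eq_cint => z.
  by rewrite setXTT indE in_setT mul1r.
- by move=> _ [A mA [B mB <-]]; exact: rect.
Qed.
End TestFunctions.

(** * From weak derivatives to integral identities *)

Section WeakDerivatives.
Context {R : realType}.
Local Notation leb := (@lebesgue_measure R).
Local Notation leb2 := (prodsf leb leb).
Implicit Types (phi psi : R -> R) (p q : R * R -> R[i]).

Lemma cintble_bddM_tensor p (B : R) phi psi : cmeasurable p -> (forall z, nc (p z) <= B) -> bump phi -> bump psi ->
  cintble leb2 (fun z => p z * (tensor phi psi z)%:C).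
Proof. move=> mp pB b1 b2; have h := @cintble_bddM _ _ _ leb2 _ _ B mp pB (cintble_tensor b1 b2). exact: h. Qed.

(** A product of bumps is a bump, so p times a plateau in each variable satisfies the hypotheses of
    [zero_of_tensors]; the plateaus on (-n, n) are positive at any given point for large n. *)
Lemma zero_of_tensors_loc p : cmeasurable p ->
  (forall phi psi, bump phi -> bump psi -> cintble leb2 (fun z => p z * (tensor phi psi z)%:C)) ->
  (forall phi psi, bump phi -> bump psi -> cintegral leb2 (fun z => p z * (tensor phi psi z)%:C) = 0) ->
  {ae leb2, forall z, p z = 0}.
Proof.
move=> mp ip H; pose c (n : nat) := plateau 0 (- n%:R : R) n%:R.
have bc n : bump (c n) by exact: bump_plateau.
have h n : {ae leb2, forall z, p z * (tensor (c n) (c n) z)%:C = 0}.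
  apply: zero_of_tensors; first exact: ip.
  move=> phi psi b1 b2; rewrite -(H _ _ (bumpM (bc n) b1) (bumpM (bc n) b2)).
  apply: eq_cint => z; rewrite mulrCA; congr (_ * _).
  rewrite /tensor -rmorphM; congr (_%:C); ring.
have {}h := ae_all_nat h; apply: ae_imp h => z /(_ (Num.trunc (`|z.1| + `|z.2|)).+1) /eqP.
rewrite mulf_eq0 => /orP[/eqP//|]; set n := _.+1 => e0; exfalso.
have hn : `|z.1| + `|z.2| < n%:R by exact: truncnS_gt.
have : 0 < tensor (c n) (c n) z.
  have := normr_ge0 z.1; have := normr_ge0 z.2 => n1 n2.
  rewrite mulr_gt0// plateau_gt0// -ltr_norml; lra.
by move: e0 => /eqP [->]; rewrite ltxx.
Qed.

Definition tensorb (b : bool) phi psi : R * R -> R := if b then tensor phi psi else tensor psi phi.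

Definition weak (b : bool) p q : Prop := forall phi phi' psi, bump phi -> bump phi' -> bump psi ->
  (forall x : R, is_derive x 1 phi (phi' x)) ->
  - cintegral leb2 (fun z => p z * (tensorb b phi' psi z)%:C) = cintegral leb2 (fun z => q z * (tensorb b phi psi z)%:C).

Lemma tensorbE b phi psi z :
  tensorb b phi psi z = phi (if b then z.1 else z.2) * psi (if b then z.2 else z.1).
Proof. by rewrite /tensorb /tensor; case: b; rewrite // mulrC. Qed.

Lemma cintble_le d (T : measurableType d) (mu : {measure set T -> \bar R}) (f F : T -> R[i]) (K : R) :
  0 <= K -> cmeasurable f -> cintble mu F -> (forall x, nc (f x) <= K * nc (F x)) -> cintble mu f.
Proof.
move=> K0 mf [mF Foo] fF; apply: (@cintble_dom _ _ _ mu _ (fun x => K * nc (F x))) => //; first by mes.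
under eq_integral do rewrite EFinM.
rewrite nnintZl//; first by rewrite lte_mul_pinfty.
- exact: cmeas_nce.
- by move=> x; rewrite lee_fin nc_ge0.
Qed.

Lemma cintble_tensorb b phi psi : bump phi -> bump psi -> cintble leb2 (fun z => (tensorb b phi psi z)%:C).
Proof. by move=> b1 b2; rewrite /tensorb; case: b; exact: cintble_tensor. Qed.

Lemma tensorb_mv b (w : R) phi psi z : tensorb b phi psi (mv b w z) = tensorb b (fun x => phi (x + w)) psi z.
Proof. by rewrite /tensorb /tensor /mv; case: b => /=. Qed.

Lemma bump_subr phi (w : R) : bump phi -> bump (fun x => phi (x - w)).
Proof. exact: bump_shift. Qed.

Lemma cint_mv b (w : R) p : cintble leb2 p -> cintegral leb2 (fun z => p (mv b w z)) = cintegral leb2 p.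
Proof.
move=> mp; have [u1 [u2 e]] := mv_shift b w.
rewrite -(cint_shift2 u1 u2 mp); by apply: eq_cint => z; rewrite e.
Qed.

(** The defect p(z + u) - p(z) - int_0^u q(z + w) dw is tested on tensors. Moving the translations
    to the test function T and using the weak derivative for each w, the integral becomes that of p
    against int_0^u -T'(. - w) dw, which is T(. - u) - T by the fundamental theorem. *)
Lemma AC_of_weak b p q (B : R) : cmeasurable p -> cmeasurable q -> (forall z, nc (p z) <= B) ->
  (forall z, nc (q z) <= B) -> weak b p q -> AC b p q.
Proof.
move=> mp mq pB qB H u u0.
have B0 : 0 <= B by exact: le_trans (nc_ge0 _) (pB (0, 0)).
have u0' : 0 <= u by exact: ltW.
pose d z := p (mv b u z) - p z - cintegral leb (fun w => win 0 u w * q (mv b w z)).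
have mpu : cmeasurable (fun z => p (mv b u z)).
  by apply: cmeas_mv => //; mes.
have mqw w : cmeasurable (fun z => q (mv b w z)) by apply: cmeas_mv => //; mes.
have mI : cmeasurable (fun z => cintegral leb (fun w => win 0 u w * q (mv b w z))).
  by have mw := @cmeas_win R 0 u; mes.
have md : cmeasurable d by rewrite /d; apply: cmeasB => //; apply: cmeasB.
have Ib z : nc (cintegral leb (fun w => win 0 u w * q (mv b w z))) <= B * u.
  have mw : cmeasurable (fun w => win 0 u w * q (mv b w z)) by mes.
  have h := cint_norm_le leb mw; rewrite -lee_fin; apply: le_trans h _.
  rewrite -[X in (_ <= X)%E](_ : (\int[leb]_w (B%:E * (nc (win 0 u w))%:E))%E = _); last first.
    rewrite lebZ//; [by rewrite int_win// subr0|by mes|by move=> w; rewrite lee_fin nc_ge0].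
  apply: le_nnint => [||w|w]; [by mes|by mes|by rewrite lee_fin nc_ge0|].
  by rewrite lee_fin ncM mulrC ler_wpM2r ?nc_ge0.
have Z : {ae leb2, forall z, d z = 0}.
  apply: zero_of_tensors_loc => // [phi psi b1 b2|phi psi b1 b2].
    apply: (@cintble_bddM_tensor _ (B + B + B * u)) => // z.
    by rewrite /d (le_trans (ncB _ _))// lerD// (le_trans (ncB _ _))// lerD.
  have {b1 b2} [f [g [bf bg ->]]] : exists f g, [/\ bump f, bump g & tensor phi psi = tensorb b f g].
    by case: b {H d mpu mqw mI md Ib}; [exists phi, psi|exists psi, phi].
  have [f' bf' df] := bump_isd bf.
  have i0 := cintble_tensorb b bf bg.
  have i1 : cintble leb2 (fun z => p (mv b u z) * (tensorb b f g z)%:C).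
    by apply: (@cintble_bddM _ _ _ leb2 _ _ B mpu _ i0) => z; exact: pB.
  have i2 : cintble leb2 (fun z => p z * (tensorb b f g z)%:C) by exact: (@cintble_bddM _ _ _ leb2 _ _ B mp pB i0).
  have i3 : cintble leb2 (fun z => cintegral leb (fun w => win 0 u w * q (mv b w z)) * (tensorb b f g z)%:C).
    exact: (@cintble_bddM _ _ _ leb2 _ _ _ mI Ib i0).
  rewrite (@eq_cint _ _ _ leb2 _ (fun z => p (mv b u z) * (tensorb b f g z)%:C - p z * (tensorb b f g z)%:C -
     cintegral leb (fun w => win 0 u w * q (mv b w z)) * (tensorb b f g z)%:C)); last by move=> z; rewrite /d !mulrBl.
  rewrite (cintB (cintbleB i1 i2) i3) (cintB i1 i2).
  pose T (w : R) z := (tensorb b (fun x => f (x - w)) g z)%:C : R[i].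
  have mT phi' psi' : bump phi' -> bump psi' -> cmeasurable (fun z => (tensorb b phi' psi' z)%:C : R[i]).
    by move=> h1 h2; have [] := cintble_tensorb b h1 h2.
  have sh (r : R * R -> R[i]) (w : R) : cmeasurable r -> (forall z, nc (r z) <= B) ->
      cintegral leb2 (fun z => r (mv b w z) * (tensorb b f g z)%:C) = cintegral leb2 (fun z => r z * T w z).
    move=> mr rB; have rT : cintble leb2 (fun z => r z * T w z) by apply: (@cintble_bddM _ _ _ leb2 _ _ B mr rB); apply: cintble_tensorb => //; exact: bump_subr.
    rewrite -(cint_mv b w rT); apply: eq_cint => z; congr (_ * _).
    rewrite /T tensorb_mv; congr ((tensorb b _ g z)%:C).
    by apply/funext => x; rewrite addrK.
  have mf'2 : measurable_fun setT (fun y : (R * (R * R)) => tensorb b (fun x => f' (x - y.1)) g y.2).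
    have mf' := bump_measurable bf'; have mg := bump_measurable bg.
    by rewrite /tensorb /tensor; case: (b); apply: measurable_funM; apply: (meas_comp_of (T1 := R)) => //; mes.
  have mf2 : measurable_fun setT (fun y : (R * (R * R)) => tensorb b f g y.2).
    have mf := bump_measurable bf; have mg := bump_measurable bg.
    by rewrite /tensorb /tensor; case: (b); apply: measurable_funM; apply: (meas_comp_of (T1 := R)) => //; mes.
  have iw : cintble (prodsf leb leb2) (fun y : R * (R * R) => win 0 u y.1 * (tensorb b f g y.2)%:C).
    exact: (cintbleM_prod (cintble_win 0 u) i0).
  have i4 : cintble (prodsf leb leb2) (fun y : R * (R * R) => q (mv b y.1 y.2) * (win 0 u y.1 * (tensorb b f g y.2)%:C)).
    by apply: (@cintble_bddM _ _ _ (prodsf leb leb2) _ _ B _ _ iw) => [|y]; [mes|exact: qB].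
  have e3 : cintegral leb2 (fun z => cintegral leb (fun w => win 0 u w * q (mv b w z)) * (tensorb b f g z)%:C) =
      cintegral leb (fun w => win 0 u w * cintegral leb2 (fun z => q z * T w z)).
    rewrite (@eq_cint _ _ _ leb2 _ (fun z => cintegral leb (fun w => q (mv b w z) * (win 0 u w * (tensorb b f g z)%:C)))).
      rewrite (cfubini2 i4) -(cfubini1 i4); apply: eq_cint => w /=.
      rewrite -sh// -(cintZl (win 0 u w)); last first.
        by apply: (@cintble_bddM _ _ _ leb2 _ _ B (mqw w) _ i0) => z; exact: qB.
      by apply: eq_cint => z; rewrite mulrCA.
    move=> z; rewrite -cintZr; last first.
      have mw := @cmeas_win R 0 u.
      rewrite (_ : (fun w => _) = (fun w => q (mv b w z) * win 0 u w)); last by apply/funext => w; rewrite mulrC.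
      by apply: (@cintble_bddM _ _ _ leb _ _ B _ _ (cintble_win 0 u)) => [|w]; [mes|exact: qB].
    by apply: eq_cint => w; rewrite mulrCA mulrA.
  have e4 w : cintegral leb2 (fun z => q z * T w z) =
      - cintegral leb2 (fun z => p z * (tensorb b (fun x => f' (x - w)) g z)%:C).
    have dfw (x : R) : is_derive x 1 (fun x => f (x - w)) (f' (x - w)).
      apply: isd_eq (isd_comp (isdD (isdid x) (isdc (- w) x)) (df (x - w))) _.
      by rewrite addr0 mul1r.
    exact/esym/(H _ _ _ (bump_subr w bf) (bump_subr w bf') bg dfw).
  have i5 : cintble (prodsf leb leb2) (fun y : R * (R * R) => win 0 u y.1 * (p y.2 * (tensorb b (fun x => f' (x - y.1)) g y.2)%:C)).
    have [N N0 sN] := bump_support bf'; have [M M0 fM] := bump_bounded bf'.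
    have iF : cintble leb2 (fun z => (if b then win (- (N + u)) (N + u) z.1 else (g z.1)%:C) *
        (if b then (g z.2)%:C else win (- (N + u)) (N + u) z.2)).
      case: (b); exact: (cintbleM_prod (f := fun x => _) (cintble_win _ _) (cintble_bump bg)) ||
        exact: (cintbleM_prod (f := fun x => _) (cintble_bump bg) (cintble_win _ _)).
    have iF2 := cintbleM_prod (cintble_win 0 u) iF.
    apply: (cintble_le (K := B * M) _ _ iF2); first by rewrite mulr_ge0// ltW.
      by have mw := @cmeas_win R 0 u; have mt := cmeasR mf'2; mes.
    move=> [w [x y]] /=; have [hw|hw] := boolP ((0 <= w) && (w <= u)); last first.
      by rewrite !ncM nc_win (negbTE hw) !mul0r mulr0.
    have fw X : `|f' (X - w)| <= M * nc (win (- (N + u)) (N + u) X).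
      rewrite nc_win -ler_norml; case: (leP `|X| (N + u)) => XN; first by rewrite mulr1.
      rewrite mulr0 sN ?normr0//; have := ler_normD (X - w) w; rewrite subrK => h.
      by move: hw => /andP[w0 wu]; rewrite (ger0_norm w0) in h; move: XN h wu; clear; lra.
    rewrite !ncM [leRHS]mulrCA ler_wpM2l ?nc_ge0// tensorbE ncR normrM -mulrA ler_pM ?mulr_ge0//; first exact: nc_ge0.
    case: (b); rewrite /= ncR; first by rewrite mulrA ler_wpM2r.
    by rewrite mulrCA mulrC ler_wpM2l.
  have e5 : cintegral leb (fun w => win 0 u w * cintegral leb2 (fun z => q z * T w z)) =
      cintegral leb2 (fun z => p z * T u z) - cintegral leb2 (fun z => p z * (tensorb b f g z)%:C).
    rewrite (@eq_cint _ _ _ leb _ (fun w => - cintegral leb2 (fun z => win 0 u w * (p z * (tensorb b (fun x => f' (x - w)) g z)%:C)))).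
      rewrite cintN; last exact: (cintble_fubini1 i5).
      rewrite (cfubini1 i5) -(cfubini2 i5) -cintB//; last first.
        by apply: (@cintble_bddM _ _ _ leb2 _ _ B mp pB); apply: cintble_tensorb => //; exact: bump_subr.
      have i6 := @cintble_fubini2 _ _ _ _ _ leb leb2
        (fun w z => win 0 u w * (p z * (tensorb b (fun x => f' (x - w)) g z)%:C)) i5.
      apply: (eq_trans (esym (cintN i6))); apply: eq_cint => z /=; rewrite -mulrBr -rmorphB !tensorbE -mulrBl.
      set x := (if b then z.1 else z.2); set y := (if b then z.2 else z.1).
      have e w : win 0 u w * (p z * (tensorb b (fun x => f' (x - w)) g z)%:C) =
          - (p z * (g y)%:C) * (win 0 u w * (- f' (x - w))%:C).
        by rewrite tensorbE -/x -/y rmorphM rmorphN; ring.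
      apply: (eq_trans (congr1 -%R (@eq_cint _ _ _ leb _ _ e))); rewrite cintZl.
        have dw (w : R) : is_derive w 1 (fun w => f (x - w)) (- f' (x - w)).
          apply: isd_eq (isd_comp (isdD (isdc x w) (isdN (isdid w))) (df (x - w))) _.
          by rewrite add0r mulN1r.
        have cw : continuous (fun w => - f' (x - w)).
          move=> w; apply: cvgN; apply: (continuous_comp (f := fun w => x - w)); last exact: bump_continuous.
          by apply: cvgB; [exact: cvg_cst|exact: cvg_id].
        apply: (eq_trans (congr1 (fun c => - (- (p z * (g y)%:C) * c)) (cint_FTC u0' dw cw))).
        by rewrite subr0 mulNr opprK rmorphM -mulrA [(g y)%:C * _]mulrC.
      have [M M0 fM] := bump_bounded bf'.
      rewrite (_ : (fun w => _) = (fun w => (- f' (x - w))%:C * win 0 u w)); last by apply/funext => w; rewrite mulrC.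
      apply: (@cintble_bddM _ _ _ leb _ _ M) (cintble_win 0 u) => [|w]; last by rewrite ncR normrN.
      by have mf' := bump_measurable bf'; apply: cmeasR; mes.
    move=> w; rewrite e4 mulrN -(cintZl (win 0 u w))//.
    by apply: (@cintble_bddM _ _ _ leb2 _ _ B mp pB); apply: cintble_tensorb => //; exact: bump_subr.
  by rewrite e3 e5 sh// subrr.
by apply: ae_imp Z => z /eqP; rewrite /d subr_eq0 => /eqP.
Qed.

(** This selects the branch of the L^oo norm that is the essential supremum. *)
Lemma leb2T_gt0 : (0 < leb2 setT)%E.
Proof.
have h := measurable_itv `[(0 : R), 1]; have m2 : measurable (`[(0 : R), 1]%classic `*` `[(0 : R), 1]%classic : set (R * R)).
  exact: (@measurableX _ _ (measurableTypeR R) (measurableTypeR R)).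
apply: (@lt_le_trans _ _ (leb2 (`[(0 : R), 1]%classic `*` `[(0 : R), 1]%classic))).
  rewrite /prodsf product_measure1E//= lebesgue_measure_itv /= lte01 oppr0 adde0 mule1.
  by rewrite ?lte_fin.
by apply: le_measure; rewrite ?inE.
Qed.

Lemma cLnorm_bounded p (M : R) : (cLnorm leb2 +oo%E p < M%:E)%E -> {ae leb2, forall z, nc (p z) <= M}.
Proof.
rewrite /cLnorm unlock /= leb2T_gt0 => /ltW /ess_supP.
by apply: ae_imp => z; rewrite /= lee_fin ger0_norm// nc_ge0.
Qed.

Lemma cintble_represent p phi psi : loc_integrable2 p -> bump phi -> bump psi ->
  cintble leb2 (fun z => p z * (tensor phi psi z)%:C).
Proof.
move=> [mp pi] b1 b2; have [mT _] := cintble_tensor b1 b2.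
have [N N0 sN] := bump_support b1; have [M M0 sM] := bump_support b2.
have [A A0 fA] := bump_bounded b1; have [B B0 fB] := bump_bounded b2.
have cK : compact (`[-N, N] `*` `[-M, M] : set (R * R)) by apply: compact_setX; exact: segment_compact.
have mK : measurable (`[-N, N]%classic `*` `[-M, M]%classic : set (R * R)).
  exact: (@measurableX _ _ (measurableTypeR R) (measurableTypeR R)).
apply: (@cintble_le _ _ leb2 _ (fun z => ind (`[-N, N]%classic `*` `[-M, M]%classic) z * p z) (A * B)).
- by rewrite mulr_ge0// ltW.
- exact: cmeasM.
- split; first by apply: cmeasM => //; exact: cmeas_ind.
  have := pi _ cK; rewrite [X in (X < _)%E -> _]integral_mkcond => h.
  apply: le_lt_trans h; rewrite le_eqVlt; apply/orP; left; apply/eqP; apply: eq_integral => z _.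
  by rewrite epatch_indic /= ncM indE ncR normr_nat EFinM muleC indicE.
- move=> z; rewrite !ncM ncR indE ncR normr_nat /tensor normrM.
  have [h|h] := boolP (z \in _); last first.
    have e0 : phi z.1 * psi z.2 = 0.
      case: (ltP `|z.1| N) => z1; last by rewrite (sN _ z1) mul0r.
      case: (ltP `|z.2| M) => z2; last by rewrite (sM _ z2) mulr0.
      by exfalso; move: h; rewrite notin_setE; apply; split => /=; rewrite in_itv /= -ler_norml ltW.
    by rewrite -normrM e0 normr0 mul0r !mulr0.
  by rewrite mul1r mulrC ler_wpM2r ?nc_ge0// ler_pM.
Qed.

(** A strict bound on the infimum yields an actual representing function. Setting it to 0 on the
    null set where it exceeds M makes the bound hold everywhere. *)
Lemma distr_sup_representer (u : Defs.distribution R) (M : R) : 0 <= M -> (distr_sup u < M%:E)%E ->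
  exists P, [/\ cmeasurable P, forall z, nc (P z) <= M &
    forall phi psi, bump phi -> bump psi -> u (tensor phi psi) = cintegral leb2 (fun z => P z * (tensor phi psi z)%:C)].
Proof.
move=> M0 /ereal_inf_lt[_ [p [pl pu] <-] pM].
have pae := cLnorm_bounded pM; have [mp _] := pl.
pose P z := if nc (p z) <= M then p z else 0.
have mP : cmeasurable P.
  by apply: cmeas_if => //; apply: measurable_fun_ler => //; exact: cmeas_nc.
have PM z : nc (P z) <= M by rewrite /P; case: ifP; rewrite ?nc0.
exists P; split=> // phi psi b1 b2; rewrite pu; last exact: test_tensor.
have [mT _] := cintble_tensor b1 b2.
apply: ae_eq_cint; [exact: cmeasM|exact: cmeasM|].
by apply: ae_imp pae => z pz; rewrite /P pz.
Qed.

Lemma weak_of_distr b (u : Defs.distribution R) p q :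
  (forall phi psi, bump phi -> bump psi -> u (tensor phi psi) = cintegral leb2 (fun z => p z * (tensor phi psi z)%:C)) ->
  (forall phi psi, bump phi -> bump psi -> (if b then distr_dx u else distr_dxi u) (tensor phi psi) =
     cintegral leb2 (fun z => q z * (tensor phi psi z)%:C)) -> weak b p q.
Proof.
move=> hp hq phi phi' psi b1 b1' b2 d; rewrite /tensorb; case: b hq => hq.
  by rewrite -hp// -hq// /distr_dx (dx_tensor _ d).
by rewrite -hp// -hq// /distr_dxi (dxi_tensor _ d).
Qed.

(* [P] represents [p]; [Px], [Q], [Qx], [Pxx] represent its derivatives in [x], [xi], [x xi], [x x]. *)
Record symbol_data (p P Px Q Qx Pxx : R * R -> R[i]) (M e M2 : R) : Prop := SymbolData {
  sd_ae : {ae leb2, forall z, p z = P z};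
  sd_mP : cmeasurable P; sd_mPx : cmeasurable Px; sd_mQ : cmeasurable Q;
  sd_mQx : cmeasurable Qx; sd_mPxx : cmeasurable Pxx;
  sd_P : forall z, nc (P z) <= M; sd_Px : forall z, nc (Px z) <= M;
  sd_Q : forall z, nc (Q z) <= e; sd_Qx : forall z, nc (Qx z) <= e; sd_Pxx : forall z, nc (Pxx z) <= M2;
  sd_ACP : AC true P Px; sd_ACPx : AC true Px Pxx; sd_ACQ : AC true Q Qx;
  sd_ACPQ : AC false P Q; sd_ACPxQx : AC false Px Qx }.

Lemma distr_sup_ge0 (u : Defs.distribution R) : (0 <= distr_sup u)%E.
Proof. by apply/ereal_infP => _ [p _ <-]; exact: Lnorm_ge0. Qed.

Lemma symbol_norm_ub a c (u : Defs.distribution R) i j : (i <= a)%N -> (j <= c)%N ->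
  (distr_sup (iter i (@distr_dx R) (iter j (@distr_dxi R) u)) <= symbol_norm a c u)%E.
Proof. by move=> ia jc; apply: ereal_sup_ubound; exists (i, j). Qed.

Lemma symbol_norm_ge0 a c (u : Defs.distribution R) : (0 <= symbol_norm a c u)%E.
Proof. exact: le_trans (distr_sup_ge0 _) (symbol_norm_ub u (leq0n a) (leq0n c)). Qed.

Lemma symbol_norm_dxi (u : Defs.distribution R) : (symbol_norm 1 0 (distr_dxi u) <= symbol_norm 1 1 u)%E.
Proof.
apply: ge_ereal_sup => _ [[i j] /= [i1 j0] <-].
move: j0; rewrite leqn0 => /eqP -> /=; exact: (@symbol_norm_ub 1 1 u i 1).
Qed.

Lemma symbol_dataP p (M e M2 : R) : symbol_class 1 1 p -> (symbol_norm 1 1 (distr p) < M%:E)%E ->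
  (symbol_norm 1 0 (distr_dxi (distr p)) < e%:E)%E -> (symbol_norm 2 0 (distr p) < M2%:E)%E ->
  exists P Px Q Qx Pxx, symbol_data p P Px Q Qx Pxx M e M2.
Proof.
move=> [lp _] hM he hM2; have M0 : 0 <= M by rewrite -lee_fin (le_trans _ (ltW hM))// symbol_norm_ge0.
have e0 : 0 <= e by rewrite -lee_fin (le_trans _ (ltW he))// symbol_norm_ge0.
have M20 : 0 <= M2 by rewrite -lee_fin (le_trans _ (ltW hM2))// symbol_norm_ge0.
have [P [mP bP uP]] := distr_sup_representer M0 (le_lt_trans (@symbol_norm_ub 1 1 _ 0 0 isT isT) hM).
have [Px [mPx bPx uPx]] := distr_sup_representer M0 (le_lt_trans (@symbol_norm_ub 1 1 _ 1 0 isT isT) hM).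
have [Q [mQ bQ uQ]] := distr_sup_representer e0 (le_lt_trans (@symbol_norm_ub 1 0 _ 0 0 isT isT) he).
have [Qx [mQx bQx uQx]] := distr_sup_representer e0 (le_lt_trans (@symbol_norm_ub 1 0 _ 1 0 isT isT) he).
have [Pxx [mPxx bPxx uPxx]] := distr_sup_representer M20 (le_lt_trans (@symbol_norm_ub 2 0 _ 2 0 isT isT) hM2).
exists P, Px, Q, Qx, Pxx; split=> //.
- have [mp _] := lp.
  have h : {ae leb2, forall z, p z - P z = 0}.
    have eT phi psi : (fun z => (p z - P z) * (tensor phi psi z)%:C) =
      (fun z => p z * (tensor phi psi z)%:C - P z * (tensor phi psi z)%:C) by apply/funext => z; rewrite mulrBl.
    apply: zero_of_tensors_loc; first exact: cmeasB.
      move=> phi psi b1 b2; rewrite eT; apply: cintbleB; first exact: cintble_represent.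
      exact: cintble_bddM_tensor bP b1 b2.
    move=> phi psi b1 b2; rewrite eT cintB; last exact: (cintble_bddM_tensor mP bP b1 b2).
      by rewrite -(uP _ _ b1 b2) subrr.
    exact: cintble_represent.
  by apply: ae_imp h => z /eqP; rewrite subr_eq0 => /eqP.
- by apply: (AC_of_weak mP mPx bP bPx); exact: (weak_of_distr (b := true) (u := distr p) uP uPx).
- apply: (@AC_of_weak true Px Pxx (Num.max M M2)) => // [z|z|]; rewrite ?le_max ?bPx ?bPxx ?orbT//.
  exact: (weak_of_distr (b := true) (u := distr_dx (distr p)) uPx uPxx).
- by apply: (AC_of_weak mQ mQx bQ bQx); exact: (weak_of_distr (b := true) (u := distr_dxi (distr p)) uQ uQx).
- apply: (@AC_of_weak false P Q (Num.max M e)) => // [z|z|]; rewrite ?le_max ?bP ?bQ ?orbT//.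
  exact: (weak_of_distr (b := false) (u := distr p) uP uQ).
- apply: (@AC_of_weak false Px Qx (Num.max M e)) => // [z|z|]; rewrite ?le_max ?bPx ?bQx ?orbT//.
  (* [Qx] was obtained by differentiating in xi first and x second, whereas here it must be the
     xi-derivative of [Px]. On tensor products the two orders agree. *)
  move=> phi phi' psi b1 b1' b2 d; have [psi' bpsi' d'] := bump_isd b2.
  apply: (eq_trans (congr1 -%R (esym (uPx _ _ b2 b1')))); apply: (eq_trans _ (uQx _ _ b2 b1)).
  move: (distr p) => u /=; rewrite /distr_dx /distr_dxi (dx_tensor phi' d') (dx_tensor phi d').
  by rewrite (dxi_tensor psi' d).
Qed.
End WeakDerivatives.

(** * Square-integrable functions and density *)

Section SquareIntegrable.
Context {R : realType}.
Local Notation leb := (@lebesgue_measure R).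
Implicit Types (f g h : R -> R[i]).

Lemma L2normE f : L2norm f = (N2 f `^ 2^-1)%E.
Proof.
rewrite /L2norm /cLnorm unlock /N2; congr (_ `^ _)%E; apply: eq_integral => x _.
by rewrite gee0_abs ?lee_fin ?nc_ge0// poweR_EFin powR_mulrn ?nc_ge0.
Qed.

Lemma N2_ge0 f : (0 <= N2 f)%E.
Proof. by apply: nnint_ge0 => x; rewrite lee_fin sqr_ge0. Qed.

Lemma N2_L2norm f : N2 f = (L2norm f `^ 2)%E.
Proof. by rewrite L2normE -poweRrM mulVf// poweRe1// N2_ge0. Qed.

Lemma L2norm_ge0 f : (0 <= L2norm f)%E.
Proof. exact: Lnorm_ge0. Qed.

Lemma poweR_mono (r : R) (x y : \bar R) : 0 <= r -> (0 <= x)%E -> (x <= y)%E -> (x `^ r <= y `^ r)%E.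
Proof.
move=> r0 x0 xy; apply: gt0_ler_poweR => //; rewrite in_itv /= ?x0 ?leey//.
by rewrite (le_trans x0 xy).
Qed.

Lemma L2norm_leM f g (M : R) : 0 <= M -> (N2 f <= (M ^+ 2)%:E * N2 g)%E -> (L2norm f <= M%:E * L2norm g)%E.
Proof.
move=> M0 h; have h2 : (0 <= 2^-1 :> R) by rewrite invr_ge0.
have := poweR_mono h2 (N2_ge0 f) h; rewrite poweRM ?lee_fin ?sqr_ge0 ?N2_ge0//.
by rewrite poweR_EFin -powR_mulrn// -powRrM mulfV// powRr1// -!L2normE.
Qed.

Lemma N2_lty f : (L2norm f < +oo)%E <-> (N2 f < +oo)%E.
Proof.
split; first by rewrite N2_L2norm; exact: poweR_lty.
by rewrite L2normE; exact: poweR_lty.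
Qed.

Lemma N2_le f (c : R) : 0 <= c -> (L2norm f <= c%:E)%E -> (N2 f <= (c ^+ 2)%:E)%E.
Proof.
move=> c0 h; rewrite N2_L2norm; have := poweR_mono (r := 2) (ler0n _ _) (L2norm_ge0 f) h.
by rewrite poweR_EFin powR_mulrn.
Qed.

Lemma L2norm_le f (c : R) : 0 <= c -> (N2 f <= (c ^+ 2)%:E)%E -> (L2norm f <= c%:E)%E.
Proof.
move=> c0 h; have h2 : (0 <= 2^-1 :> R) by rewrite invr_ge0.
rewrite L2normE; have := poweR_mono h2 (N2_ge0 f) h.
by rewrite poweR_EFin -powR_mulrn// -powRrM mulfV// powRr1.
Qed.

Definition L2cvg0 (u : nat -> R -> R[i]) := forall e : R, 0 < e -> \forall n \near \oo, (N2 (u n) <= e%:E)%E.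

Lemma L2cvg0P (u : nat -> R -> R[i]) : (fun n => L2norm (u n)) @ \oo --> 0%E <-> L2cvg0 u.
Proof.
split.
  move=> /fine_cvgP[fn /cvgr0Pnorm_le cv] e e0.
  have s0 : 0 < Num.sqrt e by rewrite sqrtr_gt0.
  have := cv _ s0; apply: filterS2 fn => n fn h.
  rewrite -(sqr_sqrtr (ltW e0)); apply: N2_le; first exact: ltW.
  by rewrite -(fineK fn) lee_fin (le_trans (ler_norm _)).
move=> H; have H' e : 0 < e -> \forall n \near \oo, (L2norm (u n) <= e%:E)%E.
  by move=> e0; apply: filterS (H _ (exprn_gt0 2 e0)) => n; exact/L2norm_le/ltW.
apply/fine_cvgP; split.
  by apply: filterS (H' 1 ltr01) => n h; rewrite ge0_fin_numE ?L2norm_ge0// (le_lt_trans h)// ltry.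
apply/cvgr0Pnorm_le => e e0; apply: filterS (H' e e0) => n h /=.
have fn : L2norm (u n) \is a fin_num by rewrite ge0_fin_numE ?L2norm_ge0// (le_lt_trans h)// ltry.
by rewrite ger0_norm ?fine_ge0 ?L2norm_ge0// -lee_fin fineK.
Qed.

Lemma N2_ae f g : cmeasurable f -> cmeasurable g -> {ae leb, forall x, f x = g x} -> N2 f = N2 g.
Proof.
move=> mf mg h; apply/eqP; rewrite eq_le; apply/andP.
split; apply: ae_le_nnint; try (by mes); try (by move=> x; rewrite lee_fin sqr_ge0); apply: ae_imp h => x ->//.
Qed.

Lemma N2D f g : cmeasurable f -> cmeasurable g -> (N2 (fun x => f x + g x)%R <= 2%:E * N2 f + 2%:E * N2 g)%E.
Proof.
move=> mf mg; have p h x : (0 <= (nc (h x) ^+ 2)%:E)%E by rewrite lee_fin sqr_ge0.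
rewrite /N2 -!lebZ//; [|by mes|by mes].
rewrite -lebD//; [|by mes|by mes|by move=> x; rewrite mule_ge0|by move=> x; rewrite mule_ge0].
apply: le_nnint; [by mes|by mes|by move=> x; exact: (p (fun x => f x + g x))|move=> x].
rewrite -!EFinM -EFinD lee_fin; apply: (@le_trans _ _ ((nc (f x) + nc (g x)) ^+ 2)).
  by rewrite lerXn2r ?nnegrE ?addr_ge0 ?nc_ge0 ?ncD.
rewrite -subr_ge0 (_ : _ - _ = (nc (f x) - nc (g x)) ^+ 2) ?sqr_ge0//; ring.
Qed.

Lemma N2Z (c : R[i]) f : cmeasurable f -> (N2 (fun x => c * f x)%R = (nc c ^+ 2)%:E * N2 f)%E.
Proof.
move=> mf; rewrite /N2 -lebZ ?sqr_ge0//; [|by mes|by move=> x; rewrite lee_fin sqr_ge0].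
by apply: eq_integral => x _; rewrite -EFinM ncM exprMn.
Qed.

Lemma N2N f : N2 (fun x => - f x) = N2 f.
Proof. by apply: eq_integral => x _; rewrite ncN. Qed.

Lemma N2_sym f g : N2 (fun x => f x - g x) = N2 (fun x => g x - f x).
Proof. by rewrite -N2N; apply: eq_integral => x _; rewrite opprB. Qed.

Lemma N2_triangle f g h : cmeasurable f -> cmeasurable g -> cmeasurable h ->
  (N2 (fun x => f x - h x)%R <= 2%:E * N2 (fun x => f x - g x)%R + 2%:E * N2 (fun x => g x - h x)%R)%E.
Proof.
move=> mf mg mh; have := N2D (cmeasB mf mg) (cmeasB mg mh).
by under [X in N2 X]eq_fun do rewrite addrA subrK.
Qed.

Lemma N2_eq0 f : cmeasurable f -> (forall e : R, 0 < e -> (N2 f <= e%:E)%E) -> {ae leb, forall x, f x = 0}.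
Proof.
move=> mf h; have N0 : N2 f = 0%E.
  apply/eqP; rewrite eq_le N2_ge0 andbT; apply/lee_addgt0Pr => e e0.
  by rewrite add0e; exact: h.
have m2 : measurable_fun setT (fun x => (nc (f x) ^+ 2)%:E) by mes.
have [+ _] := ae_eq_integral_abs leb measurableT m2.
under eq_integral do rewrite gee0_abs ?lee_fin ?sqr_ge0//.
move=> /(_ N0); apply: ae_imp => x /= /(_ I) [] /eqP; rewrite sqrf_eq0 => /eqP; exact: nc_eq0.
Qed.

Lemma N2_fatou (u : nat -> R -> R[i]) h (c : \bar R) : (forall n, cmeasurable (u n)) -> cmeasurable h ->
  {ae leb, forall x, nc (u n x - h x) @[n --> \oo] --> (0 : R)} -> (forall n, (N2 (u n) <= c)%E) -> (N2 h <= c)%E.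
Proof.
move=> mu mh cv uc; pose f n x := (nc (u n x) ^+ 2)%:E.
have mf n : measurable_fun setT (f n) by rewrite /f; mes.
have f0 n x : setT x -> (0 <= f n x)%E by move=> _; rewrite lee_fin sqr_ge0.
have := fatou leb measurableT mf f0 => H.
have mE : measurable_fun setT (fun x => limn_einf (f ^~ x)).
  rewrite (_ : (fun x => _) = (fun x => - limn_esup (fun n => - f n x))%E)//.
  by apply: measurableT_comp => //; apply: measurable_fun_limn_esup => n; apply: measurableT_comp.
apply: (@le_trans _ _ (\int[leb]_x limn_einf (f ^~ x))%E).
  have e x : nc (u n x - h x) @[n --> \oo] --> (0 : R) -> limn_einf (f ^~ x) = (nc (h x) ^+ 2)%:E.
    move=> hx; suff /cvg_limn_einf_sup[-> _//] : f ^~ x @ \oo --> (nc (h x) ^+ 2)%:E.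
    apply: cvg_EFin; first by exists 0%N.
    have nn : nc (u n x) @[n --> \oo] --> nc (h x).
      apply/cvgrPdist_le => e e0; move/cvgr0Pnorm_le : hx => /(_ e e0).
      apply: filterS => n; rewrite (ger0_norm (nc_ge0 _)); apply: le_trans.
      rewrite distrC ler_norml; have := ncD (u n x - h x) (h x); rewrite subrK => h1.
      have := ncB (u n x) (u n x - h x); rewrite subKr => h2; apply/andP; split; lra.
    rewrite (_ : fine \o f ^~ x = (fun n => nc (u n x) * nc (u n x))); first by rewrite expr2; exact: cvgM.
    by apply/funext => n; rewrite /f /= expr2.
  apply: ae_le_nnint => //; [by mes|by move=> x; rewrite lee_fin sqr_ge0| |].
    move=> x; rewrite limn_einf_lim; apply: lime_ge; first exact: is_cvg_einfs.
    by exists 0%N => // n _; apply: le_ereal_inf_tmp => _ [k _ <-]; rewrite lee_fin sqr_ge0.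
  by apply: ae_imp cv => x /e ->.
apply: le_trans H _; rewrite limn_einf_lim; apply: lime_le; first exact: is_cvg_einfs.
by exists 0%N => // n _; apply: le_trans (uc n); apply: ereal_inf_lbound; exists n => /=.
Qed.

Lemma N2_dominated (u : nat -> R -> R[i]) h (G : R -> R) : (forall n, cmeasurable (u n)) -> cmeasurable h ->
  measurable_fun setT G -> (\int[leb]_x (G x ^+ 2)%:E < +oo)%E -> (forall n x, nc (u n x - h x) <= G x) ->
  {ae leb, forall x, nc (u n x - h x) @[n --> \oo] --> (0 : R)} -> L2cvg0 (fun n x => u n x - h x).
Proof.
move=> mu mh mG Goo uG cv e e0.
pose f n x := ((nc (u n x - h x) ^+ 2)%:C : R[i]).
have mf n : cmeasurable (f n) by apply: cmeasR; apply: measurable_funX; exact: cmeas_nc (cmeasB (mu n) mh).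
have c : nc (cintegral leb (f n) - cintegral leb (fun=> 0)) @[n --> \oo] --> (0 : R).
  have m0 : cmeasurable (fun _ : R => 0 : R[i]) by exact: cmeas_cst.
  apply: (@cdominated _ _ _ leb f (fun=> 0) (fun x => G x ^+ 2) mf m0 _ Goo _ _).2; [by mes| |].
    by move=> n x; rewrite ncR ger0_norm ?sqr_ge0// lerXn2r ?nnegrE ?nc_ge0// (le_trans (nc_ge0 _) (uG n x)).
  apply: ae_imp cv => x hx; rewrite (_ : (fun n => _) = (fun n => nc (u n x - h x) * nc (u n x - h x))).
    by rewrite -[X in _ --> X](mul0r 0); exact: cvgM.
  by apply/funext => n; rewrite /f subr0 ncR ger0_norm ?sqr_ge0// expr2.
move/cvgr0Pnorm_le : c => /(_ e e0); apply: filterS => n.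
rewrite cint0 subr0 ger0_norm ?nc_ge0// -lee_fin => h1.
have mn : cmeasurable (fun x => u n x - h x) by apply: cmeasB.
have mun := mu n; have int_lt : (\int[leb]_x (nc (u n x - h x) ^+ 2)%:E < +oo)%E.
  apply: le_lt_trans Goo; apply: le_nnint; [by mes|by mes|by move=> x; rewrite lee_fin sqr_ge0|move=> x].
  by rewrite lee_fin lerXn2r ?nnegrE ?nc_ge0// (le_trans (nc_ge0 _) (uG n x)).
rewrite /N2 (cint_real_ge0 _ _ int_lt)//; by [mes|move=> x; exact: sqr_ge0].
Qed.

Definition trunc (n : nat) h (x : R) : R[i] := if (`|x| <= n%:R) && (nc (h x) <= n%:R) then h x else 0.

Lemma nice_trunc n h : cmeasurable h -> nice n%:R (trunc n h).
Proof.
move=> mh; split=> [|x|x xn].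
- apply: cmeas_if => //; apply: measurable_and; apply: measurable_fun_ler => //; first by mes.
- by rewrite /trunc; case: ifP => [/andP[]//|_]; rewrite nc0.
- by rewrite /trunc leNgt xn.
Qed.

Lemma trunc_near h x : \forall n \near \oo, trunc n h x = h x.
Proof.
exists (Num.trunc (`|x| + nc (h x))).+1 => // n /= hn.
have hlt : `|x| + nc (h x) < n%:R by apply: lt_le_trans (truncnS_gt _) _; rewrite ler_nat.
have := normr_ge0 x; have := nc_ge0 (h x) => h1 h2.
by rewrite /trunc !ifT//; apply/andP; split; lra.
Qed.

Lemma nc_trunc n h x : nc (trunc n h x) <= nc (h x).
Proof. by rewrite /trunc; case: ifP; rewrite ?nc0 ?nc_ge0. Qed.

Lemma N2_trunc_lty h n : cmeasurable h -> (N2 (trunc n h) < +oo)%E.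
Proof. by move=> mh; exact: (N2_nice_lty (nice_trunc n mh)). Qed.

Lemma trunc_cvg h : cmeasurable h -> (N2 h < +oo)%E -> L2cvg0 (fun n x => trunc n h x - h x).
Proof.
move=> mh hoo; apply: (@N2_dominated _ _ (fun x => nc (h x))) => //.
- by move=> n; have [] := nice_trunc n mh.
- by mes.
- by move=> n x; rewrite /trunc; case: ifP; rewrite ?subrr ?nc0 ?nc_ge0// sub0r ncN.
- by apply: ae_true => x; apply: nc_cvg0_near; exact: trunc_near.
Qed.

(** Test with g = l times the conjugate of a truncation of h. If A is the squared norm of the
    truncation, then l A <= c (l^2 A + E), and l = 1 / (2 c) gives A <= 4 c^2 E. The truncation
    makes A finite, so that it can be absorbed, and is removed by Fatou. *)
Lemma N2_dual h (c E : R) : cmeasurable h -> 0 < c -> 0 <= E ->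
  (forall N g, nice N g -> ((nc (cintegral leb (fun x => g x * h x)))%:E <= c%:E * (N2 g + E%:E))%E) ->
  (N2 h <= (4 * c ^+ 2 * E)%:E)%E.
Proof.
move=> mh c0 E0 H; apply: (@N2_fatou (fun n => trunc n h)) => //.
- by move=> n; have [] := nice_trunc n mh.
- by apply: ae_true => x; apply: nc_cvg0_near; exact: trunc_near.
move=> n; have [mn bn zn] := nice_trunc n mh; have fn := N2_trunc_lty n mh.
pose l := (2 * c)^-1; have l0 : 0 < l by rewrite invr_gt0 mulr_gt0.
pose g x := l%:C * (trunc n h x)^*.
have ng : nice ((l + 1) * n%:R) g.
  split=> [|x|x xn].
  - by apply: cmeasM => //; exact: cmeasJ.
  - rewrite /g ncM ncR gtr0_norm// ncJ; apply: (@le_trans _ _ (l * n%:R)); first by rewrite ler_wpM2l// ltW.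
    by rewrite ler_wpM2r// lerDl.
  - rewrite /g zn ?rmorph0 ?mulr0//; apply: le_lt_trans xn.
    by rewrite mulrDl mul1r lerDr mulr_ge0// ltW.
have e x : g x * h x = (l * nc (trunc n h x) ^+ 2)%:C.
  rewrite (_ : (l * nc (trunc n h x) ^+ 2)%:C = l%:C * (nc (trunc n h x) ^+ 2)%:C); last by rewrite -rmorphM.
  rewrite -mulcJ /g -mulrA; congr (_ * _); rewrite mulrC /trunc.
  by case: ifP; rewrite // rmorph0 !mulr0.
have := H _ _ ng; rewrite (@eq_cint _ _ _ leb _ _ e).
have mt : measurable_fun setT (fun x => nc (trunc n h x)) by exact: cmeas_nc.
have Ie : (\int[leb]_x (l * nc (trunc n h x) ^+ 2)%:E = l%:E * N2 (trunc n h))%E.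
  by rewrite /N2 -lebZ ?(ltW l0)//; [by mes|by move=> x; rewrite lee_fin sqr_ge0].
rewrite -cint_real_ge0; [|by mes|by move=> x; rewrite mulr_ge0 ?sqr_ge0// ltW|by rewrite Ie lte_mul_pinfty// lee_fin ltW].
rewrite Ie /g N2Z; last exact: cmeasJ.
have -> : N2 (fun x => (trunc n h x)^*) = N2 (trunc n h) by apply: eq_integral => x _; rewrite ncJ.
rewrite ncR gtr0_norm//; have fin : N2 (trunc n h) \is a fin_num by rewrite ge0_fin_numE ?N2_ge0.
clear Ie fn; move: (N2 (trunc n h)) fin => [A _| |]//.
have -> : (c%:E * ((l ^+ 2)%:E * A%:E + E%:E) = (c * (l ^+ 2 * A + E))%:E)%E by [].
rewrite -EFinM !lee_fin => h1.
have cl : c * l = 2^-1 by rewrite /l invfM mulrCA mulfV ?gt_eqF// mulr1.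
have h2 : l * A <= 2^-1 * l * A + c * E by rewrite -cl; lra.
have h3 : 2 * c * (l * A) <= 2 * c * (2 * c * E) by rewrite ler_wpM2l ?mulr_ge0 ?(ltW c0)//; lra.
have -> : A = 2 * c * (l * A) by rewrite mulrA (_ : 2 * c * l = 1) ?mul1r// -mulrA cl mulfV.
by apply: le_trans h3 _; rewrite le_eqVlt; apply/orP; left; apply/eqP; ring.
Qed.
End SquareIntegrable.

(** * Completeness of L^2 along rapidly Cauchy sequences *)

Section Completeness.
Context {R : realType}.
Local Notation leb := (@lebesgue_measure R).
Implicit Types (f g h : R -> R[i]).

(** The triangle inequality for squared norms costs a factor 2 at each step; the ratio 1/8 outweighs
    it, since 2 times 4/8 plus 2 is at most 4. *)
Lemma N2_chain (u : nat -> R -> R[i]) : (forall n, cmeasurable (u n)) ->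
  (forall n, (N2 (fun x => u n.+1 x - u n x)%R <= (8^-1 ^+ n)%:E)%E) ->
  forall k n, (N2 (fun x => u (n + k)%N x - u n x)%R <= (4 * 8^-1 ^+ n)%:E)%E.
Proof.
move=> mu hu; elim=> [|k IH] n.
  rewrite addn0 (_ : N2 _ = 0%E) ?lee_fin ?mulr_ge0 ?exprn_ge0 ?invr_ge0//.
  rewrite /N2; under eq_integral do rewrite subrr nc0 expr0n.
  by rewrite integral0.
rewrite addnS -addSn; apply: le_trans (N2_triangle (mu _) (mu n.+1) (mu n)) _.
apply: (@le_trans _ _ (2%:E * (4 * 8^-1 ^+ n.+1)%:E + 2%:E * (8^-1 ^+ n)%:E)%E).
  by apply: leeD; apply: lee_wpmul2l; rewrite ?lee_fin//.
rewrite -!EFinM -EFinD lee_fin exprS.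
have : 0 <= (8^-1 : R) ^+ n by rewrite exprn_ge0// invr_ge0.
set a := _ ^+ n => a0; lra.
Qed.

Lemma cvg_of_summable (u : nat -> R) (W : R) : (forall n, `|u n.+1 - u n| <= W * 2^-1 ^+ n) -> cvgn u.
Proof.
move=> hu; have -> : u = (fun n => u 0%N + series (fun k => u k.+1 - u k) n).
  by apply/funext => n; rewrite seriesEnat /= telescope_sumr// addrC subrK.
apply: is_cvgD; first exact: is_cvg_cst.
apply: normed_cvg; apply: (@series_le_cvg _ _ (fun n => W * 2^-1 ^+ n)) => //.
- by move=> n /=.
- by move=> n; exact: le_trans (hu n).
- have := @is_cvg_geometric_series R W 2^-1; apply.
  by rewrite ger0_norm ?invr_ge0// invf_lt1// ltr1n.
Qed.

(** The sum of 4^n |u_(n+1) - u_n|^2 has integral at most the sum of 2^-n. Where it is finite the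
    increments are at most W 2^-n, so the sequence converges pointwise almost everywhere; Fatou
    turns this into convergence in L^2. *)
Lemma L2_complete (u : nat -> R -> R[i]) : (forall n, cmeasurable (u n)) ->
  (forall n, (N2 (fun x => u n.+1 x - u n x)%R <= (8^-1 ^+ n)%:E)%E) ->
  exists2 g, cmeasurable g & L2cvg0 (fun n x => u n x - g x).
Proof.
move=> mu hu; pose w n x := (4 ^+ n * nc (u n.+1 x - u n x) ^+ 2)%:E.
have mun n : measurable_fun setT (fun x => nc (u n.+1 x - u n x)) by exact: cmeas_nc (cmeasB (mu n.+1) (mu n)).
have mw n : measurable_fun setT (w n).
  by apply/measurable_EFinP; apply: measurable_funM => //; exact: measurable_funX.
have w0 n x : (0 <= w n x)%E by rewrite lee_fin mulr_ge0 ?sqr_ge0 ?exprn_ge0.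
have Iw : (\int[leb]_x (\sum_(n <oo) w n x) < +oo)%E.
  rewrite integral_nneseries//.
  apply: (@le_lt_trans _ _ (\sum_(n <oo) (2^-1 ^+ n)%:E)%E).
    apply: lee_nneseries => [n _ _|n _]; first by apply: integral_ge0.
    rewrite /w; under eq_integral do rewrite EFinM.
    rewrite lebZ ?exprn_ge0//; [|by apply/measurable_EFinP; exact: measurable_funX|by move=> x; rewrite lee_fin sqr_ge0].
    apply: le_trans (lee_wpmul2l _ (hu n)) _; first by rewrite lee_fin exprn_ge0.
    rewrite -EFinM lee_fin -exprMn (_ : 4 * 8^-1 = 2^-1 :> R)//; lra.
  have c : cvgn (series (fun n => 2^-1 ^+ n : R)).
    have := @is_cvg_geometric_series R 1 2^-1; rewrite (_ : geometric 1 2^-1 = (fun n => 2^-1 ^+ n)); last first.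
      by apply/funext => n; rewrite /geometric /= mul1r.
    by apply; rewrite ger0_norm ?invr_ge0// invf_lt1// ltr1n.
  rewrite (_ : (\sum_(n <oo) (2^-1 ^+ n)%:E)%E = (limn (series (fun n => 2^-1 ^+ n : R)))%:E) ?ltry//.
  apply: cvg_lim => //; under eq_fun do rewrite sumEFin.
  by apply: cvg_EFin; [exists 0%N|rewrite /=; exact: c].
have ms : measurable_fun setT (fun x => \sum_(n <oo) w n x)%E by apply: ge0_emeasurable_sum.
have aeW : {ae leb, forall x, ((\sum_(n <oo) w n x) < +oo)%E}.
  have : leb.-integrable setT (fun x => \sum_(n <oo) w n x)%E.
    apply/integrableP; split => //; under eq_integral do rewrite gee0_abs ?nneseries_ge0//.
    exact: Iw.
  move=> /(integrable_ae measurableT); apply: ae_imp => x /(_ I).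
  by rewrite ge0_fin_numE// nneseries_ge0.
have dW x : ((\sum_(n <oo) w n x) < +oo)%E ->
    exists W : R, forall n, nc (u n.+1 x - u n x) <= W * 2^-1 ^+ n.
  move=> Wx; have W0 : (0 <= \sum_(n <oo) w n x)%E by apply: nneseries_ge0.
  exists (Num.sqrt (fine (\sum_(n <oo) w n x))) => n.
  have h : (w n x <= \sum_(n <oo) w n x)%E.
    apply: le_trans (nneseries_lim_ge n.+1 _) => //.
    by rewrite big_nat_recr//= leeDr// sume_ge0.
  have fS : (\sum_(n <oo) w n x)%E \is a fin_num by rewrite ge0_fin_numE.
  rewrite -(fineK fS) lee_fin in h.
  rewrite -(@ler_pXn2r _ 2) ?nnegrE ?nc_ge0 ?mulr_ge0 ?sqrtr_ge0 ?exprn_ge0 ?invr_ge0//.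
  rewrite exprMn sqr_sqrtr ?fine_ge0// -exprM mulnC exprM.
  rewrite (_ : (2^-1 : R) ^+ 2 = 4^-1); last by rewrite exprVn -natrX.
  by rewrite exprVn ler_pdivlMr ?exprn_gt0// mulrC.
(* An upper limit is measurable without knowing where the sequence converges, and equals the limit
   wherever there is one. *)
pose L (v : nat -> R -> R) x := fine (limn_esup (fun n => (v n x)%:E)).
pose ur n x := complex.Re (u n x); pose ui n x := complex.Im (u n x).
pose g x := L ur x +i* L ui x.
have mL v : (forall n, measurable_fun setT (v n)) -> measurable_fun setT (L v).
  move=> mv; apply: measurableT_comp; first exact: fine_measurable.
  by apply: measurable_fun_limn_esup => n; exact/measurable_EFinP.
have mg : cmeasurable g by split; apply: mL => n; have [] := mu n.
have Lcvg v x : cvgn (fun n => v n x) -> v n x @[n --> \oo] --> L v x.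
  move=> /cvg_ex[l hl]; suff -> : L v x = l by [].
  have : (fun n => (v n x)%:E) @ \oo --> l%:E by apply: cvg_EFin; [exists 0%N|].
  by rewrite /L => /cvg_limn_einf_sup[_ ->].
have cg : {ae leb, forall x, nc (u n x - g x) @[n --> \oo] --> (0 : R)}.
  apply: ae_imp aeW => x /dW[W hW].
  have cr : cvgn (ur^~ x).
    by apply: (@cvg_of_summable _ W) => n; rewrite /ur -ReN -ReD; exact: le_trans (normRe_le_nc _) (hW n).
  have ci : cvgn (ui^~ x).
    by apply: (@cvg_of_summable _ W) => n; rewrite /ui -ImN -ImD; exact: le_trans (normIm_le_nc _) (hW n).
  apply: (@squeeze_cvgr _ _ _ _ (fun=> 0) (fun n => `|ur n x - L ur x| + `|ui n x - L ui x|)).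
  - exists 0%N => // n _; rewrite nc_ge0/= (le_trans (nc_le_ReIm _))//.
    by rewrite ReD ImD ReN ImN.
  - exact: cvg_cst.
  - rewrite -[X in _ --> X](addr0 0); apply: cvgD; rewrite -[X in _ --> X](@normr0 _ R); apply: cvg_norm.
    + by rewrite -(subrr (L ur x)); apply: cvgB; [exact: Lcvg|exact: cvg_cst].
    + by rewrite -(subrr (L ui x)); apply: cvgB; [exact: Lcvg|exact: cvg_cst].
exists g => // e e0.
have Hn n : (N2 (fun x => u n x - g x)%R <= (4 * 8^-1 ^+ n)%:E)%E.
  apply: (@N2_fatou _ (fun k x => u n x - u (n + k)%N x)).
  - by move=> k; apply: cmeasB.
  - exact: cmeasB.
  - apply: ae_imp cg => x hx; rewrite (_ : (fun k => _) = (fun k => nc (u (k + n)%N x - g x))).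
      by move: hx; rewrite -(cvg_shiftn n).
    by apply/funext => k; rewrite -ncN addnC; congr (nc _); ring.
  - by move=> k; rewrite N2_sym; exact: N2_chain.
have c : (4 * 8^-1 ^+ n : R) @[n --> \oo] --> (0 : R).
  by have := @cvg_geometric R 4 8^-1; apply; rewrite ger0_norm ?invr_ge0// invf_lt1// ltr1n.
move/cvgr0Pnorm_le : c => /(_ e e0); apply: filterS => n h.
by apply: le_trans (Hn n) _; rewrite lee_fin (le_trans (ler_norm _)).
Qed.
End Completeness.

(** * Schwartz functions and their Fourier transforms *)

Section Schwartz.
Context {R : realType}.
Local Notation leb := (@lebesgue_measure R).
Implicit Types (f g h : R -> R[i]).

Definition cauchy_weight (x : R) : R := (1 + x ^+ 2)^-1.

Lemma cauchy_weightE x : cauchy_weight x = pi * poisson (2 * pi) x.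
Proof.
have p0 := @pi_gt0 R; rewrite /poisson /cauchy_weight.
have h1 : 1 + x ^+ 2 != 0 by rewrite gt_eqF// ltr_wpDr ?sqr_ge0.
have -> : (2 * pi) ^+ 2 + (2 * pi * x) ^+ 2 = 4 * pi ^+ 2 * (1 + x ^+ 2) by ring.
have pn : pi != 0 :> R by rewrite gt_eqF.
clear p0; move: (pi : R) pn (1 + x ^+ 2) h1 => p pn d dn.
by field; rewrite ?dn ?pn.
Qed.

Lemma cauchy_weight_gt0 x : 0 < cauchy_weight x.
Proof. by rewrite invr_gt0 ltr_wpDr ?sqr_ge0. Qed.

Lemma cauchy_weight_le1 x : cauchy_weight x <= 1.
Proof. by rewrite invf_le1 ?ltr_wpDr ?sqr_ge0// lerDl sqr_ge0. Qed.

Lemma measurable_cauchy_weight : measurable_fun setT cauchy_weight.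
Proof.
rewrite (_ : cauchy_weight = (fun x => pi * poisson (2 * pi) x)); last exact/funext/cauchy_weightE.
by apply: measurable_funM => //; apply: measurable_poisson; rewrite mulr_gt0 ?pi_gt0.
Qed.

Lemma integral_cauchy_weight : (\int[leb]_x (cauchy_weight x)%:E = pi%:E)%E.
Proof.
have p0 := @pi_gt0 R; have p2 : 0 < 2 * pi :> R by rewrite mulr_gt0.
under eq_integral do rewrite cauchy_weightE EFinM.
rewrite lebZ ?(ltW p0) ?integral_poisson ?mule1//.
  by apply/measurable_EFinP; exact: measurable_poisson.
by move=> x; rewrite lee_fin poisson_ge0.
Qed.

Lemma cintble_weight f (C : R) : 0 <= C -> cmeasurable f -> (forall x, nc (f x) <= C * cauchy_weight x) -> cintble leb f.
Proof.
move=> C0 mf fC; apply: (@cintble_dom _ _ _ leb _ (fun x => C * cauchy_weight x)) => //.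
  by apply: measurable_funM => //; exact: measurable_cauchy_weight.
under eq_integral do rewrite EFinM.
rewrite lebZ// ?integral_cauchy_weight ?ltry//.
  by apply/measurable_EFinP; exact: measurable_cauchy_weight.
by move=> x; rewrite lee_fin ltW// cauchy_weight_gt0.
Qed.

Lemma N2_bdd_lty f (C : R) : cintble leb f -> (forall x, nc (f x) <= C) -> (N2 f < +oo)%E.
Proof.
move=> [mf foo] fC; have C0 : 0 <= C by exact: le_trans (nc_ge0 _) (fC 0).
apply: (@le_lt_trans _ _ (C%:E * \int[leb]_x (nc (f x))%:E)%E); last by rewrite lte_mul_pinfty.
rewrite -lebZ//; [|by mes|by move=> x; rewrite lee_fin nc_ge0].
apply: le_nnint; [by mes|by mes|by move=> x; rewrite lee_fin sqr_ge0|move=> x].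
by rewrite -EFinM lee_fin expr2 ler_wpM2r ?nc_ge0.
Qed.

(** With w = 1 + (2 pi xi)^2, the modulus of the transform is at most w times its square plus 1 / w.
    By [fourier_derivative] the first term is the sum of the squared transforms of h and h',
    integrable by Bessel. *)
Lemma cintble_fourier_sobolev h h' : cintble leb h -> cintble leb h' -> (N2 h < +oo)%E -> (N2 h' < +oo)%E ->
  (forall n, {ae leb, forall y, h (y + n.+1%:R^-1) - h y = cintegral leb (fun w => win 0 n.+1%:R^-1 w * h' (y + w))}) ->
  cintble leb (fourier h).
Proof.
move=> hi hi' hoo hoo' H; have [mh _] := hi; have [mh' _] := hi'.
pose w (xi : R) := 1 + (2 * pi * xi) ^+ 2.
have w0 xi : 0 < w xi by rewrite /w ltr_wpDr ?sqr_ge0.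
have F' xi : nc (fourier h' xi) ^+ 2 = (2 * pi * xi) ^+ 2 * nc (fourier h xi) ^+ 2.
  by rewrite (fourier_derivative xi hi hi' H) ncM exprMn nc_imag.
pose G xi := nc (fourier h xi) ^+ 2 + nc (fourier h' xi) ^+ 2 + 2^-1 * poisson 1 xi.
have mp := measurable_poisson (@ltr01 R).
have mf : cmeasurable (fourier h) by exact: cmeas_fourier.
have mf' : cmeasurable (fourier h') by exact: cmeas_fourier.
have mG1 : measurable_fun setT (fun xi => nc (fourier h xi) ^+ 2) by apply: measurable_funX; exact: cmeas_nc.
have mG2 : measurable_fun setT (fun xi => nc (fourier h' xi) ^+ 2) by apply: measurable_funX; exact: cmeas_nc.
apply: (@cintble_dom _ _ _ leb _ G) => //.
- by apply: measurable_funD; [exact: measurable_funD|exact: measurable_funM].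
- move=> xi; apply: le_trans (le_amgm1 (w0 xi) (nc_ge0 _)) _.
  by rewrite /G F' /w half_poisson ?w0//; lra.
- under eq_integral do rewrite !EFinD (EFinM 2^-1).
  rewrite !lebD//.
  + rewrite lebZ ?invr_ge0// ?integral_poisson// ?mule1.
    * apply: lte_add_pinfty; last by rewrite ltry.
      by apply: lte_add_pinfty; [exact: le_lt_trans (bessel hi) hoo|exact: le_lt_trans (bessel hi') hoo'].
    * exact/measurable_EFinP.
    * by move=> x; rewrite lee_fin poisson_ge0.
  + exact/measurable_EFinP.
  + exact/measurable_EFinP.
  + by move=> x; rewrite lee_fin sqr_ge0.
  + by move=> x; rewrite lee_fin sqr_ge0.
  + by apply: emeasurable_funD; exact/measurable_EFinP.
  + by apply/measurable_EFinP; exact: measurable_funM.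
  + by move=> x; rewrite -EFinD lee_fin addr_ge0 ?sqr_ge0.
  + by move=> x; rewrite -EFinM lee_fin mulr_ge0 ?invr_ge0// poisson_ge0.
Qed.

Lemma schwartz_real_decay (h : R -> R) n : schwartz_real h ->
  exists2 C, 0 <= C & forall x, `|derive1n n h x| <= C * cauchy_weight x.
Proof.
move=> [_ H]; have [M0 h0] := H 0%N n; have [M2 h2] := H 2%N n.
have M00 : 0 <= M0 by exact: le_trans (normr_ge0 _) (h0 0).
have M20 : 0 <= M2 by exact: le_trans (normr_ge0 _) (h2 0).
exists (M0 + M2) => [|x]; first exact: addr_ge0.
rewrite /cauchy_weight ler_pdivlMr ?ltr_wpDr ?sqr_ge0// mulrDr mulr1.
have := h0 x; have := h2 x; rewrite expr0 mul1r normrM ger0_norm ?sqr_ge0//; lra.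
Qed.

Lemma schwartz_real_continuous (h : R -> R) n : schwartz_real h -> continuous (derive1n n h).
Proof. by move=> [d _] x; apply: differentiable_continuous; apply/derivable1_diffP; exact: d. Qed.

Lemma schwartz_isd (h : R -> R) n (x : R) : schwartz_real h -> is_derive x 1 (derive1n n h) (derive1n n.+1 h x).
Proof. by move=> [d _]; rewrite derive1nS derive1E; apply: derivableP; exact: d. Qed.

Lemma schwartz_facts f : schwartz f ->
  [/\ cintble leb f, (N2 f < +oo)%E & cintble leb (fourier f)].
Proof.
move=> [sr si]; have S (k : nat) : let g x := derive1n k (fun x => complex.Re (f x)) x +i* derive1n k (fun x => complex.Im (f x)) x in
    cintble leb g /\ (N2 g < +oo)%E.
  move=> g; have mg : cmeasurable g by split; apply: continuous_measurable_fun; exact: schwartz_real_continuous.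
  have [A A0 fA] := schwartz_real_decay k sr; have [B B0 fB] := schwartz_real_decay k si.
  have gb x : nc (g x) <= (A + B) * cauchy_weight x.
    by apply: le_trans (nc_le_ReIm _) _; rewrite mulrDl; exact: lerD (fA x) (fB x).
  have gi : cintble leb g by apply: (cintble_weight (C := A + B)) => //; exact: addr_ge0.
  split=> //; apply: (N2_bdd_lty (C := A + B) gi) => x; apply: le_trans (gb x) _.
  by rewrite ler_piMr ?addr_ge0 ?cauchy_weight_le1.
have fE : (fun x => derive1n 0 (fun x => complex.Re (f x)) x +i* derive1n 0 (fun x => complex.Im (f x)) x) = f.
  by apply/funext => x /=; case: (f x).
have := S 0%N; rewrite /= -/(derive1n 0 _) fE => -[fi foo]; have [fi' foo'] := S 1%N; split=> //.
apply: (cintble_fourier_sobolev fi fi' foo foo') => n; apply: ae_true => y.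
have n0 : 0 <= n.+1%:R^-1 :> R by rewrite invr_ge0.
have T (h : R -> R) : schwartz_real h ->
    cintegral leb (fun w => win 0 n.+1%:R^-1 w * (derive1n 1 h (y + w))%:C) = (h (y + n.+1%:R^-1) - h y)%:C.
  move=> sh; have d (w : R) : is_derive w 1 (fun w => h (y + w)) (derive1n 1 h (y + w)).
    apply: isd_eq (isd_comp (isdD (isdc y w) (isdid w)) (schwartz_isd 0 (y + w) sh)) _.
    by rewrite add0r mul1r.
  rewrite (cint_FTC n0 d) ?addr0// => w.
  apply: (continuous_comp (f := fun w => y + w)); last exact: schwartz_real_continuous.
  by apply: cvgD; [exact: cvg_cst|exact: cvg_id].
have Tr := T _ sr; have Ti := T _ si.
have iT (h : R -> R) : schwartz_real h -> cintble leb (fun w => win 0 n.+1%:R^-1 w * (derive1n 1 h (y + w))%:C).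
  move=> sh; have [C C0 hC] := schwartz_real_decay 1 sh.
  rewrite (_ : (fun w => _) = (fun w => (derive1n 1 h (y + w))%:C * win 0 n.+1%:R^-1 w)); last by apply/funext => w; rewrite mulrC.
  apply: (@cintble_bddM _ _ _ leb _ _ C) (cintble_win _ _) => [|w].
    have mh : measurable_fun setT (derive1n 1 h) by apply: continuous_measurable_fun; exact: schwartz_real_continuous.
    by apply: cmeasR; apply: (meas_comp_of mh); mes.
  by rewrite ncR (le_trans (hC _))// ler_piMr// cauchy_weight_le1.
have e w : win 0 n.+1%:R^-1 w * (derive1n 1 (fun x => complex.Re (f x)) (y + w) +i* derive1n 1 (fun x => complex.Im (f x)) (y + w)) =
   win 0 n.+1%:R^-1 w * (derive1n 1 (fun x => complex.Re (f x)) (y + w))%:C +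
   'i%C * (win 0 n.+1%:R^-1 w * (derive1n 1 (fun x => complex.Im (f x)) (y + w))%:C).
  rewrite mulrCA -mulrDr; congr (_ * _); apply: complex_ext; rewrite ?ReD ?ImD ?ReM ?ImM /=; ring.
rewrite (@eq_cint _ _ _ leb _ _ e) (cintD (iT _ sr) (cintbleZ _ (iT _ si))) (cintZl _ (iT _ si)) Tr Ti.
apply: complex_ext; rewrite ?ReD ?ImD ?ReM ?ImM ?ReN ?ImN /=; ring.
Qed.

Lemma derive1nD (f g : R -> R) n : (forall k x, derivable (derive1n k f) x 1) -> (forall k x, derivable (derive1n k g) x 1) ->
  derive1n n (fun x => f x + g x) = (fun x => derive1n n f x + derive1n n g x).
Proof.
move=> df dg; elim: n => [//|n IH]; rewrite derive1nS IH; apply/funext => x.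
by rewrite !derive1nS !derive1E deriveD//.
Qed.

Lemma derive1nZ (c : R) (f : R -> R) n : (forall k x, derivable (derive1n k f) x 1) ->
  derive1n n (fun x => c * f x) = (fun x => c * derive1n n f x).
Proof.
move=> df; elim: n => [//|n IH]; rewrite derive1nS IH; apply/funext => x.
by rewrite !derive1nS !derive1E deriveZ//.
Qed.

Lemma schwartz_realD (f g : R -> R) : schwartz_real f -> schwartz_real g -> schwartz_real (fun x => f x + g x).
Proof.
move=> [df bf] [dg bg]; split=> [n x|k n]; rewrite derive1nD//.
  by apply: derivableD; [exact: df|exact: dg].
have [A fA] := bf k n; have [B gB] := bg k n; exists (A + B) => x.
by rewrite mulrDr (le_trans (ler_normD _ _))// lerD.
Qed.

Lemma schwartz_realZ (c : R) (f : R -> R) : schwartz_real f -> schwartz_real (fun x => c * f x).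
Proof.
move=> [df bf]; split=> [n x|k n]; rewrite derive1nZ//.
  by apply: derivableZ; exact: df.
by have [A fA] := bf k n; exists (`|c| * A) => x; rewrite mulrCA normrM ler_wpM2l.
Qed.

Lemma schwartzD f g : schwartz f -> schwartz g -> schwartz (fun x => f x + g x).
Proof.
move=> [f1 f2] [g1 g2]; split.
  by rewrite (_ : (fun x => _) = (fun x => complex.Re (f x) + complex.Re (g x))); [exact: schwartz_realD|apply/funext => x; rewrite ReD].
by rewrite (_ : (fun x => _) = (fun x => complex.Im (f x) + complex.Im (g x))); [exact: schwartz_realD|apply/funext => x; rewrite ImD].
Qed.

Lemma schwartzZ (c : R[i]) f : schwartz f -> schwartz (fun x => c * f x).
Proof.
move=> [f1 f2]; split.
  rewrite (_ : (fun x => _) = (fun x => complex.Re c * complex.Re (f x) + (- complex.Im c) * complex.Im (f x))).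
    by apply: schwartz_realD; exact: schwartz_realZ.
  by apply/funext => x; rewrite ReM mulNr.
rewrite (_ : (fun x => _) = (fun x => complex.Re c * complex.Im (f x) + complex.Im c * complex.Re (f x))).
  by apply: schwartz_realD; exact: schwartz_realZ.
by apply/funext => x; rewrite ImM.
Qed.

Lemma schwartzB f g : schwartz f -> schwartz g -> schwartz (fun x => f x - g x).
Proof.
move=> sf sg; have := schwartzD sf (schwartzZ (-1) sg).
by under [X in schwartz X -> _]eq_fun do rewrite mulN1r.
Qed.
End Schwartz.

(** * Density of Schwartz functions in L^2 *)

Section Density.
Context {R : realType}.
Local Notation leb := (@lebesgue_measure R).
Implicit Types (f g h : R -> R[i]).

Lemma schwartz_measurable f : schwartz f -> cmeasurable f.
Proof. by move=> /schwartz_facts[[]]. Qed.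

Definition approximable f := cmeasurable f /\
  forall e : R, 0 < e -> exists2 h, schwartz h & (N2 (fun x => h x - f x)%R <= e%:E)%E.

Lemma approximableD f g : approximable f -> approximable g -> approximable (fun x => f x + g x).
Proof.
move=> [mf af] [mg ag]; split=> [|e e0]; first exact: cmeasD.
have e4 : 0 < e / 4 by rewrite divr_gt0.
have [h sh hf] := af _ e4; have [k sk kg] := ag _ e4.
exists (fun x => h x + k x); first exact: schwartzD.
have mh := schwartz_measurable sh; have mk := schwartz_measurable sk.
rewrite (_ : (fun x => _) = (fun x => (h x - f x) + (k x - g x))); last by apply/funext => x; ring.
apply: le_trans (N2D (cmeasB mh mf) (cmeasB mk mg)) _.
apply: (@le_trans _ _ (2%:E * (e / 4)%:E + 2%:E * (e / 4)%:E)%E).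
  by apply: leeD; apply: lee_wpmul2l; rewrite ?lee_fin.
by rewrite -EFinM -EFinD lee_fin; lra.
Qed.

Lemma approximableZ (c : R[i]) f : approximable f -> approximable (fun x => c * f x).
Proof.
move=> [mf af]; split=> [|e e0]; first by apply: cmeasM => //; exact: cmeas_cst.
have c0 : 0 < nc c ^+ 2 + 1 by rewrite ltr_wpDl ?sqr_ge0.
have e1 : 0 < e / (nc c ^+ 2 + 1) by rewrite divr_gt0.
have [h sh hf] := af _ e1; exists (fun x => c * h x); first exact: schwartzZ.
rewrite (_ : (fun x => _) = (fun x => c * (h x - f x))); last by apply/funext => x; rewrite mulrBr.
rewrite N2Z; last by apply: cmeasB => //; exact: schwartz_measurable.
apply: le_trans (lee_wpmul2l _ hf) _; first by rewrite lee_fin sqr_ge0.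
by rewrite -EFinM lee_fin mulrCA ler_piMr ?(ltW e0)// ler_pdivrMr// mul1r lerDl.
Qed.

Lemma approximable_lim (u : nat -> R -> R[i]) f : cmeasurable f -> (forall n, approximable (u n)) ->
  L2cvg0 (fun n x => u n x - f x) -> approximable f.
Proof.
move=> mf au cv; split=> // e e0; have e4 : 0 < e / 4 by rewrite divr_gt0.
have [n _ /(_ n (leqnn n)) un] := cv _ e4.
have [mn an] := au n; have [h sh hu] := an _ e4; exists h => //.
apply: le_trans (N2_triangle (schwartz_measurable sh) mn mf) _.
apply: (@le_trans _ _ (2%:E * (e / 4)%:E + 2%:E * (e / 4)%:E)%E).
  by apply: leeD; apply: lee_wpmul2l; rewrite ?lee_fin.
by rewrite -EFinM -EFinD lee_fin; lra.
Qed.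

Lemma approximable_eq f g : approximable f -> f =1 g -> approximable g.
Proof. by move=> af /funext <-. Qed.

Lemma schwartz_approximable f : schwartz f -> approximable f.
Proof.
move=> sf; split=> [|e e0]; first exact: schwartz_measurable.
exists f => //; rewrite (_ : N2 _ = 0%E) ?lee_fin ?ltW//.
by rewrite /N2; under eq_integral do rewrite subrr nc0 expr0n; rewrite integral0.
Qed.

Lemma schwartz_of_bump phi : bump phi -> schwartz (fun x : R => (phi x)%:C).
Proof.
move=> bp; split; first exact: schwartz_bump.
have := schwartz_realZ 0 (schwartz_bump bp); congr schwartz_real.
by apply/funext => x; rewrite mul0r.
Qed.

Lemma approximable_interval (a b : R) : approximable (ind `]a, b]).
Proof.
have mS : measurable (`]a, b]%classic : set (measurableTypeR R)) by exact: measurable_itv.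
apply: (@approximable_lim (fun n x => (plateau n a b x)%:C)); first exact: cmeas_ind.
  by move=> n; apply/schwartz_approximable/schwartz_of_bump/bump_plateau.
pose G x : R := nc (win a b x).
have pz n x : ~~ ((a < x) && (x < b)) -> plateau n a b x = 0.
  move=> h; rewrite /plateau /expinv !pmulr_rgt0 ?ltr0n ?subr_gt0//.
  by move: h; case: ifP => ax; case: ifP => bx; rewrite ?mul0r ?mulr0.
apply: (@N2_dominated _ _ _ G).
- by move=> n; apply: cmeasR; exact: bump_measurable (bump_plateau n a b).
- exact: cmeas_ind.
- by apply: cmeas_nc; exact: cmeas_win.
- have -> : (\int[leb]_x (G x ^+ 2)%:E = \int[leb]_x (nc (win a b x))%:E)%E.
    by apply: eq_integral => x _; rewrite /G nc_win; case: (_ && _); rewrite ?expr1n ?expr0n.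
  by have [] := cintble_win a b.
- move=> n x; rewrite /G nc_win indE mem_setE in_itv /=.
  have [/andP[ax xb]|h] := boolP ((a < x) && (x <= b)).
    rewrite (ltW ax) xb /= -rmorphB ncR ler_norml; have := plateau_ge0 n a b x.
    have := plateau_le1 n a b x; rewrite ler_norml => /andP[_ h1] h0; apply/andP; split; lra.
  rewrite subr0 ncR pz ?normr0 ?ler0n//; apply: contra h => /andP[-> /ltW ->//].
- exists [set b]; split => //; first exact: lebesgue_measure_set1.
  move=> x /= nh; apply: contrapT => xb; apply: nh.
  have -> : ind `]a, b] x = (((a < x) && (x < b))%:R)%:C :> R[i].
    have xb' : b != x by apply/eqP => e; apply: xb.
    by rewrite indE mem_setE in_itv /= [x < b]lt_neqAle eq_sym xb'.
  have := nc_cvg_scale 1 (@plateau_cvg _ a b x).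
  by under eq_fun do rewrite !mulr1.
Qed.

Lemma ind_sq_lty (a b : R) : (\int[leb]_x (nc (ind `]a, b] x : R[i]) ^+ 2)%:E < +oo)%E.
Proof.
have mS : measurable (`]a, b]%classic : set (measurableTypeR R)) by exact: measurable_itv.
have mi := @cmeas_ind _ (measurableTypeR R) R _ mS.
apply: (@le_lt_trans _ _ (\int[leb]_x (nc (win a b x))%:E)%E); last by have [] := cintble_win a b.
apply: le_nnint; [by apply/measurable_EFinP; apply: measurable_funX; exact: cmeas_nc|by apply/measurable_EFinP; apply: cmeas_nc; exact: cmeas_win|by move=> x; rewrite lee_fin sqr_ge0|move=> x].
rewrite lee_fin nc_win indE ncR mem_setE in_itv /=.
by case: ltP => ax; case: (leP x b) => xb /=; rewrite ?normr1 ?normr0 ?expr1n ?expr0n ?ler0n ?(ltW ax).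
Qed.

(** Dynkin induction from half-open intervals. Intersecting with a fixed bounded interval keeps
    every indicator square integrable, so countable unions pass to the limit by domination. *)
Lemma approximable_set (a b : R) (S : set (measurableTypeR R)) : measurable S -> approximable (ind (S `&` `]a, b]%classic)).
Proof.
have mI : measurable (`]a, b]%classic : set (measurableTypeR R)) by exact: measurable_itv.
have mi := @cmeas_ind _ (measurableTypeR R) R _ mI.
move: S; change (forall S, @measurable _ (measurableTypeR R) S -> approximable (ind (S `&` `]a, b]%classic))).
move=> S mS; move: S mS.
apply: (@dynkin_induction _ (measurableTypeR R) (@ocitv R) (fun S => approximable (ind (S `&` `]a, b]%classic)))) => //.
- exact: ocitvI.
- by rewrite setTI; exact: approximable_interval.
- move=> S oS; have oI : @ocitv R `]a, b]%classic by exists (a, b).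
  have [[c d] _ <-] := ocitvI oS oI.
  exact: approximable_interval.
- move=> S mS aS; apply: (approximable_eq (approximableD (approximable_interval a b) (approximableZ (-1) aS))) => x.
  rewrite !indE !in_setI in_setC mulN1r; case: (x \in S); case: (x \in _); rewrite /= ?subrr ?subr0//.
- move=> F mF tF aF.
  have mU n : measurable (\big[setU/set0]_(i < n) F i) by apply: bigsetU_measurable.
  have mB : measurable (\bigcup_k F k) by exact: bigcup_measurable.
  have spl (S : set (measurableTypeR R)) x : ind (S `&` `]a, b]%classic) x = ind S x * ind `]a, b] x :> R[i].
    by rewrite !indE in_setI -rmorphM -natrM mulnb.
  apply: (@approximable_lim (fun n => ind (\big[setU/set0]_(i < n) F i `&` `]a, b]%classic))).
  + by apply: cmeas_ind; exact: measurableI.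
  + elim=> [|n IH].
      apply: (approximable_eq (approximableZ 0 (approximable_interval a b))) => x.
      by rewrite big_ord0 set0I [RHS]indE in_set0 mul0r.
    apply: (approximable_eq (approximableD IH (aF n))) => x.
    by rewrite !spl ind_cup_disjoint// mulrDl.
  + apply: (@N2_dominated _ _ _ (fun x => nc (ind `]a, b] x : R[i]))).
    * by move=> n; exact: (@cmeas_ind _ (measurableTypeR R) R _ (measurableI _ _ (mU n) mI)).
    * by apply: cmeas_ind; exact: measurableI.
    * exact: cmeas_nc.
    * exact: ind_sq_lty.
    * move=> n x; rewrite !spl -mulrBl ncM ler_piMl ?nc_ge0// !indE -rmorphB ncR.
      by case: (_ \in _); case: (_ \in _); rewrite /= ?subrr ?subr0 ?sub0r ?normrN ?normr0 ?normr1.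
    * apply: ae_true => x; apply: nc_cvg0_near.
      by near=> n; rewrite !spl; congr (_ * _); near: n; exact: cvg_ind_cup.
Unshelve. all: by end_near.
Qed.

Lemma real_complex_sum (F : nat -> R) n : (\sum_(k < n) F k)%:C = \sum_(k < n) (F k)%:C.
Proof.
elim: n => [|n IH]; first by rewrite !big_ord0.
rewrite !big_ord_recr /= -IH; exact: (rmorphD (real_complex R)).
Qed.

(** The sum counts the positive integers up to t, cut off at n, hence is within 1 of t as long as t
    <= n. The middle clause carries the induction. *)
Lemma count_below (t : R) n : 0 <= t ->
  [/\ \sum_(k < n) ((k.+1%:R <= t)%R%:R : R) <= t, (n%:R <= t -> \sum_(k < n) ((k.+1%:R <= t)%R%:R : R) = n%:R) &
    (t <= n%:R -> t <= \sum_(k < n) ((k.+1%:R <= t)%R%:R : R) + 1)].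
Proof.
move=> t0; elim: n => [|n [h1 h2 h3]]; first by rewrite big_ord0; split=> // t1; rewrite add0r (le_trans t1).
rewrite big_ord_recr /=; case: (leP n.+1%:R t) => nt.
  have nt' : n%:R <= t by apply: le_trans nt; rewrite ler_nat.
  rewrite h2//= natr1; split=> // ht; lra.
rewrite addr0; split=> // h.
by case: (leP t n%:R) => tn; [exact: h3|rewrite h2 ?natr1 ?ltW].
Qed.

(** A layer-cake approximation: with d = M / (n + 1), the sum of d times the indicators of h >= (k +
    1) d for k <= n differs from h by at most d, by [count_below]. *)
Lemma approximable_bounded (h : R -> R) (a b M : R) : measurable_fun setT h -> 0 < M -> (forall x, 0 <= h x <= M) ->
  approximable (fun x => (h x)%:C * ind `]a, b] x).
Proof.
move=> mh M0 hM.
have mI : measurable (`]a, b]%classic : set (measurableTypeR R)) by exact: measurable_itv.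
have mi := @cmeas_ind _ (measurableTypeR R) R _ mI.
pose S (n k : nat) : set (measurableTypeR R) := [set x | k.+1%:R * (M / n.+1%:R) <= h x].
have mS n k : measurable (S n k).
  rewrite (_ : S n k = h @^-1` `[k.+1%:R * (M / n.+1%:R), +oo[); first by rewrite -[X in measurable X]setTI; exact: mh.
  by apply/seteqP; split => x /=; rewrite /S /= in_itv /= andbT.
pose u n x : R[i] := \sum_(k < n.+1) (M / n.+1%:R)%:C * ind (S n k `&` `]a, b]%classic) x.
have mu n : cmeasurable (u n).
  have au m : cmeasurable (fun x => \sum_(k < m) (M / n.+1%:R)%:C * ind (S n k `&` `]a, b]%classic) x).
    elim: m => [|m IH]; first by under eq_fun do rewrite big_ord0; exact: cmeas_cst.
    under eq_fun do rewrite big_ord_recr /=.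
    by apply: cmeasD => //; apply: cmeasM; [exact: cmeas_cst|apply: cmeas_ind; exact: measurableI].
  exact: au.
have mf : cmeasurable (fun x => (h x)%:C * ind `]a, b] x) by apply: cmeasM => //; exact: cmeasR.
have uE n x : u n x = (M / n.+1%:R * \sum_(k < n.+1) (k.+1%:R <= h x / (M / n.+1%:R))%R%:R)%:C * ind `]a, b] x.
  have d0 : 0 < M / n.+1%:R by rewrite divr_gt0.
  rewrite /u /S; set d := M / n.+1%:R in d0 *.
  rewrite [RHS](_ : _ = d%:C * (\sum_(k < n.+1) (((k.+1%:R <= h x / d)%R%:R : R)%:C) * ind `]a, b] x)); last first.
    have e := real_complex_sum (fun k => ((k.+1%:R <= h x / d)%R%:R : R)) n.+1.
    rewrite -mulr_suml -e mulrA; congr (_ * _); exact: (rmorphM (real_complex R)).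
  rewrite mulr_sumr; apply: eq_bigr => k _; congr (_ * _).
  by rewrite !indE in_setI -mulnb natrM rmorphM mem_setE /= ler_pdivlMr.
have bd n x : nc (u n x - (h x)%:C * ind `]a, b] x) <= M / n.+1%:R * nc (ind `]a, b] x : R[i]).
  rewrite uE -mulrBl ncM ler_wpM2r ?nc_ge0// -rmorphB ncR.
  have d0 : 0 < M / n.+1%:R by rewrite divr_gt0.
  have /andP[h0 hM'] := hM x; have t0 : 0 <= h x / (M / n.+1%:R) by rewrite divr_ge0// ltW.
  have tn : h x / (M / n.+1%:R) <= n.+1%:R by rewrite ler_pdivrMr// mulrC divfK.
  have [c1 _ c3] := count_below n.+1 t0; have {}c3 := c3 tn.
  set s := \sum_(k < n.+1) _ in c1 c3 *; set d := M / n.+1%:R in d0 t0 tn c1 c3 *.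
  have e : h x = d * (h x / d) by rewrite mulrC divfK// gt_eqF.
  by rewrite [X in _ - X]e ler_norml; apply/andP; split; nra.
apply: (@approximable_lim u) => //.
  move=> n; have au m : approximable (fun x => \sum_(k < m) (M / n.+1%:R)%:C * ind (S n k `&` `]a, b]%classic) x).
    elim: m => [|m IH].
      by apply: (approximable_eq (approximableZ 0 (approximable_interval a b))) => x; rewrite big_ord0 mul0r.
    apply: (approximable_eq (approximableD IH (approximableZ (M / n.+1%:R)%:C (approximable_set a b (mS n m))))) => x.
    by rewrite big_ord_recr.
  exact: au.
apply: (@N2_dominated _ _ _ (fun x => M * nc (ind `]a, b] x : R[i]))) => //.
- by apply: measurable_funM => //; exact: cmeas_nc.
- under eq_integral do rewrite exprMn EFinM.
  rewrite lebZ ?sqr_ge0//; first by rewrite lte_mul_pinfty ?lee_fin ?sqr_ge0// ind_sq_lty.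
    by apply/measurable_EFinP; apply: measurable_funX; exact: cmeas_nc.
  by move=> x; rewrite lee_fin sqr_ge0.
- move=> n x; apply: le_trans (bd n x) _; rewrite ler_wpM2r ?nc_ge0// ler_pdivrMr ?ltr0n//.
  by rewrite ler_peMr ?(ltW M0)// ler1n.
- apply: ae_true => x; apply: (@squeeze_cvgr _ _ _ _ (fun=> 0) (fun n => n.+1%:R^-1 * M)).
  + exists 0%N => // n _; rewrite nc_ge0 /=; apply: le_trans (bd n x) _.
    by rewrite (mulrC _ M) ler_piMr ?nc_ind// mulr_ge0 ?(ltW M0).
  + exact: cvg_cst.
  + by rewrite -[X in _ --> X](mul0r M); apply: cvgMl; exact: cvg_harmonic.
Qed.

Lemma L2_approximable f : cmeasurable f -> (N2 f < +oo)%E -> approximable f.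
Proof.
move=> mf foo; apply: (@approximable_lim (fun n => trunc n f)) => //; last exact: trunc_cvg.
move=> n; have [mt bt zt] := nice_trunc n mf.
pose M : R := n%:R + 1; have M0 : 0 < M by rewrite ltr_wpDl.
have [mr mi] := mt.
have Ap (k : R -> R) : measurable_fun setT k -> (forall x, `|k x| <= n%:R) ->
    approximable (fun x => (k x)%:C * ind `](- M), M] x).
  move=> mk kn.
  have mp : measurable_fun setT (fun x => Num.max (k x) 0) by exact: measurable_maxr.
  have mm : measurable_fun setT (fun x => Num.max (- k x) 0) by apply: measurable_maxr => //; exact: measurableT_comp.
  have b1 x : 0 <= Num.max (k x) 0 <= M.
    by rewrite le_max lexx orbT ge_max (ltW M0) andbT (le_trans (ler_norm _))// (le_trans (kn x))// lerDl.
  have b2 x : 0 <= Num.max (- k x) 0 <= M.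
    rewrite le_max lexx orbT ge_max (ltW M0) andbT (le_trans (ler_norm _))// normrN (le_trans (kn x))// lerDl//.
  have A1 := approximable_bounded (- M) M mp M0 b1.
  have A2 := approximableZ (-1) (approximable_bounded (- M) M mm M0 b2).
  apply: (approximable_eq (approximableD A1 A2)) => x.
  rewrite mulN1r -mulrBl -rmorphB; congr (_%:C * _).
  by rewrite !maxEle; case: (leP (k x) 0) => h1; case: (leP (- k x) 0) => h2; lra.
have Ar := Ap _ mr (fun x => le_trans (normRe_le_nc _) (bt x)).
have Ai := approximableZ ('i%C) (Ap _ mi (fun x => le_trans (normIm_le_nc _) (bt x))).
apply: (approximable_eq (approximableD Ar Ai)) => x.
rewrite mulrA -mulrDl; have -> : (complex.Re (trunc n f x))%:C + 'i%C * (complex.Im (trunc n f x))%:C = trunc n f x.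
  by apply: complex_ext; rewrite ?ReD ?ImD ?ReM ?ImM /=; ring.
rewrite indE mem_setE in_itv /=; case: (leP `|x| n%:R) => xn; last by rewrite zt// mul0r.
have h : - M < x <= M.
  have h1 := ler_norm x; have h2 := ler_norm (- x); rewrite normrN in h2.
  by apply/andP; rewrite /M; split; lra.
by rewrite h mulr1.
Qed.
End Density.

(** * Operators on square-integrable functions *)

Section BoundedSymbols.
Context {R : realType}.
Local Notation leb := (@lebesgue_measure R).
Local Notation leb2 := (prodsf leb leb).
Implicit Types (f g h F G : R -> R[i]) (p q : R * R -> R[i]).

Lemma AC_add b p p' q q' (A B : R) : cmeasurable p' -> cmeasurable q' -> (forall z, nc (p' z) <= A) ->
  (forall z, nc (q' z) <= B) -> AC b p p' -> AC b q q' ->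
  AC b (fun z => p z + q z) (fun z => p' z + q' z).
Proof.
move=> mp mq pA qB Hp Hq u u0; apply: ae_imp2 (Hp u u0) (Hq u u0) => z hp hq.
have i (r : R * R -> R[i]) (C : R) : cmeasurable r -> (forall z, nc (r z) <= C) -> cintble leb (fun w => win 0 u w * r (mv b w z)).
  move=> mr rC; rewrite (_ : (fun w => _) = (fun w => r (mv b w z) * win 0 u w)); last by apply/funext => w; rewrite mulrC.
  apply: (@cintble_bddM _ _ _ leb _ _ C) (cintble_win 0 u) => [|w]; last exact: rC.
  by apply: cmeas_mv => //; mes.
rewrite opprD addrACA hp hq -(cintD (i _ _ mp pA) (i _ _ mq qB)).
by apply: eq_cint => w; rewrite mulrDr.
Qed.

(** Only the conclusion of [calderon_vaillancourt] is kept, so that the two symbols and their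
    product, whose derivatives have different shapes, are extended to L^2 by one argument. *)
Record cvsymbol p (B : R) : Prop := CVSymbol {
  cv_gt0 : 0 < B; cv_meas : cmeasurable p; cv_bound : forall z, nc (p z) <= B;
  cv_pair : forall g G, cintble leb g -> cintble leb G ->
    ((nc (cintegral leb2 (fun z => g z.1 * G z.2 * expi (2 * pi * z.1 * z.2) * p z)))%:E <=
     (512 * B)%:E * (N2 g + N2 G))%E }.

Lemma cvsymbol_of_data p P Px Q Qx Pxx (M e M2 : R) : 0 < M -> 0 <= e -> symbol_data p P Px Q Qx Pxx M e M2 ->
  cvsymbol P (M + e).
Proof.
move=> M0 e0 sd; have B0 : 0 < M + e by rewrite ltr_wpDr.
have M1 : M <= M + e by rewrite lerDl.
have M2' : e <= M + e by rewrite lerDr ltW.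
case: sd => _ mP mPx mQ mQx _ bP bPx bQ bQx _ A1 _ _ A4 A5.
split=> // [z|g G gi Gi]; first exact: le_trans M1.
by apply: (calderon_vaillancourt mP mPx mQ mQx) => // z; [apply: le_trans M1|apply: le_trans M1|apply: le_trans M2'|apply: le_trans M2'].
Qed.

Lemma nc_mul_le (z w : R[i]) (A B : R) : nc z <= A -> nc w <= B -> nc (z * w) <= A * B.
Proof. by move=> zA wB; rewrite ncM ler_pM ?nc_ge0. Qed.

Lemma nc_add_le (z w : R[i]) (A B : R) : nc z <= A -> nc w <= B -> nc (z + w) <= A + B.
Proof. by move=> zA wB; rewrite (le_trans (ncD _ _))// lerD. Qed.

(** The 4 counts the terms in the mixed derivative of a product. *)
Lemma cvsymbol_mul p P Px Q Qx Pxx (M e M2 : R) p' P' Px' Q' Qx' Pxx' (M' e' M2' : R) : 0 < M -> 0 <= e -> 0 < M' -> 0 <= e' ->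
  symbol_data p P Px Q Qx Pxx M e M2 -> symbol_data p' P' Px' Q' Qx' Pxx' M' e' M2' ->
  cvsymbol (fun z => P z * P' z) (4 * (M + e) * (M' + e')).
Proof.
move=> M0 e0 M0' e0' sd sd'.
have B0 : 0 < M + e by rewrite ltr_wpDr.
have B0' : 0 < M' + e' by rewrite ltr_wpDr.
case: sd => _ mP mPx mQ mQx _ bP bPx bQ bQx _ A1 _ _ A4 A5.
case: sd' => _ mP' mPx' mQ' mQx' _ bP' bPx' bQ' bQx' _ A1' _ _ A4' A5'.
have c0 : 0 < 4 * (M + e) * (M' + e') by rewrite !mulr_gt0.
have le1 (x y : R) : x <= M + e -> y <= M' + e' -> 0 <= x -> 0 <= y -> x * y <= (M + e) * (M' + e').
  by move=> *; rewrite ler_pM.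
have m0 : 0 <= (M + e) * (M' + e') by rewrite ltW ?mulr_gt0.
have X1 : M * M' <= (M + e) * (M' + e') by apply: le1; lra.
have X2 : M * e' <= (M + e) * (M' + e') by apply: le1; lra.
have X3 : e * M' <= (M + e) * (M' + e') by apply: le1; lra.
have X4 : e * e' <= (M + e) * (M' + e') by apply: le1; lra.
have Ax := AC_mul mP mPx mP' mPx' bP bPx bP' bPx' A1 A1'.
have Axi := AC_mul mP mQ mP' mQ' bP bQ bP' bQ' A4 A4'.
have Ax1 := AC_mul mPx mQx mP' mQ' bPx bQx bP' bQ' A5 A4'.
have Ax2 := AC_mul mP mQ mPx' mQx' bP bQ bPx' bQx' A4 A5'.
have Axx : AC false (fun z => Px z * P' z + P z * Px' z) (fun z => Qx z * P' z + Px z * Q' z + (Q z * Px' z + P z * Qx' z)).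
  apply: (AC_add (A := e * M' + M * e') (B := e * M' + M * e') _ _ _ _ Ax1 Ax2).
  - by apply: cmeasD; apply: cmeasM.
  - by apply: cmeasD; apply: cmeasM.
  - by move=> z; apply: nc_add_le; apply: nc_mul_le.
  - by move=> z; apply: nc_add_le; apply: nc_mul_le.
split=> // [|z|g G gi Gi].
- exact: cmeasM.
- by apply: le_trans (nc_mul_le (bP z) (bP' z)) _; lra.
- apply: (calderon_vaillancourt (p10 := fun z => Px z * P' z + P z * Px' z) (p01 := fun z => Q z * P' z + P z * Q' z)
    (p11 := fun z => Qx z * P' z + Px z * Q' z + (Q z * Px' z + P z * Qx' z))) .
  - exact: cmeasM.
  - by apply: cmeasD; apply: cmeasM.
  - by apply: cmeasD; apply: cmeasM.
  - by apply: cmeasD; apply: cmeasD; apply: cmeasM.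
  - by move=> z; apply: le_trans (nc_mul_le (bP z) (bP' z)) _; lra.
  - by move=> z; apply: le_trans (nc_add_le (nc_mul_le (bPx z) (bP' z)) (nc_mul_le (bP z) (bPx' z))) _; lra.
  - by move=> z; apply: le_trans (nc_add_le (nc_mul_le (bQ z) (bP' z)) (nc_mul_le (bP z) (bQ' z))) _; lra.
  - move=> z; apply: le_trans (nc_add_le (nc_add_le (nc_mul_le (bQx z) (bP' z)) (nc_mul_le (bPx z) (bQ' z)))
      (nc_add_le (nc_mul_le (bQ z) (bPx' z)) (nc_mul_le (bP z) (bQx' z)))) _; lra.
  - exact: Ax.
  - exact: Axi.
  - exact: Axx.
  - exact: gi.
  - exact: Gi.
  - exact: c0.
Qed.

Lemma cmeas_op p G : cmeasurable p -> cmeasurable G -> cmeasurable (op p G).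
Proof. by move=> mp mG; rewrite /op; mes. Qed.

Lemma cintble_op p G (B y : R) : cmeasurable p -> (forall z, nc (p z) <= B) -> cintble leb G ->
  cintble leb (fun eta => expi (2 * pi * y * eta) * p (y, eta) * G eta).
Proof.
move=> mp pB Gi; apply: (@cintble_bddM _ _ _ leb _ _ B) Gi => [|eta]; first by mes.
by rewrite ncM nc_expi mul1r.
Qed.

Lemma opB p F G (B : R) : cmeasurable p -> (forall z, nc (p z) <= B) -> cintble leb F -> cintble leb G ->
  op p (fun x => F x - G x) = fun y => op p F y - op p G y.
Proof.
move=> mp pB Fi Gi; apply/funext => y.
rewrite /op -(cintB (cintble_op y mp pB Fi) (cintble_op y mp pB Gi)).
by apply: eq_cint => eta; rewrite mulrBr.
Qed.

Lemma op_ae p q G : cmeasurable p -> cmeasurable q -> cmeasurable G -> {ae leb2, forall z, p z = q z} ->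
  {ae leb, forall y, op p G y = op q G y}.
Proof.
move=> mp mq mG h; apply: ae_imp (@ae_prod_ae _ _ _ _ _ leb leb _ h) => y hy.
apply: ae_eq_cint; [by mes|by mes|].
by apply: ae_imp hy => eta /= ->.
Qed.

Lemma cintble_pairing p g G (B : R) : cmeasurable p -> (forall z, nc (p z) <= B) -> cintble leb g -> cintble leb G ->
  cintble leb2 (fun z => g z.1 * G z.2 * expi (2 * pi * z.1 * z.2) * p z).
Proof.
move=> mp pB gi Gi; rewrite (_ : (fun z => _) = (fun z => (expi (2 * pi * z.1 * z.2) * p z) * (g z.1 * G z.2))); last first.
  by apply/funext => z; ring.
apply: (@cintble_bddM _ _ _ leb2 _ _ B) (cintbleM_prod gi Gi) => [|z].
  by apply: cmeasM => //; mes.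
by rewrite ncM nc_expi mul1r.
Qed.

Lemma op_pairing p g G (B : R) : cmeasurable p -> (forall z, nc (p z) <= B) -> cintble leb g -> cintble leb G ->
  cintegral leb (fun x => g x * op p G x) = cintegral leb2 (fun z => g z.1 * G z.2 * expi (2 * pi * z.1 * z.2) * p z).
Proof.
move=> mp pB gi Gi; rewrite -(cfubini1 (cintble_pairing mp pB gi Gi)); apply: eq_cint => x.
by rewrite /op -(cintZl (g x) (cintble_op x mp pB Gi)); apply: eq_cint => eta /=; ring.
Qed.

Lemma Kg_pairing p g G (B : R) : cmeasurable p -> (forall z, nc (p z) <= B) -> cintble leb g -> cintble leb G ->
  cintegral leb (fun xi => G xi * Kg g p xi) = cintegral leb2 (fun z => g z.1 * G z.2 * expi (2 * pi * z.1 * z.2) * p z).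
Proof.
move=> mp pB gi Gi; rewrite -(cfubini2 (cintble_pairing mp pB gi Gi)); apply: eq_cint => xi.
have i : cintble leb (fun x => g x * (expi (2 * pi * x * xi) * p (x, xi))).
  rewrite (_ : (fun x => _) = (fun x => (expi (2 * pi * x * xi) * p (x, xi)) * g x)); last by apply/funext => x; rewrite mulrC.
  apply: (@cintble_bddM _ _ _ leb _ _ B) gi => [|x]; first by mes.
  by rewrite ncM nc_expi mul1r.
by rewrite /Kg -(cintZl (G xi) i); apply: eq_cint => x /=; ring.
Qed.

(** The constant 4 c^2 of [N2_dual] for c = 512 B. *)
Definition opK (B : R) : R := 4 * (512 * B) ^+ 2.

Lemma opK_ge0 B : 0 <= opK B.
Proof. by rewrite /opK; apply: mulr_ge0; [exact: ler0n|exact: sqr_ge0]. Qed.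

Lemma N2_op p G (B : R) : cvsymbol p B -> cintble leb G -> (N2 G < +oo)%E -> (N2 (op p G) <= (opK B)%:E * N2 G)%E.
Proof.
move=> [B0 mp pB cvp] Gi Goo; have [mG _] := Gi.
have fG : N2 G \is a fin_num by rewrite ge0_fin_numE ?N2_ge0.
rewrite -(fineK fG) -EFinM; apply: N2_dual.
- exact: cmeas_op.
- by apply: mulr_gt0; [rewrite ltr0n|].
- by rewrite fine_ge0 ?N2_ge0.
- move=> N g ng; rewrite fineK// (op_pairing mp pB (cintble_nice ng) Gi); exact: cvp (cintble_nice ng) Gi.
Qed.

(** By |g h| <= l |g|^2 + |h|^2 / l, with l chosen so that the first term contributes at most eps /
    2. *)
Lemma pair_small g N (eps : R) : nice N g -> 0 < eps -> exists2 del : R, 0 < del &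
  forall h, cmeasurable h -> (N2 h <= del%:E)%E -> cintble leb (fun x => g x * h x) /\ nc (cintegral leb (fun x => g x * h x)) <= eps.
Proof.
move=> ng e0; have goo := N2_nice_lty ng; have [mg _ _] := ng.
have fg : N2 g \is a fin_num by rewrite ge0_fin_numE ?N2_ge0.
pose a := fine (N2 g); have a0 : 0 <= a by rewrite fine_ge0 ?N2_ge0.
pose l := eps / (2 * (a + 1)); have l0 : 0 < l by rewrite divr_gt0// mulr_gt0// ltr_wpDl.
exists (l * (eps / 2)) => [|h mh hh]; first by rewrite mulr_gt0// divr_gt0.
have mgh : cmeasurable (fun x => g x * h x) by exact: cmeasM.
have H : (\int[leb]_x (nc (g x * h x))%:E <= eps%:E)%E.
  apply: (@le_trans _ _ (l%:E * N2 g + (l^-1)%:E * N2 h)%E).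
    rewrite /N2 -!lebZ ?invr_ge0 ?(ltW l0)//; [|by mes|by move=> x; rewrite lee_fin sqr_ge0|by mes|by move=> x; rewrite lee_fin sqr_ge0].
    rewrite -lebD; [|by mes|by mes|by move=> x; rewrite -EFinM lee_fin mulr_ge0 ?sqr_ge0 ?(ltW l0)|by move=> x; rewrite -EFinM lee_fin mulr_ge0 ?sqr_ge0 ?invr_ge0 ?(ltW l0)].
    apply: le_nnint; [by mes|by mes|by move=> x; rewrite lee_fin nc_ge0|move=> x].
    rewrite -!EFinM -EFinD lee_fin ncM; set u := nc (g x); set v := nc (h x).
    have h1 : 0 <= l * (u - l^-1 * v) ^+ 2 by rewrite mulr_ge0 ?sqr_ge0 ?ltW.
    have h2 : l * (u - l^-1 * v) ^+ 2 = l * u ^+ 2 - 2 * (u * v) + l^-1 * v ^+ 2 by field; rewrite gt_eqF.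
    have h3 : 0 <= u * v by rewrite mulr_ge0 ?nc_ge0.
    lra.
  rewrite -(fineK fg) -/a; apply: (@le_trans _ _ ((l * a)%:E + (l^-1)%:E * (l * (eps / 2))%:E)%E).
    by rewrite EFinM leeD2l// lee_wpmul2l// lee_fin invr_ge0 ltW.
  rewrite -EFinM -EFinD lee_fin mulKf ?gt_eqF// /l.
  have := mul_half_frac a0 e0; rewrite mulrC; lra.
split; first by split => //; exact: le_lt_trans H (ltry _).
by rewrite -lee_fin; apply: le_trans H; exact: cint_norm_le.
Qed.
End BoundedSymbols.

(** * Extension of the operators to L^2 *)

Section Extension.
Context {R : realType}.
Local Notation leb := (@lebesgue_measure R).
Local Notation leb2 := (prodsf leb leb).
Implicit Types (f g h u : R -> R[i]).
Variables (p : R * R -> R[i]) (B : R).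
Hypothesis cv : cvsymbol p B.
Let K := opK B.
Let K0 : 0 <= K. Proof. exact: opK_ge0. Qed.
Let mp : cmeasurable p. Proof. by case: cv. Qed.
Let pB : forall z, nc (p z) <= B. Proof. by case: cv. Qed.

Lemma cmeas_Op f : cmeasurable f -> cmeasurable (Op p f).
Proof. by move=> mf; apply: (@cmeas_op R p (fourier f)) => //; exact: cmeas_fourier. Qed.

Lemma fourierB f g : cintble leb f -> cintble leb g -> fourier (fun x => f x - g x) = fun xi => fourier f xi - fourier g xi.
Proof.
move=> fi gi; apply/funext => xi.
rewrite /fourier -(cintB (cintble_fourier xi fi) (cintble_fourier xi gi)); apply: eq_cint => x; exact: mulrBr.
Qed.

Lemma N2_fourier f : cintble leb f -> (N2 (fourier f) <= N2 f)%E.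
Proof. exact: bessel. Qed.

Lemma Op_lip f g : schwartz f -> schwartz g ->
  (N2 (fun x => Op p f x - Op p g x)%R <= K%:E * N2 (fun x => f x - g x)%R)%E.
Proof.
move=> sf sg; have [fi foo Fi] := schwartz_facts sf; have [gi goo Gi] := schwartz_facts sg.
have [di doo Di] := schwartz_facts (schwartzB sf sg).
have e : (fun x => Op p f x - Op p g x) = op p (fourier (fun x => f x - g x)).
  by rewrite (fourierB fi gi) (opB mp pB Fi Gi).
rewrite e; apply: le_trans (N2_op cv Di _) _; first exact: le_lt_trans (N2_fourier di) doo.
by apply: lee_wpmul2l; [rewrite lee_fin|exact: N2_fourier].
Qed.

Lemma Op_bounded f : schwartz f -> (N2 (Op p f) <= K%:E * N2 f)%E.
Proof.
move=> sf; have [fi foo Fi] := schwartz_facts sf.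
apply: le_trans (N2_op cv Fi _) _; first exact: le_lt_trans (N2_fourier fi) foo.
by apply: lee_wpmul2l; [rewrite lee_fin|exact: N2_fourier].
Qed.

Lemma L2P f : L2 f <-> cmeasurable f /\ (N2 f < +oo)%E.
Proof. by rewrite /L2 /=; split => -[mf] /N2_lty. Qed.

Lemma L2_bounded_Op : L2_bounded (Op p).
Proof.
exists (Num.sqrt K) => f sf; have [[mf _] foo Fi] := schwartz_facts sf; have h := Op_bounded sf; split.
  apply/L2P; split; first exact: cmeas_Op.
  by apply: le_lt_trans h _; rewrite lte_mul_pinfty.
by apply: L2norm_leM; [exact: sqrtr_ge0|rewrite sqr_sqrtr].
Qed.

Lemma value_approx f g : is_L2_value (Op p) f g ->
  [/\ cmeasurable g, (N2 g < +oo)%E & forall e : R, 0 < e -> exists h, [/\ schwartz h,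
    (N2 (fun x => h x - f x)%R <= e%:E)%E & (N2 (fun x => Op p h x - g x)%R <= e%:E)%E]].
Proof.
move=> [/L2P[mg goo] [fn [sf /L2cvg0P cf /L2cvg0P cg]]]; split=> // e e0.
have [a _ ha] := cf e e0; have [b _ hb] := cg e e0.
exists (fn (maxn a b)); split=> //; [apply: ha|apply: hb]; rewrite /= ?leq_maxl ?leq_maxr//.
Qed.

Lemma le_eps (x y : \bar R) (C : R) : 0 <= C -> (forall e : R, 0 < e -> (x <= y + (C * e)%:E)%E) -> (x <= y)%E.
Proof.
move=> C0 h; apply/lee_addgt0Pr => e e0; have e1 : 0 < e / (C + 1) by rewrite divr_gt0// ltr_wpDl.
apply: le_trans (h _ e1) _; rewrite leeD2l// lee_fin mulrCA ler_piMr ?(ltW e0)//.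
by rewrite ler_pdivrMr ?ltr_wpDl// mul1r lerDl.
Qed.

Lemma N2_tri_le f g h (a b : R) : cmeasurable f -> cmeasurable g -> cmeasurable h ->
  (N2 (fun x => f x - g x)%R <= a%:E)%E -> (N2 (fun x => g x - h x)%R <= b%:E)%E ->
  (N2 (fun x => f x - h x)%R <= (2 * a + 2 * b)%:E)%E.
Proof.
move=> mf mg mh fa gb; apply: le_trans (N2_triangle mf mg mh) _.
have -> : ((2 * a + 2 * b)%:E = 2%:E * a%:E + 2%:E * b%:E)%E by [].
by apply: leeD; apply: lee_wpmul2l; rewrite ?lee_fin.
Qed.

(** Compare h with a Schwartz function k close to f whose image is close to g. Two triangle
    inequalities for squared norms turn the constant K into 4 K, and the distance from k to f is
    sent to 0. *)
Lemma value_lip f g h (a : R) : cmeasurable f -> is_L2_value (Op p) f g -> schwartz h ->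
  (N2 (fun x => h x - f x)%R <= a%:E)%E -> (N2 (fun x => Op p h x - g x)%R <= (4 * K * a)%:E)%E.
Proof.
move=> mf /value_approx[mg goo ap] sh ha; have mh := schwartz_measurable sh; have mOh := cmeas_Op mh.
apply: (@le_eps _ _ (4 * K + 2)) => [|e e0]; first by rewrite addr_ge0// mulr_ge0.
have [k [sk kf kg]] := ap e e0; have mk := schwartz_measurable sk; have mOk := cmeas_Op mk.
rewrite N2_sym in kf; have t := N2_tri_le mh mf mk ha kf.
have l : (N2 (fun x => Op p h x - Op p k x)%R <= (K * (2 * a + 2 * e))%:E)%E.
  have -> : ((K * (2 * a + 2 * e))%:E = K%:E * (2 * a + 2 * e)%:E)%E by [].
  by apply: le_trans (Op_lip sh sk) _; apply: lee_wpmul2l; rewrite ?lee_fin.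
apply: le_trans (N2_tri_le mOh mOk mg l kg) _; rewrite -EFinD lee_fin; lra.
Qed.

Lemma value_unique f g f' g' : cmeasurable f -> cmeasurable f' -> {ae leb, forall x, f x = f' x} ->
  is_L2_value (Op p) f g -> is_L2_value (Op p) f' g' -> {ae leb, forall x, g x = g' x}.
Proof.
move=> mf mf' ff' v v'; have [mg goo ap] := value_approx v; have [mg' _ _] := value_approx v'.
suff : {ae leb, forall x, g x - g' x = 0} by apply: ae_imp => x /eqP; rewrite subr_eq0 => /eqP.
apply: N2_eq0; first exact: cmeasB.
move=> e e0; rewrite -[e%:E]add0e; apply: (@le_eps _ _ (2 + 8 * K)) => [|d d0]; first by rewrite addr_ge0// mulr_ge0.
have [h [sh hf hg]] := ap d d0; have mh := schwartz_measurable sh; rewrite N2_sym in hg.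
have hf' : (N2 (fun x => h x - f' x)%R <= d%:E)%E.
  rewrite -(N2_ae (cmeasB mh mf) (cmeasB mh mf'))//.
  by apply: ae_imp ff' => x ->.
have hg' := value_lip mf' v' sh hf'.
apply: le_trans (N2_tri_le mg (cmeas_Op mh) mg' hg hg') _.
by rewrite add0e -EFinD lee_fin; lra.
Qed.

Lemma value_exists f : L2 f -> exists g, is_L2_value (Op p) f g.
Proof.
move=> Lf; have /L2P[mf foo] := Lf; have [_ af] := L2_approximable mf foo.
(* Chosen so that consecutive images differ by at most K (2 d_(n+1) + 2 d_n) <= 4 K d_n <= 8^-n, the
   rate asked for by [L2_complete]. *)
pose d n : R := 8^-1 ^+ n / (4 * (K + 1)).
have c0 : 0 < 4 * (K + 1) by rewrite mulr_gt0// ltr_wpDl.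
have p8 n : 0 < (8^-1 : R) ^+ n by rewrite exprn_gt0// invr_gt0.
have d0 n : 0 < d n by rewrite divr_gt0.
have /choice[h hh] : forall n, exists h, schwartz h /\ (N2 (fun x => h x - f x)%R <= (d n)%:E)%E.
  by move=> n; have [h sh hf] := af _ (d0 n); exists h.
have sh n : schwartz (h n) by have [] := hh n.
have hf n : (N2 (fun x => h n x - f x)%R <= (d n)%:E)%E by have [] := hh n.
have mh n := schwartz_measurable (sh n).
have d8 n : d n <= 8^-1 ^+ n.
  have k1 : 1 <= 4 * (K + 1) by have := K0; lra.
  by rewrite /d ler_pdivrMr// ler_peMr// ltW.
have dS n : d n.+1 <= d n.
  rewrite /d ler_pM2r ?invr_gt0// exprS ler_piMl ?(ltW (p8 n))//; lra.
have step n : (N2 (fun x => Op p (h n.+1) x - Op p (h n) x)%R <= (8^-1 ^+ n)%:E)%E.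
  apply: le_trans (Op_lip (sh _) (sh _)) _.
  have fh : (N2 (fun x => f x - h n x)%R <= (d n)%:E)%E by rewrite N2_sym.
  apply: le_trans (lee_wpmul2l _ (N2_tri_le (mh _) mf (mh _) (hf n.+1) fh)) _; first by rewrite lee_fin.
  rewrite -EFinM lee_fin; apply: (@le_trans _ _ (K * (4 * d n))).
    by rewrite ler_wpM2l//; have := dS n; lra.
  rewrite /d; set a := _ ^+ n; rewrite (_ : K * (4 * (a / (4 * (K + 1)))) = a * (K / (K + 1))); last first.
    by field; rewrite gt_eqF// ltr_wpDl.
  by rewrite ler_piMr ?(ltW (p8 n))// ler_pdivrMr ?ltr_wpDl// mul1r lerDl.
have mO n : cmeasurable (Op p (h n)) by exact: cmeas_Op.
have [g mg cg] := L2_complete mO step.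
exists g; split.
  apply/L2P; split=> //.
  have [n _ /(_ n (leqnn n)) hn] := cg 1 ltr01; rewrite N2_sym in hn.
  have hoo : (N2 (Op p (h n)) < +oo)%E.
    apply: le_lt_trans (Op_bounded (sh n)) _; rewrite lte_mul_pinfty//.
    by have [] := schwartz_facts (sh n).
  have e x : g x = (g x - Op p (h n) x) + Op p (h n) x by rewrite subrK.
  rewrite (_ : g = fun x => (g x - Op p (h n) x) + Op p (h n) x); last exact/funext.
  apply: le_lt_trans (N2D (cmeasB mg (mO n)) (mO n)) _.
  apply: lte_add_pinfty; apply: lte_mul_pinfty => //; exact: le_lt_trans hn (ltry _).
exists h; split=> //; apply/L2cvg0P => // e e0.
have c : (1 * 8^-1 ^+ n : R) @[n --> \oo] --> (0 : R).
  by have := @cvg_geometric R 1 8^-1; apply; rewrite ger0_norm ?invr_ge0// invf_lt1// ltr1n.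
move/cvgr0Pnorm_le : c => /(_ e e0); apply: filterS => n hn.
apply: le_trans (hf n) _; rewrite lee_fin (le_trans (d8 n))//.
by move: hn; rewrite mul1r ger0_norm// ltW.
Qed.

Lemma ext_value f : L2 f -> is_L2_value (Op p) f (L2_ext (Op p) f).
Proof. by move=> /value_exists h; exact: (xgetPex (fun=> 0) h). Qed.

Lemma Op_scale (c : R[i]) f : schwartz f -> Op p (fun x => c * f x) = fun x => c * Op p f x.
Proof.
move=> sf; have [fi _ Fi] := schwartz_facts sf.
have e : fourier (fun x => c * f x) = fun xi => c * fourier f xi.
  apply/funext => xi; rewrite /fourier -(cintZl c (cintble_fourier xi fi)); apply: eq_cint => x; exact: mulrCA.
apply/funext => y; rewrite /Op e -(cintZl c (cintble_op y mp pB Fi)).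
by apply: eq_cint => x; exact: mulrCA.
Qed.

Lemma L2cvg0Z (c : R[i]) (u : nat -> R -> R[i]) : (forall n, cmeasurable (u n)) -> L2cvg0 u -> L2cvg0 (fun n x => c * u n x).
Proof.
move=> mu cu e e0; have c0 : 0 < nc c ^+ 2 + 1 by rewrite ltr_wpDl ?sqr_ge0.
have e1 : 0 < e / (nc c ^+ 2 + 1) by rewrite divr_gt0.
apply: filterS (cu _ e1) => n h; rewrite N2Z//.
apply: le_trans (lee_wpmul2l _ h) _; first by rewrite lee_fin sqr_ge0.
by rewrite -EFinM lee_fin mulrCA ler_piMr ?(ltW e0)// ler_pdivrMr// mul1r lerDl.
Qed.

Lemma value_scale (c : R[i]) f g : cmeasurable f -> is_L2_value (Op p) f g -> is_L2_value (Op p) (fun x => c * f x) (fun x => c * g x).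
Proof.
move=> mf [/L2P[mg goo] [fn [sf /L2cvg0P cf /L2cvg0P cg]]].
have mfn n := schwartz_measurable (sf n); split.
  apply/L2P; split; first by apply: cmeasM => //; exact: cmeas_cst.
  by rewrite N2Z// lte_mul_pinfty// lee_fin sqr_ge0.
exists (fun n x => c * fn n x); split=> [n| |]; first exact: schwartzZ.
  apply/L2cvg0P; have := L2cvg0Z c (fun n => cmeasB (mfn n) mf) cf.
  by congr L2cvg0; apply/funext => n; apply/funext => x; exact: mulrBr.
apply/L2cvg0P; have := L2cvg0Z c (fun n => cmeasB (cmeas_Op (mfn n)) mg) cg.
by congr L2cvg0; apply/funext => n; apply/funext => x; rewrite Op_scale// mulrBr.
Qed.
End Extension.

Lemma Op_ae_L2 (R : realType) (p q : R * R -> R[i]) : cmeasurable p -> cmeasurable q ->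
  {ae prodsf (@lebesgue_measure R) (@lebesgue_measure R), forall z, p z = q z} ->
  forall f g, schwartz f -> cmeasurable g ->
  L2norm (fun x => Op p f x - g x) = L2norm (fun x => Op q f x - g x).
Proof.
move=> mp mq pq f g sf mg; have mF := cmeas_fourier (schwartz_measurable sf).
rewrite !L2normE (N2_ae (g := fun x => Op q f x - g x))//.
- by apply: cmeasB => //; exact: (@cmeas_op R p (fourier f)).
- by apply: cmeasB => //; exact: (@cmeas_op R q (fourier f)).
- by apply: ae_imp (op_ae mp mq mF pq) => x h; congr (_ - _).
Qed.

(** The two symbols define the same set of admissible values, from which [xget] picks; the chosen
    representatives are therefore equal and not merely equal almost everywhere. *)
Lemma L2_ext_ae (R : realType) (p q : R * R -> R[i]) : cmeasurable p -> cmeasurable q ->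
  {ae prodsf (@lebesgue_measure R) (@lebesgue_measure R), forall z, p z = q z} -> L2_ext (Op p) = L2_ext (Op q).
Proof.
move=> mp mq pq; apply/funext => f; congr (xget _ _); apply/seteqP.
have E := Op_ae_L2 mp mq pq.
split=> g /= [Lg [fn [sf cf cg]]]; split=> //; exists fn; split=> //; have [mg _] := Lg.
  by under eq_fun do rewrite -E//.
by under eq_fun do rewrite E//.
Qed.

Lemma L2_bounded_ae (R : realType) (p q : R * R -> R[i]) : cmeasurable p -> cmeasurable q ->
  {ae prodsf (@lebesgue_measure R) (@lebesgue_measure R), forall z, p z = q z} -> L2_bounded (Op q) -> L2_bounded (Op p).
Proof.
move=> mp mq pq [M H]; exists M => f sf; have [[mT Tf] h] := H f sf.
have e : L2norm (Op p f) = L2norm (Op q f).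
  have := @Op_ae_L2 R p q mp mq pq f (fun=> 0) sf (cmeas_cst _ _).
  by under eq_fun do rewrite subr0; under [X in _ = L2norm X -> _]eq_fun do rewrite subr0.
split; last by rewrite e.
split; last by rewrite e.
apply: (@cmeas_op R p (fourier f)) => //; exact: cmeas_fourier (schwartz_measurable sf).
Qed.

(** * The composition error *)

Section Cutoff.
Context {R : realType}.
Local Notation leb := (@lebesgue_measure R).
Local Notation leb2 := (prodsf leb leb).

Lemma AC_of_fst (f f' : R -> R) : (forall x : R, is_derive x 1 f (f' x)) -> continuous f' ->
  AC true (fun z => (f z.1)%:C : R[i]) (fun z => (f' z.1)%:C).
Proof.
move=> df cf u u0; apply: ae_true => -[x y] /=.
have d (w : R) : is_derive w 1 (fun w => f (x + w)) (f' (x + w)).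
  by apply: isd_eq (isd_comp (isdD (isdc x w) (isdid w)) (df (x + w))) _; rewrite add0r mul1r.
have c : continuous (fun w => f' (x + w)).
  move=> w; apply: (continuous_comp (f := fun w => x + w)); last exact: cf.
  by apply: cvgD; [exact: cvg_cst|exact: cvg_id].
by apply: (eq_trans _ (esym (cint_FTC (ltW u0) d c))); rewrite addr0 rmorphB.
Qed.

Lemma AC_fst_other (f : R -> R) : AC false (fun z => (f z.1)%:C : R[i]) (fun _ => 0).
Proof.
move=> u u0; apply: ae_true => -[x y] /=.
rewrite subrr (@eq_cint _ _ _ leb _ (fun=> 0)) ?cint0// => w; exact: mulr0.
Qed.

Variable n : nat.
Let m : R := n.+1%:R.
Let m0 : 0 < m. Proof. by rewrite ltr0n. Qed.
Let m1 : 1 <= m. Proof. by rewrite ler1n. Qed.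

(** [chi1] and [chi2] are the first two derivatives of [chi]. They are bounded by multiples of [chi]
    itself, uniformly in n, so the cut-off symbol and its derivatives share one integrable majorant
    while their bounds do not depend on n. *)
Definition chi (y : R) : R := cauchy_weight (y / m).
Definition chi1 (y : R) : R := - (chi y * chi y * (2 * (y / m) / m)).
Definition chi2 (y : R) : R := - (2 * chi y * chi1 y * (2 * (y / m) / m) + chi y * chi y * (2 / m / m)).

Lemma chi_gt0 y : 0 < chi y. Proof. exact: cauchy_weight_gt0. Qed.
Lemma chi_le1 y : chi y <= 1. Proof. exact: cauchy_weight_le1. Qed.

Lemma chi_isd (y : R) : is_derive y 1 chi (chi1 y).
Proof.
have dl : is_derive y 1 (fun y : R => y / m) (m^-1).
  by apply: isd_eq (isdM (isdid y) (isdc (m^-1) y)) _; rewrite mulr0 add0r mulr1.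
have dd : is_derive y 1 (fun y : R => 1 + y / m * (y / m)) (2 * (y / m) / m).
  by apply: isd_eq (isdD (isdc 1 y) (isdM dl dl)) _; ring.
have nz : 1 + y / m * (y / m) != 0 by rewrite gt_eqF// ltr_wpDr// -expr2 sqr_ge0.
have := @is_deriveV R _ y _ 1 nz dd.
rewrite (_ : (fun y => (1 + y / m * (y / m))^-1) = chi); last first.
  by apply/funext => x; rewrite /chi /cauchy_weight expr2.
move=> h; apply: isd_eq h _; rewrite /GRing.scale /= /chi1 /chi /cauchy_weight.
by rewrite -expr2 -exprVn expr2 mulNr.
Qed.

Lemma chi1_isd (y : R) : is_derive y 1 chi1 (chi2 y).
Proof.
have dl : is_derive y 1 (fun y : R => 2 * (y / m) / m) (2 / m / m).
  apply: isd_eq (isdM (isdM (isdc 2 y) (isdM (isdid y) (isdc (m^-1) y))) (isdc (m^-1) y)) _; ring.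
apply: isd_eq (isdN (isdM (isdM (chi_isd y) (chi_isd y)) dl)) _; rewrite /chi2; ring.
Qed.

Lemma chi_continuous : continuous chi.
Proof. by move=> y; exact: isd_continuous (chi_isd y). Qed.

Lemma chi1_continuous : continuous chi1.
Proof. by move=> y; exact: isd_continuous (chi1_isd y). Qed.

Lemma chi2_continuous : continuous chi2.
Proof.
have cl : continuous (fun y : R => 2 * (y / m) / m).
  move=> y; apply: cvgM; last exact: cvg_cst.
  by apply: cvgM; [exact: cvg_cst|apply: cvgM; [exact: cvg_id|exact: cvg_cst]].
move=> y; apply: cvgN; apply: cvgD; apply: cvgM.
- by apply: cvgM; [apply: cvgM; [exact: cvg_cst|exact: chi_continuous]|exact: chi1_continuous].
- exact: cl.
- by apply: cvgM; exact: chi_continuous.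
- exact: cvg_cst.
Qed.

(** With t = y / m the factor is 2 t / (1 + t^2) divided by m, and m >= 1. *)
Lemma slope_le y : `|chi y * (2 * (y / m) / m)| <= 1.
Proof.
have h : `|chi y * (2 * (y / m))| <= 1.
  have d0 : 0 < 1 + (y / m) ^+ 2 by rewrite ltr_wpDr ?sqr_ge0.
  rewrite normrM ger0_norm ?(ltW (chi_gt0 y))// /chi /cauchy_weight mulrC ler_pdivrMr// mul1r.
  by move: (y / m) => t; rewrite ler_norml; have := sqr_ge0 (t - 1); have := sqr_ge0 (t + 1) => h1 h2; apply/andP; split; nra.
rewrite mulrA normrM; apply: le_trans (ler_wpM2r _ h) _ => //.
by rewrite mul1r ger0_norm ?invr_ge0 ?(ltW m0)// invf_le1.
Qed.

Lemma chi1_le y : `|chi1 y| <= chi y.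
Proof.
rewrite /chi1 normrN -mulrA normrM (ger0_norm (ltW (chi_gt0 y))).
by rewrite ler_piMr ?(ltW (chi_gt0 y))// slope_le.
Qed.

Lemma chi2_le y : `|chi2 y| <= 4 * chi y.
Proof.
have c0 := chi_gt0 y; have c1 := chi_le1 y.
rewrite /chi2 normrN (le_trans (ler_normD _ _))//.
have h1 : `|2 * chi y * chi1 y * (2 * (y / m) / m)| <= 2 * chi y.
  rewrite (_ : 2 * chi y * chi1 y * _ = 2 * chi1 y * (chi y * (2 * (y / m) / m))); last by ring.
  rewrite normrM -[leRHS]mulr1; apply: ler_pM => //; last exact: slope_le.
  by rewrite normrM ger0_norm// ler_wpM2l// chi1_le.
have h2 : `|chi y * chi y * (2 / m / m)| <= 2 * chi y.
  rewrite ger0_norm ?mulr_ge0 ?(ltW c0) ?invr_ge0 ?(ltW m0)//.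
  have i0 : 0 <= m^-1 by rewrite invr_ge0 ltW.
  have i1 : m^-1 <= 1 by rewrite invf_le1.
  rewrite mulrC (_ : 2 / m / m = 2 * (m^-1 * m^-1)); last by ring.
  apply: ler_pM; rewrite ?mulr_ge0 ?(ltW c0)//.
    by rewrite -[leRHS]mulr1 ler_wpM2l// -[leRHS]mulr1 ler_pM.
  by rewrite -[leRHS]mulr1 ler_pM ?(ltW c0).
lra.
Qed.

Lemma chi_majorant y : chi y <= m ^+ 2 * cauchy_weight y.
Proof.
have d1 : 0 < 1 + (y / m) ^+ 2 by rewrite ltr_wpDr ?sqr_ge0.
have d2 : 0 < 1 + y ^+ 2 by rewrite ltr_wpDr ?sqr_ge0.
rewrite /chi /cauchy_weight ler_pdivlMr// mulrC ler_pdivrMr// mulrDr mulr1 -exprMn (mulrC m) divfK ?gt_eqF//.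
by rewrite lerD2r expr_ge1.
Qed.

Lemma chi_measurable : measurable_fun setT chi.
Proof. exact: continuous_measurable_fun chi_continuous. Qed.

Lemma op_chi (p : R * R -> R[i]) F (B y : R) : cmeasurable p -> (forall z, nc (p z) <= B) -> cintble leb F ->
  op (fun z => (chi z.1)%:C * p z) F y = (chi y)%:C * op p F y.
Proof.
move=> mp pB Fi; rewrite /op -(cintZl _ (cintble_op y mp pB Fi)); apply: eq_cint => eta /=; ring.
Qed.
End Cutoff.

Section CutoffLimit.
Context {R : realType}.
Local Notation leb := (@lebesgue_measure R).

Lemma chi_cvg (y : R) : chi n y @[n --> \oo] --> (1 : R).
Proof.
have h : (y * n.+1%:R^-1) @[n --> \oo] --> (0 : R).
  by rewrite -[X in _ --> X](mulr0 y); apply: cvgM; [exact: cvg_cst|exact: cvg_harmonic].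
have c1 : {for (0 : R), continuous (@cauchy_weight R)}.
  have := @chi_continuous R 0 0; rewrite (_ : chi 0 = cauchy_weight)//.
  by apply/funext => x; rewrite /chi divr1.
rewrite (_ : 1 = cauchy_weight (0 : R)); last by rewrite /cauchy_weight expr0n addr0 invr1.
exact: (continuous_cvg _ c1 h).
Qed.

Lemma cutoff_cvg (h : R -> R[i]) : cmeasurable h -> (N2 h < +oo)%E -> L2cvg0 (fun n x => (chi n x)%:C * h x - h x).
Proof.
move=> mh hoo; apply: (@N2_dominated _ _ _ (fun x => nc (h x))) => //.
- by move=> n; apply: cmeasM => //; apply: cmeasR; exact: chi_measurable.
- by mes.
- move=> n x; rewrite -{2}(mul1r (h x)) -mulrBl ncM ler_piMl ?nc_ge0//.
  rewrite -(rmorphB _ _ 1) ncR ler_norml; have := chi_gt0 n x; have := chi_le1 n x => h1 h2; apply/andP; split; lra.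
- by apply: ae_true => x; have := nc_cvg_scale (h x) (@chi_cvg x); under eq_fun do rewrite mul1r.
Qed.
End CutoffLimit.

Lemma cutoff_constants (R : realType) (M e M' : R) : 0 < M -> 0 < e -> 0 < M' ->
  [/\ 0 < 6 * M + M', 0 < 6 * M + M' + 2 * e, 1 * M <= 6 * M + M', 1 * M + 1 * M <= 6 * M + M' &
      4 * M + 1 * M + (1 * M + 1 * M') <= 6 * M + M'] /\
  [/\ 6 * M + M' <= 6 * M + M' + 2 * e, 2 * e <= 6 * M + M' + 2 * e, 1 * e <= 2 * e, 1 * e + 1 * e <= 2 * e & 0 < 2 * e].
Proof. by move=> M0 e0 M0'; split; split; lra. Qed.

Section Composition.
Context {R : realType}.
Local Notation leb := (@lebesgue_measure R).
Local Notation leb2 := (prodsf leb leb).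
Variables (p1 P1 Px1 Q1 Qx1 Pxx1 : R * R -> R[i]) (M1 e1 M1' : R).
Variables (p2 P2 Px2 Q2 Qx2 Pxx2 : R * R -> R[i]) (M2 e2 M2' : R).
Hypotheses (M10 : 0 < M1) (e10 : 0 < e1) (e1M1 : e1 <= M1) (M20 : 0 < M2) (e20 : 0 < e2) (M2'0 : 0 < M2').
Hypothesis sd1 : symbol_data p1 P1 Px1 Q1 Qx1 Pxx1 M1 e1 M1'.
Hypothesis sd2 : symbol_data p2 P2 Px2 Q2 Qx2 Pxx2 M2 e2 M2'.

(** 6 M2 + M2' bounds the second x-derivative of the cut-off p2: 4 M2 from chi2 p2, twice M2 from
    the cross terms, and M2' from the second derivative of p2. Likewise 2 e2 bounds the x-derivative
    of the cut-off dp2/dxi. *)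
Definition comp_const : R := (2 * Kc) * (M1 * (2 * e2) + (6 * M2 + M2') * e1).

Lemma cutoff_composition n F N g Ng : nice N F -> nice Ng g ->
  let b z := (chi n z.1)%:C * P2 z in
  [/\ cintble leb (op b F), cintble leb (fourier (op b F)) &
  ((nc (cintegral leb (fun xi => fourier (op b F) xi * Kg g P1 xi) -
        cintegral leb (fun x => g x * op (fun z => P1 z * b z) F x)))%:E <=
   comp_const%:E * (N2 g + N2 F))%E].
Proof.
move=> nF ng b.
have [MM [mE [MM0 C0 t1 t2 t3] [MMC e2C t4 t5 e2']]] : exists MM : R, [/\ MM = 6 * M2 + M2',
    [/\ 0 < MM, 0 < MM + 2 * e2, 1 * M2 <= MM, 1 * M2 + 1 * M2 <= MM & 4 * M2 + 1 * M2 + (1 * M2 + 1 * M2') <= MM] &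
    [/\ MM <= MM + 2 * e2, 2 * e2 <= MM + 2 * e2, 1 * e2 <= 2 * e2, 1 * e2 + 1 * e2 <= 2 * e2 & 0 < 2 * e2]].
  by have [A1 A2] := cutoff_constants M20 e20 M2'0; exists (6 * M2 + M2').
pose c (f : R -> R) (z : R * R) : R[i] := (f z.1)%:C.
have mc f : continuous f -> cmeasurable (c f).
  move=> cf; apply: cmeasR; apply: (meas_comp_of (T1 := R) (f := f)); last exact: measurable_fst.
  exact: continuous_measurable_fun.
have m0' := mc _ (@chi_continuous R n); have m1' := mc _ (@chi1_continuous R n); have m2' := mc _ (@chi2_continuous R n).
have b0 z : nc (c (chi n) z) <= chi n z.1 by rewrite ncR ger0_norm// ltW// chi_gt0.
have b1 z : nc (c (chi1 n) z) <= chi n z.1 by rewrite ncR chi1_le.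
have b2 z : nc (c (chi2 n) z) <= 4 * chi n z.1 by rewrite ncR chi2_le.
have x0 (y : R) : 0 <= chi n y by rewrite ltW ?chi_gt0.
have x1 (y : R) : chi n y <= 1 by exact: chi_le1.
have b0' z : nc (c (chi n) z) <= 1 by exact: le_trans (b0 z) (x1 _).
have b1' z : nc (c (chi1 n) z) <= 1 by exact: le_trans (b1 z) (x1 _).
have b2' z : nc (c (chi2 n) z) <= 4 by apply: le_trans (b2 z) _; have := x1 z.1; lra.
have bz z : nc ((fun _ : R * R => 0 : R[i]) z) <= 0 by rewrite nc0.
have mz : cmeasurable (fun _ : R * R => 0 : R[i]) by exact: cmeas_cst.
have A0 : AC true (c (chi n)) (c (chi1 n)) by exact: (AC_of_fst (@chi_isd R n) (@chi1_continuous R n)).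
have A1 : AC true (c (chi1 n)) (c (chi2 n)) by exact: (AC_of_fst (@chi1_isd R n) (@chi2_continuous R n)).
have Az : AC false (c (chi n)) (fun=> 0) by exact: AC_fst_other.
case: sd1 => _ mP1 mPx1 mQ1 mQx1 _ bP1 bPx1 bQ1 bQx1 _ B1 _ B3 B4 B5.
case: sd2 => _ mP2 mPx2 mQ2 mQx2 mPxx2 bP2 bPx2 bQ2 bQx2 bPxx2 D1 D2 D3 D4 D5.
pose bx z := c (chi1 n) z * P2 z + c (chi n) z * Px2 z.
pose bxx z := (c (chi2 n) z * P2 z + c (chi1 n) z * Px2 z) + (c (chi1 n) z * Px2 z + c (chi n) z * Pxx2 z).
(* The vanishing summand is the xi-derivative of the cutoff; [r] is kept in the shape delivered by
   [AC_mul]. *)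
pose r z := 0 * P2 z + c (chi n) z * Q2 z.
pose rx z := c (chi1 n) z * Q2 z + c (chi n) z * Qx2 z.
have rE : r = fun z => c (chi n) z * Q2 z by apply/funext => z; rewrite /r mul0r add0r.
pose X y := (MM + 2 * e2) * (n.+1%:R ^+ 2 * cauchy_weight y).
have sX (B : R) (P : R * R -> R[i]) : cmeasurable P -> 0 < B -> B <= MM + 2 * e2 ->
    (forall z, nc (P z) <= B * chi n z.1) -> symb X B P.
  move=> mP B0 BC PB; split=> // z.
    by apply: le_trans (PB z) _; rewrite ler_piMr ?(ltW B0).
  by apply: le_trans (PB z) _; rewrite /X ler_pM ?(ltW B0)// chi_majorant.
have mX : measurable_fun setT X.
  by apply: measurable_funM => //; apply: measurable_funM => //; exact: measurable_cauchy_weight.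
have X0 y : 0 <= X y by rewrite /X mulr_ge0 ?(ltW C0)// mulr_ge0 ?exprn_ge0// ltW// cauchy_weight_gt0.
have iX : (\int[leb]_y (X y)%:E < +oo)%E.
  under eq_integral do rewrite /X mulrA EFinM.
  rewrite lebZ ?integral_cauchy_weight ?ltry ?mulr_ge0 ?exprn_ge0 ?(ltW C0)//.
    by apply/measurable_EFinP; exact: measurable_cauchy_weight.
  by move=> x; rewrite lee_fin ltW// cauchy_weight_gt0.
have pr (u v : R * R -> R[i]) (k B : R) z : nc (u z) <= k * chi n z.1 -> nc (v z) <= B ->
    nc (u z * v z) <= k * B * chi n z.1.
  by move=> hu hv; apply: le_trans (nc_mul_le hu hv) _; rewrite mulrAC.
have up (w : R[i]) (k K : R) (z : R * R) : k <= K -> nc w <= k * chi n z.1 -> nc w <= K * chi n z.1.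
  by move=> kK h; apply: le_trans h _; rewrite ler_wpM2r.
have ad (u v : R[i]) (k l : R) (z : R * R) : nc u <= k * chi n z.1 -> nc v <= l * chi n z.1 -> nc (u + v) <= (k + l) * chi n z.1.
  by move=> hu hv; rewrite mulrDl; exact: nc_add_le.
have b0k z : nc (c (chi n) z) <= 1 * chi n z.1 by rewrite mul1r.
have b1k z : nc (c (chi1 n) z) <= 1 * chi n z.1 by rewrite mul1r.
have mb : cmeasurable b by apply: cmeasM.
have sb : symb X MM b by apply: sX => // z; apply: (up (b z) _ _ z t1); exact: (pr (c (chi n)) P2).
have sbx : symb X MM bx.
  apply: sX => // [|z]; first by apply: cmeasD; apply: cmeasM.
  by apply: (up (bx z) _ _ z t2); apply: ad; [exact: (pr (c (chi1 n)) P2)|exact: (pr (c (chi n)) Px2)].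
have sbxx : symb X MM bxx.
  apply: sX => // [|z]; first by apply: cmeasD; apply: cmeasD; apply: cmeasM.
  apply: (up (bxx z) _ _ z t3); apply: (ad); apply: (ad).
  - exact: (pr (c (chi2 n)) P2).
  - exact: (pr (c (chi1 n)) Px2).
  - exact: (pr (c (chi1 n)) Px2).
  - exact: (pr (c (chi n)) Pxx2).
have sr : symb X (2 * e2) r.
  rewrite rE; apply: sX => // [|z]; first exact: cmeasM.
  by apply: (up (c (chi n) z * Q2 z) _ _ z t4); exact: (pr (c (chi n)) Q2).
have srx : symb X (2 * e2) rx.
  apply: sX => // [|z]; first by apply: cmeasD; apply: cmeasM.
  by apply: (up (rx z) _ _ z t5); apply: ad; [exact: (pr (c (chi1 n)) Q2)|exact: (pr (c (chi n)) Qx2)].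
have ACb : AC true b bx by exact: (AC_mul m0' m1' mP2 mPx2 b0' b1' bP2 bPx2 A0 D1).
have ACbx : AC true bx bxx.
  apply: (AC_add (A := 4 * M2 + 1 * M2) (B := 1 * M2 + 1 * M2')).
  - by apply: cmeasD; apply: cmeasM.
  - by apply: cmeasD; apply: cmeasM.
  - by move=> z; apply: nc_add_le; apply: nc_mul_le.
  - by move=> z; apply: nc_add_le; apply: nc_mul_le.
  - exact: (AC_mul m1' m2' mP2 mPx2 b1' b2' bP2 bPx2 A1 D1).
  - exact: (AC_mul m0' m1' mPx2 mPxx2 b0' b1' bPx2 bPxx2 A0 D2).
have ACr : AC false b r by exact: (AC_mul m0' mz mP2 mQ2 b0' bz bP2 bQ2 Az D4).
have ACrx : AC true r rx by rewrite rE; exact: (AC_mul m0' m1' mQ2 mQx2 b0' b1' bQ2 bQx2 A0 D3).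
have w0 := @window_E0 R; have w1 := @window_E1 R; have [mb' bb _] := sb; have [mr br _] := sr.
have mF : cmeasurable F by case: nF.
have iS0 := cintble_smearOp nF mX X0 iX w0 sb; have iS1 := cintble_smearOp nF mX X0 iX w1 sr.
have opE : {ae leb, forall y, op b F y = smearOp F (@E0 R) b y + smearOp F (@E1 R) r y}.
  apply: (op_smear nF (B := MM + 2 * e2)) => // z; [exact: le_trans (bb z) _|exact: le_trans (br z) _].
have iop : cintble leb (op b F).
  have [mS Soo] := cintbleD iS0 iS1; split; first exact: cmeas_op.
  have mo := cmeas_op mb mF; have mS' := mS.
  apply: le_lt_trans Soo; apply: ae_le_nnint; [by mes|by apply/measurable_EFinP; apply: cmeas_nc|by move=> x; rewrite lee_fin nc_ge0|by move=> x; rewrite lee_fin nc_ge0|].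
  by apply: ae_imp opE => y ->.
have H := composition_bound nF mX X0 iX ng M10 MM0 e10 e2' e1M1 mP1 mPx1 mQ1 mQx1 bP1 bPx1 bQ1 bQx1
  B1 B4 B5 B3 sb sbx sbxx sr srx ACb ACbx ACr ACrx.
split; [exact: iop| |by rewrite /comp_const -mE; exact: H].
clear H.
have fS E P P' B : window E -> symb X B P -> symb X B P' -> AC true P P' -> cintble leb (fourier (smearOp F E P)).
  move=> wE sP sP' A; have [mP PB _] := sP.
  have ee : smearOp F E P = fun y => cintegral leb (fun t => P (y, t) * (expi (2 * pi * y * t) * Hf E F y t)).
    by apply/funext => y; exact: (esym (smearOp_Hf nF y wE mP PB)).
  rewrite ee (_ : fourier _ = fun xi => cintegral leb (fun t => Gam F E P (xi - t) t)).
    exact: (@cintble_fubini2 _ _ _ _ _ leb leb _ (cintble_Gam_shift nF mX X0 iX wE sP sP' A)).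
  by apply/funext => xi; exact: (fourier_superposition nF mX X0 iX xi wE sP).
have i0 := fS _ _ _ _ w0 sb sbx ACb; have i1 := fS _ _ _ _ w1 sr srx ACrx.
rewrite (_ : fourier (op b F) = fun xi => fourier (smearOp F (@E0 R) b) xi + fourier (smearOp F (@E1 R) r) xi).
  exact: (@cintbleD _ _ _ leb _ _ i0 i1).
have [ms0 _] := iS0; have [ms1 _] := iS1; have [mop _] := iop.
apply/funext => xi; rewrite /fourier -(cintD (cintble_fourier xi iS0) (cintble_fourier xi iS1)).
apply: ae_eq_cint; [by mes|by case: (cintbleD (cintble_fourier xi iS0) (cintble_fourier xi iS1))|].
by apply: ae_imp opE => y ->; rewrite mulrDr.
Qed.
End Composition.

(** * Passage to square-integrable functions *)

Section CompositionL2.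
Context {R : realType}.
Local Notation leb := (@lebesgue_measure R).
Local Notation leb2 := (prodsf leb leb).
Implicit Types (f g h u v w : R -> R[i]).

Lemma pair_cintble g h : cmeasurable g -> cmeasurable h -> (N2 g < +oo)%E -> (N2 h < +oo)%E ->
  cintble leb (fun x => g x * h x).
Proof.
move=> mg mh goo hoo; split; first exact: cmeasM.
apply: (@le_lt_trans _ _ (N2 g + N2 h)%E); last exact: lte_add_pinfty.
rewrite /N2 -lebD; [|by mes|by mes|by move=> x; rewrite lee_fin sqr_ge0|by move=> x; rewrite lee_fin sqr_ge0].
have mgh := cmeasM mg mh.
apply: le_nnint; [exact: cmeas_nce|by mes|by move=> x; rewrite lee_fin nc_ge0|move=> x].
rewrite -EFinD lee_fin ncM; have := sqr_ge0 (nc (g x) - nc (h x)); have := mulr_ge0 (nc_ge0 (g x)) (nc_ge0 (h x)); nra.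
Qed.

Lemma comp_const_gt0 (M1 e1 M2 e2 M2' : R) : 0 < M1 -> 0 < e1 -> 0 < M2 -> 0 < e2 -> 0 < M2' ->
  0 < comp_const M1 e1 M2 e2 M2'.
Proof.
move=> a b c d e; rewrite /comp_const; apply: mulr_gt0.
  by rewrite /Kc; do ![apply: mulr_gt0 | apply: exprn_gt0 | rewrite ltr0n].
by apply: addr_gt0; apply: mulr_gt0 => //; lra.
Qed.

Variables (p1 P1 Px1 Q1 Qx1 Pxx1 : R * R -> R[i]) (M1 e1 M1' : R).
Variables (p2 P2 Px2 Q2 Qx2 Pxx2 : R * R -> R[i]) (M2 e2 M2' : R).
Hypotheses (M10 : 0 < M1) (e10 : 0 < e1) (e1M1 : e1 <= M1) (M20 : 0 < M2) (e20 : 0 < e2) (M2'0 : 0 < M2').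
Hypothesis sd1 : symbol_data p1 P1 Px1 Q1 Qx1 Pxx1 M1 e1 M1'.
Hypothesis sd2 : symbol_data p2 P2 Px2 Q2 Qx2 Pxx2 M2 e2 M2'.
Local Notation P12 := (fun z => P1 z * P2 z).
Local Notation cc := (comp_const M1 e1 M2 e2 M2').
Let cv1 : cvsymbol P1 (M1 + e1). Proof. exact: (cvsymbol_of_data M10 (ltW e10) sd1). Qed.
Let cv2 : cvsymbol P2 (M2 + e2). Proof. exact: (cvsymbol_of_data M20 (ltW e20) sd2). Qed.
Let cv12 : cvsymbol P12 (4 * (M1 + e1) * (M2 + e2)).
Proof. exact: (cvsymbol_mul M10 (ltW e10) M20 (ltW e20) sd1 sd2). Qed.

(** Writing K for [opK B], two triangle inequalities for squared norms give 2 a + 2 (2 K a + 2 (4 K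
    a)) = (2 + 20 K) a. *)
Lemma cutoff_approx p B h g n F N (a : R) : cvsymbol p B -> 0 < a -> schwartz h -> cmeasurable g -> nice N F ->
  (N2 (fun x => F x - fourier h x)%R <= a%:E)%E -> (N2 (fun x => Op p h x - g x)%R <= (4 * opK B * a)%:E)%E ->
  (N2 (fun x => (chi n x)%:C * op p F x - op p F x)%R <= a%:E)%E ->
  (N2 (fun x => (chi n x)%:C * op p F x - g x)%R <= ((2 + 20 * opK B) * a)%:E)%E.
Proof.
move=> cv a0 sh mg nF Fh hg cF; have [_ mp pB _] := cv.
have [hi hoo Hi] := schwartz_facts sh; have [mH _] := Hi; have [mF _ _] := nF.
have Fi := cintble_nice nF; have Di := cintbleB Fi Hi.
have Doo : (N2 (fun x => F x - fourier h x)%R < +oo)%E by exact: le_lt_trans Fh (ltry _).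
have mO : cmeasurable (op p F) by exact: cmeas_op.
have mOh : cmeasurable (Op p h) by exact: (@cmeas_op R p (fourier h)).
have mc : cmeasurable (fun x => (chi n x)%:C * op p F x).
  by apply: cmeasM => //; apply: cmeasR; exact: chi_measurable.
have NO := N2_op cv Di Doo; move: (opK B) (opK_ge0 B) hg NO => K K0 hg NO.
have d1 : (N2 (fun x => op p F x - Op p h x)%R <= (K * a)%:E)%E.
  have -> : (fun x => op p F x - Op p h x) = op p (fun x => F x - fourier h x) by rewrite (opB mp pB Fi Hi).
  apply: le_trans NO _.
  have -> : ((K * a)%:E = K%:E * a%:E)%E by [].
  apply: lee_wpmul2l; [rewrite lee_fin; exact: K0|exact: Fh].
have d2 := N2_tri_le mO mOh mg d1 hg.
apply: le_trans (N2_tri_le mc mO mg cF d2) _; rewrite lee_fin; lra.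
Qed.

(** f is replaced by a Schwartz h, its transform by a truncation F, and P2 by its cutoff;
    [cutoff_composition] then applies. With g fixed, each replacement changes the pairing by at most
    eps. The 2 before [N2 f] comes from N2 F <= N2 h <= 2 N2 (h - f) + 2 N2 f. *)
Lemma composition_dual f u v w g Ng : L2 f -> is_L2_value (Op P2) f u -> is_L2_value (Op P12) f v ->
  is_L2_value (Op P1) u w -> nice Ng g ->
  ((nc (cintegral leb (fun x => g x * (w x - v x))))%:E <= cc%:E * (N2 g + 2%:E * N2 f))%E.
Proof.
move=> Lf vu vv vw ng; have /L2P[mf foo] := Lf; have [_ af] := L2_approximable mf foo.
have [mu uoo _] := value_approx vu; have [mv voo _] := value_approx vv; have [mw woo aw] := value_approx vw.
have c0 := comp_const_gt0 M10 e10 M20 e20 M2'0; have goo := N2_nice_lty ng; have [mg _ _] := ng.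
have gi := cintble_nice ng; have [_ mP1 bP1 _] := cv1; have [_ mP2 bP2 _] := cv2; have [_ mP12 bP12 _] := cv12.
apply: (@le_eps _ _ _ (3 + 2 * cc)) => [|eps eps0]; first by rewrite addr_ge0// mulr_ge0// ltW.
have [del del0 small] := pair_small ng eps0.
pose K1 := opK (M1 + e1); pose K2 := opK (M2 + e2); pose K12 := opK (4 * (M1 + e1) * (M2 + e2)).
have K10 : 0 <= K1 by exact: opK_ge0.
have K20 : 0 <= K2 by exact: opK_ge0.
have K120 : 0 <= K12 by exact: opK_ge0.
(* [a] is a common tolerance: the three functions paired with g at the end have squared norms at
   most a, (2 + 20 K12) a and K1 (2 a + 2 (2 + 20 K2) a), all within the threshold [del]. *)
have [a [a0 aeps adel aV aG]] : exists a : R, [/\ 0 < a, a <= eps, a <= del, (2 + 20 * K12) * a <= del &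
    K1 * (2 * a + 2 * ((2 + 20 * K2) * a)) <= del].
  pose S := 1 + (2 + 20 * K12) + K1 * (2 + 2 * (2 + 20 * K2)).
  have k1 : 0 <= K1 * (2 + 2 * (2 + 20 * K2)) by rewrite mulr_ge0//; lra.
  have S0 : 0 < S by rewrite /S; lra.
  exists (Num.min eps del / S); have m0 : 0 < Num.min eps del by rewrite lt_min eps0.
  have a0 : 0 < Num.min eps del / S by rewrite divr_gt0.
  have aS : S * (Num.min eps del / S) = Num.min eps del by rewrite mulrC divfK// gt_eqF.
  set a := Num.min eps del / S in a0 aS *.
  have me : S * a <= eps by rewrite aS ge_min lexx.
  have md : S * a <= del by rewrite aS ge_min lexx orbT.
  have x1 : 0 <= K12 * a by rewrite mulr_ge0// ltW.
  have x2 : 0 <= K1 * (2 + 2 * (2 + 20 * K2)) * a by rewrite mulr_ge0// ltW.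
  rewrite /S in me md; split=> //; move: x1 x2 me md; lra.
have [h sh hf] := af _ a0; have mh := schwartz_measurable sh; have [hi hoo Hi] := schwartz_facts sh; have [mH _] := Hi.
have hu := value_lip cv2 mf vu sh hf; have hv := value_lip cv12 mf vv sh hf.
have Hoo : (N2 (fourier h) < +oo)%E by exact: le_lt_trans (bessel hi) hoo.
have [N _ /(_ N (leqnn N)) FH] := trunc_cvg mH Hoo a0.
pose F := trunc N (fourier h); have nF : nice N%:R F by exact: nice_trunc.
have [mF _ _] := nF; have Fi := cintble_nice nF; have Foo := N2_nice_lty nF.
have mO2 : cmeasurable (op P2 F) by exact: cmeas_op.
have mO12 : cmeasurable (op P12 F) by exact: cmeas_op.
have O2oo : (N2 (op P2 F) < +oo)%E by apply: le_lt_trans (N2_op cv2 Fi Foo) _; rewrite lte_mul_pinfty.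
have O12oo : (N2 (op P12 F) < +oo)%E by apply: le_lt_trans (N2_op cv12 Fi Foo) _; rewrite lte_mul_pinfty.
have [n2 _ cn2] := cutoff_cvg mO2 O2oo a0; have [n12 _ cn12] := cutoff_cvg mO12 O12oo a0.
pose n := maxn n2 n12; have {}cn2 := cn2 n (leq_maxl _ _); have {}cn12 := cn12 n (leq_maxr _ _).
have Uu := cutoff_approx cv2 a0 sh mu nF FH hu cn2.
have Vv := cutoff_approx cv12 a0 sh mv nF FH hv cn12.
pose b z := (chi n z.1)%:C * P2 z.
have [Ui fUi comp] := cutoff_composition M10 e10 e1M1 M20 e20 M2'0 sd1 sd2 n nF ng; rewrite -/b in Ui fUi comp.
have UE : op b F = fun x => (chi n x)%:C * op P2 F x by apply/funext => y; exact: (op_chi n y mP2 bP2 Fi).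
have VE : op (fun z => P1 z * b z) F = fun x => (chi n x)%:C * op P12 F x.
  apply/funext => y; rewrite -(op_chi n y mP12 bP12 Fi); apply: eq_cint => eta; rewrite /b /=; ring.
pose U := op b F; pose V := op (fun z => P1 z * b z) F.
have mU : cmeasurable U by case: Ui.
have mV : cmeasurable V by rewrite /V VE; apply: cmeasM => //; apply: cmeasR; exact: chi_measurable.
have Uu' : (N2 (fun x => U x - u x)%R <= ((2 + 20 * K2) * a)%:E)%E by rewrite /U UE.
have Vv' : (N2 (fun x => V x - v x)%R <= ((2 + 20 * K12) * a)%:E)%E by rewrite /V VE.
(* [U] need not be a Schwartz function, while w is a limit of images of Schwartz functions. So w is
   compared with the image of a Schwartz phi near u; since phi - U is small in L^2, so is [op P1] of
   its transform [G]. *)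
have [phi [sphi phiu phiw]] := aw a a0; have mphi := schwartz_measurable sphi.
have [phii phioo Phii] := schwartz_facts sphi; have [mPhi _] := Phii.
pose G xi := fourier phi xi - fourier U xi.
have Gi : cintble leb G by exact: (@cintbleB _ _ _ leb _ _ Phii fUi).
have [mG _] := Gi.
have GE : fourier (fun x => phi x - U x) = G by rewrite (fourierB phii Ui).
have phiU : (N2 (fun x => phi x - U x)%R <= (2 * a + 2 * ((2 + 20 * K2) * a))%:E)%E.
  by apply: (N2_tri_le mphi mu mU phiu); rewrite N2_sym.
have NG : (N2 G <= (2 * a + 2 * ((2 + 20 * K2) * a))%:E)%E.
  rewrite -GE; apply: le_trans (bessel (@cintbleB _ _ _ leb _ _ phii Ui)) phiU.
have NOG : (N2 (op P1 G) <= del%:E)%E.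
  apply: le_trans (N2_op cv1 Gi (le_lt_trans NG (ltry _))) _.
  apply: le_trans (lee_wpmul2l _ NG) _; first by rewrite lee_fin.
  by rewrite -EFinM lee_fin.
pose A := Op P1 phi; have mA : cmeasurable A by exact: (@cmeas_op R P1 (fourier phi)).
have Aoo : (N2 A < +oo)%E by apply: le_lt_trans (Op_bounded cv1 sphi) _; rewrite lte_mul_pinfty.
have Voo : (N2 V < +oo)%E.
  rewrite (_ : V = fun x => (V x - v x) + v x); last by apply/funext => x; rewrite subrK.
  apply: le_lt_trans (N2D (cmeasB mV mv) mv) _.
  by apply: lte_add_pinfty; apply: lte_mul_pinfty => //; exact: le_lt_trans Vv' (ltry _).
have [i1 s1] : cintble leb (fun x => g x * (w x - A x)) /\ nc (cintegral leb (fun x => g x * (w x - A x))) <= eps.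
  apply: small; first exact: cmeasB.
  by rewrite N2_sym; apply: le_trans phiw _; rewrite lee_fin.
have [i2 s2] : cintble leb (fun x => g x * (V x - v x)) /\ nc (cintegral leb (fun x => g x * (V x - v x))) <= eps.
  apply: small; first exact: cmeasB.
  by apply: le_trans Vv' _; rewrite lee_fin.
have [i3 s3] : cintble leb (fun x => g x * op P1 G x) /\ nc (cintegral leb (fun x => g x * op P1 G x)) <= eps.
  by apply: small NOG; apply: cmeas_op => //; case: Gi.
have iA := pair_cintble mg mA goo Aoo; have iV := pair_cintble mg mV goo Voo.
have e1' : cintegral leb (fun x => g x * (w x - v x)) =
    cintegral leb (fun x => g x * (w x - A x)) + (cintegral leb (fun x => g x * A x) - cintegral leb (fun x => g x * V x)) +
    cintegral leb (fun x => g x * (V x - v x)).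
  rewrite -(cintB iA iV) -(cintD i1 (cintbleB iA iV)) -(cintD (cintbleD i1 (cintbleB iA iV)) i2).
  by apply: eq_cint => x; ring.
have e2' : cintegral leb (fun x => g x * A x) =
    cintegral leb (fun x => g x * op P1 G x) + cintegral leb (fun xi => fourier U xi * Kg g P1 xi).
  have opA : op P1 G = fun x => A x - op P1 (fourier U) x by exact: (opB mP1 bP1 Phii fUi).
  rewrite (op_pairing mP1 bP1 gi Gi) -(Kg_pairing mP1 bP1 gi Gi).
  rewrite (op_pairing mP1 bP1 gi Phii) -(Kg_pairing mP1 bP1 gi Phii).
  have mK : cmeasurable (Kg g P1) by rewrite /Kg; mes.
  have [MK KM] := Kg_bounded ng mP1 bP1.
  have iK (H : R -> R[i]) : cintble leb H -> cintble leb (fun xi => H xi * Kg g P1 xi).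
    move=> iH; rewrite (_ : (fun xi => _) = (fun xi => Kg g P1 xi * H xi)); last by apply/funext => xi; rewrite mulrC.
    exact: (@cintble_bddM _ _ _ leb _ _ MK mK KM iH).
  by rewrite -(cintD (iK _ Gi) (iK _ fUi)); apply: eq_cint => xi; rewrite -mulrDl /G subrK.
have tri : nc (cintegral leb (fun x => g x * (w x - v x))) <=
    3 * eps + nc (cintegral leb (fun xi => fourier U xi * Kg g P1 xi) - cintegral leb (fun x => g x * V x)).
  rewrite e1' e2'; set x1 := cintegral _ _ in s1 *; set x2 := cintegral _ _ in s3 *; set x3 := cintegral _ _; set x4 := cintegral _ _; set x5 := cintegral _ _ in s2 *.
  have -> : x1 + (x2 + x3 - x4) + x5 = (x1 + x2 + x5) + (x3 - x4) by ring.
  apply: le_trans (ncD _ _) _; rewrite lerD2r; apply: le_trans (ncD _ _) _.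
  have aux (lA lB lC lD lE : R) : lA <= lE -> lB <= lE -> lC <= lE -> lD <= lA + lC -> lD + lB <= 3 * lE by lra.
  exact: aux s1 s2 s3 (ncD x1 x2).
have NF : (N2 F <= 2%:E * N2 f + (2 * eps)%:E)%E.
  apply: (@le_trans _ _ (N2 (fourier h))).
    by apply: le_nnint; [by mes|by mes|by move=> x; rewrite lee_fin sqr_ge0|move=> x; rewrite lee_fin lerXn2r ?nnegrE ?nc_ge0 ?nc_trunc].
  apply: (@le_trans _ _ (N2 h)); first exact: bessel.
  rewrite (_ : N2 h = N2 (fun x => (h x - f x) + f x)); last by apply: eq_integral => x _; rewrite subrK.
  apply: le_trans (N2D (cmeasB mh mf) mf) _; rewrite addeC; apply: leeD2l.
  have -> : ((2 * eps)%:E = 2%:E * eps%:E)%E by [].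
  by apply: lee_wpmul2l; rewrite ?lee_fin//; apply: le_trans hf _; rewrite lee_fin.
have tri' : ((nc (cintegral leb (fun x => g x * (w x - v x))))%:E <= (3 * eps)%:E + cc%:E * (N2 g + N2 F))%E.
  by apply: (@le_trans _ _ ((3 * eps)%:E + (nc (cintegral leb (fun xi => fourier U xi * Kg g P1 xi) - cintegral leb (fun x => g x * V x)))%:E)%E);
    [rewrite -EFinD lee_fin|exact: leeD2l].
apply: le_trans tri' _.
apply: (@le_trans _ _ ((3 * eps)%:E + cc%:E * (N2 g + (2%:E * N2 f + (2 * eps)%:E)))%E).
  by apply: leeD2l; apply: lee_wpmul2l; [rewrite lee_fin ltW|exact: leeD2l].
have fg : N2 g \is a fin_num by rewrite ge0_fin_numE ?N2_ge0.
have ff : N2 f \is a fin_num by rewrite ge0_fin_numE ?N2_ge0.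
rewrite -(fineK fg) -(fineK ff); move: (fine (N2 g)) (fine (N2 f)) => x y.
have -> : ((3 * eps)%:E + cc%:E * (x%:E + (2%:E * y%:E + (2 * eps)%:E)) = (3 * eps + cc * (x + (2 * y + 2 * eps)))%:E)%E by [].
have -> : (cc%:E * (x%:E + 2%:E * y%:E) + ((3 + 2 * cc) * eps)%:E = (cc * (x + 2 * y) + (3 + 2 * cc) * eps)%:E)%E by [].
move: cc => k; rewrite lee_fin le_eqVlt; apply/orP; left; apply/eqP; ring.
Qed.

(** [N2_dual] with E = 2 N2 f gives 8 times the squared constant, which is below 9 = 3^2. *)
Lemma composition_L2 f u v w : L2 f -> is_L2_value (Op P2) f u -> is_L2_value (Op P12) f v ->
  is_L2_value (Op P1) u w -> (L2norm (fun x => w x - v x)%R <= (3 * cc)%:E * L2norm f)%E.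
Proof.
move=> Lf vu vv vw; have /L2P[mf foo] := Lf; have c0 := comp_const_gt0 M10 e10 M20 e20 M2'0.
have [mv _ _] := value_approx vv; have [mw _ _] := value_approx vw.
have ff : N2 f \is a fin_num by rewrite ge0_fin_numE ?N2_ge0.
apply: L2norm_leM; first by apply: mulr_ge0; [exact: ler0n|exact: ltW].
have y0 : 0 <= fine (N2 f) by rewrite fine_ge0 ?N2_ge0.
have E : (2%:E * N2 f = (2 * fine (N2 f))%:E)%E by rewrite EFinM fineK.
have H : (N2 (fun x => w x - v x)%R <= (4 * cc ^+ 2 * (2 * fine (N2 f)))%:E)%E.
  apply: N2_dual => [||| N g ng]; [exact: cmeasB|exact: c0|by rewrite mulr_ge0|].
  by rewrite -E; exact: (composition_dual Lf vu vv vw ng).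
apply: le_trans H _; rewrite -(fineK ff) -EFinM lee_fin.
move: (fine (N2 f)) y0 (cc) => y y0 k.
rewrite (_ : 4 * k ^+ 2 * (2 * y) = 8 * (k ^+ 2 * y)); last by ring.
rewrite (_ : (3 * k) ^+ 2 * y = 9 * (k ^+ 2 * y)); last by ring.
have h : 0 <= k ^+ 2 * y by rewrite mulr_ge0 ?sqr_ge0.
lra.
Qed.
End CompositionL2.

(** * The operator norm of the composition error *)

Section FinalEstimate.
Context {R : realType}.
Local Notation leb := (@lebesgue_measure R).
Local Notation leb2 := (prodsf leb leb).
Implicit Types (f g : R -> R[i]).

Lemma L2normZ (c : R[i]) f : cmeasurable f -> L2norm (fun x => c * f x) = ((nc c)%:E * L2norm f)%E.
Proof.
move=> mf; rewrite !L2normE N2Z// poweRM ?lee_fin ?sqr_ge0 ?N2_ge0//; congr (_ * _)%E.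
by rewrite poweR_EFin -powR_mulrn ?nc_ge0// -powRrM mulfV// powRr1 ?nc_ge0.
Qed.

Lemma L2norm_ae f g : cmeasurable f -> cmeasurable g -> {ae leb, forall x, f x = g x} -> L2norm f = L2norm g.
Proof. by move=> mf mg h; rewrite !L2normE (N2_ae mf mg h). Qed.

Section Pair.
Variables (p1 P1 Px1 Q1 Qx1 Pxx1 : R * R -> R[i]) (M1 e1 M1' : R).
Variables (p2 P2 Px2 Q2 Qx2 Pxx2 : R * R -> R[i]) (M2 e2 M2' : R).
Hypotheses (mp1 : cmeasurable p1) (mp2 : cmeasurable p2).
Hypotheses (M10 : 0 < M1) (e10 : 0 < e1) (e1M1 : e1 <= M1) (M20 : 0 < M2) (e20 : 0 < e2) (M2'0 : 0 < M2').
Hypothesis sd1 : symbol_data p1 P1 Px1 Q1 Qx1 Pxx1 M1 e1 M1'.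
Hypothesis sd2 : symbol_data p2 P2 Px2 Q2 Qx2 Pxx2 M2 e2 M2'.
Let cv1 : cvsymbol P1 (M1 + e1). Proof. exact: (cvsymbol_of_data M10 (ltW e10) sd1). Qed.
Let cv2 : cvsymbol P2 (M2 + e2). Proof. exact: (cvsymbol_of_data M20 (ltW e20) sd2). Qed.
Let cv12 : cvsymbol (fun z => P1 z * P2 z) (4 * (M1 + e1) * (M2 + e2)).
Proof. exact: (cvsymbol_mul M10 (ltW e10) M20 (ltW e20) sd1 sd2). Qed.
Let mP1 : cmeasurable P1. Proof. by case: sd1. Qed.
Let mP2 : cmeasurable P2. Proof. by case: sd2. Qed.
Let ae1 : {ae leb2, forall z, p1 z = P1 z}. Proof. by case: sd1. Qed.
Let ae2 : {ae leb2, forall z, p2 z = P2 z}. Proof. by case: sd2. Qed.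
Let ae12 : {ae leb2, forall z, p1 z * p2 z = P1 z * P2 z}.
Proof. by apply: ae_imp2 ae1 ae2 => z -> ->. Qed.

Lemma composition_errorE f : composition_error p1 p2 f = fun x =>
  L2_ext (Op P1) (L2_ext (Op P2) f) x - L2_ext (Op (fun z => P1 z * P2 z)) f x.
Proof.
rewrite /composition_error (L2_ext_ae mp1 mP1 ae1) (L2_ext_ae mp2 mP2 ae2).
by rewrite (L2_ext_ae (cmeasM mp1 mp2) (cmeasM mP1 mP2) ae12).
Qed.

Lemma Op_L2_bounded : [/\ L2_bounded (Op p1), L2_bounded (Op p2) & L2_bounded (Op (fun z => p1 z * p2 z))].
Proof.
split.
- exact: (L2_bounded_ae mp1 mP1 ae1 (L2_bounded_Op cv1)).
- exact: (L2_bounded_ae mp2 mP2 ae2 (L2_bounded_Op cv2)).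
- exact: (L2_bounded_ae (cmeasM mp1 mp2) (cmeasM mP1 mP2) ae12 (L2_bounded_Op cv12)).
Qed.

Lemma ext_values f : L2 f -> [/\ is_L2_value (Op P2) f (L2_ext (Op P2) f),
  is_L2_value (Op (fun z => P1 z * P2 z)) f (L2_ext (Op (fun z => P1 z * P2 z)) f) &
  is_L2_value (Op P1) (L2_ext (Op P2) f) (L2_ext (Op P1) (L2_ext (Op P2) f))].
Proof.
move=> Lf; have v2 := ext_value cv2 Lf.
split; [exact: v2|exact: (ext_value cv12 Lf)|exact: (ext_value cv1 (proj1 v2))].
Qed.

Lemma composition_error_bound f : L2 f ->
  (L2norm (composition_error p1 p2 f) <= (3 * comp_const M1 e1 M2 e2 M2')%:E * L2norm f)%E.
Proof.
move=> Lf; have [v2 v12 v1] := ext_values Lf; rewrite composition_errorE.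
exact: (composition_L2 M10 e10 e1M1 M20 e20 M2'0 sd1 sd2 Lf v2 v12 v1).
Qed.

Lemma cmeas_composition_error f : L2 f -> cmeasurable (composition_error p1 p2 f).
Proof.
move=> Lf; have [v2 v12 v1] := ext_values Lf; rewrite composition_errorE.
by apply: cmeasB; [case: (value_approx v1)|case: (value_approx v12)].
Qed.

(** Each extension selects a representative, so homogeneity holds only almost everywhere, through
    uniqueness of the L^2 values. *)
Lemma composition_error_scale (c : R[i]) f : L2 f -> L2 (fun x => c * f x) ->
  {ae leb, forall x, composition_error p1 p2 (fun x => c * f x) x = c * composition_error p1 p2 f x}.
Proof.
move=> Lf Lcf; have [v2 v12 v1] := ext_values Lf; have [w2 w12 w1] := ext_values Lcf.
have /L2P[mf _] := Lf; have /L2P[mcf _] := Lcf.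
have [mu _ _] := value_approx v2; have [mu' _ _] := value_approx w2.
rewrite !composition_errorE.
have t (h : R -> R[i]) : {ae leb, forall x, h x = h x} by exact: ae_true.
have a2 := value_unique cv2 mcf mcf (t _) w2 (value_scale cv2 c mf v2).
have a12 := value_unique cv12 mcf mcf (t _) w12 (value_scale cv12 c mf v12).
have mcu : cmeasurable (fun x => c * L2_ext (Op P2) f x) by apply: cmeasM => //; exact: cmeas_cst.
have a1 := value_unique cv1 mu' mcu a2 w1 (value_scale cv1 c mu v1).
by apply: ae_imp2 a1 a12 => x -> ->; rewrite mulrBr.
Qed.

Lemma composition_error_opnorm f : L2 f ->
  (L2norm (composition_error p1 p2 f) <= L2_opnorm (composition_error p1 p2) * L2norm f)%E.
Proof.
move=> Lf; have /L2P[mf foo] := Lf; have foo' : (L2norm f < +oo)%E by exact/N2_lty.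
have B := composition_error_bound Lf.
have fin : L2norm f \is a fin_num by rewrite ge0_fin_numE ?L2norm_ge0.
(* A function of norm 0 cannot be normalized; there the quantitative bound already gives 0. *)
have [l0|l0] := eqVneq (L2norm f) 0%E; first by move: B; rewrite l0 !mule0.
pose l := fine (L2norm f); have lE : L2norm f = l%:E by rewrite /l fineK.
have lp : 0 < l by rewrite -lte_fin -lE lt_neqAle eq_sym l0 L2norm_ge0.
pose c : R[i] := (l^-1)%:C; have nl : nc c = l^-1 by rewrite ncR ger0_norm// invr_ge0 ltW.
have N1 : L2norm (fun x => c * f x) = 1%E by rewrite L2normZ// nl lE -EFinM mulVf ?gt_eqF.
have Lcf : L2 (fun x => c * f x).
  split; first by apply: cmeasM => //; exact: cmeas_cst.
  by rewrite N1 ltry.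
have mC := cmeas_composition_error Lf.
have e : L2norm (composition_error p1 p2 f) = (l%:E * L2norm (composition_error p1 p2 (fun x => c * f x)%R))%E.
  have mcC : cmeasurable (fun x => c * composition_error p1 p2 f x) by apply: cmeasM => //; exact: cmeas_cst.
  rewrite (L2norm_ae (cmeas_composition_error Lcf) mcC (composition_error_scale Lf Lcf)).
  by rewrite L2normZ// nl muleA -EFinM mulfV ?gt_eqF// mul1e.
rewrite e lE muleC; apply: lee_wpmul2r; first by rewrite lee_fin ltW.
by apply: ereal_sup_ubound; exists (fun x => c * f x) => //; split=> //; rewrite N1.
Qed.

Lemma opnorm_composition_error : (L2_opnorm (composition_error p1 p2) <= (3 * comp_const M1 e1 M2 e2 M2')%:E)%E.
Proof.
apply: ge_ereal_sup => _ [f [Lf f1] <-]; apply: le_trans (composition_error_bound Lf) _.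
have c0 := comp_const_gt0 M10 e10 M20 e20 M2'0; move: (comp_const _ _ _ _ _) c0 => k k0.
rewrite -[leRHS]mule1; apply: lee_wpmul2l => //.
by rewrite lee_fin; apply: mulr_ge0; [exact: ler0n|exact: ltW].
Qed.
End Pair.

(** The left side is Kc (12 M1 e2 + 36 M2 e1 + 6 M2' e1), whose largest coefficient is 36. *)
Lemma comp_const_le (M1 e1 M2 e2 M2' : R) : 0 < M1 -> 0 < e1 -> 0 < M2 -> 0 < e2 -> 0 < M2' ->
  3 * comp_const M1 e1 M2 e2 M2' <= (36 * Kc) * (M1 * e2 + (M2 + M2') * e1).
Proof.
move=> a b c d e; have k0 : 0 < Kc :> R.
  by rewrite /Kc; do ![apply: mulr_gt0 | apply: exprn_gt0 | rewrite ltr0n].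
rewrite /comp_const; move: Kc k0 => k k0.
have h1 : 0 <= k * (M1 * e2) by rewrite !mulr_ge0 ?ltW.
have h2 : 0 <= k * (M2' * e1) by rewrite !mulr_ge0 ?ltW.
have h3 : 0 <= k * (M2 * e1) by rewrite !mulr_ge0 ?ltW.
by rewrite -subr_ge0 (_ : _ - _ = 24 * (k * (M1 * e2)) + 30 * (k * (M2' * e1))); [lra|ring].
Qed.

(** Representing functions exist only for bounds strictly above the norms, hence the slack d; it
    also makes every bound positive when a norm vanishes. E <= N11 supplies the hypothesis e1 <= M1
    of the composition estimate. *)
Lemma approximation_data (p : R * R -> R[i]) : (symbol_class 1 1 `&` symbol_class 2 0) p ->
  exists N11 E N20 : R, [/\ symbol_norm 1 1 (distr p) = N11%:E, symbol_norm 1 0 (distr_dxi (distr p)) = E%:E,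
    symbol_norm 2 0 (distr p) = N20%:E, [/\ 0 <= E, E <= N11 & 0 <= N20] &
    forall d : R, 0 < d -> exists P Px Q Qx Pxx, symbol_data p P Px Q Qx Pxx (N11 + d) (E + d) (N20 + d)].
Proof.
move=> [S11 S20]; have [_ f11] := S11; have [_ f20] := S20.
have le := symbol_norm_dxi (distr p).
have H := @symbol_dataP R p.
have i11 := symbol_norm_ge0 1 1 (distr p); have i10 := symbol_norm_ge0 1 0 (distr_dxi (distr p)).
have i20 := symbol_norm_ge0 2 0 (distr p).
move: (symbol_norm 1 1 (distr p)) (symbol_norm 1 0 (distr_dxi (distr p))) (symbol_norm 2 0 (distr p)) f11 f20 le H i11 i10 i20.
move=> [N11| |] [E| |] [N20| |] // _ _ le H i11 i10 i20.
exists N11, E, N20; split; [exact: erefl|exact: erefl|exact: erefl|by rewrite -!lee_fin|].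
by move=> d d0; apply: H => //; rewrite lte_fin ltrDl.
Qed.
End FinalEstimate.

Theorem theorem5p2 (R : realType) :
  exists C : R, forall p1 p2 : R * R -> R[i],
    (symbol_class 1 1 `&` symbol_class 2 0) p1 ->
    (symbol_class 1 1 `&` symbol_class 2 0) p2 ->
    [/\ L2_bounded (Op p1), L2_bounded (Op p2) &
        L2_bounded (Op (fun z => p1 z * p2 z))] /\
    (forall f : R -> R[i], L2 f ->
       (L2norm (composition_error p1 p2 f) <=
        L2_opnorm (composition_error p1 p2) * L2norm f)%E) /\
    (L2_opnorm (composition_error p1 p2) <=
     C%:E * (symbol_norm 1 1 (distr p1) * symbol_norm 1 0 (distr_dxi (distr p2))
             + (symbol_norm 1 1 (distr p2) + symbol_norm 2 0 (distr p2))
               * symbol_norm 1 0 (distr_dxi (distr p1))))%E.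
Proof.
exists (36 * Kc) => p1 p2 S1 S2.
have mp1 : cmeasurable p1 by case: S1 => -[[]].
have mp2 : cmeasurable p2 by case: S2 => -[[]].
have [m1 [E1 [m1' [-> -> _ [a1 b1 c1] D1]]]] := approximation_data S1.
have [m2 [E2 [m2' [-> -> -> [a2 b2 c2] D2]]]] := approximation_data S2.
have g0 (x y : R) : 0 <= x -> 0 < y -> 0 < x + y by move=> *; rewrite ltr_wpDl.
have n1 := le_trans a1 b1; have n2 := le_trans a2 b2.
have le1 (d : R) : E1 + d <= m1 + d by rewrite lerD2r.
(* The first two claims are qualitative, so any slack will do for them. *)
have [P1 [Px1 [Q1 [Qx1 [Pxx1 sd1]]]]] := D1 1 ltr01.
have [P2 [Px2 [Q2 [Qx2 [Pxx2 sd2]]]]] := D2 1 ltr01.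
split; [|split].
- exact: (Op_L2_bounded mp1 mp2 (g0 _ _ n1 ltr01) (g0 _ _ a1 ltr01) (g0 _ _ n2 ltr01) (g0 _ _ a2 ltr01) sd1 sd2).
- move=> f Lf; exact: (composition_error_opnorm mp1 mp2 (g0 _ _ n1 ltr01) (g0 _ _ a1 ltr01) (le1 _) (g0 _ _ n2 ltr01)
    (g0 _ _ a2 ltr01) (g0 _ _ c2 ltr01) sd1 sd2 Lf).
(* The operator norm does not depend on d, so the slack can be sent to 0 in this bound. *)
have H (d : R) : 0 < d -> (L2_opnorm (composition_error p1 p2) <=
    (36 * Kc * ((m1 + d) * (E2 + d) + ((m2 + d) + (m2' + d)) * (E1 + d)))%:E)%E.
  move=> d0; have [P1' [Px1' [Q1' [Qx1' [Pxx1' sd1']]]]] := D1 d d0.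
  have [P2' [Px2' [Q2' [Qx2' [Pxx2' sd2']]]]] := D2 d d0.
  apply: le_trans (opnorm_composition_error mp1 mp2 (g0 _ _ n1 d0) (g0 _ _ a1 d0) (le1 _) (g0 _ _ n2 d0)
    (g0 _ _ a2 d0) (g0 _ _ c2 d0) sd1' sd2') _.
  rewrite lee_fin; apply: comp_const_le; exact: g0.
clear sd1 sd2 D1 D2; move: H; move: (L2_opnorm (composition_error p1 p2)) => opn.
have k0 : 0 <= 36 * Kc :> R.
  by rewrite /Kc; do ![apply: mulr_ge0 | apply: exprn_ge0 | exact: ler0n].
move: (36 * Kc) k0 => k k0 H.
have -> : (k%:E * (m1%:E * E2%:E + (m2%:E + m2'%:E) * E1%:E) = (k * (m1 * E2 + (m2 + m2') * E1))%:E)%E by [].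
(* Expanding the products, the excess is d (m1 + E2 + m2 + m2' + 2 E1) + 3 d^2, which is at most S d
   as soon as d <= 1. *)
pose S := m1 + E2 + m2 + m2' + 2 * E1 + 3; have S0 : 0 <= k * S by rewrite mulr_ge0// /S; lra.
apply: (le_eps S0) => e e0.
pose d := Num.min 1 e; have d0 : 0 < d by rewrite lt_min ltr01.
have d1 : d <= 1 by rewrite ge_min lexx.
have de : d <= e by rewrite ge_min lexx orbT.
apply: le_trans (H d d0) _; rewrite -EFinD lee_fin -mulrA -mulrDr ler_wpM2l//.
have q : d * d <= d by rewrite ler_piMr// ltW.
have s : S * d <= S * e by rewrite ler_wpM2l// /S; lra.
rewrite /S in s *; nra.
Qed.
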